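(* Assume that $\mathbb{P}(\bm{C}(\bm{y})\neq\bm{I}_r)>0$ and that there is a constant $c>0$ with $\bm{C}(\bm{y})\succeq c\bm{I}_r$ almost surely. Let $\bm{T}_\ast$ be the optimal preprocessing map defined in the context. Then the lower and upper spectral thresholds of $\bm{T}_\ast$ coincide: $$\alpha_{\mathrm{c},\min}(\bm{T}_\ast)=\alpha_{\mathrm{c},\max}(\bm{T}_\ast)\eqqcolon\alpha_{\mathrm c}^\ast.$$ Moreover $0<\alpha_{\mathrm c}^\ast<\infty$ and $$\frac1{\alpha_{\mathrm c}^\ast}=\left\|\mathbb{E}_{\bm{y}}\left[(\bm{C}(\bm{y})-\bm{I}_r)\otimes(\bm{C}(\bm{y})-\bm{I}_r)\right]\right\|_{\mathrm{op}}.$$ Furthermore, for every fixed $p\ge1$ and every measurable $\bm{T}\colon\mathbb{R}^q\to\mathrm{Sym}_p(\mathbb{R})$ with $\mathbb{P}(\bm{T}(\bm{y})\neq\bm{0}_{p\times p})>0$ and $\|\bm{T}(\bm{y})\|_{\mathrm{op}}\le C_T$ almost surely for some finite $C_T>0$, it holds that $$\alpha_{\mathrm{c},\min}(\bm{T})\ge\alpha_{\mathrm c}^\ast.$$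
   Context: Setting. Fix integers $r,q\ge1$ and a conditional probability distribution (Markov kernel) $P_\ast(\cdot\mid\bm{s})$, $\bm{s}\in\mathbb{R}^r$, on $\mathbb{R}^q$. Let $\bm{s}\sim\mathcal{N}(\bm{0}_r,\bm{I}_r)$, $\bm{y}\mid\bm{s}\sim P_\ast(\cdot\mid\bm{s})$; $\mathbb{E}_{\bm{y}}$ is expectation over $\bm{y}$, and $\bm{C}(\bm{y})=\mathbb{E}[\bm{s}\bm{s}^\top\mid\bm{y}]\in\mathbb{R}^{r\times r}$ (so $\mathbb{E}_{\bm{y}}[\bm{C}(\bm{y})]=\bm{I}_r$). The parameter $\alpha\in(0,\infty)$ is the limiting sampling ratio $n/d$ of the proportional regime $n,d\to\infty$, $n/d\to\alpha$, with $r,q,p$ fixed; all quantities below are deterministic functions of $\alpha$, $\bm{T}$ and $P_\ast$. Thresholds. Let $p\ge1$ and let $\bm{T}\colon\mathbb{R}^q\to\mathrm{Sym}_p(\mathbb{R})$ (real symmetric $p\times p$ matrices) be measurable, with $\bm{T}(\bm{y})$ almost surely bounded and not almost surely zero. Write $\Im\bm{X}=(\bm{X}-\bm{X}^\ast)/(2i)$, $\mathbb{C}_+=\{z\colon\Im z>0\}$. For $\alpha>0$, $\bm{M}_\alpha\colon\mathbb{C}_+\to\mathbb{C}^{p\times p}$ is the unique analytic function with $\Im\bm{M}_\alpha(z)\succeq0$ on $\mathbb{C}_+$, $\lim_{\eta\to\infty}i\eta\bm{M}_\alpha(i\eta)=-\bm{I}_p$, and $\bm{M}_\alpha(z)^{-1}=-z\bm{I}_p+\mathbb{E}_{\bm{y}}[\bm{T}(\bm{y})(\bm{I}_p+\frac1\alpha\bm{M}_\alpha(z)\bm{T}(\bm{y}))^{-1}]$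 for $z\in\mathbb{C}_+$. There is a unique positive semidefinite matrix-valued Borel measure $\bm{\Omega}_\alpha$ on $\mathbb{R}$ with $\bm{\Omega}_\alpha(\mathbb{R})=\bm{I}_p$ and $\bm{M}_\alpha(z)=\int(\lambda-z)^{-1}\bm{\Omega}_\alpha(\mathrm{d}\lambda)$; $\mu_\alpha=\frac1p\operatorname{Tr}\bm{\Omega}_\alpha$ is a compactly supported probability measure with the same support as $\bm{\Omega}_\alpha$, and $\bm{M}_\alpha$ is extended to $\mathbb{C}\setminus\operatorname{supp}\mu_\alpha$ by the same integral formula. Put $\lambda_+(\alpha)=\sup\operatorname{supp}(\mu_\alpha)$. For $x>\lambda_+(\alpha)$, $\bm{I}_p+\frac1\alpha\bm{M}_\alpha(x)\bm{T}(\bm{y})$ is almost surely invertible; set $$h_\alpha(x)=\lambda_1\left(\mathbb{E}_{\bm{y}}\left[\bm{T}(\bm{y})\left(\bm{I}_p+\tfrac1\alpha\bm{M}_\alpha(x)\bm{T}(\bm{y})\right)^{-1}\otimes\bm{C}(\bm{y})\right]\right)-x,\qquad\Delta_{\bm{T}}(\alpha)=\sup_{x>\lambda_+(\alpha)}h_\alpha(x),$$ where $\lambda_1$ is the largest eigenvalue, and $$\alpha_{\mathrm{c},\min}(\bm{T})=\inf\{\alpha>0\colon\Delta_{\bm{T}}(\alpha)>0\},\quad\alpha_{\mathrm{c},\max}(\bm{T})=\inf\{\bar\alpha>0\colon\Delta_{\bm{T}}(\alpha)>0\ \forall\alpha>\bar\alpha\},\quad\inf\emptyset=+\infty.$$ Optimal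 preprocessing map. Let $\mathcal{A}\colon\mathrm{Sym}_r(\mathbb{R})\to\mathrm{Sym}_r(\mathbb{R})$, $\mathcal{A}[\bm{H}]=\mathbb{E}_{\bm{y}}[(\bm{C}(\bm{y})-\bm{I}_r)\bm{H}(\bm{C}(\bm{y})-\bm{I}_r)]$, with operator norm $\|\mathcal{A}\|_{\mathrm{op}}$ induced by the Frobenius norm. Let $\mathscr{P}_\ast=\{\bm{H}\succeq\bm{0}\colon\operatorname{Tr}\bm{H}=1,\ \mathcal{A}[\bm{H}]=\|\mathcal{A}\|_{\mathrm{op}}\bm{H}\}$, which is nonempty and convex. Choose any $\bm{H}_\ast\in\operatorname{relint}(\mathscr{P}_\ast)$ (relative interior), set $p_\ast=\operatorname{rank}(\bm{H}_\ast)$, let $\bm{U}_\ast\in\mathbb{R}^{r\times p_\ast}$ have orthonormal columns spanning $\operatorname{range}(\bm{H}_\ast)$, put $\bm{C}_\ast(\bm{y})=\bm{U}_\ast^\top\bm{C}(\bm{y})\bm{U}_\ast$, and define $\bm{T}_\ast(\bm{y})=\bm{I}_{p_\ast}-\bm{C}_\ast(\bm{y})^{-1}\in\mathrm{Sym}_{p_\ast}(\mathbb{R})$. (Under the hypotheses of the theorem $\bm{T}_\ast(\bm{y})$ is almost surely bounded and not almost surely zero, so $\bm{M}_\alpha$, $\mu_\alpha$, $\lambda_+(\alpha)$, $h_\alpha$ and $\Delta_{\bm{T}_\ast}(\alpha)$ are defined with $\bm{T}=\bm{T}_\ast$ and $p=p_\ast$, and the thresholds of $\bm{T}_\ast$ are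 $\alpha_{\mathrm{c},\min}(\bm{T}_\ast)=\inf\{\alpha>0\colon\Delta_{\bm{T}_\ast}(\alpha)>0\}$ and $\alpha_{\mathrm{c},\max}(\bm{T}_\ast)=\inf\{\bar\alpha>0\colon\Delta_{\bm{T}_\ast}(\alpha)>0\ \forall\alpha>\bar\alpha\}$.) *)

(* Defs.v *)
From HB Require Import structures.
From mathcomp Require Import all_boot all_order all_algebra.
From mathcomp Require Import all_classical all_reals all_analysis.
From mathcomp Require Import complex mxtens.

Set Implicit Arguments.
Unset Strict Implicit.
Unset Printing Implicit Defensive.
Import Order.TTheory GRing.Theory Num.Theory numFieldNormedType.Exports.
Local Open Scope classical_set_scope.
Local Open Scope complex_scope.
Local Open Scope sesquilinear_scope.
Local Open Scope ring_scope.

Section Matrices.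
Context {R : realType}.

Definition toC {m n : nat} (A : 'M[R]_(m, n)) : 'M[R[i]]_(m, n) :=
  map_mx (real_complex R) A.

Definition sym_mx {n : nat} (A : 'M[R]_n) : Prop := A^T = A.

Definition psd_real {n : nat} (A : 'M[R]_n) : Prop :=
  sym_mx A /\ forall v : 'cV[R]_n, 0 <= (v^T *m A *m v) 0 0.

(* [0 <= z] in [R[i]] means that [z] is real and nonnegative. *)
Definition psd {n : nat} (A : 'M[R[i]]_n) : Prop :=
  A^t* = A /\ forall v : 'cV[R[i]]_n, 0 <= (v^t* *m A *m v) 0 0.

(* Im X = (X - X^* ) / (2 i) *)
Definition im_mx {n : nat} (X : 'M[R[i]]_n) : 'M[R[i]]_n :=
  (2 * 'i)^-1 *: (X - X^t*).

(* Frobenius norm; on column vectors this is the Euclidean norm. *)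
Definition frob {m n : nat} (A : 'M[R]_(m, n)) : R :=
  Num.sqrt (\sum_i \sum_j A i j ^+ 2).

Definition opnorm_mx {n : nat} (A : 'M[R]_n) : R :=
  sup [set frob (A *m v) | v in [set v : 'cV[R]_n | frob v <= 1]].

(* Norm of a linear operator on Sym_n, induced by the Frobenius norm. *)
Definition opnorm_sym {n : nat} (L : 'M[R]_n -> 'M[R]_n) : R :=
  sup [set frob (L H) | H in [set H : 'M[R]_n | sym_mx H /\ frob H <= 1]].

(* Largest real eigenvalue; it is only applied to Hermitian matrices. *)
Definition lambda1 {n : nat} (A : 'M[R[i]]_n) : R :=
  sup [set x : R | eigenvalue A x%:C].

Definition affine_hull {n : nat} (S : set 'M[R]_n) : set 'M[R]_n :=
  [set X | exists (k : nat) (a : 'I_k -> R) (V : 'I_k -> 'M[R]_n),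
     [/\ forall i, S (V i), \sum_i a i = 1 & X = \sum_i a i *: V i]].

Definition relint {n : nat} (S : set 'M[R]_n) : set 'M[R]_n :=
  [set H | S H /\ \forall X \near H, affine_hull S X -> S X].

End Matrices.

Section Expectation.
Context {R : realType} {d : measure_display} {W : measurableType d}.
Variable P : probability W R.

Definition Emx {m n : nat} (X : W -> 'M[R]_(m, n)) : 'M[R]_(m, n) :=
  \matrix_(i, j) fine ('E_P[fun w => X w i j])%E.

Definition EmxC {m n : nat} (X : W -> 'M[R[i]]_(m, n)) : 'M[R[i]]_(m, n) :=
  \matrix_(i, j) (fine ('E_P[fun w => complex.Re (X w i j)])%E
               +i* fine ('E_P[fun w => complex.Im (X w i j)])%E).

End Expectation.

Section Model.
Context {R : realType} {d : measure_display} {W : measurableType d}.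
Variable P : probability W R.

Definition measurable_mx {d' : measure_display} {T : measurableType d'}
    {m n : nat} (X : T -> 'M[R]_(m, n)) : Prop :=
  forall i j, measurable_fun [set: T] (fun t => X t i j).

Definition standard_gaussian {r : nat} (s : W -> r.-tuple R) : Prop :=
  measurable_fun [set: W] s /\
  forall A : 'I_r -> set R, (forall i, measurable (A i)) ->
    P [set w | forall i, A i (tnth (s w) i)] =
    (\prod_(i < r) normal_prob 0 1 (A i))%E.

Definition conditional_law {r q : nat} (s : W -> r.-tuple R)
    (y : W -> q.-tuple R) (K : R.-pker (r.-tuple R) ~> (q.-tuple R)) : Prop :=
  measurable_fun [set: W] y /\
  forall (A : set (r.-tuple R)) (B : set (q.-tuple R)),
    measurable A -> measurable B ->
    P (s @^-1` A `&` y @^-1` B) = (\int[P]_(w in s @^-1` A) K (s w) B)%E.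

Definition outer {r : nat} (v : r.-tuple R) : 'M[R]_r :=
  \matrix_(i, j) (tnth v i * tnth v j).

(* [C] is a version of E[S | y], as a measurable function of [y]. *)
Definition cond_expectation_mx {q r : nat} (y : W -> q.-tuple R)
    (S : W -> 'M[R]_r) (C : q.-tuple R -> 'M[R]_r) : Prop :=
  measurable_mx C /\
  forall i j,
    P.-integrable [set: W] (fun w => (C (y w) i j)%:E) /\
    forall B : set (q.-tuple R), measurable B ->
      (\int[P]_(w in y @^-1` B) (C (y w) i j)%:E =
       \int[P]_(w in y @^-1` B) (S w i j)%:E)%E.

End Model.

Section MatrixMeasure.
Context {R : realType} {p : nat}.
Implicit Type Omega : set R -> 'M[R[i]]_p.

Definition psd_measure Omega : Prop :=
  [/\ Omega set0 = 0,
      forall A, measurable A -> psd (Omega A)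
    & forall F : nat -> set R, (forall k, measurable (F k)) ->
        trivIset setT F -> forall i j,
        \sum_(k < n) Omega (F k) i j @[n --> \oo] -->
          (Omega (\bigcup_k F k) i j : R[i]^o)].

(* The finite positive measure v^* Omega v. *)
Definition quad_measure Omega (v : 'cV[R[i]]_p) : set R -> \bar R :=
  fun A => (complex.Re ((v^t* *m Omega A *m v) 0 0))%:E.

Definition integralC (nu : set R -> \bar R) (f : R -> R[i]) : R[i] :=
  fine (\int[nu]_x (complex.Re (f x))%:E)%E
  +i* fine (\int[nu]_x (complex.Im (f x))%:E)%E.

(* Entry (i, j) of the integral of f dOmega, i.e. the integral of f against the
   complex measure e_i^* Omega e_j, which by polarization equals
   1/4 * \sum_(k < 4) (-i)^k (e_i + i^k e_j)^* Omega (e_i + i^k e_j). *)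
Definition integral_mx Omega (f : R -> R[i]) : 'M[R[i]]_p :=
  \matrix_(i, j)
    (4^-1 * \sum_(k < 4) (- 'i) ^+ k *
       integralC (quad_measure Omega (delta_mx i 0 + 'i ^+ k *: delta_mx j 0)) f).

Definition stieltjes Omega (z : R[i]) : 'M[R[i]]_p :=
  integral_mx Omega (fun l => (l%:C - z)^-1).

Definition trace_measure Omega : set R -> \bar R :=
  fun A => (p%:R^-1 * complex.Re (\tr (Omega A)))%:E.

Definition supp (mu : set R -> \bar R) : set R :=
  [set x | forall U : set R, open U -> U x -> (0 < mu U)%E].

Definition lambda_plus Omega : \bar R :=
  ereal_sup [set x%:E | x in supp (trace_measure Omega)].

End MatrixMeasure.

Section Thresholds.
Context {R : realType} {d : measure_display} {W : measurableType d}.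
Variable P : probability W R.
Context {p : nat}.
Implicit Types (alpha : R) (M : R[i] -> 'M[R[i]]_p) (T : W -> 'M[R]_p).

(* T (I + M T / alpha)^-1 *)
Definition Gmx alpha (M : 'M[R[i]]_p) (T : 'M[R]_p) : 'M[R[i]]_p :=
  toC T *m invmx (1%:M + (alpha^-1)%:C *: (M *m toC T)).

(* [invmx] is total, so that the invertibility implicit in the inverses of the
   equation is made explicit. *)
Definition is_M T alpha M : Prop :=
  [/\ forall z : R[i], 0 < complex.Im z -> forall i j,
        derivable ((fun w => M w i j) : R[i]^o -> R[i]^o) (z : R[i]^o) 1,
      forall z : R[i], 0 < complex.Im z -> psd (im_mx (M z)),
      forall i j, 'i * eta%:C * M ('i * eta%:C) i j @[eta --> +oo%R] -->
        ((- 1%:M : 'M[R[i]]_p) i j : R[i]^o)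
    & forall z : R[i], 0 < complex.Im z ->
        [/\ M z \in unitmx,
            {ae P, forall w,
              1%:M + (alpha^-1)%:C *: (M z *m toC (T w)) \in unitmx}
          & invmx (M z) = - z%:M + EmxC P (fun w => Gmx alpha (M z) (T w))]].

(* [Omega] is the matrix measure whose Stieltjes transform is M_alpha; the
   extension of M_alpha outside of the support is then [stieltjes Omega]. *)
Definition is_Omega T alpha (Omega : set R -> 'M[R[i]]_p) : Prop :=
  exists M, [/\ is_M T alpha M, psd_measure Omega, Omega setT = 1%:M
    & forall z : R[i], 0 < complex.Im z -> M z = stieltjes Omega z].

Context {r : nat}.
Variables (T : W -> 'M[R]_p) (C : W -> 'M[R]_r).
Variable Omega : R -> set R -> 'M[R[i]]_p.

Definition h alpha (x : R) : R :=
  lambda1 (EmxC P (fun w =>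
    Gmx alpha (stieltjes (Omega alpha) x%:C) (T w) *t toC (C w))) - x.

Definition Delta alpha : \bar R :=
  ereal_sup [set (h alpha x)%:E |
    x in [set x | (lambda_plus (Omega alpha) < x%:E)%E]].

Definition alpha_c_min : \bar R :=
  ereal_inf [set alpha%:E |
    alpha in [set alpha | 0 < alpha /\ (0 < Delta alpha)%E]].

Definition alpha_c_max : \bar R :=
  ereal_inf [set abar%:E | abar in [set abar | 0 < abar /\
    forall alpha, abar < alpha -> (0 < Delta alpha)%E]].

End Thresholds.

Section Optimal.
Context {R : realType} {d : measure_display} {W : measurableType d}.
Variable P : probability W R.
Context {r : nat}.
Variable C : W -> 'M[R]_r.

Definition calA (H : 'M[R]_r) : 'M[R]_r :=
  Emx P (fun w => (C w - 1%:M) *m H *m (C w - 1%:M)).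

Definition scrP : set 'M[R]_r :=
  [set H | [/\ psd_real H, \tr H = 1 & calA H = opnorm_sym calA *: H]].

End Optimal.

(* The columns of [U] are an orthonormal basis of the range (column space) of
   [H]. *)
Definition orthonormal_range {R : realType} {r p : nat} (H : 'M[R]_r)
    (U : 'M[R]_(r, p)) : Prop :=
  U^T *m U = 1%:M /\ (U^T == H^T)%MS.

Definition Tstar {R : realType} {r p : nat} (U : 'M[R]_(r, p)) (C : 'M[R]_r)
    : 'M[R]_p :=
  1%:M - invmx (U^T *m C *m U).

(* Main.v *)
(* Let B = C(y) - I, so that E B = 0, and let rho be the norm of H |-> E[B H B] on
   symmetric matrices, which is also the norm of E[B (x) B].  For x > lambda_+ put
   M = M_alpha(x), Q = (- M)^-1 and F = T (I + M T / alpha)^-1; the equation for M reads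
   E F = x - Q, hence h(x) > 0 iff Re tr (V^* Q V) < E Re tr (V^* F V B) for some V.

   Lower bound.  The imaginary part of the equation gives, in the limit z -> x,
   E[F K F] <= alpha Q K Q with K = int (l - x)^-2 dOmega > 0, while the operator
   H |-> E[B H B] has norm rho.  A moment argument bounds the Rayleigh quotient of
   V |-> E[F V B] relative to V |-> Q V by sqrt (alpha rho), so that h(x) > 0 forces
   alpha > 1 / rho.

   Upper bound.  For T_* put b = U^* B U and D = I + M / alpha.  Then F (I + D b) = b, hence
   F D b = b - F has mean Q - x and V = D gives the difference (1 / alpha - x) tr D, which is
   positive if lambda_+ < x < 1 / alpha.  It remains to see that lambda_+ < 1 / alpha as soon as
   alpha rho > 1.  Otherwise M converges as x decreases to lambda_+, the limit still satisfies
   b - F >= 0, and H_* > 0 forces D > 0 there; the equation is then stable near the limit and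
   its solution continues to the left of lambda_+ without any mass. *)
Require Import Defs.
From HB Require Import structures.
From mathcomp Require Import all_boot all_order all_algebra.
From mathcomp Require Import all_classical all_reals all_analysis.
From mathcomp Require Import complex mxtens.
From mathcomp Require Import measurable_realfun ring lra.

Set Implicit Arguments.
Unset Strict Implicit.
Unset Printing Implicit Defensive.
Import Order.TTheory GRing.Theory Num.Theory numFieldNormedType.Exports.
Local Open Scope classical_set_scope.
Local Open Scope complex_scope.
Local Open Scope ring_scope.
Local Open Scope sesquilinear_scope.
Local Open Scope ring_scope.

(** * Complex matrices and quadratic forms *)

(** For the lower bound a single Cauchy-Schwarz inequality is not enough: the equation controls F
    through K, whereas h compares with Q, and K need not be a multiple of Q. The operator V |-> Q^-1
    E[F V B] is self-adjoint for tr (X^* Q Y), so its norm is bounded by the growth rate of its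
    moments, and a growth rate may be measured with any pair of positive forms, in particular with
    K. The same argument with F replaced by B identifies the norm of E[B (x) B] with the norm on
    symmetric matrices, and with B replaced by F it gives E tr (F X F X) <= alpha tr (X Q X Q). For
    the upper bound, b - F has a sign only once 0 <= D <= 1 is known, and this is propagated from x
    = +oo. If D vanishes at 1 / alpha it is useless as a test matrix, and H_* takes its place. At
    the edge no spectral gap is left to control F, so all properties of the limit are drawn from 0
    <= D <= 1 and Fatou's lemma. Once D > 0, the matrix D - D^2 is a strict Lyapunov form for the
    linearized equation, which is what stability requires. *)

Local Notation nc := ComplexField.Normc.normc.
Local Notation Re := complex.Re.
Local Notation Im := complex.Im.

Section ComplexScalars.
Context {R : realType}.
Implicit Types (x y : R[i]) (a : R).

Lemma ReD x y : Re (x + y) = Re x + Re y. Proof. by case: x y => ? ? []. Qed.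
Lemma ImD x y : Im (x + y) = Im x + Im y. Proof. by case: x y => ? ? []. Qed.
Lemma ReN x : Re (- x) = - Re x. Proof. by case: x. Qed.
Lemma ImN x : Im (- x) = - Im x. Proof. by case: x. Qed.
Lemma ReB x y : Re (x - y) = Re x - Re y. Proof. by rewrite ReD ReN. Qed.
Lemma ImB x y : Im (x - y) = Im x - Im y. Proof. by rewrite ImD ImN. Qed.
Lemma ReM x y : Re (x * y) = Re x * Re y - Im x * Im y.
Proof. by case: x y => ? ? []. Qed.
Lemma ImM x y : Im (x * y) = Re x * Im y + Im x * Re y.
Proof. by case: x y => a b [c e] /=; rewrite [b * c]mulrC. Qed.
Lemma ReZ a x : Re (a%:C * x) = a * Re x. Proof. by rewrite ReM mul0r subr0. Qed.
Lemma ImZ a x : Im (a%:C * x) = a * Im x. Proof. by rewrite ImM mul0r addr0. Qed.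
Lemma ReJ x : Re (Num.conj x) = Re x. Proof. by case: x. Qed.
Lemma ImJ x : Im (Num.conj x) = - Im x. Proof. by case: x. Qed.

Lemma Re_sum (I : Type) (r : seq I) (P : pred I) (F : I -> R[i]) :
  Re (\sum_(i <- r | P i) F i) = \sum_(i <- r | P i) Re (F i).
Proof. by elim/big_rec2: _ => [//|i a b _ <-]; rewrite ReD. Qed.
Lemma Im_sum (I : Type) (r : seq I) (P : pred I) (F : I -> R[i]) :
  Im (\sum_(i <- r | P i) F i) = \sum_(i <- r | P i) Im (F i).
Proof. by elim/big_rec2: _ => [//|i a b _ <-]; rewrite ImD. Qed.

Lemma complex_ext x y : Re x = Re y -> Im x = Im y -> x = y.
Proof. by case: x y => a b [c e] /= -> ->. Qed.

Lemma conj_realC a : Num.conj (a%:C : R[i]) = a%:C.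
Proof. by apply: complex_ext => /=; rewrite ?oppr0. Qed.

Lemma nc_ge0 x : 0 <= nc x. Proof. by case: x => a b; exact: sqrtr_ge0. Qed.
Lemma ncD x y : nc (x + y) <= nc x + nc y. Proof. exact: le_normcD. Qed.
Lemma ncM x y : nc (x * y) = nc x * nc y.
Proof. exact: ComplexField.Normc.normcM. Qed.
Lemma ncN x : nc (- x) = nc x. Proof. exact: normcN. Qed.
Lemma ncV x : nc x^-1 = (nc x)^-1. Proof. exact: ComplexField.Normc.normcV. Qed.
Lemma nc_sqr x : nc x ^+ 2 = Re x ^+ 2 + Im x ^+ 2.
Proof. by case: x => a b /=; rewrite sqr_sqrtr// addr_ge0 ?sqr_ge0. Qed.
Lemma nc0 : nc (0 : R[i]) = 0. Proof. exact: ComplexField.Normc.normc0. Qed.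
Lemma nc1 : nc (1 : R[i]) = 1. Proof. exact: ComplexField.Normc.normc1. Qed.
Lemma nc0_eq0 x : nc x = 0 -> x = 0.
Proof. exact: ComplexField.Normc.eq0_normc. Qed.
Lemma ncJ x : nc (Num.conj x) = nc x.
Proof. by case: x => a b /=; rewrite sqrrN. Qed.
Lemma nc_real a : nc a%:C = `|a|.
Proof. by rewrite /= expr0n /= addr0 sqrtr_sqr. Qed.
Lemma nc_Re x : `|Re x| <= nc x.
Proof.
rewrite -(@ler_pXn2r _ 2) ?nnegrE ?nc_ge0// real_normK ?num_real//.
by rewrite nc_sqr lerDl sqr_ge0.
Qed.
Lemma nc_Im x : `|Im x| <= nc x.
Proof.
rewrite -(@ler_pXn2r _ 2) ?nnegrE ?nc_ge0// real_normK ?num_real//.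
by rewrite nc_sqr lerDr sqr_ge0.
Qed.
Lemma nc_le x : nc x <= `|Re x| + `|Im x|.
Proof.
rewrite -(@ler_pXn2r _ 2) ?nnegrE ?nc_ge0 ?addr_ge0// nc_sqr sqrrD.
rewrite !real_normK ?num_real// addrAC lerDl.
by rewrite mulrn_wge0// mulr_ge0.
Qed.
Lemma nc_sum (I : Type) (r : seq I) (P : pred I) (F : I -> R[i]) :
  nc (\sum_(i <- r | P i) F i) <= \sum_(i <- r | P i) nc (F i).
Proof.
elim/big_rec2: _ => [|i a b _ h]; first by rewrite nc0.
by rewrite (le_trans (ncD _ _))// lerD.
Qed.
Lemma mulcJ x : Num.conj x * x = (nc x ^+ 2)%:C.
Proof.
rewrite nc_sqr; case: x => a b; apply: complex_ext => /=; ring.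
Qed.
Lemma nc_i : nc ('i : R[i]) = 1.
Proof. by rewrite /= expr0n expr1n add0r sqrtr1. Qed.

Lemma ler_2M (a b : R) : 2 * (a * b) <= a ^+ 2 + b ^+ 2.
Proof. by rewrite -subr_ge0; have := sqr_ge0 (a - b); rewrite sqrrB; lra. Qed.

End ComplexScalars.

Section ConjTranspose.
Context {R : realType}.
Local Notation K := R[i].

Lemma trmxCE m n (A : 'M[K]_(m, n)) i j : (A^t*) i j = Num.conj (A j i).
Proof. by rewrite !mxE. Qed.
Lemma trmxCD m n (A B : 'M[K]_(m, n)) : (A + B)^t* = A^t* + B^t*.
Proof. by rewrite linearD /= map_mxD. Qed.
Lemma trmxCN m n (A : 'M[K]_(m, n)) : (- A)^t* = - A^t*.
Proof. by rewrite linearN /= map_mxN. Qed.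
Lemma trmxCB m n (A B : 'M[K]_(m, n)) : (A - B)^t* = A^t* - B^t*.
Proof. by rewrite trmxCD trmxCN. Qed.
Lemma trmxCM m n p (A : 'M[K]_(m, n)) (B : 'M[K]_(n, p)) :
  (A *m B)^t* = B^t* *m A^t*.
Proof. by rewrite trmx_mul map_mxM. Qed.
Lemma trmxCZ m n (a : K) (A : 'M[K]_(m, n)) : (a *: A)^t* = Num.conj a *: A^t*.
Proof. by rewrite linearZ /= map_mxZ. Qed.
Lemma trmxCZr m n (a : R) (A : 'M[K]_(m, n)) : (a%:C *: A)^t* = a%:C *: A^t*.
Proof. by rewrite trmxCZ conj_realC. Qed.
Lemma trmxC0 m n : (0 : 'M[K]_(m, n))^t* = 0.
Proof. by rewrite trmx0 map_mx0. Qed.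
Lemma trmxC1 n : (1%:M : 'M[K]_n)^t* = 1%:M.
Proof. by rewrite trmx1 map_mx1. Qed.
Lemma trmxC_inv n (A : 'M[K]_n) : (invmx A)^t* = invmx (A^t*).
Proof. by rewrite trmx_inv map_invmx. Qed.
Lemma trmxC_unit n (A : 'M[K]_n) : (A^t* \in unitmx) = (A \in unitmx).
Proof. by rewrite map_unitmx unitmx_tr. Qed.
Lemma trmxC_toC m n (A : 'M[R]_(m, n)) : (toC A)^t* = toC A^T.
Proof. by apply/matrixP => i j; rewrite !mxE conj_realC. Qed.
Lemma mxtrace_trmxC n (A : 'M[K]_n) : \tr (A^t*) = Num.conj (\tr A).
Proof. by rewrite /mxtrace rmorph_sum; apply: eq_bigr => i _; rewrite trmxCE. Qed.

Lemma toCB m n (A B : 'M[R]_(m, n)) : toC (A - B) = toC A - toC B.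
Proof. by rewrite /toC map_mxB. Qed.
Lemma toCM m n p (A : 'M[R]_(m, n)) (B : 'M[R]_(n, p)) :
  toC (A *m B) = toC A *m toC B.
Proof. by rewrite /toC map_mxM. Qed.
Lemma toC1 n : toC (1%:M : 'M[R]_n) = 1%:M. Proof. by rewrite /toC map_mx1. Qed.
Lemma toC_scalar n a : toC (a%:M : 'M[R]_n) = (a%:C)%:M.
Proof. by rewrite /toC map_scalar_mx. Qed.
Lemma toCZ m n a (A : 'M[R]_(m, n)) : toC (a *: A) = a%:C *: toC A.
Proof. by rewrite /toC map_mxZ. Qed.
Lemma toC_inj m n : injective (@toC R m n).
Proof. by move=> A B /matrixP h; apply/matrixP => i j; have := h i j; rewrite !mxE => -[]. Qed.

End ConjTranspose.

Section EntrywiseNorm.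
Context {R : realType}.
Local Notation K := R[i].

(* The entrywise l1 norm is submultiplicative and invariant under conjugate
   transposition, which is all that is needed from a matrix norm. *)
Definition nm m n (A : 'M[K]_(m, n)) : R := \sum_i \sum_j nc (A i j).

Lemma nm_ge0 m n (A : 'M[K]_(m, n)) : 0 <= nm A.
Proof. by apply: sumr_ge0 => i _; apply: sumr_ge0 => j _; exact: nc_ge0. Qed.
Lemma nmD m n (A B : 'M[K]_(m, n)) : nm (A + B) <= nm A + nm B.
Proof.
rewrite /nm -big_split; apply: ler_sum => i _ /=.
by rewrite -big_split; apply: ler_sum => j _; rewrite mxE ncD.
Qed.
Lemma nmN m n (A : 'M[K]_(m, n)) : nm (- A) = nm A.
Proof. by apply: eq_bigr => i _; apply: eq_bigr => j _; rewrite mxE ncN. Qed.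
Lemma nmB m n (A B : 'M[K]_(m, n)) : nm (A - B) <= nm A + nm B.
Proof. by rewrite -(nmN B) nmD. Qed.
Lemma nmBC m n (A B : 'M[K]_(m, n)) : nm (A - B) = nm (B - A).
Proof. by rewrite -nmN opprB. Qed.
Lemma nmZ m n (a : K) (A : 'M[K]_(m, n)) : nm (a *: A) = nc a * nm A.
Proof.
rewrite /nm mulr_sumr; apply: eq_bigr => i _; rewrite mulr_sumr.
by apply: eq_bigr => j _; rewrite mxE ncM.
Qed.
Lemma nm0 m n : nm (0 : 'M[K]_(m, n)) = 0.
Proof. by rewrite /nm big1// => i _; rewrite big1// => j _; rewrite mxE nc0. Qed.
Lemma nm_entry m n (A : 'M[K]_(m, n)) i j : nc (A i j) <= nm A.
Proof.
rewrite /nm (bigD1 i)//= (bigD1 j)//= -addrA lerDl addr_ge0//.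
  by apply: sumr_ge0 => ? _; exact: nc_ge0.
by apply: sumr_ge0 => ? _; apply: sumr_ge0 => ? _; exact: nc_ge0.
Qed.
Lemma nm_eq0 m n (A : 'M[K]_(m, n)) : nm A <= 0 -> A = 0.
Proof.
move=> h; apply/matrixP => i j; rewrite mxE; apply: nc0_eq0; apply/eqP.
by rewrite eq_le nc_ge0 andbT (le_trans (nm_entry A i j)).
Qed.
Lemma nmM m n p (A : 'M[K]_(m, n)) (B : 'M[K]_(n, p)) : nm (A *m B) <= nm A * nm B.
Proof.
have rowB j : \sum_k nc (B j k) <= nm B.
  by rewrite /nm (bigD1 j)//= lerDl; apply: sumr_ge0 => ? _; apply: sumr_ge0 => ? _; exact: nc_ge0.
rewrite {1 2}/nm mulr_suml; apply: ler_sum => i _.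
apply: (@le_trans _ _ (\sum_k \sum_j nc (A i j) * nc (B j k))).
  apply: ler_sum => k _; rewrite mxE (le_trans (nc_sum _ _ _))//.
  by apply: ler_sum => j _; rewrite ncM.
rewrite exchange_big mulr_suml; apply: ler_sum => j _ /=.
by rewrite -mulr_sumr ler_wpM2l ?nc_ge0.
Qed.
Lemma nmMc m n p (A : 'M[K]_(m, n)) (B : 'M[K]_(n, p)) a b :
  nm A <= a -> nm B <= b -> nm (A *m B) <= a * b.
Proof. by move=> ? ?; rewrite (le_trans (nmM _ _))// ler_pM// nm_ge0. Qed.
Lemma nm_trmxC m n (A : 'M[K]_(m, n)) : nm (A^t*) = nm A.
Proof.
rewrite /nm exchange_big; apply: eq_bigr => i _; apply: eq_bigr => j _.
by rewrite trmxCE ncJ.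
Qed.
Lemma nm_le m n (A : 'M[K]_(m, n)) c : (forall i j, nc (A i j) <= c) ->
  nm A <= m%:R * n%:R * c.
Proof.
move=> h; apply: (@le_trans _ _ (\sum_(i < m) \sum_(j < n) c)).
  by apply: ler_sum => i _; apply: ler_sum => j _.
by rewrite !sumr_const !card_ord -[(c *+ n) *+ m]mulr_natl -[c *+ n]mulr_natl mulrA.
Qed.
Lemma nm_trace n (A : 'M[K]_n) : nc (\tr A) <= nm A.
Proof.
rewrite (le_trans (nc_sum _ _ _))//; apply: ler_sum => i _.
by rewrite (bigD1 i)//= lerDl sumr_ge0// => ? _; exact: nc_ge0.
Qed.

End EntrywiseNorm.

Section QuadraticForms.
Context {R : realType}.
Local Notation K := R[i].

Definition hf n (A : 'M[K]_n) (u v : 'cV[K]_n) : K := (u^t* *m A *m v) 0 0.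
Definition qf n (A : 'M[K]_n) (v : 'cV[K]_n) : R := Re (hf A v v).
Definition sq n (v : 'cV[K]_n) : R := \sum_i nc (v i 0) ^+ 2.

Lemma hfD n (A B : 'M[K]_n) u v : hf (A + B) u v = hf A u v + hf B u v.
Proof. by rewrite /hf mulmxDr mulmxDl mxE. Qed.
Lemma hfN n (A : 'M[K]_n) u v : hf (- A) u v = - hf A u v.
Proof. by rewrite /hf mulmxN mulNmx mxE. Qed.
Lemma hfB n (A B : 'M[K]_n) u v : hf (A - B) u v = hf A u v - hf B u v.
Proof. by rewrite hfD hfN. Qed.
Lemma hfZ n a (A : 'M[K]_n) u v : hf (a *: A) u v = a * hf A u v.
Proof. by rewrite /hf -scalemxAr -scalemxAl mxE. Qed.
Lemma hfDl n (A : 'M[K]_n) u u' v : hf A (u + u') v = hf A u v + hf A u' v.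
Proof. by rewrite /hf trmxCD !mulmxDl mxE. Qed.
Lemma hfDr n (A : 'M[K]_n) u v v' : hf A u (v + v') = hf A u v + hf A u v'.
Proof. by rewrite /hf mulmxDr mxE. Qed.
Lemma hfZl n (A : 'M[K]_n) a u v : hf A (a *: u) v = Num.conj a * hf A u v.
Proof. by rewrite /hf trmxCZ -!scalemxAl mxE. Qed.
Lemma hfZr n (A : 'M[K]_n) a u v : hf A u (a *: v) = a * hf A u v.
Proof. by rewrite /hf -scalemxAr mxE. Qed.
Lemma hfJ n (A : 'M[K]_n) u v : Num.conj (hf A u v) = hf (A^t*) v u.
Proof. by rewrite /hf -trmxCE !trmxCM trmxCK mulmxA. Qed.
Lemma hf_congr m n (B : 'M[K]_(m, n)) (A : 'M[K]_m) u v :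
  hf (B^t* *m A *m B) u v = hf A (B *m u) (B *m v).
Proof. by rewrite /hf trmxCM !mulmxA. Qed.
Lemma hfE n (A : 'M[K]_n) u v :
  hf A u v = \sum_i \sum_j Num.conj (u i 0) * A i j * v j 0.
Proof.
rewrite /hf -mulmxA mxE; apply: eq_bigr => i _; rewrite trmxCE mxE mulr_sumr.
by apply: eq_bigr => j _; rewrite mulrA.
Qed.
Lemma hf_delta n (A : 'M[K]_n) i j : hf A (delta_mx i 0) (delta_mx j 0) = A i j.
Proof.
rewrite hfE (bigD1 i)//= (bigD1 j)//= !mxE !eqxx /= mulr1 conjC1 mul1r.
rewrite !big1 ?addr0// => k kn; first rewrite big1// => l _.
  by rewrite !mxE (negbTE kn)/= conjC0 !mul0r.
by rewrite !mxE (negbTE kn)/= mulr0.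
Qed.

Lemma qfD n (A B : 'M[K]_n) v : qf (A + B) v = qf A v + qf B v.
Proof. by rewrite /qf hfD ReD. Qed.
Lemma qfN n (A : 'M[K]_n) v : qf (- A) v = - qf A v.
Proof. by rewrite /qf hfN ReN. Qed.
Lemma qfB n (A B : 'M[K]_n) v : qf (A - B) v = qf A v - qf B v.
Proof. by rewrite qfD qfN. Qed.
Lemma qfZ n a (A : 'M[K]_n) v : qf (a%:C *: A) v = a * qf A v.
Proof. by rewrite /qf hfZ ReZ. Qed.
Lemma qfZv n a (A : 'M[K]_n) v : qf A (a%:C *: v) = a ^+ 2 * qf A v.
Proof. by rewrite /qf hfZl hfZr conj_realC !ReZ mulrA. Qed.
Lemma qf_congr m n (B : 'M[K]_(m, n)) (A : 'M[K]_m) v :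
  qf (B^t* *m A *m B) v = qf A (B *m v).
Proof. by rewrite /qf hf_congr. Qed.
Lemma hf_herm n (A : 'M[K]_n) v : A^t* = A -> hf A v v = (qf A v)%:C.
Proof.
move=> hA; apply: complex_ext => //=; have : Im (hf A v v) = - Im (hf A v v).
  by rewrite -ImJ hfJ hA.
by move=> ?; lra.
Qed.

Lemma sq_ge0 n (v : 'cV[K]_n) : 0 <= sq v.
Proof. by apply: sumr_ge0 => i _; exact: sqr_ge0. Qed.
Lemma hf1 n (v : 'cV[K]_n) : hf 1%:M v v = (sq v)%:C.
Proof.
rewrite /hf mulmx1 mxE rmorph_sum; apply: eq_bigr => i _ /=.
by rewrite trmxCE mulcJ.
Qed.
Lemma qf1 n (v : 'cV[K]_n) : qf 1%:M v = sq v. Proof. by rewrite /qf hf1. Qed.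
Lemma qf_scalar n a (v : 'cV[K]_n) : qf (a%:C)%:M v = a * sq v.
Proof. by rewrite -scalemx1 qfZ qf1. Qed.
Lemma sqE n (v : 'cV[K]_n) : (v^t* *m v) 0 0 = (sq v)%:C.
Proof. by rewrite -hf1 /hf mulmx1. Qed.
Lemma sq_eq0 n (v : 'cV[K]_n) : sq v <= 0 -> v = 0.
Proof.
move=> h; apply/matrixP => i j; rewrite mxE [j]ord1; apply: nc0_eq0; apply/eqP.
rewrite -sqrf_eq0 eq_le sqr_ge0 andbT (le_trans _ h)//.
by rewrite /sq (bigD1 i)//= lerDl sumr_ge0// => ? _; exact: sqr_ge0.
Qed.
Lemma sq_gt0 n (v : 'cV[K]_n) : v != 0 -> 0 < sq v.
Proof. by move=> v0; rewrite ltNge; apply: contra v0 => /sq_eq0 ->. Qed.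
Lemma sq0 n : sq (0 : 'cV[K]_n) = 0.
Proof. by rewrite /sq big1// => i _; rewrite mxE nc0 expr0n. Qed.
Lemma nm_cV n (v : 'cV[K]_n) : nm v = \sum_i nc (v i 0).
Proof. by apply: eq_bigr => i _; rewrite big_ord1. Qed.
Lemma sq_le_nm n (v : 'cV[K]_n) : sq v <= nm v ^+ 2.
Proof.
rewrite expr2 {1}nm_cV mulr_suml; apply: ler_sum => i _.
by rewrite expr2 ler_wpM2l ?nc_ge0// nm_entry.
Qed.
Lemma nm_le_sq n (v : 'cV[K]_n) : nm v ^+ 2 <= n%:R * sq v.
Proof.
rewrite nm_cV expr2 mulr_suml.
have h i j : nc (v i 0) * nc (v j 0) <= nc (v i 0) ^+ 2 / 2 + nc (v j 0) ^+ 2 / 2.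
  by rewrite -mulrDl ler_pdivlMr// mulrC ler_2M.
apply: (@le_trans _ _ (\sum_i \sum_j (nc (v i 0) ^+ 2 / 2 + nc (v j 0) ^+ 2 / 2))).
  by apply: ler_sum => i _; rewrite mulr_sumr; apply: ler_sum => j _.
under eq_bigr do rewrite big_split /= sumr_const card_ord.
rewrite big_split /= sumrMnl sumr_const card_ord -[X in X + _]mulr_natl
  -[X in _ + X]mulr_natl -mulrDr.
rewrite ler_wpM2l// -big_split; apply: ler_sum => i _ /=; lra.
Qed.
Lemma hf_nm n (A : 'M[K]_n) u v : nc (hf A u v) <= nm A * nm u * nm v.
Proof.
rewrite (le_trans (nm_entry _ 0 0))// (le_trans (nmM _ _))//.
by rewrite ler_wpM2r ?nm_ge0// mulrC -(nm_trmxC u) nmM.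
Qed.
Lemma qf_le n (A : 'M[K]_n) v : `|qf A v| <= n%:R * nm A * sq v.
Proof.
rewrite (le_trans (nc_Re _))// (le_trans (hf_nm _ _ _))//.
by rewrite -mulrA -expr2 mulrAC mulrC ler_wpM2r ?nm_ge0// nm_le_sq.
Qed.

(** These are the vectors used in [integral_mx]. A complex matrix is determined by its quadratic
    form on them, which reduces matrix statements to scalar ones. *)
Definition polv n (i j : 'I_n) (k : nat) : 'cV[K]_n :=
  delta_mx i 0 + 'i ^+ k *: delta_mx j 0.
Lemma nc_iX k : nc ('i ^+ k : K) = 1.
Proof.
elim: k => [|k IH]; last by rewrite exprS ncM nc_i IH mul1r.
by rewrite expr0 nc1.
Qed.
Lemma conj_iX k : Num.conj ('i ^+ k : K) = (- 'i) ^+ k.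
Proof.
rewrite rmorphXn /=; congr (_ ^+ _).
by apply: complex_ext => /=; rewrite ?oppr0.
Qed.
Lemma hf_addZ n (A : 'M[K]_n) u w c : hf A (u + c *: w) (u + c *: w) =
  hf A u u + c * hf A u w + Num.conj c * hf A w u + Num.conj c * c * hf A w w.
Proof.
rewrite hfDl !hfDr !hfZl !hfZr.
move: (hf A u u) (hf A u w) (hf A w u) (hf A w w) => x y z t; ring.
Qed.
(** The powers of -i and those of (-i)^2 = -1 both sum to zero over the four values of k. This kills
    the diagonal terms and [A j i], and leaves four copies of [A i j]. *)
Lemma polarization n (A : 'M[K]_n) i j :
  A i j = 4^-1 * \sum_(k < 4) (- 'i) ^+ k * hf A (polv i j k) (polv i j k).
Proof.
have E k : (- 'i) ^+ k * hf A (polv i j k) (polv i j k) =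
    (- 'i) ^+ k * (A i i + A j j) + A i j + (- 'i) ^+ k * (- 'i) ^+ k * A j i.
  rewrite /polv hf_addZ !hf_delta.
  have e : (- 'i) ^+ k * 'i ^+ k = 1 :> K.
    by rewrite -conj_iX mulcJ nc_iX expr1n.
  rewrite conj_iX e; transitivity ((- 'i) ^+ k * (A i i + A j j) +
    ((- 'i) ^+ k * 'i ^+ k) * A i j + (- 'i) ^+ k * (- 'i) ^+ k * A j i); first ring.
  by rewrite e mul1r.
under eq_bigr do rewrite E.
have i2 : (- 'i : K) ^+ 2 = -1 by rewrite sqrrN sqr_i.
rewrite !big_ord_recr big_ord0 /= add0r.
move: (- 'i : K) i2 => t i2; have t3 : t ^+ 3 = - t by rewrite exprS i2 mulrN1.
rewrite t3 i2 expr0 expr1.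
have h4 : (4 : K) != 0 by rewrite pnatr_eq0.
apply: (mulfI h4); rewrite [RHS]mulrA divff// mul1r.
transitivity (4 * A i j + (t ^+ 2 + 1) * 2 * A j i); last ring.
by rewrite i2 addNr !mul0r addr0.
Qed.
Lemma sq_polv n (i j : 'I_n) k : sq (polv i j k) <= 4.
Proof.
apply: (@le_trans _ _ (\sum_l (2 * ((l == i)%:R + (l == j)%:R)) : R)).
  apply: ler_sum => l _; rewrite !mxE !andbT.
  have -> : ((l == i)%:R + 'i ^+ k * (l == j)%:R : K) =
    (l == i)%:R%:C + 'i ^+ k * (l == j)%:R%:C by rewrite !rmorph_nat.
  have h : nc ((l == i)%:R%:C + 'i ^+ k * (l == j)%:R%:C : K) <=
      (l == i)%:R + (l == j)%:R :> R.
    by rewrite (le_trans (ncD _ _))// ncM nc_iX mul1r !nc_real !ger0_norm.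
  rewrite (le_trans (_ : _ <= ((l == i)%:R + (l == j)%:R) ^+ 2))//.
    by rewrite ler_pXn2r ?nnegrE ?nc_ge0// addr_ge0.
  by case: (l == i); case: (l == j); rewrite /= ?expr2; lra.
have d1 (m : 'I_n) : \sum_l (l == m)%:R = 1 :> R.
  by rewrite (bigD1 m)//= eqxx big1 ?addr0// => l /negbTE ->.
rewrite -mulr_sumr big_split /= !d1; lra.
Qed.
(** By polarization each entry is an average of four values of the quadratic form at vectors of
    squared length at most 4, hence at most 4 c; there are n^2 entries. *)
Lemma nm_numrange n (A : 'M[K]_n) c : (forall v, nc (hf A v v) <= c * sq v) ->
  nm A <= 4 * n%:R ^+ 2 * c.
Proof.
move=> h; apply: (@le_trans _ _ (n%:R * n%:R * (4 * c))); last by rewrite expr2; lra.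
apply: nm_le => i j; rewrite polarization ncM.
have c0 : 0 <= c.
  have := h (delta_mx i 0); rewrite -qf1 /qf !hf_delta mxE eqxx /= mulr1.
  by move=> /(le_trans (nc_ge0 _)).
have n4 : nc (4^-1 : K) = 4^-1 :> R.
  have -> : (4^-1 : K) = (4^-1)%:C by rewrite fmorphV rmorph_nat.
  by rewrite nc_real ger0_norm.
rewrite n4 ler_pdivrMl//.
apply: (@le_trans _ _ (\sum_(k < 4) (4 * c))); last first.
  by rewrite sumr_const card_ord -[_ *+ 4]mulr_natl.
rewrite (le_trans (nc_sum _ _ _))//; apply: ler_sum => k _.
have -> : nc ((- 'i) ^+ k * hf A (polv i j k) (polv i j k)) =
  nc (hf A (polv i j k) (polv i j k)).
  rewrite ncM (_ : nc _ = 1) ?mul1r//; elim: (k : nat) => [|l IH].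
    by rewrite expr0 nc1.
  by rewrite exprS ncM ncN nc_i IH mulr1.
by rewrite (le_trans (h _))// mulrC ler_wpM2r// sq_polv.
Qed.
Lemma hf_inj n (A B : 'M[K]_n) : (forall v, hf A v v = hf B v v) -> A = B.
Proof.
by move=> h; apply/matrixP => i j; rewrite !polarization; under eq_bigr do rewrite h.
Qed.

End QuadraticForms.

Section Spectral.
Context {R : realType}.
Local Notation K := R[i].

Definition pd n (A : 'M[K]_n) := A^t* = A /\ forall v, v != 0 -> 0 < qf A v.

Lemma psdE n (A : 'M[K]_n) : psd A <-> A^t* = A /\ forall v, 0 <= qf A v.
Proof.
split=> -[hA h]; split=> // v.
  by have := h v; rewrite -/(hf A v v) (hf_herm v hA) ler0c.
by rewrite -/(hf A v v) (hf_herm v hA) ler0c.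
Qed.

Lemma spectral n (A : 'M[K]_n) : A^t* = A ->
  exists (U : 'M[K]_n) (d : 'I_n -> R),
    [/\ U *m U^t* = 1%:M, U^t* *m U = 1%:M &
        A = U^t* *m diag_mx (\row_i (d i)%:C) *m U].
Proof.
move=> hA; pose P := spectralmx A.
have hP : P \is unitarymx by exact: spectral_unitarymx.
have hU : P *m P^t* = 1%:M by exact/unitarymxP.
have hU' : P^t* *m P = 1%:M by apply: mulmx1C.
have hN : A \is normalmx by apply/normalmxP; rewrite hA.
have /orthomx_spectralP := hN; rewrite -/P invmx_unitary// => eA.
set D := spectral_diag A in eA; exists P, (fun i => Re (D 0 i)); split=> [//|//|].
suff <- : diag_mx D = diag_mx (\row_i (Re (D 0 i))%:C) by [].
have hD : diag_mx D = P *m A *m P^t*.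
  by rewrite {1}eA !mulmxA hU mul1mx -mulmxA hU mulmx1.
have hDh : (diag_mx D)^t* = diag_mx D by rewrite hD !trmxCM trmxCK hA mulmxA.
congr diag_mx; apply/rowP => i; rewrite mxE.
have := congr1 (fun X : 'M[K]_n => X i i) hDh; rewrite trmxCE !mxE eqxx !mulr1n.
move=> e; apply: complex_ext => //=; have := congr1 (@complex.Im R) e; rewrite ImJ; lra.
Qed.

Lemma qf_diag n (d : 'I_n -> R) (v : 'cV[K]_n) :
  qf (diag_mx (\row_i (d i)%:C)) v = \sum_i d i * nc (v i 0) ^+ 2.
Proof.
rewrite /qf /hf -mulmxA mxE Re_sum; apply: eq_bigr => i _.
rewrite trmxCE mul_diag_mx !mxE mulrCA mulcJ; exact: ReZ.
Qed.

Lemma sq_unitary n (U : 'M[K]_n) v : U^t* *m U = 1%:M -> sq (U *m v) = sq v.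
Proof. by move=> hU; rewrite -qf1 -qf_congr mulmx1 hU qf1. Qed.

Lemma qf_spectral n (A U : 'M[K]_n) d v :
  A = U^t* *m diag_mx (\row_i (d i)%:C) *m U ->
  qf A v = \sum_i d i * nc ((U *m v) i 0) ^+ 2.
Proof. by move=> ->; rewrite qf_congr qf_diag. Qed.

Lemma sq_delta n (i : 'I_n) : sq (delta_mx i 0 : 'cV[K]_n) = 1.
Proof. by rewrite -qf1 /qf hf_delta mxE eqxx. Qed.

Lemma qf_eigen n (A U : 'M[K]_n) d i : U *m U^t* = 1%:M ->
  A = U^t* *m diag_mx (\row_i (d i)%:C) *m U ->
  qf A (U^t* *m delta_mx i 0) = d i.
Proof.
move=> hU /qf_spectral ->; rewrite mulmxA hU mul1mx (bigD1 i)//= big1 => [|j ji].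
  have -> : (delta_mx i 0 : 'cV[K]_n) i 0 = 1 by rewrite mxE !eqxx.
  by rewrite nc1 expr1n mulr1 addr0.
have -> : (delta_mx i 0 : 'cV[K]_n) j 0 = 0 by rewrite mxE (negbTE ji).
by rewrite nc0 expr0n mulr0.
Qed.

Lemma psd_factor n (A : 'M[K]_n) : psd A -> exists Z : 'M[K]_n, A = Z^t* *m Z.
Proof.
move=> /psdE[hA h]; have [U [d [hU hU' eA]]] := spectral hA.
have d0 i : 0 <= d i by rewrite -(qf_eigen i hU eA).
exists (diag_mx (\row_i (Num.sqrt (d i))%:C) *m U).
set S := diag_mx _.
have hS : S^t* = S.
  rewrite tr_diag_mx map_diag_mx; congr diag_mx; apply/rowP => i.
  by rewrite !mxE [LHS]conj_realC.
suff e : diag_mx (\row_i (d i)%:C) = S *m S by rewrite trmxCM hS eA e !mulmxA.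
rewrite mulmx_diag; congr diag_mx; apply/rowP => i.
by rewrite !mxE -rmorphM /= -expr2 sqr_sqrtr.
Qed.

Lemma pd_lower n (A : 'M[K]_n) : pd A ->
  exists2 k, 0 < k & forall v, k * sq v <= qf A v.
Proof.
move=> [hA h]; have [U [d [hU hU' eA]]] := spectral hA.
have d0 i : 0 < d i.
  rewrite -(qf_eigen i hU eA) h//; apply/eqP => e.
  have := sq_unitary (delta_mx i 0) (_ : (U^t*)^t* *m U^t* = 1%:M).
  by rewrite trmxCK e sq0 sq_delta => /(_ hU)/eqP; rewrite eq_sym oner_eq0.
(* This s dominates every inverse eigenvalue, so 1 / s is a lower bound of the spectrum without
   taking a minimum; the summand 1 keeps s positive when n = 0. *)
pose s := 1 + \sum_i (d i)^-1.
have si i : (d i)^-1 <= s.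
  rewrite /s (bigD1 i)//= addrCA lerDl addr_ge0// sumr_ge0// => j _.
  by rewrite invr_ge0 ltW.
have s0 : 0 < s by rewrite ltr_pwDl// sumr_ge0// => j _; rewrite invr_ge0 ltW.
exists s^-1 => [|v]; first by rewrite invr_gt0.
rewrite (qf_spectral v eA) -(sq_unitary v hU') mulr_sumr.
apply: ler_sum => i _; rewrite ler_wpM2r ?sqr_ge0//.
by rewrite -[leRHS]invrK lef_pV2 ?posrE ?invr_gt0.
Qed.

Lemma pd_unit n (A : 'M[K]_n) : pd A -> A \in unitmx.
Proof.
move=> [hA h]; rewrite -row_free_unit -kermx_eq0; apply/negPn/negP.
move=> /rowV0Pn[u /sub_kermxP uA u0].
have : (u^t* : 'cV_n) != 0.
  by apply: contra u0 => /eqP e; rewrite -(trmxCK u) e trmxC0.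
by move=> /h; rewrite /qf /hf trmxCK uA mul0mx mxE ltxx.
Qed.

Lemma pd_psd n (A : 'M[K]_n) : pd A -> psd A.
Proof.
move=> [hA h]; apply/psdE; split=> // v; have [->|/h/ltW//] := eqVneq v 0.
by rewrite /qf /hf mulmx0 mxE.
Qed.

Lemma pd_inv n (A : 'M[K]_n) : pd A -> pd (invmx A).
Proof.
move=> hA; have uA := pd_unit hA; case: hA => hA h.
have hI : (invmx A)^t* = invmx A by rewrite trmxC_inv hA.
split=> [//|v v0]; have : invmx A *m v != 0.
  by apply: contra v0 => /eqP e; rewrite -[v](mulKVmx uA) e mulmx0.
by move=> /h; rewrite -qf_congr hI (mulVmx uA) mul1mx.
Qed.

Lemma psd_kernel n (A : 'M[K]_n) v : psd A -> qf A v <= 0 -> A *m v = 0.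
Proof.
move=> /psd_factor[Z ->]; rewrite -(mulmx1 (Z^t*)) qf_congr qf1 => /sq_eq0.
by rewrite mulmx1 -mulmxA => ->; rewrite mulmx0.
Qed.

Lemma eigenvalue_diag n (A U : 'M[K]_n) d (i : 'I_n) : U *m U^t* = 1%:M ->
  A = U^t* *m diag_mx (\row_i (d i)%:C) *m U -> eigenvalue A (d i)%:C.
Proof.
move=> hU eA; apply/eigenvalueP; exists (delta_mx 0 i *m U).
  rewrite {1}eA !mulmxA -[_ *m U *m U^t*]mulmxA hU mulmx1.
  by rewrite -(rowE i (diag_mx _)) row_diag_mx mxE -scalemxAl.
apply/eqP => /(congr1 (fun X => X *m U^t*)); rewrite mul0mx -mulmxA hU mulmx1.
by move=> /matrixP/(_ 0 i)/eqP; rewrite !mxE !eqxx oner_eq0.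
Qed.

Lemma eigenvalue_qf n (A : 'M[K]_n) (x : R) : eigenvalue A x%:C ->
  exists2 v : 'cV[K]_n, v != 0 & qf A v = x * sq v.
Proof.
move=> /eigenvalueP[u uA u0]; exists (u^t*).
  by apply: contra u0 => /eqP e; rewrite -(trmxCK u) e trmxC0.
by rewrite /qf /hf trmxCK uA -scalemxAl mxE -{1}(trmxCK u) sqE ReZ.
Qed.

Lemma lambda1_gtP n (A : 'M[K]_n) x : (0 < n)%N -> A^t* = A ->
  x < lambda1 A <-> exists2 v, v != 0 & x * sq v < qf A v.
Proof.
move=> n0 hA; have [U [d [hU hU' eA]]] := spectral hA.
split=> [|[v v0 hv]].
  move=> /sup_gt[|y]; first by exists (d (Ordinal n0)); apply: eigenvalue_diag eA.
  move=> /eigenvalue_qf[v v0 qv] xy; exists v => //.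
  by rewrite qv ltr_pM2r// sq_gt0.
have [i di] : exists i, x < d i.
  apply/not_existsP => H; move: hv; rewrite ltNge => /negP; apply.
  rewrite (qf_spectral v eA) -(sq_unitary v hU') mulr_sumr.
  apply: ler_sum => i _; rewrite ler_wpM2r ?sqr_ge0//.
  by rewrite leNgt; apply/negP/H.
rewrite (lt_le_trans di)//; apply: ub_le_sup; last exact: eigenvalue_diag eA.
(* [sup] dominates the eigenvalues only if their set is bounded above, which this bound on the
   quadratic form provides. *)
exists (n%:R * nm A) => y /eigenvalue_qf[w w0 qw].
rewrite -(ler_pM2r (sq_gt0 w0)) -qw; exact: le_trans (ler_norm _) (qf_le _ _).
Qed.

End Spectral.

(** * Integrals of real functions and of complex matrices *)

Section RealIntegrals.
Context {R : realType} {d : measure_display} {T : measurableType d}.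
Variable mu : {measure set T -> \bar R}.
Implicit Types f g : T -> R.

Definition rint f := mu.-integrable [set: T] (EFin \o f).
Definition RI f : R := fine (\int[mu]_x (f x)%:E)%E.

Lemma rint_meas f : rint f -> measurable_fun [set: T] f.
Proof. by move=> /measurable_int /measurable_EFinP. Qed.
Lemma RIE f : rint f -> (\int[mu]_x (f x)%:E)%E = (RI f)%:E.
Proof. by move=> hf; rewrite /RI fineK//; exact: integrable_fin_num hf. Qed.

Lemma rintD f g : rint f -> rint g -> rint (fun x => f x + g x).
Proof. exact: integrableD. Qed.
Lemma rintZ a f : rint f -> rint (fun x => a * f x).
Proof. exact: integrableZl. Qed.
Lemma rintN f : rint f -> rint (fun x => - f x).
Proof. exact: integrableN. Qed.
Lemma rintB f g : rint f -> rint g -> rint (fun x => f x - g x).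
Proof. by move=> hf hg; apply: rintD => //; exact: rintN. Qed.
Lemma rint0 : rint (fun=> 0). Proof. exact: integrable0. Qed.
Lemma rint_sum (I : Type) (s : seq I) (F : I -> T -> R) :
  (forall i, rint (F i)) -> rint (fun x => \sum_(i <- s) F i x).
Proof.
move=> h; elim: s => [|i s IH]; first by under eq_fun do rewrite big_nil; exact: rint0.
by under eq_fun do rewrite big_cons; exact: rintD.
Qed.
Lemma rint_abs f : rint f -> rint (fun x => `|f x|).
Proof. exact: integrable_abse. Qed.
Lemma rint_dom f g : measurable_fun [set: T] f -> rint g ->
  {ae mu, forall x, `|f x| <= g x} -> rint f.
Proof.
move=> mf /integrableP[mg hg] fg; apply/integrableP; split.
  exact/measurable_EFinP.
apply: le_lt_trans hg; apply: ae_ge0_le_integral => //.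
- by apply: measurableT_comp => //; exact/measurable_EFinP.
- exact: measurableT_comp.
- by apply: filterS fg => x h _ /=; rewrite lee_fin (le_trans h)// ler_norm.
Qed.

Lemma RID f g : rint f -> rint g -> RI (fun x => f x + g x) = RI f + RI g.
Proof. by move=> hf hg; exact: RintegralD. Qed.
Lemma RIZ a f : rint f -> RI (fun x => a * f x) = a * RI f.
Proof. by move=> hf; exact: RintegralZl. Qed.
Lemma RIN f : rint f -> RI (fun x => - f x) = - RI f.
Proof. by move=> hf; rewrite -mulN1r -RIZ//; congr RI; apply/funext => x; rewrite mulN1r. Qed.
Lemma RIB f g : rint f -> rint g -> RI (fun x => f x - g x) = RI f - RI g.
Proof. by move=> hf hg; rewrite RID ?RIN//; exact: rintN. Qed.
Lemma RI0 : RI (fun=> 0) = 0.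
Proof. by rewrite /RI integral0. Qed.
Lemma RI_sum (I : Type) (s : seq I) (F : I -> T -> R) :
  (forall i, rint (F i)) -> RI (fun x => \sum_(i <- s) F i x) = \sum_(i <- s) RI (F i).
Proof.
move=> h; elim: s => [|i s IH].
  by under eq_fun do rewrite big_nil; rewrite RI0 big_nil.
by under eq_fun do rewrite big_cons; rewrite big_cons -IH RID//; exact: rint_sum.
Qed.
Lemma RI_eq f g : measurable_fun [set: T] f -> measurable_fun [set: T] g ->
  {ae mu, forall x, f x = g x} -> RI f = RI g.
Proof.
move=> mf mg h; congr fine; apply: ae_eq_integral => //; try exact/measurable_EFinP.
by apply: filterS h => x /= -> _.
Qed.
Lemma RI_ge0 f : rint f -> {ae mu, forall x, 0 <= f x} -> 0 <= RI f.
Proof.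
move=> hf h; have mf := rint_meas hf.
rewrite (@RI_eq f (fun x => `|f x|))//; first exact: Rintegral_ge0.
  exact: measurableT_comp.
by apply: filterS h => x h; rewrite ger0_norm.
Qed.
Lemma RI_le f g : rint f -> rint g -> {ae mu, forall x, f x <= g x} -> RI f <= RI g.
Proof.
move=> hf hg h; rewrite -subr_ge0 -RIB//; apply: RI_ge0; first exact: rintB.
by apply: filterS h => x; rewrite subr_ge0.
Qed.

Lemma RI_cvg (f : nat -> T -> R) (g h : T -> R) :
  (forall n, measurable_fun [set: T] (f n)) -> measurable_fun [set: T] g -> rint h ->
  {ae mu, forall x, f n x @[n --> \oo] --> g x} ->
  (forall n, {ae mu, forall x, `|f n x| <= h x}) ->
  [/\ rint g, (forall n, rint (f n)) & RI (f n) @[n --> \oo] --> RI g].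
Proof.
move=> mf mg hh fg fh.
have rf n : rint (f n) by exact: rint_dom (fh n).
have fg' : {ae mu, forall x, setT x -> (EFin \o f n) x @[n --> \oo] --> (EFin \o g) x}.
  by apply: filterS fg => x H _; apply: cvg_EFin => //; exact: nearW.
have fh' : {ae mu, forall x n, setT x -> (`|(EFin \o f n) x| <= (EFin \o h) x)%E}.
  by apply: filterS (ae_foralln fh) => x H n _; rewrite /= lee_fin.
have mf' n : measurable_fun setT (EFin \o f n) by exact/measurable_EFinP.
have mg' : measurable_fun setT (EFin \o g) by exact/measurable_EFinP.
have [ig _ c] := dominated_convergence measurableT mf' mg' fg' hh fh'.
by split=> //; move: c; rewrite (RIE ig) => /fine_cvg.
Qed.

Lemma limn_einf_ub (u : (\bar R)^nat) c : (forall n, (u n <= c)%E) -> (limn_einf u <= c)%E.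
Proof.
move=> h; rewrite limn_einf_lim; apply: lime_le; first exact: is_cvg_einfs.
by near=> n; apply: le_trans (h n); apply: ereal_inf_lbound; exists n => /=.
Unshelve. all: by end_near. Qed.

Lemma measurable_fun_limn_einf (f : (T -> \bar R)^nat) :
  (forall n, measurable_fun [set: T] (f n)) ->
  measurable_fun [set: T] (fun x => limn_einf (f ^~ x)).
Proof.
move=> mf; rewrite (_ : (fun x => _) =
    (fun x => - limn_esup ((fun n x => - f n x)%E ^~ x))%E).
  apply: measurableT_comp => //; apply: measurable_fun_limn_esup => n.
  exact: measurableT_comp.
by apply/funext => x; rewrite -limn_einfN; congr limn_einf; apply/funext => n /=;
  rewrite oppeK.
Qed.

(** By Fatou's lemma the lower limit of the sequence has integral at most c, so it is finite almost
    everywhere. This later excludes that 1 + M T / alpha degenerates on the real axis. *)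
Lemma fatou_not_infty (f : nat -> T -> R) c :
  (forall n, rint (f n)) -> (forall n x, 0 <= f n x) -> (forall n, RI (f n) <= c) ->
  {ae mu, forall x, ~ (f n x @[n --> \oo] --> +oo)}.
Proof.
move=> rf f0 fc.
have mf n : measurable_fun [set: T] (EFin \o f n) by exact/measurable_EFinP/rint_meas.
pose g x := limn_einf (fun n => (f n x)%:E).
have ig : mu.-integrable [set: T] g.
  have mg : measurable_fun [set: T] g by exact: measurable_fun_limn_einf.
  apply/integrableP; split=> //.
  have g0 x : (0 <= g x)%E.
    rewrite /g limn_einf_lim; apply: lime_ge; first exact: is_cvg_einfs.
    by near=> n; apply: le_ereal_inf_tmp => _ [m _ <-]; rewrite lee_fin.
  under eq_integral do rewrite gee0_abs//.
  apply: (@le_lt_trans _ _ c%:E); last exact: ltry.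
  apply: le_trans (fatou mu measurableT mf _) _ => [n x _|]; first by rewrite lee_fin.
  by apply: limn_einf_ub => n; rewrite (RIE (rf n)) lee_fin.
have := integrable_ae measurableT ig; apply: filterS => x /(_ I) gx fx.
have : (fun n => (f n x)%:E) @ \oo --> +oo%E by exact/cvgeryP.
by move=> h; move: gx; rewrite /g is_cvg_limn_einfE; [rewrite (cvg_lim _ h)|apply/cvg_ex; eexists; exact: h].
Unshelve. all: by end_near. Qed.

(** Fatou's lemma is applied to a tail of the sequence, on which all bounds [c n] are below c0 + e;
    then e tends to 0. Integrability of the limit is part of the conclusion, since nothing dominates
    the sequence. *)
Lemma fatou_le (f : nat -> T -> R) (g : T -> R) (c : nat -> R) c0 :
  (forall n, rint (f n)) -> (forall n x, 0 <= f n x) -> measurable_fun [set: T] g ->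
  {ae mu, forall x, f n x @[n --> \oo] --> g x} ->
  (forall n, RI (f n) <= c n) -> c n @[n --> \oo] --> c0 ->
  rint g /\ RI g <= c0.
Proof.
move=> rf f0 mg fg fc cc.
have mf n : measurable_fun [set: T] (EFin \o f n) by exact/measurable_EFinP/rint_meas.
have g0 : {ae mu, forall x, 0 <= g x}.
  by apply: filterS fg => x fx; rewrite -(cvg_lim _ fx)//; apply: limr_ge;
   [apply/cvg_ex; eexists; exact: fx|exact: nearW].
have key e : 0 < e -> (\int[mu]_x (`|g x|)%:E <= (c0 + e)%:E)%E.
  move=> e0; have [N _ hN] : \forall n \near \oo, c n <= c0 + e.
    by move/cvgrPdist_le : cc => /(_ _ e0); apply: filterS => n; rewrite distrC ler_norml; lra.
  apply: (@le_trans _ _ (\int[mu]_x (limn_einf (fun n => (f (n + N)%N x)%:E)))%E); last first.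
    apply: le_trans (fatou mu measurableT (fun n => mf (n + N)%N) _) _ => [n x _|].
      by rewrite lee_fin.
    apply: limn_einf_ub => n; rewrite (RIE (rf _)) lee_fin (le_trans (fc _))// hN//=.
    exact: leq_addl.
  apply: ae_ge0_le_integral => //.
  - by apply/measurable_EFinP; exact: measurableT_comp.
  - move=> x _; rewrite limn_einf_lim; apply: lime_ge; first exact: is_cvg_einfs.
    by near=> n; apply: le_ereal_inf_tmp => _ [m _ <-]; rewrite lee_fin.
  - exact: (@measurable_fun_limn_einf (fun n x => (f (n + N)%N x)%:E) (fun n => mf (n + N)%N)).
  apply: filterS2 fg g0 => x fx gx _.
  have h : (fun n => (f (n + N)%N x)%:E) @ \oo --> (g x)%:E.
    by apply: cvg_EFin; [exact: nearW|rewrite (cvg_shiftn N (fun n => f n x))].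
  rewrite is_cvg_limn_einfE; last by apply/cvg_ex; eexists; exact: h.
  by rewrite (cvg_lim _ h)// ger0_norm.
have rg : rint g.
  apply/integrableP; split; first exact/measurable_EFinP.
  by apply: le_lt_trans (key 1 ltr01) _; exact: ltry.
split=> //; apply/ler_addgt0Pr => e e0.
rewrite -lee_fin -(RIE rg) (le_trans _ (key e e0))//.
apply: le_trans (_ : _ <= \int[mu]_x (`|g x|)%:E)%E; last by [].
rewrite (@ae_eq_integral _ _ _ mu setT (fun x => (`|g x|)%:E))//.
- exact/measurable_EFinP.
- by apply/measurable_EFinP; exact: measurableT_comp.
by apply: filterS g0 => x gx _; rewrite ger0_norm.
Unshelve. all: by end_near. Qed.

Lemma RI_eq0 f : rint f -> (forall w, 0 <= f w) -> RI f <= 0 ->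
  {ae mu, forall w, f w = 0}.
Proof.
move=> rf f0 h; have h0 : RI f = 0 by apply/eqP; rewrite eq_le h Rintegral_ge0.
have : (\int[mu]_x `|(f x)%:E| = 0)%E.
  by under eq_integral do rewrite gee0_abs ?lee_fin//; rewrite (RIE rf) h0.
have mf : measurable_fun setT (EFin \o f) by apply/measurable_EFinP; exact: rint_meas rf.
move/(ae_eq_integral_abs _ measurableT mf).
by apply: filterS => w /(_ I) [].
Qed.
End RealIntegrals.

Section MatrixIntegrals.
Context {R : realType} {d : measure_display} {T : measurableType d}.
Variable mu : {measure set T -> \bar R}.
Local Notation K := R[i].

Definition cmeas (f : T -> K) := measurable_fun [set: T] (fun x => Re (f x)) /\
  measurable_fun [set: T] (fun x => Im (f x)).
Definition cint (f : T -> K) :=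
  rint mu (fun x => Re (f x)) /\ rint mu (fun x => Im (f x)).
Definition CI (f : T -> K) : K :=
  RI mu (fun x => Re (f x)) +i* RI mu (fun x => Im (f x)).

Lemma cmeas_cst a : cmeas (fun=> a). Proof. by split. Qed.
Lemma cmeasD f g : cmeas f -> cmeas g -> cmeas (fun x => f x + g x).
Proof.
move=> [f1 f2] [g1 g2]; split; [under eq_fun do rewrite ReD|under eq_fun do rewrite ImD];
  exact: measurable_funD.
Qed.
Lemma cmeasN f : cmeas f -> cmeas (fun x => - f x).
Proof.
move=> [f1 f2]; split; [under eq_fun do rewrite ReN|under eq_fun do rewrite ImN];
  exact: measurableT_comp.
Qed.
Lemma cmeasM f g : cmeas f -> cmeas g -> cmeas (fun x => f x * g x).
Proof.
move=> [f1 f2] [g1 g2]; split; [under eq_fun do rewrite ReM|under eq_fun do rewrite ImM].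
  by apply: measurable_funB; exact: measurable_funM.
by apply: measurable_funD; exact: measurable_funM.
Qed.
Lemma cmeasJ f : cmeas f -> cmeas (fun x => Num.conj (f x)).
Proof.
move=> [f1 f2]; split; [under eq_fun do rewrite ReJ|under eq_fun do rewrite ImJ] => //.
exact: measurableT_comp.
Qed.
Lemma cmeas_sum (I : Type) (s : seq I) (F : I -> T -> K) :
  (forall i, cmeas (F i)) -> cmeas (fun x => \sum_(i <- s) F i x).
Proof.
move=> h; elim: s => [|i s IH].
  by under eq_fun do rewrite big_nil; exact: cmeas_cst.
by under eq_fun do rewrite big_cons; exact: cmeasD.
Qed.
Lemma cmeas_prod (I : Type) (s : seq I) (F : I -> T -> K) :
  (forall i, cmeas (F i)) -> cmeas (fun x => \prod_(i <- s) F i x).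
Proof.
move=> h; elim: s => [|i s IH].
  by under eq_fun do rewrite big_nil; exact: cmeas_cst.
by under eq_fun do rewrite big_cons; exact: cmeasM.
Qed.
Lemma measurable_nc2 f : cmeas f -> measurable_fun [set: T] (fun x => nc (f x) ^+ 2).
Proof.
move=> [f1 f2]; under eq_fun do rewrite nc_sqr.
by apply: measurable_funD; exact: measurable_funX.
Qed.
Lemma measurable_nc f : cmeas f -> measurable_fun [set: T] (fun x => nc (f x)).
Proof.
move=> /measurable_nc2 h; rewrite (_ : (fun _ => _) = fun x => Num.sqrt (nc (f x) ^+ 2)).
  by apply: measurableT_comp => //; apply: continuous_measurable_fun; exact: sqrt_continuous.
by apply/funext => x; rewrite sqrtr_sqr ger0_norm ?nc_ge0.
Qed.
Lemma cmeasV f : cmeas f -> cmeas (fun x => (f x)^-1).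
Proof.
move=> hf; rewrite (_ : (fun _ => _) = fun x => ((nc (f x) ^+ 2)^-1)%:C * Num.conj (f x)).
  apply: cmeasM; last exact: cmeasJ.
  have m2 := measurable_nc2 hf; split=> //=.
  (* The reciprocal of a nonnegative function is written as exp (- ln) where it is positive and as
     the default value 0 elsewhere, so that measurability follows from that of [expR] and [ln]. *)
  rewrite (_ : (fun _ => _) = fun x => if 0 < nc (f x) ^+ 2 then expR (- ln (nc (f x) ^+ 2)) else 0).
    apply: measurable_fun_ifT => //; first exact: measurable_fun_ltr.
    apply: measurableT_comp => //; apply: measurableT_comp => //.
    exact: measurableT_comp m2.
  apply/funext => x; case: ltP => [h|]; first by rewrite expRN lnK.
  by rewrite le_eqVlt ltNge sqr_ge0 orbF => /eqP ->; rewrite invr0.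
apply/funext => x; have [->|fx] := eqVneq (f x) 0; first by rewrite invr0 conjC0 mulr0.
by apply: (mulIf fx); rewrite mulVf// -mulrA mulcJ -rmorphM /= mulVf// expf_eq0 /=;
  apply: contra fx => /eqP/nc0_eq0 ->.
Qed.

Lemma cint_dom f g : cmeas f -> rint mu g -> {ae mu, forall x, nc (f x) <= g x} -> cint f.
Proof.
move=> [f1 f2] hg h; split.
  by apply: rint_dom hg _ => //; apply: filterS h => x; apply: le_trans; exact: nc_Re.
by apply: rint_dom hg _ => //; apply: filterS h => x; apply: le_trans; exact: nc_Im.
Qed.
Lemma cint_nc f : cint f -> rint mu (fun x => nc (f x)).
Proof.
move=> [f1 f2]; apply: (@rint_dom _ _ _ _ _ (fun x => `|Re (f x)| + `|Im (f x)|)).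
- by apply: measurable_nc; split; [exact: rint_meas f1|exact: rint_meas f2].
- by apply: rintD; exact: rint_abs.
by apply: aeW => x; rewrite ger0_norm ?nc_ge0// nc_le.
Qed.
Lemma cint_meas f : cint f -> cmeas f. Proof. by move=> [f1 f2]; split; [exact: rint_meas f1|exact: rint_meas f2]. Qed.
Lemma cintD f g : cint f -> cint g -> cint (fun x => f x + g x).
Proof.
move=> [f1 f2] [g1 g2]; rewrite /cint; under eq_fun do rewrite ReD.
by under [X in _ /\ rint _ X]eq_fun do rewrite ImD; split; exact: rintD.
Qed.
Lemma cintZ a f : cint f -> cint (fun x => a * f x).
Proof.
move=> [f1 f2]; rewrite /cint; under eq_fun do rewrite ReM.
under [X in _ /\ rint _ X]eq_fun do rewrite ImM.
by split; [apply: rintB|apply: rintD]; exact: rintZ.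
Qed.
Lemma cint_sum (I : Type) (s : seq I) (F : I -> T -> K) :
  (forall i, cint (F i)) -> cint (fun x => \sum_(i <- s) F i x).
Proof.
move=> h; rewrite /cint; under eq_fun do rewrite Re_sum.
under [X in _ /\ rint _ X]eq_fun do rewrite Im_sum.
by split; apply: rint_sum => i; have [] := h i.
Qed.
Lemma CID f g : cint f -> cint g -> CI (fun x => f x + g x) = CI f + CI g.
Proof.
move=> [f1 f2] [g1 g2]; apply: complex_ext; rewrite ?ReD ?ImD /=.
  by under eq_fun do rewrite ReD; rewrite RID.
by under eq_fun do rewrite ImD; rewrite RID.
Qed.
Lemma CIZ a f : cint f -> CI (fun x => a * f x) = a * CI f.
Proof.
move=> [f1 f2]; apply: complex_ext; rewrite ?ReM ?ImM /=.
  by under eq_fun do rewrite ReM; rewrite RIB ?RIZ//; exact: rintZ.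
by under eq_fun do rewrite ImM; rewrite RID ?RIZ//; exact: rintZ.
Qed.
Lemma CI_sum (I : Type) (s : seq I) (F : I -> T -> K) :
  (forall i, cint (F i)) -> CI (fun x => \sum_(i <- s) F i x) = \sum_(i <- s) CI (F i).
Proof.
move=> h; apply: complex_ext; rewrite ?Re_sum ?Im_sum /=.
  by under eq_fun do rewrite Re_sum; rewrite RI_sum// => i; case: (h i).
by under eq_fun do rewrite Im_sum; rewrite RI_sum// => i; case: (h i).
Qed.
Lemma CI_eq f g : cmeas f -> cmeas g -> {ae mu, forall x, f x = g x} -> CI f = CI g.
Proof.
move=> [f1 f2] [g1 g2] h; apply: complex_ext; apply: RI_eq => //;
  by apply: filterS h => x ->.
Qed.
Lemma CIJ f : cint f -> CI (fun x => Num.conj (f x)) = Num.conj (CI f).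
Proof.
move=> [f1 f2]; apply: complex_ext; rewrite ?ReJ ?ImJ /=.
  by under eq_fun do rewrite ReJ.
by under eq_fun do rewrite ImJ; rewrite RIN.
Qed.
Lemma cintJ f : cint f -> cint (fun x => Num.conj (f x)).
Proof.
move=> [f1 f2]; split; first by under eq_fun do rewrite ReJ.
by under eq_fun do rewrite ImJ; exact: rintN.
Qed.

Definition mmeas m n (X : T -> 'M[K]_(m, n)) := forall i j, cmeas (fun x => X x i j).
Definition mint m n (X : T -> 'M[K]_(m, n)) := forall i j, cint (fun x => X x i j).
Definition MI m n (X : T -> 'M[K]_(m, n)) : 'M[K]_(m, n) :=
  \matrix_(i, j) CI (fun x => X x i j).

Lemma mmeas_cst m n (A : 'M[K]_(m, n)) : mmeas (fun=> A).
Proof. by move=> i j; exact: cmeas_cst. Qed.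
Lemma mmeasD m n (X Y : T -> 'M[K]_(m, n)) : mmeas X -> mmeas Y -> mmeas (fun x => X x + Y x).
Proof. by move=> hX hY i j; under eq_fun do rewrite mxE; exact: cmeasD. Qed.
Lemma mmeasN m n (X : T -> 'M[K]_(m, n)) : mmeas X -> mmeas (fun x => - X x).
Proof. by move=> hX i j; under eq_fun do rewrite mxE; exact: cmeasN. Qed.
Lemma mmeasB m n (X Y : T -> 'M[K]_(m, n)) : mmeas X -> mmeas Y -> mmeas (fun x => X x - Y x).
Proof. by move=> hX hY; apply: mmeasD => //; exact: mmeasN. Qed.
Lemma mmeasM m n p (X : T -> 'M[K]_(m, n)) (Y : T -> 'M[K]_(n, p)) :
  mmeas X -> mmeas Y -> mmeas (fun x => X x *m Y x).
Proof.
move=> hX hY i j; under eq_fun do rewrite mxE.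
by apply: cmeas_sum => k; exact: cmeasM.
Qed.
Lemma mmeasZ m n a (X : T -> 'M[K]_(m, n)) : mmeas X -> mmeas (fun x => a *: X x).
Proof.
by move=> hX i j; under eq_fun do rewrite mxE; apply: cmeasM => //; exact: cmeas_cst.
Qed.
Lemma mmeas_trmxC m n (X : T -> 'M[K]_(m, n)) : mmeas X -> mmeas (fun x => (X x)^t*).
Proof. by move=> hX i j; under eq_fun do rewrite trmxCE; exact: cmeasJ. Qed.
Lemma mmeas_toC m n (X : T -> 'M[R]_(m, n)) : measurable_mx X -> mmeas (fun x => toC (X x)).
Proof.
move=> hX i j; split; first by under eq_fun do rewrite mxE; exact: hX.
by under eq_fun do rewrite mxE /=; exact: measurable_cst.
Qed.
Lemma cmeas_det n (X : T -> 'M[K]_n) : mmeas X -> cmeas (fun x => \det (X x)).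
Proof.
move=> hX; apply: cmeas_sum => s; apply: cmeasM; first exact: cmeas_cst.
exact: cmeas_prod.
Qed.
Lemma mmeas_invmx n (X : T -> 'M[K]_n) : mmeas X -> mmeas (fun x => invmx (X x)).
Proof.
move=> hX i j.
have hadj : cmeas (fun x => ((\det (X x))^-1 *: \adj (X x)) i j).
  under eq_fun do rewrite !mxE; apply: cmeasM; first exact/cmeasV/cmeas_det.
  apply: cmeasM; first exact: cmeas_cst.
  by apply: cmeas_det => k l; under eq_fun do rewrite !mxE; exact: hX.
have md : measurable_fun [set: T] (fun x => 0 < nc (\det (X x))).
  by apply: measurable_fun_ltr => //; exact/measurable_nc/cmeas_det.
(* [invmx] returns its argument on singular matrices, so the cofactor formula covers only the event
   that the determinant is nonzero. *)
have E x : invmx (X x) i j =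
    if 0 < nc (\det (X x)) then ((\det (X x))^-1 *: \adj (X x)) i j else X x i j.
  rewrite /invmx unitmxE unitfE; have -> : (\det (X x) != 0) = (0 < nc (\det (X x))); last first.
    by case: ifP.
  rewrite lt_def nc_ge0 andbT; congr negb; apply/eqP/eqP => [->|/nc0_eq0//].
  exact: nc0.
rewrite /cmeas; under eq_fun do rewrite E fun_if.
under [X in _ /\ measurable_fun _ X]eq_fun do rewrite E fun_if.
by split; apply: measurable_fun_ifT => //; [case: hadj|case: (hX i j)|case: hadj|case: (hX i j)].
Qed.
Lemma measurable_nm m n (X : T -> 'M[K]_(m, n)) : mmeas X ->
  measurable_fun [set: T] (fun x => nm (X x)).
Proof.
by move=> hX; apply: measurable_sum => i; apply: measurable_sum => j; exact: measurable_nc.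
Qed.

Lemma mint_meas m n (X : T -> 'M[K]_(m, n)) : mint X -> mmeas X.
Proof. by move=> hX i j; exact/cint_meas/hX. Qed.
Lemma mint_dom m n (X : T -> 'M[K]_(m, n)) g : mmeas X -> rint mu g ->
  {ae mu, forall x, nm (X x) <= g x} -> mint X.
Proof.
move=> mX hg h i j; apply: cint_dom hg _ => //.
by apply: filterS h => x; apply: le_trans; exact: nm_entry.
Qed.
Lemma mint_nm m n (X : T -> 'M[K]_(m, n)) : mint X -> rint mu (fun x => nm (X x)).
Proof.
by move=> hX; apply: rint_sum => i; apply: rint_sum => j; exact/cint_nc/hX.
Qed.
Lemma mintD m n (X Y : T -> 'M[K]_(m, n)) : mint X -> mint Y -> mint (fun x => X x + Y x).
Proof. by move=> hX hY i j; under eq_fun do rewrite mxE; exact: cintD. Qed.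
Lemma mintN m n (X : T -> 'M[K]_(m, n)) : mint X -> mint (fun x => - X x).
Proof.
move=> hX i j; under eq_fun do rewrite mxE -mulN1r; exact: cintZ.
Qed.
Lemma mintB m n (X Y : T -> 'M[K]_(m, n)) : mint X -> mint Y -> mint (fun x => X x - Y x).
Proof. by move=> hX hY; apply: mintD => //; exact: mintN. Qed.
Lemma mintMl m n p (A : 'M[K]_(m, n)) (X : T -> 'M[K]_(n, p)) :
  mint X -> mint (fun x => A *m X x).
Proof.
move=> hX i j; under eq_fun do rewrite mxE.
by apply: cint_sum => k; exact: cintZ.
Qed.
Lemma mintMr m n p (A : 'M[K]_(n, p)) (X : T -> 'M[K]_(m, n)) :
  mint X -> mint (fun x => X x *m A).
Proof.
move=> hX i j; under eq_fun do rewrite mxE.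
by apply: cint_sum => k; under eq_fun do rewrite mulrC; exact: cintZ.
Qed.
Lemma mint_trmxC m n (X : T -> 'M[K]_(m, n)) : mint X -> mint (fun x => (X x)^t*).
Proof. by move=> hX i j; under eq_fun do rewrite trmxCE; exact: cintJ. Qed.

Lemma MID m n (X Y : T -> 'M[K]_(m, n)) : mint X -> mint Y ->
  MI (fun x => X x + Y x) = MI X + MI Y.
Proof.
move=> hX hY; apply/matrixP => i j; rewrite !mxE -CID//.
by congr CI; apply/funext => x; rewrite mxE.
Qed.
Lemma MIZ m n a (X : T -> 'M[K]_(m, n)) : mint X -> MI (fun x => a *: X x) = a *: MI X.
Proof.
move=> hX; apply/matrixP => i j; rewrite !mxE -CIZ//.
by congr CI; apply/funext => x; rewrite mxE.
Qed.
Lemma MIN m n (X : T -> 'M[K]_(m, n)) : mint X -> MI (fun x => - X x) = - MI X.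
Proof.
move=> hX; rewrite -scaleN1r -MIZ//; congr MI; apply/funext => x.
by rewrite scaleN1r.
Qed.
Lemma MIB m n (X Y : T -> 'M[K]_(m, n)) : mint X -> mint Y ->
  MI (fun x => X x - Y x) = MI X - MI Y.
Proof. by move=> hX hY; rewrite MID ?MIN//; exact: mintN. Qed.
Lemma MIMl m n p (A : 'M[K]_(m, n)) (X : T -> 'M[K]_(n, p)) :
  mint X -> MI (fun x => A *m X x) = A *m MI X.
Proof.
move=> hX; apply/matrixP => i j; rewrite !mxE.
under eq_bigr do rewrite mxE -CIZ//; rewrite -CI_sum => [|k]; last exact: cintZ.
by congr CI; apply/funext => x; rewrite mxE.
Qed.
Lemma MI_trmxC m n (X : T -> 'M[K]_(m, n)) : mint X ->
  MI (fun x => (X x)^t*) = (MI X)^t*.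
Proof.
move=> hX; apply/matrixP => i j; rewrite trmxCE !mxE -CIJ//.
by congr CI; apply/funext => x; rewrite trmxCE.
Qed.
Lemma MIMr m n p (A : 'M[K]_(n, p)) (X : T -> 'M[K]_(m, n)) :
  mint X -> MI (fun x => X x *m A) = MI X *m A.
Proof.
move=> hX; apply: (can_inj (@trmxCK _ _ _)); rewrite trmxCM -MI_trmxC//.
rewrite -MIMl; last exact: mint_trmxC.
rewrite -MI_trmxC; last exact: mintMr.
by under eq_fun do rewrite trmxCM.
Qed.
Lemma MI_eq m n (X Y : T -> 'M[K]_(m, n)) : mmeas X -> mmeas Y ->
  {ae mu, forall x, X x = Y x} -> MI X = MI Y.
Proof.
move=> hX hY h; apply/matrixP => i j; rewrite !mxE; apply: CI_eq => //.
by apply: filterS h => x ->.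
Qed.
Lemma cint_hf n (X : T -> 'M[K]_n) u v : mint X -> cint (fun x => hf (X x) u v).
Proof. by move=> hX; exact: (mintMr _ (mintMl _ hX)). Qed.
Lemma hf_MI n (X : T -> 'M[K]_n) u v : mint X -> hf (MI X) u v = CI (fun x => hf (X x) u v).
Proof.
move=> hX; rewrite /hf -MIMl// -MIMr; last exact: mintMl.
by rewrite mxE.
Qed.
Lemma rint_qf n (X : T -> 'M[K]_n) v : mint X -> rint mu (fun x => qf (X x) v).
Proof. by move=> hX; case: (cint_hf v v hX). Qed.
Lemma qf_MI n (X : T -> 'M[K]_n) v : mint X -> qf (MI X) v = RI mu (fun x => qf (X x) v).
Proof. by move=> hX; rewrite /qf hf_MI. Qed.
Lemma cint_tr n (X : T -> 'M[K]_n) : mint X -> cint (fun x => \tr (X x)).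
Proof. by move=> hX; apply: cint_sum => i; exact: hX. Qed.
Lemma tr_MI n (X : T -> 'M[K]_n) : mint X -> \tr (MI X) = CI (fun x => \tr (X x)).
Proof. by move=> hX; rewrite /mxtrace CI_sum//; apply: eq_bigr => i _; rewrite mxE. Qed.

(** The class shared by F and B: neither needs to be bounded, but products of two members are
    integrable ([mint_mul]). *)
Definition sqint m n (X : T -> 'M[K]_(m, n)) := mmeas X /\ rint mu (fun x => nm (X x) ^+ 2).

Lemma sqint_dom m n (X : T -> 'M[K]_(m, n)) g : mmeas X -> rint mu g ->
  {ae mu, forall x, nm (X x) ^+ 2 <= g x} -> sqint X.
Proof.
move=> mX hg h; split=> //; apply: rint_dom hg _; first exact/measurable_funX/measurable_nm.
by apply: filterS h => x; rewrite ger0_norm// sqr_ge0.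
Qed.
Lemma sqintMl m n p (A : 'M[K]_(m, n)) (X : T -> 'M[K]_(n, p)) :
  sqint X -> sqint (fun x => A *m X x).
Proof.
move=> [mX hX]; apply: sqint_dom (rintZ (nm A ^+ 2) hX) _.
  by apply: mmeasM => //; exact: mmeas_cst.
apply: aeW => x; rewrite -exprMn ler_pXn2r ?nnegrE ?mulr_ge0 ?nm_ge0//.
exact: nmM.
Qed.
Lemma sqintMr m n p (A : 'M[K]_(n, p)) (X : T -> 'M[K]_(m, n)) :
  sqint X -> sqint (fun x => X x *m A).
Proof.
move=> [mX hX]; apply: sqint_dom (rintZ (nm A ^+ 2) hX) _.
  by apply: mmeasM => //; exact: mmeas_cst.
apply: aeW => x; rewrite -exprMn ler_pXn2r ?nnegrE ?mulr_ge0 ?nm_ge0//.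
by rewrite mulrC nmM.
Qed.
Lemma sqint_trmxC m n (X : T -> 'M[K]_(m, n)) : sqint X -> sqint (fun x => (X x)^t*).
Proof.
move=> [mX hX]; split; first exact: mmeas_trmxC.
by under eq_fun do rewrite nm_trmxC.
Qed.
Lemma sqintD m n (X Y : T -> 'M[K]_(m, n)) : sqint X -> sqint Y -> sqint (fun x => X x + Y x).
Proof.
move=> [mX hX] [mY hY]; apply: sqint_dom (rintZ 2 (rintD hX hY)) _; first exact: mmeasD.
apply: aeW => x; apply: (@le_trans _ _ ((nm (X x) + nm (Y x)) ^+ 2)).
  by rewrite ler_pXn2r ?nnegrE ?addr_ge0 ?nm_ge0// nmD.
have := ler_2M (nm (X x)) (nm (Y x)); rewrite sqrrD; lra.
Qed.
Lemma sqintN m n (X : T -> 'M[K]_(m, n)) : sqint X -> sqint (fun x => - X x).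
Proof. by move=> [mX hX]; split; [exact: mmeasN|under eq_fun do rewrite nmN]. Qed.
Lemma sqintB m n (X Y : T -> 'M[K]_(m, n)) : sqint X -> sqint Y -> sqint (fun x => X x - Y x).
Proof. by move=> hX hY; apply: sqintD => //; exact: sqintN. Qed.
Lemma mint_mul m n p (X : T -> 'M[K]_(m, n)) (Y : T -> 'M[K]_(n, p)) :
  sqint X -> sqint Y -> mint (fun x => X x *m Y x).
Proof.
move=> [mX hX] [mY hY]; apply: mint_dom (rintD hX hY) _; first exact: mmeasM.
apply: aeW => x; rewrite (le_trans (nmM _ _))//.
have := ler_2M (nm (X x)) (nm (Y x)).
have := mulr_ge0 (nm_ge0 (X x)) (nm_ge0 (Y x)); lra.
Qed.

End MatrixIntegrals.

Section ProbabilityIntegrals.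
Context {R : realType} {d : measure_display} {T : measurableType d}.
Variable P : probability T R.
Local Notation K := R[i].

Lemma rint_cst (a : R) : rint P (fun=> a).
Proof. exact: finite_measure_integrable_cst. Qed.
Lemma RI_cst (a : R) : RI P (fun=> a) = a.
Proof. by rewrite /RI integral_cst// [X in (_ * X)%E](@probability_setT _ _ _ P) mule1. Qed.
Lemma sqint_cst m n (A : 'M[K]_(m, n)) : sqint P (fun=> A).
Proof. by split; [exact: mmeas_cst|exact: rint_cst]. Qed.
Lemma sqint_bounded m n (X : T -> 'M[K]_(m, n)) c : mmeas X ->
  {ae P, forall x, nm (X x) <= c} -> sqint P X.
Proof.
move=> mX h; apply: sqint_dom (rint_cst (c ^+ 2)) _ => //.
apply: filterS h => x h; rewrite ler_pXn2r ?nnegrE ?nm_ge0//.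
exact: le_trans (nm_ge0 _) h.
Qed.
Lemma sqint_mint m n (X : T -> 'M[K]_(m, n)) : sqint P X -> mint P X.
Proof.
move=> hX; have := mint_mul hX (sqint_cst 1%:M).
by under [X in mint _ X]eq_fun do rewrite mulmx1.
Qed.
Lemma EmxCE m n (X : T -> 'M[K]_(m, n)) : EmxC P X = MI P X.
Proof. by apply/matrixP => i j; rewrite !mxE !unlock. Qed.
Lemma EmxE m n (X : T -> 'M[R]_(m, n)) i j : Emx P X i j = RI P (fun x => X x i j).
Proof. by rewrite mxE unlock. Qed.
Lemma toC_Emx m n (X : T -> 'M[R]_(m, n)) : toC (Emx P X) = MI P (fun x => toC (X x)).
Proof.
apply/matrixP => i j; rewrite !mxE unlock; apply: complex_ext => /=.
  by congr RI; apply/funext => x; rewrite mxE.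
by under eq_fun do rewrite mxE /=; rewrite RI0.
Qed.
End ProbabilityIntegrals.

(** * A Rayleigh quotient bound *)

Section PowerBound.
Context {R : realType}.
Local Notation K := R[i].

Lemma bernoulli (e : R) n : 0 <= e -> 1 + n%:R * e <= (1 + e) ^+ n.
Proof.
move=> e0; elim: n => [|n IH]; first by rewrite mul0r addr0 expr0.
rewrite exprS; apply: (@le_trans _ _ ((1 + e) * (1 + n%:R * e))); last first.
  by rewrite ler_wpM2l// addr_ge0.
rewrite -natr1; have : 0 <= n%:R * e * e by rewrite !mulr_ge0.
lra.
Qed.

Lemma expr_unbounded (q C : R) : 1 < q -> exists k, C < q ^+ (2 ^ k).
Proof.
move=> q1; pose e := q - 1; have e0 : 0 < e by rewrite subr_gt0.
have [k hk] : exists k : nat, C / e < k%:R.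
  by exists (Num.truncn (C / e)).+1; exact: truncnS_gt.
exists k; have -> : q = 1 + e by rewrite /e addrC subrK.
apply: lt_le_trans (bernoulli _ (ltW e0)).
have k2 : (k%:R : R) <= (2 ^ k)%:R by rewrite ler_nat ltnW// ltn_expl.
move: hk; rewrite ltr_pdivrMr// => hk.
have : k%:R * e <= (2 ^ k)%:R * e by rewrite ler_wpM2r// ltW.
lra.
Qed.

Section SelfAdjoint.
Variables (V : lmodType K) (b : V -> V -> R) (L : V -> V).
Hypothesis bC : forall x y, b x y = b y x.
Hypothesis bD : forall x y z, b (x + y) z = b x z + b y z.
Hypothesis bZ : forall (a : R) x y, b (a%:C *: x) y = a * b x y.
Hypothesis b_ge0 : forall x, 0 <= b x x.
Hypothesis bL : forall x y, b (L x) y = b x (L y).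

Lemma form_CS x y : b x y ^+ 2 <= b x x * b y y.
Proof.
have key t : 0 <= b x x + 2 * t * b x y + t ^+ 2 * b y y.
  have := b_ge0 (x + t%:C *: y).
  rewrite bD [b x _]bC bD !bZ [b y (_ + _)]bC bD bZ [b y x]bC; lra.
have [yy0|yy0] := eqVneq (b y y) 0.
  have [->|xy0] := eqVneq (b x y) 0; first by rewrite expr0n mulr_ge0.
  (* The form may be degenerate. When b y y = 0 the polynomial in [key] is affine in t, and this t
     gives it the value -1. *)
  have := key (- (b x x + 1) / (2 * b x y)).
  rewrite yy0 mulr0 addr0 (_ : 2 * _ * _ = - (b x x + 1)); last by field.
  lra.
have yp : 0 < b y y by rewrite lt_def yy0 b_ge0.
have := key (- b x y / b y y).
rewrite (_ : _ + _ = b x x - b x y ^+ 2 / b y y); last by field.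
by rewrite subr_ge0 ler_pdivrMr.
Qed.

(* The moments S_n = b(v, L^n v) satisfy S_n^2 <= S_0 S_(2n), so that the
   exponential growth rate of (S_n) dominates S_2 / S_0. *)
Lemma form_power_bound v (sigma C : R) : 0 < sigma ->
  (forall n, `|b v (iter n L v)| <= C * sigma ^+ n) ->
  b (L v) (L v) <= sigma ^+ 2 * b v v.
Proof.
move=> s0 hC; pose S n := b v (iter n L v).
have bLn n x y : b (iter n L x) y = b x (iter n L y).
  by elim: n x y => // n IH x y; rewrite iterS bL IH -iterSr.
have S2 n : S n ^+ 2 <= S 0%N * S (n + n)%N.
  have -> : S (n + n)%N = b (iter n L v) (iter n L v) by rewrite /S iterD bLn.
  exact: form_CS.
rewrite bL -/(S 2%N) -[b v v]/(S 0%N) leNgt; apply/negP => lt2.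
have S0p : 0 < S 0%N.
  rewrite lt_def b_ge0 andbT; apply/eqP => S00.
  have := S2 2%N; rewrite S00 mul0r; move: lt2; rewrite S00 mulr0 => h.
  by rewrite leNgt exprn_gt0.
pose q := S 2%N / S 0%N.
have qs : sigma ^+ 2 < q by rewrite ltr_pdivlMr.
have q0 : 0 < q by rewrite (lt_trans _ qs)// exprn_gt0.
(* Doubling the index with [S2] squares the lower bound on S_n / S_0. Thus S grows at least like
   q^(n/2) along n = 2^(k+1), while the hypothesis allows sigma^n, and q > sigma^2. *)
have Sk k : q ^+ (2 ^ k) * S 0%N <= S (2 * 2 ^ k)%N.
  elim: k => [|k IH]; first by rewrite expn0 expr1 muln1 divfK// gt_eqF.
  have -> : (2 * 2 ^ k.+1 = 2 * 2 ^ k + 2 * 2 ^ k)%N by rewrite expnS mul2n addnn.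
  rewrite -(ler_pM2l S0p) expnS.
  apply: le_trans (S2 _).
  apply: (@le_trans _ _ ((q ^+ (2 ^ k) * S 0%N) ^+ 2)).
    by rewrite mul2n -addnn exprD; lra.
  have qS0 : 0 <= q ^+ (2 ^ k) * S 0%N by rewrite mulr_ge0 ?exprn_ge0// ltW.
  by rewrite ler_pXn2r ?nnegrE// (le_trans qS0).
have q1 : 1 < q / sigma ^+ 2 by rewrite ltr_pdivlMr ?exprn_gt0// mul1r.
have [k hk] := expr_unbounded (C / S 0%N) q1.
move: hk; rewrite ltr_pdivrMr// expr_div_n mulrAC ltr_pdivlMr ?exprn_gt0//.
rewrite -exprM; apply/negP; rewrite -leNgt.
by rewrite (le_trans (Sk k))// (le_trans (ler_norm _) (hC _)).
Qed.

End SelfAdjoint.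

Lemma mulmx_cancel (F : fieldType) m n p (A : 'M[F]_(m, n)) (Q : 'M[F]_n) (E : 'M[F]_(n, p))
  (Q' : 'M[F]_p) : Q \in unitmx -> Q' \in unitmx ->
  A *m Q *m (invmx Q *m E *m invmx Q') *m Q' = A *m E.
Proof. by move=> uQ uQ'; rewrite -!mulmxA mulVmx// mulmx1 mulKVmx. Qed.

Lemma Re_tr_sym m n (X Y : 'M[K]_(m, n)) (Q : 'M[K]_m) (Q' : 'M[K]_n) :
  Q^t* = Q -> Q'^t* = Q' ->
  Re (\tr (X^t* *m Q *m Y *m Q')) = Re (\tr (Y^t* *m Q *m X *m Q')).
Proof.
move=> hQ hQ'; rewrite -ReJ -mxtrace_trmxC !trmxCM trmxCK hQ hQ'.
by rewrite mxtrace_mulC !mulmxA.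
Qed.

Lemma tr_psd_ge0 m n (X : 'M[K]_(m, n)) (Q : 'M[K]_m) (Q' : 'M[K]_n) :
  psd Q -> psd Q' -> 0 <= Re (\tr (X^t* *m Q *m X *m Q')).
Proof.
move=> /psd_factor[Z ->] /psd_factor[Z' ->].
rewrite mulmxA mxtrace_mulC; set Y := Z *m X *m Z'^t*.
have -> : Z' *m (X^t* *m (Z^t* *m Z) *m X *m Z'^t*) = Y^t* *m Y.
  by rewrite /Y !trmxCM trmxCK !mulmxA.
rewrite /mxtrace Re_sum; apply: sumr_ge0 => i _; rewrite mxE Re_sum.
by apply: sumr_ge0 => j _; rewrite trmxCE mulcJ /= sqr_ge0.
Qed.

Section MatrixOperator.
Context {d : measure_display} {W : measurableType d}.
Variable P : probability W R.
Variables (p r : nat) (F : W -> 'M[K]_p) (B : W -> 'M[K]_r).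
Variables (Q : 'M[K]_p) (Q' : 'M[K]_r).
Hypotheses (sF : sqint P F) (sB : sqint P B).
Hypotheses (hF : {ae P, forall w, (F w)^t* = F w}) (hB : {ae P, forall w, (B w)^t* = B w}).
Hypotheses (pQ : pd Q) (pQ' : pd Q').

Let uQ := pd_unit pQ.
Let uQ' := pd_unit pQ'.

Lemma mint_FXB X : mint P (fun w => F w *m X *m B w).
Proof. by apply: mint_mul => //; exact: sqintMr. Qed.

(** Conjugation by the weights makes X |-> E[F X B] self-adjoint for the inner product [trform],
    whose pairing with [trop] gives back the unweighted trace ([trform_trop]). *)
Definition trop X : 'M[K]_(p, r) :=
  invmx Q *m MI P (fun w => F w *m X *m B w) *m invmx Q'.
Definition trform (X Y : 'M[K]_(p, r)) : R := Re (\tr (X^t* *m Q *m Y *m Q')).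

Let bC X Y : trform X Y = trform Y X.
Proof. by apply: Re_tr_sym; [case: pQ|case: pQ']. Qed.
Let bD X Y Z : trform (X + Y) Z = trform X Z + trform Y Z.
Proof. by rewrite /trform trmxCD !mulmxDl linearD ReD. Qed.
Let bZ (a : R) X Y : trform (a%:C *: X) Y = a * trform X Y.
Proof. by rewrite /trform trmxCZr -!scalemxAl linearZ ReZ. Qed.
Let b_ge0 X : 0 <= trform X X.
Proof. by apply: tr_psd_ge0; exact: pd_psd. Qed.

Lemma trform_trop X Y : trform X (trop Y) = Re (\tr (X^t* *m MI P (fun w => F w *m Y *m B w))).
Proof. by rewrite /trform /trop (mulmx_cancel _ _ uQ uQ'). Qed.

Lemma Re_tr_MI X Y : Re (\tr (X^t* *m MI P (fun w => F w *m Y *m B w))) =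
  RI P (fun w => Re (\tr (X^t* *m F w *m Y *m B w))).
Proof.
have h : mint P (fun w => X^t* *m (F w *m Y *m B w)) by exact/mintMl/mint_FXB.
rewrite -MIMl; last exact: mint_FXB.
by rewrite tr_MI//=; under eq_fun do rewrite !mulmxA.
Qed.

Lemma rint_tr X Y : rint P (fun w => Re (\tr (X^t* *m F w *m Y *m B w))).
Proof.
have h : mint P (fun w => X^t* *m (F w *m Y *m B w)) by exact/mintMl/mint_FXB.
by have [+ _] := cint_tr h; under eq_fun do rewrite !mulmxA.
Qed.

Let bL X Y : trform (trop X) Y = trform X (trop Y).
Proof.
rewrite bC; apply: etrans (etrans (trform_trop Y X) (Re_tr_MI Y X)) _.
apply: etrans _ (esym (etrans (trform_trop X Y) (Re_tr_MI X Y))).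
apply: RI_eq.
- exact: rint_meas (rint_tr _ _).
- exact: rint_meas (rint_tr _ _).
by apply: filterS2 hF hB => w hFw hBw; exact: Re_tr_sym.
Qed.

Variables (Ps : nat -> 'M[K]_p) (Rs : nat -> 'M[K]_r) (rho1 rho2 c1 c2 : R).
Hypotheses (rho1_gt0 : 0 < rho1) (rho2_gt0 : 0 < rho2).
Hypothesis hPs : forall n a,
  RI P (fun w => qf (Ps n) (F w *m (invmx Q *m a))) <= rho1 * qf (Ps n.+1) a.
Hypothesis hRs : forall n b,
  RI P (fun w => qf (Rs n) (B w *m (invmx Q' *m b))) <= rho2 * qf (Rs n.+1) b.
Hypothesis uPs : forall n a, qf (Ps n) a <= c1 * sq a.
Hypothesis uRs : forall n b, qf (Rs n) b <= c2 * sq b.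

(** Equivalently, the block matrix with diagonal blocks t A, t D and off-diagonal blocks - X, - X^*
    is positive. The forms [Ps n], [Rs n] may vary with n because on the B side there may be no
    positive definite fixed point of H |-> E[B H B] / rho, only a bounded sequence of iterates. *)
Definition dominated (X : 'M[K]_(p, r)) (t : R) (A : 'M[K]_p) (D : 'M[K]_r) :=
  forall (a : 'cV[K]_p) (b : 'cV[K]_r), 2 * Re ((a^t* *m X *m b) 0 0) <= t * (qf A a + qf D b).

Let sigma := Num.sqrt (rho1 * rho2).
Let sigma_gt0 : 0 < sigma. Proof. by rewrite sqrtr_gt0 mulr_gt0. Qed.
Let sigma2 : sigma * sigma = rho1 * rho2.
Proof. by rewrite -expr2 sqr_sqrtr// ltW// mulr_gt0. Qed.

Lemma rint_qfF n (G : W -> 'M[K]_n) (A : 'M[K]_n) a : sqint P G ->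
  rint P (fun w => qf A (G w *m a)).
Proof.
move=> sG; under eq_fun do rewrite -qf_congr.
by apply/rint_qf/mint_mul => //; exact/sqintMr/sqint_trmxC.
Qed.

Lemma hf_trop X (a : 'cV[K]_p) (b : 'cV[K]_r) : Re ((a^t* *m trop X *m b) 0 0) =
  RI P (fun w => Re (((F w *m (invmx Q *m a))^t* *m X *m (B w *m (invmx Q' *m b))) 0 0)).
Proof.
have hQi : (invmx Q)^t* = invmx Q by have [] := pd_inv pQ.
have h := mint_FXB X.
have -> : a^t* *m trop X *m b =
    (a^t* *m invmx Q) *m MI P (fun w => F w *m X *m B w) *m (invmx Q' *m b).
  by rewrite /trop !mulmxA.
rewrite -MIMl// -MIMr; last exact: mintMl.
rewrite mxE /=.
have hm : mint P (fun w => a^t* *m invmx Q *m (F w *m X *m B w) *m (invmx Q' *m b)).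
  exact/mintMr/mintMl.
have hm' : mint P (fun w => (F w *m (invmx Q *m a))^t* *m X *m (B w *m (invmx Q' *m b))).
  apply: mint_mul; last exact: sqintMr.
  exact/sqintMr/sqint_trmxC/sqintMr.
apply: RI_eq.
- by have [/rint_meas] := hm 0 0.
- by have [/rint_meas] := hm' 0 0.
by apply: filterS hF => w hFw; rewrite !trmxCM hFw hQi !mulmxA.
Qed.

(** The domination is applied pointwise to s F Q^-1 a and s^-1 B Q'^-1 b and then averaged with
    [hPs] and [hRs]. The weight s is chosen so that s^2 rho1 = s^-2 rho2 = sigma, the geometric mean
    of the two rates. *)
Lemma dominated_trop X t n : 0 <= t -> dominated X t (Ps n) (Rs n) ->
  dominated (trop X) (t * sigma) (Ps n.+1) (Rs n.+1).
Proof.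
move=> t0 h a b; rewrite hf_trop.
set u := fun w => F w *m (invmx Q *m a); set v := fun w => B w *m (invmx Q' *m b).
pose s := Num.sqrt (sigma / rho1).
have s2 : s ^+ 2 = sigma / rho1 by rewrite sqr_sqrtr// ltW// divr_gt0.
have s0 : 0 < s by rewrite sqrtr_gt0 divr_gt0.
have hm' : mint P (fun w => (u w)^t* *m X *m v w).
  apply: mint_mul; last exact: sqintMr.
  exact/sqintMr/sqint_trmxC/sqintMr.
have [ri _] := hm' 0 0.
have rP : rint P (fun w => qf (Ps n) (u w)) by exact: rint_qfF.
have rR : rint P (fun w => qf (Rs n) (v w)) by exact: rint_qfF.
have pt w : 2 * Re (((u w)^t* *m X *m v w) 0 0) <=
    t * (s ^+ 2 * qf (Ps n) (u w) + (s ^-1) ^+ 2 * qf (Rs n) (v w)).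
  have := h (s%:C *: u w) ((s^-1)%:C *: v w).
  rewrite !qfZv trmxCZr -!scalemxAl -scalemxAr scalerA -rmorphM /= mulfV ?gt_eqF//.
  by rewrite scale1r.
rewrite -RIZ//; apply: (@le_trans _ _ (t * (s ^+ 2 * RI P (fun w => qf (Ps n) (u w)) +
    (s ^-1) ^+ 2 * RI P (fun w => qf (Rs n) (v w))))).
  rewrite -!RIZ// -RID; [|exact: rintZ|exact: rintZ].
  rewrite -RIZ; last by apply: rintD; exact: rintZ.
  apply: RI_le; first exact: rintZ.
    by apply: rintZ; apply: rintD; exact: rintZ.
  exact: aeW.
rewrite -(mulrA t sigma) ler_wpM2l//.
have e1 : s ^+ 2 * rho1 = sigma by rewrite s2 divfK// gt_eqF.
have e2 : s^-1 ^+ 2 * rho2 = sigma.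
  rewrite exprVn s2 invf_div mulrAC -sigma2 mulfK// gt_eqF//.
have := ler_wpM2l (sqr_ge0 s) (hPs n a); have := ler_wpM2l (sqr_ge0 s^-1) (hRs n b).
by rewrite !mulrA e1 e2 -/u -/v => ? ?; rewrite mulrDr addrC [X in _ <= X]addrC lerD.
Qed.

Lemma dominated_iter X n : dominated X 1 (Ps 0%N) (Rs 0%N) ->
  dominated (iter n trop X) (sigma ^+ n) (Ps n) (Rs n).
Proof.
move=> h; elim: n => [//|n IH]; rewrite iterS exprSr.
by apply: dominated_trop => //; rewrite exprn_ge0// ltW.
Qed.

(** Read column by column, [trform V X] is a finite sum of values a_j^* X e_j with a_j = Q V Q' e_j,
    each controlled by the domination. The constant does not depend on n because [uPs] and [uRs] are
    uniform. *)
Lemma trform_bounded V : exists C, forall X t n, 0 <= t ->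
  dominated X t (Ps n) (Rs n) -> `|trform V X| <= C * t.
Proof.
pose a j := Q *m V *m Q' *m (delta_mx j 0 : 'cV[K]_r).
pose b j := (delta_mx j 0 : 'cV[K]_r).
exists (\sum_j (c1 * sq (a j) + c2 * sq (b j))) => X t n t0 h.
have E : trform V X = \sum_j Re (((a j)^t* *m X *m b j) 0 0).
  have hQ : Q^t* = Q by case: pQ.
  have hQ' : Q'^t* = Q' by case: pQ'.
  rewrite /trform mxtrace_mulC /mxtrace Re_sum; apply: eq_bigr => j _.
  transitivity (Re (hf (Q' *m (V^t* *m Q *m X)) (delta_mx j 0) (delta_mx j 0))).
    by rewrite hf_delta.
  by rewrite /hf /a /b !trmxCM hQ hQ' !mulmxA.
have key j : 2 * `|Re (((a j)^t* *m X *m b j) 0 0)| <= t * (c1 * sq (a j) + c2 * sq (b j)).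
  apply: (@le_trans _ _ (t * (qf (Ps n) (a j) + qf (Rs n) (b j)))); last first.
    by rewrite ler_wpM2l// lerD.
  case: (ger0P (Re _)) => _; first exact: h.
  have := h (- a j) (b j); rewrite trmxCN !mulNmx mxE ReN.
  by rewrite -[- a j]scaleN1r -(rmorphN1 (real_complex R)) qfZv sqrrN expr1n mul1r.
rewrite E (le_trans (ler_norm_sum _ _ _))// mulr_suml; apply: ler_sum => j _.
have := key j; have := normr_ge0 (Re (((a j)^t* *m X *m b j) 0 0)).
rewrite [t * _]mulrC; lra.
Qed.

(** The moments of V under [trop] grow at most like sigma^n by domination, and [form_power_bound]
    turns this rate into a bound in the norm of [trform], although [Ps] and [Rs] are unrelated to Q
    and Q'. *)
Theorem trop_bound V : dominated V 1 (Ps 0%N) (Rs 0%N) ->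
  trform (trop V) (trop V) <= rho1 * rho2 * trform V V.
Proof.
move=> hV; have [C hC] := trform_bounded V.
rewrite -sigma2 -expr2.
apply: (form_power_bound (C := C) bC bD bZ b_ge0 bL sigma_gt0) => n.
apply: hC (dominated_iter n hV); by rewrite exprn_ge0// ltW.
Qed.

Theorem trop_rayleigh V : dominated V 1 (Ps 0%N) (Rs 0%N) ->
  RI P (fun w => Re (\tr (V^t* *m F w *m V *m B w))) <= sigma * trform V V.
Proof.
move=> hV; rewrite -Re_tr_MI -trform_trop.
have h2 := form_CS bC bD bZ b_ge0 V (trop V).
have h3 := trop_bound hV; have v0 := b_ge0 V.
have : trform V (trop V) ^+ 2 <= (sigma * trform V V) ^+ 2.
  rewrite (le_trans h2)// exprMn [sigma ^+ 2]expr2 sigma2 expr2 mulrCA.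
  by rewrite ler_wpM2l.
have : 0 <= sigma * trform V V by rewrite mulr_ge0// ltW.
move: (trform V (trop V)) (sigma * _) => x y y0.
have [x0 _|x0] := lerP x 0; first exact: le_trans y0.
by rewrite ler_pXn2r ?nnegrE// ltW.
Qed.

End MatrixOperator.
End PowerBound.

(** * The operator A and its norms *)

Section Frobenius.
Context {R : realType}.
Local Notation K := R[i].

Lemma frob_ge0 m n (A : 'M[R]_(m, n)) : 0 <= frob A.
Proof. exact: sqrtr_ge0. Qed.
Lemma frob_sqr m n (A : 'M[R]_(m, n)) : frob A ^+ 2 = \sum_i \sum_j A i j ^+ 2.
Proof.
by rewrite sqr_sqrtr// sumr_ge0// => i _; rewrite sumr_ge0// => j _; exact: sqr_ge0.
Qed.
Lemma ler_sqr2 (x y : R) : 0 <= y -> x ^+ 2 <= y ^+ 2 -> x <= y.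
Proof.
move=> y0; have [x0 _|x0] := lerP x 0; first exact: le_trans y0.
by rewrite ler_pXn2r ?nnegrE// ltW.
Qed.
Lemma frobZ m n a (A : 'M[R]_(m, n)) : frob (a *: A) = `|a| * frob A.
Proof.
rewrite /frob -sqrtr_sqr -sqrtrM ?sqr_ge0//; congr Num.sqrt; rewrite mulr_sumr.
by apply: eq_bigr => i _; rewrite mulr_sumr; apply: eq_bigr => j _; rewrite mxE exprMn.
Qed.
Lemma frob_entry m n (A : 'M[R]_(m, n)) i j : `|A i j| <= frob A.
Proof.
apply: ler_sqr2; first exact: frob_ge0.
rewrite real_normK ?num_real// frob_sqr (bigD1 i)//= (bigD1 j)//= -addrA lerDl.
by rewrite addr_ge0// sumr_ge0// => ? _; rewrite ?sqr_ge0// sumr_ge0// => ? _; exact: sqr_ge0.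
Qed.
Lemma frob_eq0 m n (A : 'M[R]_(m, n)) : frob A <= 0 -> A = 0.
Proof.
move=> h; apply/matrixP => i j; rewrite mxE; apply/eqP.
by rewrite -normr_eq0 eq_le normr_ge0 andbT (le_trans (frob_entry _ _ _)).
Qed.
Lemma nm_toC_frob m n (A : 'M[R]_(m, n)) : nm (toC A) <= m%:R * n%:R * frob A.
Proof. by apply: nm_le => i j; rewrite mxE nc_real frob_entry. Qed.
Lemma frob_nm_toC m n (A : 'M[R]_(m, n)) : frob A <= nm (toC A).
Proof.
apply: ler_sqr2; first exact: nm_ge0.
rewrite frob_sqr expr2 {1}/nm mulr_suml; apply: ler_sum => i _.
rewrite mulr_suml; apply: ler_sum => j _.
have e : A i j ^+ 2 = nc (toC A i j) * nc (toC A i j).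
  by rewrite mxE nc_real -expr2 real_normK ?num_real.
by rewrite e ler_wpM2l ?nc_ge0// nm_entry.
Qed.
Lemma frob_tr m n (A : 'M[R]_(m, n)) : Re (\tr ((toC A)^t* *m toC A)) = frob A ^+ 2.
Proof.
rewrite frob_sqr exchange_big /mxtrace Re_sum; apply: eq_bigr => j _.
rewrite mxE Re_sum; apply: eq_bigr => i _.
by rewrite trmxCE mulcJ mxE nc_real /= real_normK ?num_real.
Qed.
End Frobenius.

Lemma ae_fin {R : realType} {d : measure_display} {W : measurableType d}
  (mu : {measure set W -> \bar R}) (I : finType) (E : I -> W -> Prop) :
  (forall i, {ae mu, forall w, E i w}) -> {ae mu, forall w, forall i, E i w}.
Proof.
move=> h; suff H (s : seq I) : {ae mu, forall w, forall i, i \in s -> E i w}.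
  by apply: filterS (H (enum I)) => w Hw i; apply: Hw; rewrite mem_enum.
elim: s => [|i s IH]; first exact: aeW.
by apply: filterS2 (h i) IH => w hi hs j; rewrite inE => /orP[/eqP->//|]; exact: hs.
Qed.

Section OperatorNorm.
Context {R : realType} {d : measure_display} {W : measurableType d}.
Variable P : probability W R.
Local Notation K := R[i].
Context {r : nat}.
Variable C : W -> 'M[R]_r.
Let B w := C w - 1%:M.
Let Bc w : 'M[K]_r := toC (B w).
Hypothesis sB : sqint P Bc.
Hypothesis hB : {ae P, forall w, sym_mx (B w)}.

Lemma BcH : {ae P, forall w, (Bc w)^t* = Bc w}.
Proof. by apply: filterS hB => w h; rewrite /Bc trmxC_toC h. Qed.

Lemma mint_BXB X : mint P (fun w => Bc w *m X *m Bc w).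
Proof. by apply: mint_mul => //; exact: sqintMr. Qed.

Lemma toC_calA H : toC (calA P C H) = MI P (fun w => Bc w *m toC H *m Bc w).
Proof. by rewrite toC_Emx; under [in LHS]eq_fun do rewrite !toCM. Qed.

Lemma qf_calA H v : qf (toC (calA P C H)) v = RI P (fun w => qf (toC H) (Bc w *m v)).
Proof.
rewrite toC_calA qf_MI; last exact: mint_BXB.
apply: RI_eq.
- exact/rint_meas/rint_qf/mint_BXB.
- exact: rint_meas (rint_qfF _ _ sB).
by apply: filterS BcH => w h; rewrite -qf_congr h.
Qed.

Lemma nm_MI m n (X : W -> 'M[K]_(m, n)) : mint P X ->
  nm (MI P X) <= 2 * m%:R * n%:R * RI P (fun w => nm (X w)).
Proof.
move=> hX; rewrite -mulrA mulrCA mulrA; apply: le_trans (nm_le (c := 2 * RI P (fun w => nm (X w))) _) _.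
  move=> i j; rewrite mxE (le_trans (nc_le _))//.
  have [h1 h2] := hX i j; have hn := mint_nm hX.
  have k (f : W -> R) : rint P f -> (forall w, `|f w| <= nm (X w)) ->
      `|RI P f| <= RI P (fun w => nm (X w)).
    move=> hf fX; apply: le_trans (le_normr_Rintegral measurableT hf) _.
    by apply: RI_le => //; [exact: rint_abs|exact: aeW].
  have := k _ h1 (fun w => le_trans (nc_Re _) (nm_entry _ i j)).
  have := k _ h2 (fun w => le_trans (nc_Im _) (nm_entry _ i j)).
  rewrite /=; lra.
rewrite !mulrA; lra.
Qed.

Let M2 := RI P (fun w => nm (Bc w) ^+ 2).

Lemma calA_bounded H : frob (calA P C H) <= 2 * r%:R * r%:R * (nm (toC H) * M2).
Proof.
apply: le_trans (frob_nm_toC _) _; rewrite toC_calA.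
apply: le_trans (nm_MI (mint_BXB _)) _; rewrite ler_wpM2l ?mulr_ge0//.
rewrite -RIZ; last by case: sB.
apply: RI_le; first exact/mint_nm/mint_BXB.
  by apply: rintZ; case: sB.
apply: aeW => w; rewrite mulrC expr2 mulrAC; apply: nmMc => //; exact: nmM.
Qed.

Lemma calAZ a H : calA P C (a *: H) = a *: calA P C H.
Proof.
apply: toC_inj; rewrite toCZ !toC_calA -MIZ; last exact: mint_BXB.
by congr MI; apply/funext => w; rewrite toCZ -scalemxAr -scalemxAl.
Qed.

Lemma calA_sym H : sym_mx H -> sym_mx (calA P C H).
Proof.
move=> hH; apply: toC_inj; rewrite -trmxC_toC toC_calA -MI_trmxC; last exact: mint_BXB.
apply: MI_eq; first exact/mmeas_trmxC/mint_meas/mint_BXB.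
  exact/mint_meas/mint_BXB.
by apply: filterS BcH => w h; rewrite !trmxCM h trmxC_toC hH mulmxA.
Qed.

Let rho := opnorm_sym (calA P C).

Lemma opnorm_sym_ub H : sym_mx H -> frob (calA P C H) <= rho * frob H.
Proof.
have ub : has_ubound [set frob (calA P C H0) | H0 in [set H0 | sym_mx H0 /\ frob H0 <= 1]].
  exists (2 * r%:R * r%:R * ((r%:R * r%:R) * M2)) => _ [H0 [sH0 fH0] <-].
  apply: le_trans (calA_bounded _) _; rewrite ler_wpM2l ?mulr_ge0// ler_wpM2r//.
    by apply: Rintegral_ge0 => w _; exact: sqr_ge0.
  by apply: le_trans (nm_toC_frob _) _; rewrite ler_piMr ?mulr_ge0.
move=> hH; have [h0|h0] := lerP (frob H) 0.
  have -> : H = 0 by exact: frob_eq0.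
  by rewrite -(scale0r H) calAZ !frobZ normr0 !mul0r mulr0.
have := ub_le_sup ub; rewrite -/(opnorm_sym _) -/rho => /(_ (frob (calA P C ((frob H)^-1 *: H)))).
rewrite calAZ frobZ ger0_norm ?invr_ge0 ?frob_ge0// ler_pdivrMl// [X in _ -> _ <= X]mulrC; apply.
exists ((frob H)^-1 *: H); last by rewrite calAZ frobZ ger0_norm ?invr_ge0 ?frob_ge0.
split; first by rewrite /sym_mx linearZ /= hH.
by rewrite frobZ ger0_norm ?invr_ge0 ?frob_ge0// mulVf// gt_eqF.
Qed.

Hypothesis hne : (0 < P [set w | C w <> 1%:M])%E.

Lemma ae_contra : ~ {ae P, forall w, B w = 0}.
Proof.
move=> [N [mN PN hN]]; move: hne.
have sub : [set w | C w <> 1%:M] `<=` N.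
  by move=> w h; apply: hN => /= e; apply: h; apply/eqP; rewrite -subr_eq0 -/(B w) e.
have mB : measurable [set w | C w <> 1%:M].
  have -> : [set w | C w <> 1%:M] = (fun w => 0 < nm (Bc w)) @^-1` [set true].
    apply/seteqP; split => w /=.
      move=> h; rewrite lt_def nm_ge0 andbT; apply/eqP => e; apply: h; apply/eqP.
      rewrite -subr_eq0 -/(B w); apply/eqP/toC_inj; rewrite -/(Bc w).
      have -> : toC (0 : 'M[R]_r) = 0 by rewrite /toC map_mx0.
      by apply: nm_eq0; rewrite e.
    move=> h e; move: h; rewrite /Bc /B e subrr /toC map_mx0 nm0 ltxx; exact.
  rewrite -[X in measurable X]setTI.
  by apply: (measurable_fun_ltr (measurable_cst _)) => //; apply: measurable_nm; case: sB.
rewrite lt_def => /andP[/eqP + _]; apply.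
by apply/eqP; rewrite eq_le measure_ge0 andbT -PN le_measure ?inE.
Qed.

(** The image of the identity is E[B^2]. If it vanished, every column of B would vanish almost
    surely, against the hypothesis that C differs from the identity with positive probability. *)
Lemma rho_gt0 : 0 < rho.
Proof.
have s1 : sym_mx (1%:M : 'M[R]_r) by rewrite /sym_mx trmx1.
have := opnorm_sym_ub s1.
case: (ltrP 0 rho) => // r0 h; exfalso; apply: ae_contra.
have A0 : calA P C 1%:M = 0.
  by apply: frob_eq0; rewrite (le_trans h)// mulr_le0_ge0// frob_ge0.
have key i : {ae P, forall w, sq (Bc w *m (delta_mx i 0)) = 0}.
  apply: RI_eq0; [|by move=> w; exact: sq_ge0|].
    by under eq_fun do rewrite -qf1; exact: rint_qfF.
  under eq_fun do rewrite -qf1 -toC1.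
  by rewrite -qf_calA A0 /toC map_mx0 /qf /hf mulmx0 mul0mx mxE.
move/ae_fin: key; apply: filterS => w hw; apply: toC_inj; rewrite -/(Bc w).
have -> : toC (0 : 'M[R]_r) = 0 by rewrite /toC map_mx0.
apply/matrixP => i j; have : Bc w *m (delta_mx j 0 : 'cV_r) = 0 by apply: sq_eq0; rewrite hw.
by move=> /matrixP/(_ i 0); rewrite -colE !mxE.
Qed.

(** These iterates serve as the forms on the B side of [trop_bound]: the transport inequality is an
    equality by construction, and they stay bounded because rho is the operator norm. Starting at
    the identity makes every matrix dominated up to a factor. *)
Definition Rseq n : 'M[R]_r := iter n (fun X => rho^-1 *: calA P C X) 1%:M.

Lemma Rseq_sym n : sym_mx (Rseq n).
Proof.
elim: n => [|n IH]; first by rewrite /sym_mx trmx1.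
by rewrite /Rseq iterS /sym_mx linearZ /= -/(Rseq n) calA_sym.
Qed.
Lemma Rseq_frob n : frob (Rseq n) <= frob (1%:M : 'M[R]_r).
Proof.
elim: n => [//|n IH]; rewrite /Rseq iterS frobZ -/(Rseq n).
have r0 := rho_gt0; rewrite ger0_norm ?invr_ge0 ?(ltW r0)// ler_pdivrMl//.
apply: le_trans (opnorm_sym_ub (Rseq_sym n)) _.
by rewrite ler_wpM2l// ltW.
Qed.
Lemma Rseq_qf n v : RI P (fun w => qf (toC (Rseq n)) (Bc w *m v)) = rho * qf (toC (Rseq n.+1)) v.
Proof.
rewrite -qf_calA [Rseq n.+1]iterS -/(Rseq n) toCZ qfZ mulrA mulfV ?mul1r//.
by rewrite gt_eqF// rho_gt0.
Qed.
Definition Rbound : R := r%:R * (r%:R * r%:R * frob (1%:M : 'M[R]_r)).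
Lemma Rseq_bound n v : qf (toC (Rseq n)) v <= Rbound * sq v.
Proof.
apply: le_trans (ler_norm _) _; apply: le_trans (qf_le _ _) _.
rewrite ler_wpM2r ?sq_ge0// /Rbound ler_wpM2l//; apply: le_trans (nm_toC_frob _) _.
by rewrite ler_wpM2l ?mulr_ge0// Rseq_frob.
Qed.

Lemma pd1 n : pd (1%:M : 'M[K]_n).
Proof. by split=> [|v v0]; [exact: trmxC1|rewrite qf1 sq_gt0]. Qed.

Lemma Re_bilinear_le m n (V : 'M[K]_(m, n)) a b :
  2 * Re ((a^t* *m V *m b) 0 0) <= nm V * (m%:R + n%:R) * (sq a + sq b).
Proof.
have h : Re ((a^t* *m V *m b) 0 0) <= nm V * (nm a * nm b).
  apply: le_trans (ler_norm _) _; apply: le_trans (nc_Re _) _.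
  apply: le_trans (nm_entry _ _ _) _; rewrite mulrCA mulrA.
  by apply: nmMc => //; apply: nmMc => //; rewrite nm_trmxC.
have : 2 * (nm a * nm b) <= (m%:R + n%:R) * (sq a + sq b).
  apply: le_trans (ler_2M _ _) _; have := nm_le_sq a; have := nm_le_sq b.
  have := mulr_ge0 (ler0n R m) (sq_ge0 b); have := mulr_ge0 (ler0n R n) (sq_ge0 a); lra.
move=> /(ler_wpM2l (nm_ge0 V)); lra.
Qed.

(** rho is a norm on symmetric matrices only, whereas V is arbitrary. [trop_bound] with F = B and
    identity weights needs the iterates of the identity alone, which are symmetric, and still bounds
    the operator at every V. *)
Lemma calA_opnorm V : frob (calA P C V) <= rho * frob V.
Proof.
set t := nm (toC V) * (r%:R + r%:R).
have t0 : 0 <= t by rewrite mulr_ge0 ?nm_ge0// addr_ge0.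
pose Rs n : 'M[K]_r := t%:C *: toC (Rseq n).
have h1 : pd (1%:M : 'M[K]_r) by exact: pd1.
have hRs n b : RI P (fun w => qf (Rs n) (Bc w *m (invmx 1%:M *m b))) <= rho * qf (Rs n.+1) b.
  rewrite invmx1 mul1mx; under eq_fun do rewrite qfZ.
  by rewrite RIZ ?Rseq_qf ?qfZ; [lra|exact: rint_qfF].
have uRs n b : qf (Rs n) b <= t * Rbound * sq b.
  by rewrite qfZ -mulrA ler_wpM2l// Rseq_bound.
have := trop_bound sB sB BcH BcH h1 h1 rho_gt0 rho_gt0 hRs hRs uRs uRs (V := toC V).
rewrite /trop invmx1 mul1mx mulmx1 -toC_calA /trform !mulmx1 !frob_tr => H.
apply: ler_sqr2; first by rewrite mulr_ge0 ?frob_ge0// ltW// rho_gt0.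
rewrite exprMn expr2 [rho ^+ 2]expr2 -expr2; apply: H => a b.
rewrite mul1r /Rs /Rseq /= !qfZ toC1 !qf1 -mulrDr; exact: Re_bilinear_le.
Qed.

Definition vecmx (V : 'M[R]_r) : 'cV[R]_(r * r) :=
  \col_k V (mxtens_unindex k).1 (mxtens_unindex k).2.
Definition unvecmx (v : 'cV[R]_(r * r)) : 'M[R]_r :=
  \matrix_(i, j) v (mxtens_index (i, j)) 0.
Lemma vecmxK v : vecmx (unvecmx v) = v.
Proof. by apply/colP => k; rewrite !mxE -surjective_pairing mxtens_unindexK. Qed.

Lemma sum_mxtens (V : nmodType) m n (f : 'I_(m * n) -> V) :
  \sum_k f k = \sum_i \sum_j f (mxtens_index (i, j)).
Proof.
rewrite pair_big /= (reindex (@mxtens_index m n))/=.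
  by apply: eq_bigr => -[i j] _.
exists (@mxtens_unindex m n) => k _; [exact: mxtens_indexK|exact: mxtens_unindexK].
Qed.

Lemma frob_vecmx V : frob (vecmx V) = frob V.
Proof.
rewrite /frob; congr Num.sqrt; rewrite sum_mxtens; apply: eq_bigr => i _.
by apply: eq_bigr => j _; rewrite big_ord1 !mxE mxtens_indexK.
Qed.

(** The tensor square of B sends the vectorization of V to that of B V B^T, and B is symmetric
    almost surely. *)
Lemma calA_vec V : Emx P (fun w => B w *t B w) *m vecmx V = vecmx (calA P C V).
Proof.
have rB i j k l : rint P (fun w => B w i j * B w k l).
  have [h _] := mint_FXB sB sB (delta_mx j k) i l.
  move: h; rewrite (_ : (fun w => _) = fun w => B w i j * B w k l)//.
  apply/funext => w; rewrite mxE Re_sum (bigD1 k)//= big1 => [|k' k'k].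
    rewrite mxE (bigD1 j)//= big1 => [|j' j'j]; last by rewrite !mxE (negbTE j'j) mulr0.
    by rewrite !mxE !eqxx mulr1 addr0 !addr0 -rmorphM.
  by rewrite mxE big1 ?mul0r// => j' _; rewrite !mxE (negbTE k'k) andbF mulr0.
have mB i j : measurable_fun [set: W] (fun w => B w i j).
  by have [mBc _] := sB; have [+ _] := mBc i j; under eq_fun do rewrite mxE.
apply/colP => k; case: (mxtens_indexP k) => i l.
rewrite mxE [RHS]mxE mxtens_indexK /= EmxE sum_mxtens.
have E w : (B w *m V *m B w) i l = \sum_j \sum_k V j k * (B w i j * B w k l).
  rewrite mxE exchange_big; apply: eq_bigr => k' _ /=; rewrite mxE mulr_suml.
  by apply: eq_bigr => j _; rewrite mulrA [V _ _ * _]mulrC.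
under [in RHS]eq_fun do rewrite E.
rewrite RI_sum => [|j]; last by apply: rint_sum => k'; exact: rintZ.
apply: eq_bigr => j _; rewrite RI_sum => [|k']; last exact: rintZ.
apply: eq_bigr => k' _; rewrite RIZ// EmxE [vecmx V _ _]mxE mxtens_indexK /= mulrC.
under eq_fun do rewrite tensmxE; congr (_ * _).
apply: RI_eq => [||].
- by apply: measurable_funM.
- exact: rint_meas (rB _ _ _ _).
by apply: filterS hB => w /matrixP/(_ k' l); rewrite mxE => ->.
Qed.

(** Vectorization is an isometry for the Frobenius norm. One inequality is the extension
    [calA_opnorm] to all matrices, the other restricts the supremum to symmetric ones. *)
Lemma opnorm_mx_calA : opnorm_mx (Emx P (fun w => B w *t B w)) = rho.
Proof.
have ub (v : 'cV_(r * r)) : frob v <= 1 -> frob (Emx P (fun w => B w *t B w) *m v) <= rho.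
  move=> hv; rewrite -(vecmxK v) calA_vec frob_vecmx (le_trans (calA_opnorm _))//.
  by rewrite -frob_vecmx vecmxK ler_piMr// ltW// rho_gt0.
have f0 m n : frob (0 : 'M[R]_(m, n)) = 0 by rewrite -(scale0r 0) frobZ normr0 mul0r.
apply/eqP; rewrite eq_le; apply/andP; split.
  apply: ge_sup; first by exists (frob (Emx P (fun w => B w *t B w) *m (0 : 'cV_(r * r)))); exists 0; rewrite //= f0.
  by move=> _ [v hv <-]; exact: ub.
apply: ge_sup.
  by exists (frob (calA P C 0)); exists 0; rewrite //=; split; rewrite /sym_mx ?trmx0 ?f0.
move=> _ [H [sH fH] <-]; apply: ub_le_sup; first by exists rho => _ [v hv <-]; exact: ub.
by exists (vecmx H); rewrite /= ?frob_vecmx// calA_vec frob_vecmx.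
Qed.

End OperatorNorm.

(** * Moments of the standard normal law and conditional expectations *)

Section GaussianMoments.
Context {R : realType}.
Local Notation mu := (@lebesgue_measure R).

Definition gauss (x : R) : R := expR (- (x ^+ 2 / 2)).

Lemma gauss_gt0 x : 0 < gauss x. Proof. exact: expR_gt0. Qed.

Lemma measurable_gauss : measurable_fun [set: R] gauss.
Proof.
apply: measurableT_comp => //; apply: measurableT_comp => //.
by apply: measurable_funM => //; exact: measurable_funX.
Qed.

Lemma normal_pdf01E x : normal_pdf 0 1 x = normal_peak 1 * gauss x.
Proof.
rewrite normal_pdfE ?oner_eq0// /normal_fun /gauss subr0 expr1n.
by rewrite mulNr.
Qed.

Lemma sqr_le_expR (t : R) : 0 <= t -> t ^+ 2 <= 4 * expR t.
Proof.
move=> t0; have -> : expR t = expR (t / 2) ^+ 2 by rewrite -expRM_natl; congr expR; lra.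
have -> : (4 : R) = 2 ^+ 2 by rewrite expr2; lra.
rewrite -exprMn ler_pXn2r ?nnegrE ?mulr_ge0 ?expR_ge0//.
by have := expR_ge1Dx (t / 2); lra.
Qed.

(** One half of the Gaussian exponent absorbs the polynomial: t^2 <= 4 e^t at t = x^2 / 4. The other
    half is, up to a factor, the density of a normal law of variance 2, hence integrable. *)
Lemma x4_gauss_le x : x ^+ 4 * gauss x <= 64 * expR (- (x ^+ 2 / 4)).
Proof.
have x2 := sqr_ge0 x; have h : 0 <= x ^+ 2 / 4 by rewrite divr_ge0.
have := sqr_le_expR h.
have -> : gauss x = expR (- (x ^+ 2 / 4)) * expR (- (x ^+ 2 / 4)).
  by rewrite -expRD; congr expR; lra.
rewrite mulrA ler_pM2r ?expR_gt0// expRN ler_pdivrMr ?expR_gt0//.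
rewrite expr_div_n -exprM ler_pdivrMr; last by rewrite exprn_gt0.
by rewrite -natrX => hh; apply: le_trans hh _; lra.
Qed.

Lemma rint_expR4 : rint mu (fun x => expR (- (x ^+ 2 / 4))).
Proof.
have s0 : Num.sqrt 2 != 0 :> R by rewrite gt_eqF// sqrtr_gt0.
have := rintZ (normal_peak (Num.sqrt 2))^-1 (@integrable_normal_pdf R 0 (Num.sqrt 2)).
rewrite (_ : (fun x => _) = fun x => expR (- (x ^+ 2 / 4)))//.
apply/funext => x; rewrite normal_pdfE// mulKf ?gt_eqF ?normal_peak_gt0//.
by rewrite /normal_fun subr0 sqr_sqrtr// mulNr -mulr_natr; congr (expR (- (_ / _))); lra.
Qed.

Lemma rint_gauss_dom (f : R -> R) : measurable_fun [set: R] f ->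
  (forall x, `|f x| <= 1 + x ^+ 4) -> rint mu (fun x => f x * gauss x).
Proof.
move=> mf hf; apply: (rint_dom _ (rintZ 65 rint_expR4)).
  by apply: measurable_funM => //; exact: measurable_gauss.
apply: aeW => x; rewrite normrM (gtr0_norm (gauss_gt0 x)).
apply: (@le_trans _ _ ((1 + x ^+ 4) * gauss x)); first by rewrite ler_wpM2r// ltW// gauss_gt0.
have h1 : gauss x <= expR (- (x ^+ 2 / 4)).
  by rewrite ler_expR lerN2; have := sqr_ge0 x; lra.
have := x4_gauss_le x; lra.
Qed.

(** The fundamental theorem of calculus on [-n, n] is combined with dominated convergence. Both
    Gaussian moments are obtained in this way, the integrands being derivatives of functions
    vanishing at infinity. *)
Lemma RI_derivative (f F : R -> R) : continuous f -> rint mu f ->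
  (forall x : R, is_derive x 1 F (f x)) ->
  F n%:R - F (- n%:R) @[n --> \oo] --> 0 -> RI mu f = 0.
Proof.
move=> cf rf dF hF.
have mf := rint_meas rf.
pose fn n x := f x * \1_(`[- n%:R, n%:R]) x.
have mfn n : measurable_fun [set: measurableTypeR R] (fn n).
  by apply: measurable_funM => //; exact: measurable_indic.
have h1 : {ae mu, forall x, fn n x @[n --> \oo] --> f x}.
  apply: aeW => x; apply: cvg_near_cst.
  near=> n; rewrite /fn indicE mem_set ?mulr1//= in_itv/=.
  have : `|x| <= n%:R by near: n; exact: nbhs_infty_ger.
  by rewrite ler_norml.
have h2 n : {ae mu, forall x, `|fn n x| <= `|f x|}.
  apply: aeW => x; rewrite /fn normrM ler_piMr// indicE.
  by case: (_ \in _); rewrite /= ?normr1 ?normr0.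
have [_ _ c] := RI_cvg (mu := mu) mfn mf (rint_abs rf) h1 h2.
(* The index is shifted because the fundamental theorem is stated on a nondegenerate interval, which
   excludes n = 0. *)
suff E n : RI mu (fn n.+1) = F n.+1%:R - F (- n.+1%:R).
  have c1 : RI mu (fn n.+1) @[n --> \oo] --> RI mu f by rewrite (cvg_shiftS (fun n => RI mu (fn n))).
  have c2 : RI mu (fn n.+1) @[n --> \oo] --> (0 : R).
    rewrite (funext E).
    by have := hF; rewrite -(cvg_shiftS (fun n : nat => F n%:R - F (- n%:R))).
  by rewrite -(cvg_lim _ c1)//; apply: cvg_lim.
rewrite /RI; have -> : (\int[mu]_x (fn n.+1 x)%:E = \int[mu]_(x in `[(- n.+1%:R)%R, n.+1%:R%R]) (f x)%:E)%E.
  rewrite [RHS]integral_mkcond; apply: eq_integral => x _.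
  by rewrite /fn patchE indicE; case: ifP => _; rewrite ?mulr1 ?mulr0.
have cF : continuous F.
  move=> x; apply: differentiable_continuous; apply/derivable1_diffP.
  by have [] := dF x.
rewrite (@continuous_FTC2 _ f F)//.
- by rewrite gtrN// ltr0n.
- by apply: continuous_subspaceT.
- split.
  + by move=> x _; have [] := dF x.
  + by apply: cvg_at_right_filter; exact: cF.
  + by apply: cvg_at_left_filter; exact: cF.
by move=> x _; rewrite derive1E; exact: derive_val.
Unshelve. all: by end_near. Qed.

Lemma derive_gauss (x : R) : is_derive x 1 gauss (- x * gauss x).
Proof.
have h : is_derive x 1 (fun y : R => - (y ^+ 2 / 2)) (- x).
  by apply: is_derive_eq; rewrite ?scaler0 /= /GRing.scale /=; field.
have -> : - x * gauss x = expR (- (x ^+ 2 / 2)) * - x by rewrite mulrC.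
exact: is_derive1_comp.
Qed.

Lemma continuous_gauss : continuous gauss.
Proof.
move=> x; apply: differentiable_continuous; apply/derivable1_diffP.
by have [] := derive_gauss x.
Qed.

Lemma cvg_gauss_n : (n%:R : R) * gauss n%:R @[n --> \oo] --> (0 : R).
Proof.
apply: (@squeeze_cvgr _ _ _ _ (fun=> 0) (fun n : nat => 8 / n%:R)).
- near=> n; have n0 : 0 < n%:R :> R by rewrite ltr0n; near: n; exact: nbhs_infty_gt.
  rewrite mulr_ge0//= ?(ltW (gauss_gt0 _))// /gauss expRN ler_pdivrMr ?expR_gt0//.
  have h : 0 <= n%:R ^+ 2 / 2 :> R by rewrite divr_ge0 ?sqr_ge0.
  have h1 := expR_ge1Dx (n%:R ^+ 2 / 2 : R).
  rewrite mulrAC ler_pdivlMr// -expr2; lra.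
- exact: cvg_cst.
have h : (n%:R : R)^-1 @[n --> \oo] --> (0 : R).
  apply/gtr0_cvgV0; last exact: cvgr_idn.
  by near=> n; rewrite ltr0n; near: n; exact: nbhs_infty_gt.
by have := cvgM (cvg_cst (8 : R)) h; rewrite mulr0; apply.
Unshelve. all: by end_near. Qed.

Lemma gauss_even (x : R) : gauss (- x) = gauss x.
Proof. by rewrite /gauss sqrrN. Qed.

Lemma abs_le_x4 (x : R) : `|x| <= 1 + x ^+ 4.
Proof.
have h : x ^+ 2 <= (1 + x ^+ 4) / 2 * 1.
  have := sqr_ge0 (x ^+ 2 - 1); rewrite sqrrB -exprM; lra.
have : `|x| <= (1 + x ^+ 2) / 2.
  by have := sqr_ge0 (`|x| - 1); rewrite sqrrB real_normK ?num_real//; lra.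
have := sqr_ge0 (x ^+ 2); rewrite -exprM /=; lra.
Qed.
Lemma sqr_le_x4 (x : R) : `|x ^+ 2| <= 1 + x ^+ 4.
Proof.
rewrite ger0_norm ?sqr_ge0//; have := sqr_ge0 (x ^+ 2 - 1); rewrite sqrrB -exprM.
have := sqr_ge0 x; have := sqr_ge0 (x ^+ 2); rewrite -exprM; lra.
Qed.

Lemma RI_x_gauss : RI mu (fun x => x * gauss x) = 0.
Proof.
have r : rint mu (fun x => x * gauss x) by apply: rint_gauss_dom => // x; exact: abs_le_x4.
apply: (@RI_derivative _ (fun x => - gauss x)) => //.
- by move=> x; apply: cvgM => //; exact: continuous_gauss.
- move=> x; have := derive_gauss x => h; apply: is_derive_eq.
  by rewrite mulNr opprK.
- under eq_fun do rewrite gauss_even subrr; exact: cvg_cst.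
Qed.

(** The function (x^2 - 1) [gauss x] is the derivative of - x [gauss x]. *)
Lemma RI_x2_gauss : RI mu (fun x => x ^+ 2 * gauss x) = RI mu gauss.
Proof.
have r2 : rint mu (fun x => x ^+ 2 * gauss x).
  by apply: rint_gauss_dom => [|x]; [exact: measurable_funX|exact: sqr_le_x4].
have r0 : rint mu gauss.
  have := @rint_gauss_dom (fun=> 1) (measurable_cst _) _.
  under eq_fun do rewrite mul1r; apply => x.
  by rewrite normr1 lerDl (_ : 4 = 2 * 2)%N// exprM sqr_ge0.
apply/eqP; rewrite -subr_eq0 -RIB//; apply/eqP.
apply: (@RI_derivative _ (fun x => - (x * gauss x))).
- move=> x; apply: cvgB; last exact: continuous_gauss.
  by apply: cvgM; [exact: exprn_continuous|exact: continuous_gauss].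
- exact: rintB.
- move=> x; have h := derive_gauss x; apply: is_derive_eq.
  by rewrite /GRing.scale /=; ring.
have E n : - (n%:R * gauss n%:R) - - (- n%:R * gauss (- n%:R)) = -2 * (n%:R * gauss n%:R).
  by rewrite gauss_even; ring.
under eq_fun do rewrite E.
have := cvgM (cvg_cst (-2 : R)) cvg_gauss_n; rewrite mulr0; exact.
Qed.

Notation N01 := (normal_prob (0 : R) 1).

Lemma ge0_integral_normal_prob (f : R -> R) : measurable_fun [set: R] f ->
  (forall x, 0 <= f x) ->
  (\int[N01]_x (f x)%:E = \int[mu]_x (f x * normal_pdf 0 1 x)%:E)%E.
Proof.
move=> mf f0.
have dom := @normal_prob_dominates R 0 1.
have mf' : measurable_fun [set: R] (EFin \o f) by exact/measurable_EFinP.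
rewrite -(Radon_Nikodym_SigmaFinite.change_of_variables dom _ measurableT mf'); last first.
  by move=> x; rewrite lee_fin.
apply: ae_eq_integral => //.
- apply: emeasurable_funM; first exact/measurable_EFinP.
  exact: measurable_int (Radon_Nikodym_SigmaFinite.f_integrable dom).
- apply/measurable_EFinP/measurable_funM => //; exact: measurable_normal_pdf.
have : ae_eq mu setT (Radon_Nikodym_SigmaFinite.f N01 mu) (EFin \o normal_pdf 0 1).
  apply: integral_ae_eq => //.
  - exact: Radon_Nikodym_SigmaFinite.f_integrable.
  - by apply/measurable_EFinP; exact: measurable_normal_pdf.
  by move=> E _ mE; rewrite -Radon_Nikodym_SigmaFinite.f_integral.
by apply: filterS => x H _; rewrite H// EFinM.
Qed.

Lemma normal_peak_RI : normal_peak 1 * RI mu gauss = 1.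
Proof.
have := @integral_normal_pdf R 0 1.
under eq_integral do rewrite normal_pdf01E.
move=> h; have : RI mu (fun x => normal_peak 1 * gauss x) = 1 by rewrite /RI h.
rewrite RIZ//.
have := @rint_gauss_dom (fun=> 1) (measurable_cst _) _.
under eq_fun do rewrite mul1r; apply => x.
by rewrite normr1 lerDl (_ : 4 = 2 * 2)%N// exprM sqr_ge0.
Qed.

Lemma rint_normal_ge0 (f : R -> R) : measurable_fun [set: R] f -> (forall x, 0 <= f x) ->
  (forall x, `|f x| <= 1 + x ^+ 4) ->
  rint N01 f /\ RI N01 f = normal_peak 1 * RI mu (fun x => f x * gauss x).
Proof.
move=> mf f0 hf; have r := rint_gauss_dom mf hf.
have E : (\int[N01]_x (f x)%:E = (normal_peak 1 * RI mu (fun x => f x * gauss x))%:E)%E.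
  rewrite ge0_integral_normal_prob// -RIZ// -RIE; last exact: rintZ.
  by apply: eq_integral => x _; rewrite normal_pdf01E mulrCA.
split; last by rewrite /RI E.
apply/integrableP; split; first exact/measurable_EFinP.
by under eq_integral do rewrite gee0_abs ?lee_fin//; rewrite E ltry.
Qed.

Lemma rint_normal (f : R -> R) : measurable_fun [set: R] f ->
  (forall x, `|f x| <= 1 + x ^+ 4) ->
  rint N01 f /\ RI N01 f = normal_peak 1 * RI mu (fun x => f x * gauss x).
Proof.
move=> mf hf.
pose fp x := Num.max (f x) 0; pose fm x := Num.max (- f x) 0.
have mfp : measurable_fun [set: R] fp by exact: measurable_maxr.
have mfm : measurable_fun [set: R] fm by apply: measurable_maxr => //; exact: measurableT_comp.
have ffE x : f x = fp x - fm x.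
  by rewrite /fp /fm; case: (leP (f x) 0); case: (leP (- f x) 0); lra.
have hfp x : `|fp x| <= 1 + x ^+ 4.
  have := hf x; have := le_trans (normr_ge0 _) (hf x); rewrite /fp.
  by case: (leP (f x) 0) => //; rewrite normr0.
have hfm x : `|fm x| <= 1 + x ^+ 4.
  have := hf x; have := le_trans (normr_ge0 _) (hf x); rewrite /fm.
  by case: (leP (- f x) 0) => //; rewrite ?normr0 ?normrN.
have fp0 x : 0 <= fp x by rewrite /fp le_max lexx orbT.
have fm0 x : 0 <= fm x by rewrite /fm le_max lexx orbT.
have [rp ep] := rint_normal_ge0 mfp fp0 hfp.
have [rm em] := rint_normal_ge0 mfm fm0 hfm.
have -> : f = fun x => fp x - fm x by apply/funext.
split; first exact: rintB.
rewrite RIB// ep em -mulrBr -RIB; [|exact: rint_gauss_dom|exact: rint_gauss_dom].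
by under [in RHS]eq_fun do rewrite mulrBl.
Qed.

Lemma normal_mean : rint N01 (fun x => x) /\ RI N01 (fun x => x) = 0.
Proof.
have [//|x|r ->] := @rint_normal (fun x => x); first exact: abs_le_x4.
by rewrite RI_x_gauss mulr0.
Qed.
Lemma normal_sqr : rint N01 (fun x => x ^+ 2) /\ RI N01 (fun x => x ^+ 2) = 1.
Proof.
have [|x|r ->] := @rint_normal (fun x => x ^+ 2); [exact: measurable_funX|exact: sqr_le_x4|].
by rewrite RI_x2_gauss normal_peak_RI.
Qed.
Lemma normal_x4 : rint N01 (fun x => x ^+ 4).
Proof.
have m4 : measurable_fun [set: R] (fun x : R => x ^+ 4) by exact: measurable_funX.
have h4 (x : R) : `|x ^+ 4| <= 1 + x ^+ 4.
  by rewrite ger0_norm ?lerDr// (_ : 4 = 2 * 2)%N// exprM sqr_ge0.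
by have [] := rint_normal m4 h4.
Qed.

End GaussianMoments.

Section GaussianVector.
Context {R : realType} {d : measure_display} {W : measurableType d}.
Variable P : probability W R.
Notation N01 := (normal_prob (0 : R) 1).
Context {r : nat}.
Variable s : W -> r.-tuple R.
Hypothesis hs : standard_gaussian P s.

Let ms i : measurable_fun [set: W] (fun w => tnth (s w) i).
Proof. by apply: (measurableT_comp (measurable_tnth i)); case: hs. Qed.

(* Standard normal probabilities live on [measurableTypeR R], whose display differs
   from the one of the canonical measurable structure of [R]. *)
Let coord i : W -> measurableTypeR R := fun w => tnth (s w) i.
Let mcoord i : measurable_fun [set: W] (coord i).
Proof. exact: ms. Qed.

Lemma gaussian_pair i j A D : i != j -> measurable A -> measurable D ->
  P [set w | A (tnth (s w) i) /\ D (tnth (s w) j)] = (N01 A * N01 D)%E.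
Proof.
move=> ij mA mD; case: hs => _.
move=> /(_ (fun k => if k == i then A else if k == j then D else setT)) h.
transitivity (P [set w | forall k, (if k == i then A else if k == j then D else setT) (tnth (s w) k)]).
  congr (P _); apply/seteqP; split => w /=.
    by move=> [Aw Dw] k; case: eqP => [->//|_]; case: eqP => [->|].
  move=> hk; split; first by have := hk i; rewrite eqxx.
  by have := hk j; rewrite eq_sym (negbTE ij) eqxx.
rewrite h => [|k]; last by case: ifP => // _; case: ifP.
rewrite (bigD1 i)//= eqxx (bigD1 j)/=; last by rewrite eq_sym.
rewrite [j == i]eq_sym (negbTE ij) eqxx big1 ?mule1// => k.
by move=> /andP[/negbTE-> /negbTE->]; exact: probability_setT.
Qed.

Lemma gaussian_marginal i A : measurable A -> P [set w | A (tnth (s w) i)] = N01 A.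
Proof.
move=> mA; case: hs => _ /(_ (fun k => if k == i then A else setT)) h.
transitivity (P [set w | forall k, (if k == i then A else setT) (tnth (s w) k)]).
  congr (P _); apply/seteqP; split => w /=; first by move=> Aw k; case: eqP => [->|].
  by move=> /(_ i); rewrite eqxx.
rewrite h => [|k]; last by case: ifP.
rewrite (bigD1 i)//= eqxx big1 ?mule1// => k /negbTE->; exact: probability_setT.
Qed.

Lemma integral_marginal i (f : R -> R) : rint N01 f ->
  rint P (fun w => f (tnth (s w) i)) /\ RI P (fun w => f (tnth (s w) i)) = RI N01 f.
Proof.
move=> rf; have mf := rint_meas rf.
pose mm := isMeasurableFun.Build _ _ _ _ _ (mcoord i).
pose X : {mfun W >-> measurableTypeR R} := HB.pack (coord i) mm.
have mf' : measurable_fun [set: measurableTypeR R] (EFin \o f) by exact/measurable_EFinP.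
have eX (g : measurableTypeR R -> \bar R) :
    (\int[distribution P X]_x g x = \int[N01]_x g x)%E.
  by apply: eq_measure_integral => A mA _; exact: gaussian_marginal.
have rP : rint P (fun w => f (tnth (s w) i)).
  apply/integrableP; split; first exact: (measurableT_comp mf' (mcoord i)).
  have := @ge0_integral_distribution _ _ _ _ _ P X (fun x => `|(f x)%:E|%E).
  rewrite eX => <- //; first by case/integrableP: rf.
  exact: measurableT_comp.
split=> //; rewrite /RI -eX integral_distribution//.
Qed.

Lemma rint_s4 i : rint P (fun w => tnth (s w) i ^+ 4).
Proof. by have [] := integral_marginal i normal_x4. Qed.

(** The square of s_i s_j is integrable by the fourth Gaussian moments. This is the source of the
    square integrability of C(y), which is not assumed bounded above. *)
Lemma second_moment i j :
  rint P (fun w => outer (s w) i j ^+ 2) /\ rint P (fun w => outer (s w) i j).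
Proof.
have mo : measurable_fun [set: W] (fun w => outer (s w) i j).
  by under eq_fun do rewrite mxE; exact: measurable_funM.
have r2 : rint P (fun w => outer (s w) i j ^+ 2).
  apply: (rint_dom _ (rintD (rint_s4 i) (rint_s4 j))); first exact: measurable_funX.
  apply: aeW => w; rewrite ger0_norm ?sqr_ge0// mxE exprMn.
  have := ler_2M (tnth (s w) i ^+ 2) (tnth (s w) j ^+ 2); rewrite -!exprM.
  have := mulr_ge0 (sqr_ge0 (tnth (s w) i)) (sqr_ge0 (tnth (s w) j)); lra.
split=> //; apply: (rint_dom mo (rintD (rint_cst P 1) r2)).
apply: aeW => w; have := sqr_ge0 (`|outer (s w) i j| - 1).
rewrite sqrrB real_normK ?num_real//; have := sqr_ge0 (outer (s w) i j); lra.
Qed.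

(** Off the diagonal, the law of the pair of coordinates agrees with the product measure on
    rectangles, hence everywhere; Fubini's theorem then leaves the mean of one coordinate, which is
    zero. *)
Lemma covariance_gauss i j : RI P (fun w => outer (s w) i j) = (i == j)%:R.
Proof.
case: eqVneq => [<-|ij].
  have [_ <-] := @normal_sqr R.
  have [_ <-] := integral_marginal i (proj1 normal_sqr).
  by under eq_fun do rewrite mxE -expr2.
pose T2 := (measurableTypeR R * measurableTypeR R)%type.
pose phi w : T2 := (coord i w, coord j w).
have mphi : measurable_fun [set: W] phi by exact: measurable_fun_pair.
pose mm := isMeasurableFun.Build _ _ _ _ _ mphi.
pose X : {mfun W >-> T2} := HB.pack phi mm.
pose g (z : T2) : \bar R := (z.1 * z.2)%:E.
have mg : measurable_fun [set: T2] g.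
  by apply/measurable_EFinP; apply: measurable_funM; [exact: measurable_fst|exact: measurable_snd].
have eX (k : T2 -> \bar R) : (\int[distribution P X]_x k x = \int[N01 \x N01]_x k x)%E.
  apply: eq_measure_integral => A mA _; apply/esym.
  by apply: (product_measure_unique (m' := distribution P X)) => // D E mD mE; exact: gaussian_pair.
have ro : P.-integrable setT (g \o phi).
  have [_] := second_moment i j; rewrite /rint (_ : EFin \o _ = g \o phi)//.
  by apply/funext => w; rewrite /= mxE.
have e1 : (\int[P]_w (g \o phi) w = \int[N01 \x N01]_z g z)%E.
  by rewrite -eX integral_distribution.
have ig : (N01 \x N01)%E.-integrable setT g.
  apply/integrableP; split=> //; rewrite -eX ge0_integral_distribution//.
    by case/integrableP: ro.
  exact: measurableT_comp.
rewrite /RI (_ : (\int[P]_w _ = 0)%E)//.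
transitivity (\int[P]_w (g \o phi) w)%E.
  by apply: eq_integral => w _; rewrite mxE.
rewrite e1 -(integral12_prod_meas1 ig) integral0_eq// => x _.
rewrite /fubini_F /g /=.
have [rN e0] := @normal_mean R.
under eq_integral do rewrite EFinM.
rewrite integralZl//; by rewrite (RIE rN) e0 mule0.
Qed.

End GaussianVector.

(** * Square integrability of conditional expectations *)

Section ConditionalExpectation.
Context {R : realType} {d d' : measure_display} {W : measurableType d} {T : measurableType d'}.
Variable P : probability W R.
Variable y : W -> T.
Hypothesis my : measurable_fun [set: W] y.
Import HBNNSimple.

Section PositivePart.
Variables (g : W -> R) (f : T -> R).
Hypothesis mf : measurable_fun [set: T] f.
Hypotheses (rf : rint P (fun w => f (y w))) (rg : rint P g) (rg2 : rint P (fun w => g w ^+ 2)).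
Hypothesis hfg : forall D, measurable D ->
  (\int[P]_(w in y @^-1` D) (f (y w))%:E = \int[P]_(w in y @^-1` D) (g w)%:E)%E.

Lemma cond_exp_indic D : measurable D ->
  RI P (fun w => \1_D (y w) * f (y w)) = RI P (fun w => \1_D (y w) * g w).
Proof.
move=> mD; have h (k : W -> R) : (\int[P]_w (\1_D (y w) * k w)%:E = \int[P]_(w in y @^-1` D) (k w)%:E)%E.
  rewrite [RHS]integral_mkcond; apply: eq_integral => w _; rewrite patchE indicE.
  have -> : (w \in y @^-1` D) = (y w \in D) by apply/idP/idP; rewrite !inE.
  by case: ifP => _; rewrite ?mul1r ?mul0r.
by rewrite /RI !h hfg.
Qed.

Lemma rint_indicM (k : W -> R) D : measurable D -> rint P k ->
  rint P (fun w => \1_D (y w) * k w).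
Proof.
move=> mD rk; apply: (rint_dom _ (rint_abs rk)).
  apply: measurable_funM; last exact: rint_meas rk.
  by apply: measurableT_comp my; exact: measurable_indic.
apply: aeW => w; rewrite indicE normrM ler_piMl//.
by case: (_ \in _); rewrite /= ?normr1 ?normr0.
Qed.

Lemma cond_exp_simple (h : {nnsfun T >-> R}) :
  [/\ rint P (fun w => h (y w) * f (y w)), rint P (fun w => h (y w) * g w),
      rint P (fun w => h (y w) ^+ 2) &
      RI P (fun w => h (y w) * f (y w)) = RI P (fun w => h (y w) * g w)].
Proof.
pose s : seq R := finmap.enum_fset (fset_set (range h)).
have hE t : h t = \sum_(x <- s) x * \1_(h @^-1` [set x]) t.
  by rewrite {1}fimfunE fsbig_finite.
have mD x : measurable (h @^-1` [set x]) by exact: measurable_sfunP.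
have E (k : W -> R) w : h (y w) * k w = \sum_(x <- s) x * (\1_(h @^-1` [set x]) (y w) * k w).
  by rewrite hE mulr_suml; apply: eq_bigr => x _; rewrite mulrA.
have r (k : W -> R) : rint P k -> rint P (fun w => h (y w) * k w).
  move=> rk; under eq_fun do rewrite E; apply: rint_sum => x; apply: rintZ.
  exact: rint_indicM.
have r1 : rint P (fun w => h (y w)) by have := r _ (rint_cst P 1); under eq_fun do rewrite mulr1.
split; [exact: r|exact: r|by under eq_fun do rewrite expr2; exact: r|].
rewrite (funext (E g)) [in LHS](funext (E (fun w => f (y w)))).
rewrite !RI_sum => [|x|x]; [|exact/rintZ/rint_indicM|exact/rintZ/rint_indicM].
apply: eq_bigr => x _; rewrite !RIZ; [|exact: rint_indicM|exact: rint_indicM].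
by rewrite cond_exp_indic.
Qed.

(** For a simple function h between 0 and the positive part of f, E h^2 <= E h f = E h g <= (E h^2 +
    E g^2) / 2, and E h^2 is finite, so E h^2 <= E g^2. Fatou's lemma along increasing simple
    approximations concludes. *)
Lemma cond_exp_pos_L2 : rint P (fun w => Num.max (f (y w)) 0 ^+ 2).
Proof.
pose fp t := Num.max (f t) 0.
have mfp : measurable_fun [set: T] (EFin \o fp).
  by apply/measurable_EFinP; exact: measurable_maxr.
have fp0 t : 0 <= fp t by rewrite /fp le_max lexx orbT.
pose h := nnsfun_approx measurableT mfp.
have hc t : h n t @[n --> \oo] --> fp t.
  have := @cvg_nnsfun_approx _ _ _ _ measurableT _ mfp (fun t _ => fp0 t) t I.
  by move=> /fine_cvg.
have hfp n t : h n t <= fp t.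
  rewrite -(cvg_lim _ (hc t))//; apply: (nondecreasing_cvgn_le (u_ := fun n => h n t)).
    by move=> a b ab; exact/lefP/nd_nnsfun_approx.
  by apply/cvg_ex; eexists; exact: hc.
have hm n : RI P (fun w => h n (y w) ^+ 2) <= RI P (fun w => g w ^+ 2).
  have [r1 r2 r3 e] := cond_exp_simple (h n).
  have h1 : RI P (fun w => h n (y w) ^+ 2) <= RI P (fun w => h n (y w) * f (y w)).
    apply: RI_le => //; apply: aeW => w; rewrite expr2.
    have h0 : 0 <= h n (y w) by []; have := hfp n (y w); rewrite /fp.
    have [f0 /(le_trans h0) hh|f0 hh] := leP (f (y w)) 0; last by rewrite ler_wpM2l.
    have -> : h n (y w) = 0; last by rewrite !mul0r.
    by apply/eqP; rewrite eq_le h0 andbT; have := hfp n (y w); rewrite /fp max_r.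
  have h2 : RI P (fun w => 2 * (h n (y w) * g w)) <=
      RI P (fun w => h n (y w) ^+ 2 + g w ^+ 2).
    apply: RI_le; [exact: rintZ|exact: rintD|apply: aeW => w; exact: ler_2M].
  by move: h2; rewrite RIZ// RID//; move: h1; rewrite e; lra.
have [] // := @fatou_le _ _ _ P (fun n w => h n (y w) ^+ 2) (fun w => fp (y w) ^+ 2)
  (fun=> RI P (fun w => g w ^+ 2)) (RI P (fun w => g w ^+ 2)).
- by move=> n; have [] := cond_exp_simple (h n).
- by move=> n w; exact: sqr_ge0.
- apply: measurable_funX; apply: measurableT_comp my; exact: measurable_maxr.
- by apply: aeW => w; rewrite expr2; under eq_fun do rewrite expr2; apply: cvgM; exact: hc.
exact: cvg_cst.
Qed.
End PositivePart.

Lemma cond_exp_L2 (g : W -> R) (f : T -> R) : measurable_fun [set: T] f ->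
  rint P (fun w => f (y w)) -> rint P g -> rint P (fun w => g w ^+ 2) ->
  (forall D, measurable D ->
    (\int[P]_(w in y @^-1` D) (f (y w))%:E = \int[P]_(w in y @^-1` D) (g w)%:E)%E) ->
  rint P (fun w => f (y w) ^+ 2).
Proof.
move=> mf rf rg rg2 hfg.
have rp := cond_exp_pos_L2 mf rf rg rg2 hfg.
have rm : rint P (fun w => Num.max (- f (y w)) 0 ^+ 2).
  apply: (@cond_exp_pos_L2 (fun w => - g w) (fun t => - f t)).
  - exact: measurableT_comp.
  - exact: rintN.
  - exact: rintN.
  - by under eq_fun do rewrite sqrrN.
  move=> D mD; have mD' : measurable (y @^-1` D) by rewrite -[X in measurable X]setTI; exact: my.
  under eq_integral do rewrite EFinN; rewrite integralN ?hfg//; last first.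
    have iD : P.-integrable (y @^-1` D) (fun w => (f (y w))%:E) := integrableS measurableT mD' (@subsetT _ _) rf.
    exact: (integrable_add_def mD' iD).
  under [in RHS]eq_integral do rewrite EFinN; rewrite integralN//.
  have iD : P.-integrable (y @^-1` D) (fun w => (g w)%:E) := integrableS measurableT mD' (@subsetT _ _) rg.
  exact: (integrable_add_def mD' iD).
have -> : (fun w => f (y w) ^+ 2) =
    fun w => Num.max (f (y w)) 0 ^+ 2 + Num.max (- f (y w)) 0 ^+ 2.
  apply/funext => w; case: (leP (f (y w)) 0); case: (leP (- f (y w)) 0) => a b;
    rewrite ?sqrrN ?expr0n ?addr0 ?add0r//; last lra.
  have -> : f (y w) = 0 by lra.
  by rewrite expr0n.
exact: rintD.
Qed.

End ConditionalExpectation.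

(** * Matrix measures and their Stieltjes transforms *)

Import HBNNSimple.
(** Integrals of simple functions see a set function on measurable sets only. [quad_measure] is a
    bare set function, and this allows it to be replaced by a genuine measure under the integral. *)
Lemma eq_integral_measurable {d} {T : measurableType d} {R : realType}
    (mu nu : set T -> \bar R) D f :
  (forall A, measurable A -> mu A = nu A) ->
  (\int[mu]_(x in D) f x = \int[nu]_(x in D) f x)%E.
Proof.
move=> h; rewrite /integral.
have E (k : T -> \bar R) : [set sintegral mu h | h in [set h : {nnsfun T >-> R} | forall x, ((h x)%:E <= k x)%E]] =
   [set sintegral nu h | h in [set h : {nnsfun T >-> R} | forall x, ((h x)%:E <= k x)%E]].
  apply: eq_imagel => g _; rewrite !sintegralET; apply: eq_fsbigr => x _.
  by rewrite h.
by rewrite !E.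
Qed.

Section FiniteCombination.
Context {R : realType} {d : measure_display} {T : measurableType d}.
Implicit Type mu : {finite_measure set T -> \bar R}.

Lemma rint_mscale (a : {nonneg R}) (mu : {measure set T -> \bar R}) f :
  rint mu f -> rint (mscale a mu) f /\ RI (mscale a mu) f = a%:num * RI mu f.
Proof.
move=> rf; have /integrableP[mf h] := rf; split.
  apply/integrableP; split => //.
  rewrite ge0_integral_mscale//; first by rewrite lte_mul_pinfty// ?lee_fin.
  exact: measurableT_comp.
rewrite /RI integralE [in RHS]integralE !ge0_integral_mscale//; last 2 first.
- exact: measurable_funeneg.
- exact: measurable_funepos.
have hp := integrable_pos_fin_num measurableT rf.
have hn := integrable_neg_fin_num measurableT rf.
rewrite -(fineK hp) -(fineK hn) /=; exact/esym/mulrBr.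
Qed.

(** Linearity of the integral in the measure, for nonnegative coefficients. Signed relations are
    reduced to it by moving the negative terms to the other side. *)
Lemma conic_measure (I : Type) (s : seq I) (nu : I -> {measure set T -> \bar R}) (a : I -> R) :
  (forall i, 0 <= a i) -> exists m : {measure set T -> \bar R},
    (forall A, m A = \sum_(i <- s) (a i)%:E * nu i A)%E /\
    forall f, measurable_fun [set: T] f -> (forall i, rint (nu i) f) -> rint m f /\ RI m f = \sum_(i <- s) a i * RI (nu i) f.
Proof.
move=> a0; elim: s => [|i s [m [mA mf]]].
  exists mzero; split => [A|f mm hf]; first by rewrite big_nil.
  rewrite big_nil /RI integral_measure_zero; split => //.
  apply/integrableP; split; first exact/measurable_EFinP.
  by rewrite integral_measure_zero.
exists (measure_add (mscale (NngNum (a0 i)) (nu i)) m); split => [A|f mf' hf].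
  by rewrite big_cons -mA; exact: measure_addE.
have [h1 h2] := mf f mf' hf; have [h3 h4] := rint_mscale (NngNum (a0 i)) (hf i).
have mm : measurable_fun setT (EFin \o f) by apply/measurable_EFinP; exact: rint_meas h1.
split.
  apply/integrableP; split => //.
  rewrite ge0_integral_measure_add//; last exact: measurableT_comp.
  by rewrite lte_add_pinfty//; [case/integrableP: h3|case/integrableP: h1].
rewrite /RI integral_measure_add// fineD ?big_cons -?h2; [|exact: integrable_fin_num h3|exact: integrable_fin_num h1].
by congr (_ + _).
Qed.
End FiniteCombination.

Lemma cvg_sumr {R : realType} (I : Type) (s : seq I) (F : I -> nat -> R) (l : I -> R) :
  (forall i, F i n @[n --> \oo] --> l i) ->
  \sum_(i <- s) F i n @[n --> \oo] --> \sum_(i <- s) l i.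
Proof.
move=> h; elim: s => [|i s IH].
  by rewrite big_nil (funext (fun n => big_nil _ _ _ _)); exact: cvg_cst.
rewrite big_cons (funext (fun n => big_cons _ _ _ _ _ _)); exact: cvgD.
Qed.

Section PsdMeasure.
Context {R : realType} {p : nat}.
Local Notation K := R[i].
Variable Omega : set R -> 'M[K]_p.
Hypothesis hO : psd_measure Omega.

Lemma cvg_normc (u : nat -> K) (l : K) : u n @[n --> \oo] --> (l : R[i]^o) ->
  Re (u n) @[n --> \oo] --> Re l.
Proof.
move=> /(@cvgrPdist_lt K R[i]^o) h; apply/cvgrPdist_lt => e e0.
have e0' : 0 < (e%:C : K) by rewrite ltcR.
have := h _ e0'; apply: filterS => n.
rewrite -[`|_|]/((nc (l - u n))%:C) ltcR; apply: le_lt_trans.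
by rewrite -ReB nc_Re.
Qed.

(** A measure has to be nonnegative on all sets, whereas [Omega] is known to be positive on
    measurable ones only; hence the value 0 elsewhere. *)
Definition qmeas (v : 'cV[K]_p) (A : set R) : \bar R :=
  if `[< measurable A >] then quad_measure Omega v A else 0%E.

Lemma qmeasE v A : measurable A -> qmeas v A = (qf (Omega A) v)%:E.
Proof. by move=> mA; rewrite /qmeas asboolT. Qed.

Lemma qmeas0 v : qmeas v set0 = 0%E.
Proof. by rewrite qmeasE//; have [-> _ _] := hO; rewrite /qf /hf mulmx0 mul0mx mxE. Qed.

Lemma qf_Omega_ge0 v A : measurable A -> 0 <= qf (Omega A) v.
Proof. by move=> mA; have [_ h _] := hO; have /psdE[] := h _ mA. Qed.

Lemma qmeas_ge0 v A : (0 <= qmeas v A)%E.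
Proof. by rewrite /qmeas; case: asboolP => // mA; rewrite lee_fin; exact: qf_Omega_ge0. Qed.

Lemma qmeas_sigma_additive v : semi_sigma_additive (qmeas v).
Proof.
move=> F mF tF mU; rewrite qmeasE//.
have E : (fun n => \sum_(0 <= i < n) qmeas v (F i))%E =
  (fun n => (\sum_(i < n) qf (Omega (F i)) v)%:E).
  by apply/funext => n; rewrite big_mkord -sumEFin; apply: eq_bigr => i _; rewrite qmeasE.
rewrite E; apply: cvg_EFin; first exact: nearW.
have -> : fine \o (fun n => (\sum_(i < n) qf (Omega (F i)) v)%:E) =
  (fun n => \sum_i \sum_j Re (Num.conj (v i 0) * v j 0 * \sum_(k < n) Omega (F k) i j)).
  apply/funext => n /=; rewrite /qf -Re_sum.
  rewrite (eq_bigr (fun k : 'I_n => \sum_i \sum_j Num.conj (v i 0) * Omega (F k) i j * v j 0)); last by move=> k _; rewrite hfE.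
  rewrite exchange_big /= Re_sum; apply: eq_bigr => i _.
  rewrite exchange_big /= Re_sum; apply: eq_bigr => j _.
  by congr (@complex.Re R); rewrite mulr_sumr; apply: eq_bigr => k _; ring.
have -> : qf (Omega (\bigcup_n F n)) v =
   \sum_i \sum_j Re (Num.conj (v i 0) * v j 0 * Omega (\bigcup_n F n) i j).
  rewrite /qf hfE Re_sum; apply: eq_bigr => i _; rewrite Re_sum; apply: eq_bigr => j _.
  by congr (@complex.Re R); ring.
apply: cvg_sumr => i; apply: cvg_sumr => j; apply: cvg_normc.
have [_ _ h] := hO.
exact: (cvgM (cvg_cst (Num.conj (v i 0) * v j 0 : R[i]^o)) (h F mF tF i j)).
Qed.

HB.instance Definition _ v := isMeasure.Build _ _ _ (qmeas v) (qmeas0 v) (qmeas_ge0 v) (@qmeas_sigma_additive v).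
Definition qmu v : {measure set R -> \bar R} := qmeas v.

Lemma qmuE v A : measurable A -> qmu v A = (qf (Omega A) v)%:E.
Proof. exact: qmeasE. Qed.

Lemma integralC_qmu v f : integralC (quad_measure Omega v) f = CI (qmu v) f.
Proof.
rewrite /integralC /CI /RI; congr (fine _ +i* fine _);
  by apply: eq_integral_measurable => A mA; rewrite qmuE.
Qed.

(** Separating the positive and negative coefficients turns the relation between set functions into
    the equality of two genuine measures, whose integrals then agree. *)
Lemma qmu_relation (I : Type) (s : seq I) (V : I -> 'cV[K]_p) (a : I -> R) (f : R -> R) :
  (forall A, measurable A -> \sum_(x <- s) a x * qf (Omega A) (V x) = 0) ->
  measurable_fun [set: R] f -> (forall x, rint (qmu (V x)) f) ->
  \sum_(x <- s) a x * RI (qmu (V x)) f = 0.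
Proof.
move=> h mf rf.
have [|m1 [h1 /(_ f mf rf)[_ e1]]] := @conic_measure R _ _ I s (fun x => qmu (V x)) (fun x => Num.max (a x) 0).
  by move=> x; rewrite le_max lexx orbT.
have [|m2 [h2 /(_ f mf rf)[_ e2]]] := @conic_measure R _ _ I s (fun x => qmu (V x)) (fun x => Num.max (- a x) 0).
  by move=> x; rewrite le_max lexx orbT.
have split x : a x = Num.max (a x) 0 - Num.max (- a x) 0.
  by case: (lerP (a x) 0) => ?; case: (lerP (- a x) 0) => ?; lra.
have E (g : I -> R) : \sum_(x <- s) a x * g x =
    \sum_(x <- s) Num.max (a x) 0 * g x - \sum_(x <- s) Num.max (- a x) 0 * g x.
  by rewrite -sumrB; apply: eq_bigr => x _; rewrite {1}split mulrBl.
rewrite E -e1 -e2; apply/eqP; rewrite subr_eq0; apply/eqP; congr fine.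
apply: eq_integral_measurable => A mA; rewrite h1 h2.
have F (g : I -> R) : (\sum_(x <- s) (g x)%:E * qmu (V x) A)%E = (\sum_(x <- s) g x * qf (Omega A) (V x))%:E.
  by rewrite -sumEFin; apply: eq_bigr => x _; rewrite qmuE.
rewrite !F; congr (_%:E); apply/eqP; rewrite -subr_eq0; apply/eqP.
by rewrite -E h.
Qed.

Lemma qmu_relationC (I : Type) (s : seq I) (V : I -> 'cV[K]_p) (a : I -> K) (f : R -> K) :
  (forall A, measurable A -> \sum_(x <- s) a x * hf (Omega A) (V x) (V x) = 0) ->
  (forall v, cint (qmu v) f) -> \sum_(x <- s) a x * CI (qmu (V x)) f = 0.
Proof.
move=> h cf.
have hE A x : measurable A -> hf (Omega A) (V x) (V x) = (qf (Omega A) (V x))%:C.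
  by move=> mA; apply: hf_herm; have [_ /(_ A mA)[]] := hO.
have key (g : R -> R) : (forall v, rint (qmu v) g) -> \sum_(x <- s) a x * (RI (qmu (V x)) g)%:C = 0.
  move=> rg; have mg := rint_meas (rg 0).
  apply: complex_ext.
    rewrite Re_sum -[RHS](@qmu_relation I s V (fun x => Re (a x)) g) //.
      by apply: eq_bigr => x _; rewrite mulrC ReZ mulrC.
    move=> A mA; transitivity (Re (0 : K)) => //; rewrite -(h A mA) Re_sum.
    by apply: eq_bigr => x _; rewrite hE// [in RHS]mulrC ReZ mulrC.
  rewrite Im_sum -[RHS](@qmu_relation I s V (fun x => Im (a x)) g) //.
    by apply: eq_bigr => x _; rewrite mulrC ImZ mulrC.
  move=> A mA; transitivity (Im (0 : K)) => //; rewrite -(h A mA) Im_sum.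
  by apply: eq_bigr => x _; rewrite hE// [in RHS]mulrC ImZ mulrC.
have k1 := key (fun x => Re (f x)) (fun v => (cf v).1).
have k2 := key (fun x => Im (f x)) (fun v => (cf v).2).
transitivity (\sum_(x <- s) a x * (RI (qmu (V x)) (fun x => Re (f x)))%:C +
   'i * \sum_(x <- s) a x * (RI (qmu (V x)) (fun x => Im (f x)))%:C); last first.
  by rewrite k1 k2 mulr0 addr0.
rewrite mulr_sumr -big_split; apply: eq_bigr => x _ /=.
by rewrite [CI _ _]complexE /CI mulrDr mulrCA.
Qed.

(** [integral_mx] involves only the measures of polarization vectors. The measure of v is a linear
    combination of these by polarization of [Omega A], and [qmu_relationC] carries this relation
    over to integrals; the index [None] stands for v itself. *)
Lemma hf_integral_mx f v : (forall u, cint (qmu u) f) ->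
  hf (integral_mx Omega f) v v = CI (qmu v) f.
Proof.
move=> cf; pose T := ('I_p * 'I_p * 'I_4)%type.
pose V (x : option T) := if x is Some (i, j, k) then polv i j k else v.
pose a (x : option T) : K := if x is Some (i, j, k) then
   Num.conj (v i 0) * v j 0 * (4^-1 * (- 'i) ^+ k) else -1.
have E (g : 'cV[K]_p -> K) (A : 'M[K]_p) :
   (forall i j, A i j = 4^-1 * \sum_(k < 4) (- 'i) ^+ k * g (polv i j k)) ->
   \sum_(x <- None :: map Some (index_enum T)) a x * g (V x) = hf A v v - g v.
  move=> hA; rewrite big_cons big_map /= mulN1r addrC; congr (_ - _).
  rewrite hfE pair_bigA /=.
  rewrite (eq_bigr (fun q : 'I_p * 'I_p => \sum_(k < 4) a (Some (q.1, q.2, k)) * g (polv q.1 q.2 k))).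
    by rewrite pair_bigA; apply: eq_bigr => -[[i j] k] _.
  move=> [i j] _ /=; rewrite hA !mulr_sumr mulr_suml; apply: eq_bigr => k _.
  by ring.
have := @qmu_relationC (option T) (None :: map Some (index_enum T)) V a f _ cf.
rewrite (E (fun u => CI (qmu u) f) (integral_mx Omega f)); last first.
  move=> i j; rewrite mxE; congr (_ * _); apply: eq_bigr => k _; rewrite integralC_qmu.
  by [].
move=> H; apply/eqP; rewrite -subr_eq0; apply/eqP; apply: H => A mA.
rewrite (E (fun u => hf (Omega A) u u) (Omega A)) ?subrr// => i j.
by rewrite polarization.
Qed.
End PsdMeasure.

Lemma CIB {R : realType} {d : measure_display} {T : measurableType d}
    (m : {measure set T -> \bar R}) (f g : T -> R[i]) : cint m f -> cint m g ->
  CI m (fun x => f x - g x) = CI m f - CI m g.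
Proof.
move=> cf cg; rewrite (_ : (fun x => _) = fun x => f x + -1 * g x); last first.
  by apply/funext => x; rewrite mulN1r.
by rewrite CID ?CIZ ?mulN1r//; exact: cintZ.
Qed.

Lemma nc_CI {R : realType} {d : measure_display} {T : measurableType d}
    (m : {measure set T -> \bar R}) (f : T -> R[i]) : cint m f ->
  nc (CI m f) <= RI m (fun x => nc (f x)).
Proof.
move=> cf; set X := CI m f.
have [X0|Xp] := leP (nc X) 0.
  by apply: le_trans X0 _; apply: RI_ge0; [exact: cint_nc|apply: aeW => x; exact: nc_ge0].
(* Multiplication by the conjugate of the integral rotates it onto the real axis, where the
   inequality for real integrands applies. *)
have h : nc X ^+ 2 <= nc X * RI m (fun x => nc (f x)).
  have -> : nc X ^+ 2 = Re (Num.conj X * X) by rewrite mulcJ.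
  rewrite {2}/X -CIZ// -RIZ; last exact: cint_nc.
  apply: RI_le; first exact: (cintZ _ cf).1.
    by apply: rintZ; exact: cint_nc.
  apply: aeW => x; rewrite -[in leRHS](ncJ X) -ncM.
  exact: le_trans (ler_norm _) (nc_Re _).
by rewrite expr2 ler_pM2l in h.
Qed.

(** * Stieltjes transforms and estimates of mass *)

Section Stieltjes.
Context {R : realType} {p : nat}.
Local Notation K := R[i].
Variable Omega : set R -> 'M[K]_p.
Hypothesis hO : psd_measure Omega.
Hypothesis hO1 : Omega setT = 1%:M.
Local Notation mu := (qmu hO).
Local Notation S := (stieltjes Omega).

Lemma qmu_setT v : mu v setT = (sq v)%:E.
Proof. by rewrite qmuE// hO1 qf1. Qed.

Lemma rint_qmu_cst v (a : R) : rint (mu v) (fun=> a).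
Proof.
apply/integrableP; split; first exact: measurable_cst.
by rewrite integral_cst//= qmu_setT ltry.
Qed.

Lemma RI_qmu_cst v (a : R) : RI (mu v) (fun=> a) = a * sq v.
Proof. by rewrite /RI integral_cst// qmu_setT. Qed.

Lemma rint_qmu_bounded v (f : R -> R) c : measurable_fun [set: R] f ->
  {ae mu v, forall l, `|f l| <= c} -> rint (mu v) f.
Proof. by move=> mf; apply: rint_dom => //; exact: rint_qmu_cst. Qed.

(** Treats at once points of the upper half-plane, with g the imaginary part, and real points to the
    right of the support, with g the spectral gap. *)
Definition away (z : K) (g : R) :=
  0 < g /\ forall v, {ae mu v, forall l : R, g <= nc (l%:C - z)}.

Lemma away_im z : 0 < Im z -> away z (Im z).
Proof.
move=> z0; split=> // v; apply: aeW => l.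
rewrite (le_trans _ (nc_Im _))// ImB /= sub0r normrN; exact: ler_norm.
Qed.

Definition ker2 (z : K) (l : R) : R := (nc (l%:C - z) ^+ 2)^-1.
(** This is v^* Im S(z) v / Im z in the upper half-plane ([Im_stieltjes]), and it keeps a meaning on
    the real axis, where it is the form of K. *)
Definition Kq z v : R := RI (mu v) (ker2 z).

Lemma cmeas_res z : cmeas (fun l : R => l%:C - z).
Proof.
by apply: (cmeasD (f := fun l : R => l%:C)); [split => /=|exact: cmeas_cst].
Qed.
Lemma measurable_ker2 z : measurable_fun [set: R] (ker2 z).
Proof.
have -> : ker2 z = fun l => nc ((l%:C - z)^-1) ^+ 2.
  by apply/funext => l; rewrite ncV exprVn.
by apply: measurable_nc2; apply: cmeasV; exact: cmeas_res.
Qed.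
Lemma ker2_ge0 z l : 0 <= ker2 z l.
Proof. by rewrite invr_ge0 sqr_ge0. Qed.

Section Away.
Variables (z : K) (g : R).
Hypothesis zg : away z g.

Lemma nc_res v : {ae mu v, forall l, nc ((l%:C - z)^-1) <= g^-1}.
Proof.
have [g0 h] := zg; apply: filterS (h v) => l hl.
by rewrite ncV lef_pV2 ?posrE// (lt_le_trans g0).
Qed.

Lemma ker2_le v : {ae mu v, forall l, `|ker2 z l| <= (g ^+ 2)^-1}.
Proof.
apply: filterS (nc_res v) => l; rewrite ger0_norm ?ker2_ge0// /ker2 -!exprVn -ncV => h.
by rewrite ler_pXn2r// ?nnegrE ?nc_ge0// invr_ge0 ltW//; have [] := zg.
Qed.

Lemma cint_res v : cint (mu v) (fun l : R => (l%:C - z)^-1).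
Proof.
apply: (cint_dom _ (rint_qmu_cst v g^-1)); last exact: nc_res.
by apply: cmeasV; exact: cmeas_res.
Qed.

Lemma rint_ker2 v : rint (mu v) (ker2 z).
Proof. by apply: rint_qmu_bounded; [exact: measurable_ker2|exact: ker2_le]. Qed.

Lemma hf_stieltjes v : hf (S z) v v = CI (mu v) (fun l => (l%:C - z)^-1).
Proof. by apply: hf_integral_mx => u; exact: cint_res. Qed.

Lemma Kq_ge0 v : 0 <= Kq z v.
Proof. by apply: RI_ge0; [exact: rint_ker2|apply: aeW => l; exact: ker2_ge0]. Qed.

Lemma Kq_le v : Kq z v <= (g ^+ 2)^-1 * sq v.
Proof.
rewrite -RI_qmu_cst; apply: RI_le; [exact: rint_ker2|exact: rint_qmu_cst|].
by apply: filterS (ker2_le v) => l; exact: le_trans (ler_norm _).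
Qed.

Lemma Kq_gt0 v : v != 0 -> 0 < Kq z v.
Proof.
move=> v0; rewrite lt_neqAle Kq_ge0 andbT; apply/eqP => h.
have H := RI_eq0 (rint_ker2 v) (ker2_ge0 z).
have {}H : {ae mu v, forall l, ker2 z l = 0} by apply: H; rewrite -/(Kq z v) -h.
have [g0 hg] := zg.
have F : {ae mu v, forall l : R, False}.
  apply: filterS2 H (hg v) => l; rewrite /ker2 => /eqP.
  rewrite invr_eq0 sqrf_eq0 => /eqP ->; by rewrite leNgt g0.
case: F => A [mA A0 hA].
have AT : A = setT by apply/seteqP; split=> // x _; apply: hA => /= -[].
move: A0; rewrite AT qmu_setT => -[/eqP]; by rewrite gt_eqF// sq_gt0.
Qed.

Lemma Im_stieltjes v : Im (hf (S z) v v) = Im z * Kq z v.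
Proof.
rewrite hf_stieltjes /CI /Kq -RIZ; last exact: rint_ker2.
congr (RI _ _); apply/funext => l /=.
case: z => a b; rewrite /ker2 nc_sqr ReB ImB /=.
by rewrite sub0r sqrrN mulNr opprK.
Qed.

Definition Kmx : 'M[K]_p := integral_mx Omega (fun l => (ker2 z l)%:C).
Lemma hf_Kmx v : hf Kmx v v = (Kq z v)%:C.
Proof.
rewrite hf_integral_mx /CI /Kq => [|u].
  by rewrite RI0.
by split; [exact: rint_ker2|exact: rint0].
Qed.
Lemma qf_Kmx v : qf Kmx v = Kq z v. Proof. by rewrite /qf hf_Kmx. Qed.
Lemma pd_Kmx : pd Kmx.
Proof.
split=> [|v v0]; last by rewrite qf_Kmx Kq_gt0.
by apply: hf_inj => v; rewrite -hfJ hf_Kmx conj_realC.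
Qed.

End Away.

(** The difference of the two kernels is (z - w) times their product, and the arithmetic-geometric
    mean inequality bounds the product by the two squares. The estimate depends on [Kq] at the
    endpoints only, not on their heights. *)
Lemma hf_stieltjes_sub z w g g' s v : away z g -> away w g' -> 0 < s ->
  nc (hf (S z - S w) v v) <= nc (z - w) * ((s * Kq z v + s^-1 * Kq w v) / 2).
Proof.
move=> zg wg s0.
have E : CI (mu v) (fun l => (l%:C - z)^-1) - CI (mu v) (fun l => (l%:C - w)^-1) =
  CI (mu v) (fun l => (z - w) * ((l%:C - z)^-1 * (l%:C - w)^-1)).
  rewrite -CIB; [|exact: cint_res zg v|exact: cint_res wg v].
  have cz := cmeasV (cmeas_res z); have cw := cmeasV (cmeas_res w).
  apply: CI_eq.
  - by apply: cmeasD => //; exact: cmeasN.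
  - by apply: cmeasM; [exact: cmeas_cst|exact: cmeasM].
  have [g0 hz] := zg; have [g0' hw] := wg.
  apply: filterS2 (hz v) (hw v) => l h1 h2.
  have n1 : l%:C - z != 0 by apply/eqP => e; move: h1; rewrite e nc0 leNgt g0.
  have n2 : l%:C - w != 0 by apply/eqP => e; move: h2; rewrite e nc0 leNgt g0'.
  move: (l%:C) n1 n2 => u n1 n2; by field; rewrite n1 n2.
rewrite hfB (hf_stieltjes zg) (hf_stieltjes wg) E.
have rz := rint_ker2 zg v; have rw := rint_ker2 wg v.
have bd l : nc ((l%:C - z)^-1 * (l%:C - w)^-1) <= (s * ker2 z l + s^-1 * ker2 w l) / 2.
  rewrite ncM !ncV /ker2 -!exprVn.
  move: (nc _)^-1 (nc _)^-1 => B A; have h := ler_2M (s * A) B.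
  rewrite ler_pdivlMr// -(ler_pM2l s0).
  have -> : s * (s * A ^+ 2 + s^-1 * B ^+ 2) = (s * A) ^+ 2 + B ^+ 2 by field; rewrite gt_eqF.
  by lra.
have cp : cint (mu v) (fun l => (l%:C - z)^-1 * (l%:C - w)^-1).
  apply: (cint_dom (g := fun l => (s * ker2 z l + s^-1 * ker2 w l) / 2)).
  - by apply: cmeasM; apply: cmeasV; exact: cmeas_res.
  - rewrite (_ : (fun l => _) = fun l => 2^-1 * (s * ker2 z l + s^-1 * ker2 w l)); last by apply/funext => l; rewrite mulrC.
    by apply: rintZ; apply: rintD; exact: rintZ.
  - exact: aeW.
rewrite CIZ// ncM; apply: ler_wpM2l; first exact: nc_ge0.
apply: le_trans (nc_CI cp) _.
rewrite /Kq -RIZ// -(RIZ _ rw) -RID; [|exact: rintZ..].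
rewrite mulrC -RIZ; last by apply: rintD; exact: rintZ.
apply: RI_le; first exact: cint_nc.
- by apply: rintZ; apply: rintD; exact: rintZ.
- by apply: aeW => l; rewrite [leRHS]mulrC; exact: bd.
Qed.

Lemma nm_stieltjes_sub z w g g' c : away z g -> away w g' ->
  (forall v, Kq z v <= c * sq v) -> (forall v, Kq w v <= c * sq v) ->
  nm (S z - S w) <= 4 * p%:R ^+ 2 * (nc (z - w) * c).
Proof.
move=> zg wg hz hw; apply: nm_numrange => v.
apply: le_trans (hf_stieltjes_sub v zg wg ltr01) _.
rewrite -mulrA; apply: ler_wpM2l; first exact: nc_ge0.
rewrite invr1 !mul1r ler_pdivrMr//; have := hz v; have := hw v; lra.
Qed.

(** On the interval of radius h around a, the kernel [ker2] at a + i h is at least 1 / (2 h^2). *)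
Lemma qmu_itv_small (a h C : R) v : 0 < h -> (forall v, Kq (a +i* h) v <= C * sq v) ->
  (mu v `[(a - h)%R, (a + h)%R]%classic <= (2 * h ^+ 2 * C * sq v)%:E)%E.
Proof.
move=> h0 hC.
have zg : away (a +i* h) h by exact: (away_im (z := a +i* h)).
have mA : measurable (`[a - h, a + h]%classic : set R) by exact: measurable_itv.
have := hC v; rewrite -(ler_pM2l (_ : 0 < 2 * h ^+ 2)); last by rewrite mulr_gt0 ?exprn_gt0.
rewrite -(mulrA _ C) => H.
apply: (@le_trans _ _ (2 * h ^+ 2 * Kq (a +i* h) v)%:E); last by rewrite lee_fin.
rewrite /Kq -RIZ; last exact: rint_ker2 zg v.
have rk := rintZ (2 * h ^+ 2) (rint_ker2 zg v).
rewrite -(RIE rk) -[X in mu v X]setIT -(integral_indic _ measurableT mA).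
apply: ge0_le_integral => //.
- by apply/measurable_EFinP; exact: measurable_indic.
- by apply/measurable_EFinP; exact: rint_meas rk.
move=> l _; rewrite lee_fin indicE; case: (boolP (l \in _)) => [|_]; last first.
  by rewrite mulr_ge0 ?ker2_ge0// mulr_ge0 ?sqr_ge0.
rewrite inE /= in_itv /= => /andP[h1 h2].
rewrite /ker2 nc_sqr ReB ImB /= sub0r sqrrN ler_pdivlMr ?mul1r.
  have : (l - a) ^+ 2 <= h ^+ 2 by rewrite -ler_sqrt ?sqr_ge0// !sqrtr_sqr (ger0_norm (ltW h0)) ler_norml; apply/andP; split; lra.
  lra.
by rewrite ltr_wpDl ?sqr_ge0// exprn_gt0.
Qed.

(** A bound on Im S / Im z makes intervals of radius h carry mass of order h^2. About 1 / h of them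
    cover the interval, so its mass is of order h for every small h. *)
Lemma qmu_no_mass (a b etab C : R) : 0 < etab -> a < b ->
  (forall x eta, a < x < b -> 0 < eta < etab -> forall v, Kq (x +i* eta) v <= C * sq v) ->
  forall v, mu v `]a, b[%classic = 0%E.
Proof.
move=> e0 ab hC v; apply/eqP; rewrite eq_le measure_ge0 andbT.
have C0 : 0 <= C * sq v.
  apply: le_trans (hC ((a + b) / 2) (etab / 2) _ _ v); last 2 first.
  - by apply/andP; split; lra.
  - by apply/andP; split; lra.
  by apply: (@Kq_ge0 _ _); exact: (away_im (z := _ +i* _)) (divr_gt0 e0 _).
apply/lee_addgt0Pr => e egt0; rewrite add0e.
(* The first summand ensures h < [etab], so that the hypothesis applies at height h; the second
   makes the total mass 2 (b - a) h C |v|^2 at most e. *)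
pose X := (b - a) / etab + 2 * (b - a) ^+ 2 * (C * sq v) / e.
pose n := (Num.truncn X).+1.
have X0 : 0 <= X.
  apply: addr_ge0; first by rewrite divr_ge0; lra.
  by rewrite divr_ge0 ?(ltW egt0)// mulr_ge0// mulr_ge0 ?sqr_ge0.
have Xn : X < n%:R by have /andP[] := truncn_itv X0.
have n0 : 0 < n%:R :> R by rewrite ltr0n.
pose h := (b - a) / n%:R.
have h0 : 0 < h by rewrite divr_gt0// subr_gt0.
have he : h < etab.
  rewrite /h ltr_pdivrMr// mulrC -ltr_pdivrMr//; apply: le_lt_trans Xn.
  by rewrite lerDl divr_ge0 ?(ltW egt0)// mulr_ge0// mulr_ge0 ?sqr_ge0.
have nh : n%:R * h = b - a by rewrite /h mulrC divfK// gt_eqF.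
pose x (k : nat) := a + (k%:R + 2^-1) * h.
have sub : `]a, b[%classic `<=` \big[setU/set0]_(k < n) `[x k - h, x k + h]%classic.
  move=> l /=; rewrite in_itv /= => /andP[al lb].
  have la0 : 0 <= (l - a) / h by rewrite divr_ge0 ?(ltW h0)// subr_ge0 ltW.
  have /andP[k1 k2] := truncn_itv la0; set k := Num.truncn _ in k1 k2.
  rewrite ler_pdivlMr// in k1; rewrite ltr_pdivrMr// in k2.
  have kn : (k < n)%N.
    rewrite -(ltr_nat R); apply: le_lt_trans (_ : (l - a) / h < _); first by rewrite ler_pdivlMr.
    by rewrite ltr_pdivrMr// nh; lra.
  rewrite -(bigcup_mkord n (fun k => `[x k - h, x k + h]%classic)); exists k => //=; rewrite in_itv /= /x.
  rewrite -natr1 in k2; by apply/andP; split; nra.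
have : (mu v `]a, b[%classic <= \sum_(k < n) mu v `[(x k - h)%R, (x k + h)%R]%classic)%E.
  apply: le_trans (le_measure _ _ _ sub) _.
  - by rewrite inE; exact: measurable_itv.
  - by rewrite inE; apply: bigsetU_measurable => k _; exact: measurable_itv.
  - exact: (Boole_inequality (mu v) (A := fun k => `[x k - h, x k + h]%classic)).
move=> H; apply: le_trans H _.
apply: (@le_trans _ _ (\sum_(k < n) (2 * h ^+ 2 * C * sq v)%:E)%E).
  apply: lee_sum => k _; apply: qmu_itv_small => // u; apply: hC.
    rewrite /x; have : (k%:R + 1 <= n%:R :> R) by rewrite natr1 ler_nat.
    have : 0 <= k%:R :> R by [].
    by move=> k1 k2; apply/andP; split; nra.
  by rewrite h0.
rewrite sumEFin lee_fin sumr_const card_ord -[leLHS]mulr_natl.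
have -> : n%:R * (2 * h ^+ 2 * C * sq v) = 2 * (b - a) * h * (C * sq v) by rewrite -nh; ring.
have hX : 2 * (b - a) ^+ 2 * (C * sq v) / e <= n%:R.
  by apply: le_trans (ltW Xn); rewrite lerDr divr_ge0; lra.
rewrite ler_pdivrMr// in hX.
rewrite -(ler_pM2l n0); apply: le_trans hX.
by rewrite le_eqVlt; apply/orP; left; apply/eqP; rewrite -nh; ring.
Qed.
End Stieltjes.

(** * Limits of matrices through their quadratic forms *)

Section MatrixLimits.
Context {R : realType}.
Local Notation K := R[i].

Lemma cvg_squeeze0 (f g : nat -> R) l : (forall n, `|f n - l| <= g n) ->
  g n @[n --> \oo] --> 0 -> f n @[n --> \oo] --> l.
Proof.
move=> h /cvgrPdist_lt hg; apply/cvgrPdist_lt => e e0.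
apply: filterS (hg e e0) => n; rewrite sub0r normrN => hn.
by rewrite distrC (le_lt_trans (h n))// (le_lt_trans _ hn)// ler_norm.
Qed.

Lemma cvg_dist0 (f : nat -> R) l : f n @[n --> \oo] --> l ->
  `|f n - l| @[n --> \oo] --> (0 : R).
Proof.
move=> h; rewrite -(normr0 R) -(subrr l); apply: cvg_norm.
by apply: cvgB => //; exact: cvg_cst.
Qed.

Lemma cvg_ge_lim (f : nat -> R) l c : (forall n, c <= f n) -> f n @[n --> \oo] --> l -> c <= l.
Proof.
move=> h hf; rewrite -(cvg_lim _ hf)//; apply: limr_ge; first by apply/cvg_ex; exists l.
exact: nearW.
Qed.

Lemma cvg_le_lim (f : nat -> R) l c : (forall n, f n <= c) -> f n @[n --> \oo] --> l -> l <= c.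
Proof.
move=> h hf; rewrite -(cvg_lim _ hf)//; apply: limr_le; first by apply/cvg_ex; exists l.
exact: nearW.
Qed.

Lemma cvg0_sum (I : Type) (s : seq I) (F : I -> nat -> R) :
  (forall i, F i n @[n --> \oo] --> (0 : R)) ->
  \sum_(i <- s) F i n @[n --> \oo] --> (0 : R).
Proof.
by move=> h; have := cvg_sumr (s := s) h; rewrite big1.
Qed.

Lemma nm_polv n (A : 'M[K]_n) (l : 'cV[K]_n -> R) :
  nm (A - \matrix_(i, j) (4^-1 * \sum_(k < 4) (- 'i) ^+ k * (l (polv i j k))%:C)) <=
  \sum_i \sum_j \sum_(k < 4) nc (hf A (polv i j k) (polv i j k) - (l (polv i j k))%:C).
Proof.
apply: ler_sum => i _; apply: ler_sum => j _.
rewrite !mxE {1}(polarization A i j) -mulrBr -sumrB ncM.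
apply: (@le_trans _ _ (1 * nc (\sum_(k < 4) ((- 'i) ^+ k * hf A (polv i j k) (polv i j k) - (- 'i) ^+ k * (l (polv i j k))%:C)))).
  apply: ler_wpM2r; first exact: nc_ge0.
  have -> : (4^-1 : K) = (4^-1)%:C by rewrite fmorphV rmorph_nat.
  by rewrite nc_real ger0_norm// invf_le1//; lra.
rewrite mul1r; apply: le_trans (nc_sum _ _ _) _; apply: ler_sum => k _.
by rewrite -mulrBr ncM -conj_iX ncJ nc_iX mul1r.
Qed.

Lemma cvg_nm0 n (A : nat -> 'M[K]_n) :
  (forall v, nc (hf (A k) v v) @[k --> \oo] --> (0 : R)) -> nm (A k) @[k --> \oo] --> (0 : R).
Proof.
move=> h; apply: (cvg_squeeze0 (g := fun m => \sum_i \sum_j \sum_(k < 4) nc (hf (A m) (polv i j k) (polv i j k)))) => [m|].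
  rewrite subr0 ger0_norm ?nm_ge0//.
  have := nm_polv (A m) (fun=> 0).
  rewrite (_ : \matrix_(_, _) _ = 0) ?subr0 => [H|].
    apply: le_trans H _; apply: ler_sum => i _; apply: ler_sum => j _; apply: ler_sum => k _.
    by rewrite subr0.
  by apply/matrixP => i j; rewrite !mxE big1 ?mulr0// => k _; rewrite mulr0.
by apply: cvg0_sum => i; apply: cvg0_sum => j; apply: cvg0_sum => k; exact: h.
Qed.

Lemma cvg_nm_eq n m (A : nat -> 'M[K]_(n, m)) B C :
  nm (A k - B) @[k --> \oo] --> (0 : R) -> nm (A k - C) @[k --> \oo] --> (0 : R) -> B = C.
Proof.
move=> h1 h2; apply/eqP; rewrite -subr_eq0; apply/eqP; apply: nm_eq0.
have : nm (A k - B) + nm (A k - C) @[k --> \oo] --> (0 + 0 : R) by exact: cvgD.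
rewrite addr0; apply: cvg_ge_lim => k.
have -> : B - C = (A k - C) - (A k - B) by rewrite opprB [RHS]addrC addrA addrNK.
by apply: le_trans (nmB _ _) _; rewrite addrC.
Qed.

Lemma cvg_qf n (A : nat -> 'M[K]_n) B v : nm (A k - B) @[k --> \oo] --> (0 : R) ->
  qf (A k) v @[k --> \oo] --> qf B v.
Proof.
move=> h; apply: (cvg_squeeze0 (g := fun k => n%:R * sq v * nm (A k - B))) => [k|].
  by rewrite -qfB; apply: le_trans (qf_le _ _) _; rewrite mulrAC.
rewrite -[X in _ --> X](mulr0 (n%:R * sq v)); exact: cvgM (cvg_cst _) h.
Qed.

(** Pointwise convergence of the quadratic forms suffices, because finitely many vectors determine
    the entries; the limit matrix is written down by polarization. *)
Lemma herm_limit n (A : nat -> 'M[K]_n) (l : 'cV[K]_n -> R) : (forall k, (A k)^t* = A k) ->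
  (forall v, qf (A k) v @[k --> \oo] --> l v) ->
  exists B : 'M[K]_n, [/\ B^t* = B, nm (A k - B) @[k --> \oo] --> (0 : R) & forall v, qf B v = l v].
Proof.
move=> hA hc.
pose B : 'M[K]_n := \matrix_(i, j) (4^-1 * \sum_(k < 4) (- 'i) ^+ k * (l (polv i j k))%:C).
have hB : nm (A k - B) @[k --> \oo] --> (0 : R).
  apply: (cvg_squeeze0 (g := fun m => \sum_i \sum_j \sum_(k < 4) nc (hf (A m) (polv i j k) (polv i j k) - (l (polv i j k))%:C))) => [m|].
    by rewrite subr0 ger0_norm ?nm_ge0//; exact: nm_polv.
  apply: cvg0_sum => i; apply: cvg0_sum => j; apply: cvg0_sum => k.
  have := cvg_dist0 (hc (polv i j k)).
  rewrite (_ : (fun n0 => `|_|) = (fun m => nc (hf (A m) (polv i j k) (polv i j k) - (l (polv i j k))%:C)))//.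
  by apply/funext => m; rewrite hf_herm// -raddfB nc_real.
exists B; split => //.
  apply: (cvg_nm_eq _ hB).
  have -> : (fun k => nm (A k - B^t*)) = (fun k => nm (A k - B)); last exact: hB.
  by apply/funext => k; rewrite -{1}hA -trmxCB nm_trmxC.
by move=> v; rewrite -(cvg_lim _ (cvg_qf (v := v) hB))// (cvg_lim _ (hc v)).
Qed.
End MatrixLimits.

Lemma ereal_between {R : realType} (l : \bar R) (x : R) : (l < x%:E)%E ->
  exists y, (l <= y%:E)%E /\ y < x.
Proof.
case: l => [l||]//=.
- by rewrite lte_fin => h; exists ((l + x) / 2)%R; rewrite lee_fin; split; lra.
- by move=> _; exists (x - 1)%R; split; [exact: leNye|rewrite ltrBlDr ltrDl].
Qed.

(** * The support and its right edge *)

Section Support.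
Context {R : realType} {p : nat}.
Local Notation K := R[i].
Variable Omega : set R -> 'M[K]_p.
Hypothesis hO : psd_measure Omega.
Hypothesis hO1 : Omega setT = 1%:M.
Hypothesis p0 : (0 < p)%N.
Local Notation mu := (qmu hO).
Local Notation S := (stieltjes Omega).

Lemma trace_measureE U : trace_measure Omega U =
  (p%:R^-1 * \sum_i qf (Omega U) (delta_mx i 0))%:E.
Proof.
rewrite /trace_measure /mxtrace Re_sum; congr (_ * _)%:E; apply: eq_bigr => i _.
by rewrite /qf hf_delta.
Qed.

(** A positive matrix with zero trace annihilates every basis vector, hence vanishes. This links the
    scalar measure defining the support to all the measures [qmu]. *)
Lemma trace_measure_null U : measurable U ->
  (trace_measure Omega U <= 0)%E <-> (forall v, mu v U = 0%E).
Proof.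
move=> mU; rewrite trace_measureE lee_fin; split; last first.
  move=> h; rewrite big1 ?mulr0// => i _.
  by have := h (delta_mx i 0); rewrite qmuE// => -[].
rewrite pmulr_rle0 ?invr_gt0 ?ltr0n// => h v.
have [_ /(_ U mU) psdU _] := hO; have /psdE[hU q0] := psdU.
have z i : Omega U *m (delta_mx i 0 : 'cV_p) = 0.
  apply: psd_kernel => //; apply: le_trans h; rewrite (bigD1 i)//= lerDl.
  by apply: sumr_ge0.
have -> : mu v U = (qf (Omega U) v)%:E by rewrite qmuE.
have -> : Omega U = 0 by apply/matrixP => i j; have /matrixP/(_ i 0) := z j; rewrite -colE !mxE.
by rewrite /qf /hf mulmx0 mul0mx mxE.
Qed.

Lemma supp_null U x : open U -> U x -> (forall v, mu v U = 0%E) ->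
  ~ supp (trace_measure Omega) x.
Proof.
move=> oU Ux h /(_ U oU Ux); rewrite ltNge => /negP; apply.
by apply/(trace_measure_null (open_measurable oU)).
Qed.

Lemma nsupp_null x : ~ supp (trace_measure Omega) x ->
  exists a b : rat, (x \in `]ratr a, (ratr b : R)[) /\ forall v, mu v `]ratr a, (ratr b : R)[%classic = 0%E.
Proof.
move=> /existsNP[U /not_implyP[oU /not_implyP[Ux /negP]]]; rewrite -leNgt => h.
have mU := open_measurable oU; have h0 := (trace_measure_null mU).1 h.
have [e /= e0 he] := (nbhs_ballP _ _).1 (open_nbhs_nbhs (conj oU Ux)).
have [a] : exists a : rat, ratr a \in `](x - e)%R, x[ by apply: rat_in_itvoo; rewrite ltrBlDr ltrDl.
have [b] : exists b : rat, ratr b \in `]x, (x + e)%R[ by apply: rat_in_itvoo; rewrite ltrDl.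
rewrite !in_itv /= => /andP[b1 b2] /andP[a1 a2].
exists a, b; split; first by rewrite in_itv /= a2 b1.
move=> v; rewrite -[qmeas _ _ _]/(mu v _); apply/eqP; rewrite eq_le measure_ge0 andbT -(h0 v).
apply: le_measure; rewrite ?inE//.
move=> l /=; rewrite in_itv /= => /andP[l1 l2]; apply: he; rewrite /ball/=.
by rewrite ltr_distlC; apply/andP; split; lra.
Qed.

(** Each point beyond the support has a null neighbourhood with rational endpoints, and only
    countably many such intervals exist. *)
Lemma lambda_plus_null x : (lambda_plus Omega <= x%:E)%E ->
  forall v, mu v `]x, +oo[%classic = 0%E.
Proof.
move=> hx v.
(* Enumerates the rational intervals through their codes; intervals of positive mass and invalid
   codes are replaced by the empty set. *)
pose J (n : nat) : set R := if unpickle n is Some (a, b) then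
   let U := `](ratr a : R), ratr (b : rat)[%classic in if mu v U == 0%E then U else set0 else set0.
have mJ n : measurable (J n).
  by rewrite /J; case: unpickle => // -[a b]; case: ifP => // _; exact: measurable_itv.
have J0 n : mu v (J n) = 0%E.
  by rewrite /J; case: unpickle => [[a b]|]; [case: ifP => [/eqP//|_]|]; rewrite measure0.
have mU : measurable (\bigcup_n J n) by exact: bigcup_measurable.
have U0 : mu v (\bigcup_n J n) = 0%E.
  apply/eqP; rewrite eq_le measure_ge0 andbT.
  apply: le_trans (measure_sigma_subadditive _ mJ mU (@subset_refl _ _)) _.
  by rewrite eseries0.
apply/eqP; rewrite eq_le measure_ge0 andbT -U0; apply: le_measure; rewrite ?inE//.
move=> l /=; rewrite in_itv /= andbT => xl.
have [|a [b [lab h]]] := @nsupp_null l.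
  move=> sl; have : (l%:E <= x%:E)%E by apply: le_trans hx; apply: ereal_sup_ubound; exists l.
  by rewrite lee_fin leNgt xl.
exists (pickle (a, b)); first exact: Logic.I.
rewrite /J pickleK h eqxx; exact: lab.
Qed.

Lemma null_lambda_plus x : (forall v, mu v `]x, +oo[%classic = 0%E) -> (lambda_plus Omega <= x%:E)%E.
Proof.
move=> h; apply: ge_ereal_sup => _ [l sl <-]; rewrite lee_fin leNgt; apply/negP => xl.
apply: (@supp_null `]x, +oo[%classic l _ _ h sl); last by rewrite /= in_itv /= xl.
exact: interval_open.
Qed.

(* A spectral gap of width [g] to the left of [x], on which the kernel (l - x)^-1 is
   bounded. *)
Definition below (x g : R) := 0 < g /\ forall v, {ae mu v, forall l, l <= x - g}.

Lemma below_lambda x : (lambda_plus Omega < x%:E)%E -> exists g, below x g.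
Proof.
move=> /ereal_between[y [hy yx]].
exists (x - y); split; first by rewrite subr_gt0.
move=> v; exists `]y, +oo[%classic; split; first exact: measurable_itv.
  exact: lambda_plus_null.
move=> l /= /negP; rewrite -ltNge in_itv /= andbT; lra.
Qed.

Lemma below_le x y g : x <= y -> below x g -> below y (y - x + g).
Proof.
move=> xy [g0 h]; split; first lra.
by move=> v; apply: filterS (h v) => l; lra.
Qed.

Lemma below_away x g eta : below x g -> away hO (x +i* eta) g.
Proof.
move=> [g0 h]; split=> // v; apply: filterS (h v) => l hl.
apply: le_trans (nc_Re _); rewrite ReB /= distrC; apply: le_trans (ler_norm _); lra.
Qed.
End Support.

Lemma nm_tri {R : realType} m n (A B C : 'M[R[i]]_(m, n)) :
  nm (A - C) <= nm (A - B) + nm (B - C).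
Proof. by rewrite -{1}(subrK B A) -addrA nmD. Qed.

(** * The transform on the real axis and continuation along paths *)

Section RealLine.
Context {R : realType} {p : nat}.
Local Notation K := R[i].
Variable Omega : set R -> 'M[K]_p.
Hypothesis hO : psd_measure Omega.
Hypothesis hO1 : Omega setT = 1%:M.
Local Notation mu := (qmu hO).
Local Notation S := (stieltjes Omega).

Lemma below_awayR x g : below hO x g -> away hO x%:C g.
Proof. exact: below_away. Qed.

Lemma invc_real (a : R) : ((a%:C)^-1 : K) = (a^-1)%:C.
Proof. by rewrite fmorphV. Qed.

Lemma res_real (x l : R) : ((l%:C - x%:C)^-1 : K) = (- (x - l)^-1)%:C.
Proof. by rewrite -raddfB invc_real -invrN opprB. Qed.

Lemma rint_inv x g v : below hO x g -> rint (mu v) (fun l => (x - l)^-1).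
Proof.
move=> h; have := (cint_res hO1 (below_awayR h) v).1 => /rintN.
by congr (rint _ _); apply/funext => l; rewrite res_real /= opprK.
Qed.

Lemma hfS x g v : below hO x g -> hf (S x%:C) v v = (- RI (mu v) (fun l => (x - l)^-1))%:C.
Proof.
move=> h; rewrite (hf_stieltjes hO1 (below_awayR h)).
have -> : (fun l : R => (l%:C - x%:C)^-1 : K) = fun l => (- (x - l)^-1)%:C.
  by apply/funext => l; exact: res_real.
by rewrite /CI /= RI0 RIN//; exact: (rint_inv v h).
Qed.

Lemma herm_S x g : below hO x g -> (S x%:C)^t* = S x%:C.
Proof. by move=> h; apply: hf_inj => v; rewrite -hfJ (hfS _ h) conj_realC. Qed.

Lemma qfNS x g v : below hO x g -> qf (- S x%:C) v = RI (mu v) (fun l => (x - l)^-1).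
Proof. by move=> h; rewrite qfN /qf (hfS _ h) /= opprK. Qed.

Lemma ker2_real (x l : R) : ker2 x%:C l = (x - l)^-1 ^+ 2.
Proof. by rewrite /ker2 -raddfB nc_real exprVn -normrN opprB real_normK// num_real. Qed.

Lemma Kq_NS x g v : below hO x g -> g * Kq hO x%:C v <= qf (- S x%:C) v.
Proof.
move=> h; rewrite (qfNS _ h) /Kq -RIZ; last exact: (rint_ker2 hO1 (below_awayR h) v).
have [g0 hg] := h; apply: RI_le.
- by apply: rintZ; exact: (rint_ker2 hO1 (below_awayR h) v).
- exact: (rint_inv v h).
apply: filterS (hg v) => l hl; rewrite ker2_real expr2 mulrA ler_piMl//.
  by rewrite invr_ge0; lra.
by rewrite ler_pdivrMr; lra.
Qed.

Lemma pd_NS x g : below hO x g -> pd (- S x%:C).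
Proof.
move=> h; split=> [|v v0]; first by rewrite trmxCN (herm_S h).
apply: lt_le_trans (Kq_NS v h); rewrite mulr_gt0//; first by have [] := h.
exact: (Kq_gt0 hO1 (below_awayR h) v0).
Qed.

Lemma NS_le x y g v : below hO x g -> x <= y -> qf (- S y%:C) v <= qf (- S x%:C) v.
Proof.
move=> h xy; have h' := below_le xy h; rewrite [leRHS](qfNS v h) [leLHS](qfNS v h').
apply: RI_le; [exact: (rint_inv v h')|exact: (rint_inv v h)|].
have [g0 hg] := h; apply: filterS (hg v) => l hl.
by rewrite lef_pV2 ?posrE; lra.
Qed.

Lemma NS_le_inv x g v : below hO x g -> qf (- S x%:C) v <= g^-1 * sq v.
Proof.
move=> h; rewrite (qfNS _ h) -(RI_qmu_cst hO hO1 v).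
apply: RI_le; [exact: (rint_inv v h)|exact: rint_qmu_cst|].
have [g0 hg] := h; apply: filterS (hg v) => l hl.
by rewrite lef_pV2 ?posrE; lra.
Qed.

Lemma nm_S_lip z w g : away hO z g -> away hO w g ->
  nm (S z - S w) <= 4 * p%:R ^+ 2 * (nc (z - w) * (g ^+ 2)^-1).
Proof.
by move=> zg wg; apply: (nm_stieltjes_sub hO1 zg wg) => v; exact: Kq_le.
Qed.

Lemma cvg_S (x : R) (u : nat -> K) g : below hO x g -> (forall n, away hO (u n) g) ->
  nc (u n - x%:C) @[n --> \oo] --> (0 : R) -> nm (S (u n) - S x%:C) @[n --> \oo] --> (0 : R).
Proof.
move=> h hu c; apply: (cvg_squeeze0 (g := fun n => 4 * p%:R ^+ 2 * (g ^+ 2)^-1 * nc (u n - x%:C))) => [n|].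
  rewrite subr0 ger0_norm ?nm_ge0//; apply: le_trans (nm_S_lip (hu n) (below_awayR h)) _.
  by rewrite le_eqVlt; apply/orP; left; apply/eqP; ring.
by rewrite -[X in _ --> X](mulr0 (4 * p%:R ^+ 2 * (g ^+ 2)^-1)); apply: cvgM c; exact: cvg_cst.
Qed.

Definition vseq (x : R) (n : nat) : K := x +i* harmonic n.

Lemma nc_vseq x n : nc (vseq x n - x%:C) = harmonic n.
Proof.
rewrite /vseq /nc /=; rewrite subrr subr0 expr0n add0r sqrtr_sqr ger0_norm//; exact/ltW/harmonic_gt0.
Qed.

Lemma cvg_S_vseq x g : below hO x g -> nm (S (vseq x n) - S x%:C) @[n --> \oo] --> (0 : R).
Proof.
move=> h; apply: (cvg_S h) => [n|]; first exact: below_away.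
by rewrite (funext (nc_vseq x)); exact: cvg_harmonic.
Qed.

Lemma Kq_vseq x g v : below hO x g -> Kq hO (vseq x n) v @[n --> \oo] --> Kq hO x%:C v.
Proof.
move=> h; have ha n := below_away (harmonic n) h.
have [] := @RI_cvg _ _ _ (mu v) (fun n => ker2 (vseq x n)) (ker2 x%:C) (fun=> (g ^+ 2)^-1).
- by move=> n; exact: measurable_ker2.
- exact: measurable_ker2.
- exact: rint_qmu_cst.
- have [g0 hg] := h; apply: filterS (hg v) => l hl.
  rewrite ker2_real exprVn /ker2; apply: cvgV; first by rewrite sqrf_eq0 gt_eqF//; lra.
  have -> : (fun n => nc (l%:C - vseq x n) ^+ 2) = fun n => (x - l) ^+ 2 + harmonic n * harmonic n.
    by apply/funext => n; rewrite nc_sqr ReB ImB /= sub0r sqrrN -(sqrrN (l - x)) opprB -expr2.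
  rewrite -[X in _ --> X]addr0 -(mulr0 (0 : R)); apply: cvgD; first exact: cvg_cst.
  by apply: cvgM; exact: cvg_harmonic.
- by move=> n; exact: (ker2_le (ha n) v).
by [].
Qed.

(** At fixed height the kernel is bounded and tends to 0 as the real part grows, so dominated
    convergence applies along a sequence of counterexamples. *)
Lemma S_far eta e : 0 < eta -> 0 < e -> exists X, forall x, X <= x -> nm (S (x +i* eta)) <= e.
Proof.
move=> eta0 e0; apply: contrapT => /forallNP h.
have {}h n : exists x : R, n%:R <= x /\ e < nm (S (x +i* eta)).
  have /existsNP[x /not_implyP[nx /negP]] := h n%:R.
  by rewrite -ltNge => hx; exists x.
have [x hx] := choice h.
have aw n : away hO (x n +i* eta) eta by exact: (away_im hO (z := x n +i* eta)).
suff : nm (S (x n +i* eta)) @[n --> \oo] --> (0 : R).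
  move=> /(cvg_ge_lim (c := e)); rewrite leNgt e0 => H; suff : false by [].
  by apply: H => n; apply/ltW; have [] := hx n.
apply: cvg_nm0 => v.
have [] := @RI_cvg _ _ _ (mu v) (fun n l => nc ((l%:C - (x n +i* eta))^-1)) (fun=> 0) (fun=> eta^-1).
- by move=> n; apply: measurable_nc; apply: cmeasV; exact: cmeas_res.
- exact: measurable_cst.
- exact: rint_qmu_cst.
- apply: aeW => l; rewrite (funext (fun n => ncV _)).
  have P n : 0 < nc (l%:C - (x n +i* eta)).
    apply: lt_le_trans (nc_Im _); rewrite ImB /= sub0r normrN gtr0_norm//.
  apply/gtr0_cvgV0; first exact: nearW.
  apply: (ger_cvgy (f := fun n => n%:R - l)).
    apply: nearW => n; apply: le_trans (nc_Re _); rewrite ReB /= distrC.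
    by apply: le_trans (ler_norm _); have [] := hx n; lra.
  apply/cvgryPge => A; near=> n; rewrite lerBrDr; near: n; exact: nbhs_infty_ger.
- move=> n; apply: filterS (nc_res (aw n) v) => l hl; rewrite ger0_norm//; exact: nc_ge0.
move=> _ _; rewrite RI0; apply: cvg_squeeze0 => n.
rewrite subr0 ger0_norm ?nc_ge0// (hf_stieltjes hO1 (aw n)); apply: nc_CI; exact: (cint_res hO1 (aw n) v).
Unshelve. all: by end_near. Qed.

(** A continuity argument on the segment, discretized into N steps. A small step cannot leave the
    ball of radius e, inside which [Kq] is bounded by c; this bound then improves the distance to e
    / 2, which permits the next step. *)
Lemma S_path (M0 : 'M[K]_p) e c z0 z1 :
  0 < e -> 0 <= c -> 0 < Im z0 -> 0 < Im z1 ->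
  (forall z, 0 < Im z -> nm (S z - M0) <= e -> forall v, Kq hO z v <= c * sq v) ->
  nm (S z0 - M0) <= e / 4 -> 4 * p%:R ^+ 2 * (nc (z1 - z0) * c) <= e / 4 ->
  forall v, Kq hO z1 v <= c * sq v.
Proof.
move=> e0.
have e4 : e / 4 <= e by lra.
have e44 : e / 4 + e / 4 = e / 2 by lra.
have e22 : e / 2 + e / 2 = e by lra.
have e42 : e / 4 <= e / 2 by lra.
have e21 : e / 2 <= e by lra.
move=> c00 i0 i1 good h0 hd.
pose g := Num.min (Im z0) (Im z1).
have g0 : 0 < g by rewrite lt_min i0.
pose zt (t : R) : K := z0 + t%:C * (z1 - z0).
have Imt t : 0 <= t <= 1 -> g <= Im (zt t).
  move=> /andP[t0 t1]; rewrite /zt ImD ImZ ImB.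
  have a1 : g <= Im z0 by rewrite ge_min lexx.
  have a2 : g <= Im z1 by rewrite ge_min lexx orbT.
  nra.
have awt t : 0 <= t <= 1 -> away hO (zt t) g.
  move=> ht; split => // v; have [_ /(_ v)] := away_im hO (lt_le_trans g0 (Imt t ht)).
  by apply: filterS => l; apply: le_trans; exact: Imt.
(* A crude Lipschitz constant that degenerates near the real axis. It only decides the number of
   steps and does not enter the conclusion. *)
pose L := 4 * p%:R ^+ 2 * (nc (z1 - z0) * (g ^+ 2)^-1).
have L0 : 0 <= L.
  apply: mulr_ge0; first by rewrite mulr_ge0 ?sqr_ge0.
  by rewrite mulr_ge0 ?nc_ge0// invr_ge0 sqr_ge0.
pose N := (Num.truncn (2 * L / e)).+1.
have N0 : 0 < N%:R :> R by rewrite ltr0n.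
have LN : L / N%:R <= e / 2.
  have /andP[_ /ltW] : (Num.truncn (2 * L / e))%:R <= 2 * L / e < N%:R.
    by apply: truncn_itv; rewrite divr_ge0 ?(ltW e0)// mulr_ge0.
  by rewrite !ler_pdivrMr//; lra.
have near k : (k <= N)%N -> nm (S (zt (k%:R / N%:R)) - M0) <= e / 2.
  elim: k => [|k IH] kN.
    by rewrite mul0r /zt mul0r addr0; exact: le_trans h0 e42.
  have t1 : 0 <= (k.+1%:R / N%:R : R) <= 1.
    by rewrite divr_ge0//= ler_pdivrMr// mul1r ler_nat.
  have t0 : 0 <= (k%:R / N%:R : R) <= 1.
    by rewrite divr_ge0//= ler_pdivrMr// mul1r ler_nat ltnW.
  have hk := IH (ltnW kN).
  have step : nm (S (zt (k.+1%:R / N%:R)) - S (zt (k%:R / N%:R))) <= e / 2.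
    apply: le_trans (nm_S_lip (awt _ t1) (awt _ t0)) _; apply: le_trans LN.
    rewrite /zt (_ : _ - _ = (N%:R^-1)%:C * (z1 - z0)); last first.
      by rewrite opprD addrACA subrr add0r -mulrBl -raddfB -mulrBl -natrB// subSnn mul1r.
    rewrite ncM nc_real ger0_norm ?invr_ge0// /L le_eqVlt; apply/orP; left; apply/eqP.
    by ring.
  have ik : 0 < Im (zt (k.+1%:R / N%:R)) by exact: lt_le_trans (Imt _ t1).
  have hk1 : nm (S (zt (k.+1%:R / N%:R)) - M0) <= e.
    by apply: le_trans (nm_tri _ (S (zt (k%:R / N%:R))) _) _; rewrite -e22 lerD.
  have gk := good _ ik hk1.
  have gz := good _ i0 (le_trans h0 e4).
  (* The current point is compared with the starting point directly, so no error accumulates along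
     the path. *)
  have := nm_stieltjes_sub hO1 (awt _ t1) (away_im hO i0) gk gz => H.
  apply: le_trans (nm_tri _ (S z0) _) _; rewrite -e44; apply: lerD => //; apply: le_trans H _.
  rewrite /zt addrAC subrr add0r ncM nc_real.
  have /andP[t10 t11] := t1; rewrite (ger0_norm t10).
  apply: le_trans hd; apply: ler_wpM2l; first by rewrite mulr_ge0 ?sqr_ge0.
  by rewrite -mulrA ler_piMl// mulr_ge0 ?nc_ge0.
apply: good => //.
have := near N (leqnn N); rewrite divff ?gt_eqF// /zt mul1r (addrC z0) subrK => H; exact: le_trans H e21.
Qed.
End RealLine.

(** * Convergence of matrices *)

Section MatrixConvergence.
Context {R : realType}.
Local Notation K := R[i].

Definition mcvg m n (A : nat -> 'M[K]_(m, n)) (B : 'M[K]_(m, n)) :=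
  nm (A k - B) @[k --> \oo] --> (0 : R).

Lemma cvg_squeeze_near (f g : nat -> R) l : (\forall n \near \oo, `|f n - l| <= g n) ->
  g n @[n --> \oo] --> 0 -> f n @[n --> \oo] --> l.
Proof.
move=> h /cvgrPdist_lt hg; apply/cvgrPdist_lt => e e0.
apply: filterS2 h (hg e e0) => n h; rewrite sub0r normrN => hn.
by rewrite distrC (le_lt_trans h)// (le_lt_trans _ hn)// ler_norm.
Qed.

Lemma mcvg_near m n (A : nat -> 'M[K]_(m, n)) B (g : nat -> R) :
  (\forall k \near \oo, nm (A k - B) <= g k) -> g k @[k --> \oo] --> (0 : R) -> mcvg A B.
Proof.
move=> h; apply: cvg_squeeze_near; apply: filterS h => k h.
by rewrite subr0 ger0_norm ?nm_ge0.
Qed.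

Lemma mcvg_le m n (A : nat -> 'M[K]_(m, n)) B (g : nat -> R) :
  (forall k, nm (A k - B) <= g k) -> g k @[k --> \oo] --> (0 : R) -> mcvg A B.
Proof. by move=> h; apply: mcvg_near; exact: nearW. Qed.

Lemma mcvg_cst m n (B : 'M[K]_(m, n)) : mcvg (fun=> B) B.
Proof. by apply: (@mcvg_le _ _ _ _ (fun=> 0)) => [k|]; [rewrite subrr nm0|exact: cvg_cst]. Qed.

Lemma cvg0_scale (a : R) (g : nat -> R) : g k @[k --> \oo] --> (0 : R) ->
  a * g k @[k --> \oo] --> (0 : R).
Proof. by move=> h; rewrite -[X in _ --> X](mulr0 a); apply: cvgM => //; exact: cvg_cst. Qed.

Lemma mcvg_bounded m n (A : nat -> 'M[K]_(m, n)) B : mcvg A B ->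
  exists2 C, 0 <= C & forall k, nm (A k) <= C.
Proof.
move=> h; have : cvgn (fun k => nm (A k - B)) by apply/cvg_ex; exists 0.
move=> /cvg_seq_bounded/pinfty_ex_gt0[C C0 /= hC].
exists (C + nm B) => [|k]; first by rewrite addr_ge0 ?nm_ge0// ltW.
rewrite -{1}(subrK B (A k)); apply: le_trans (nmD _ _) _; rewrite lerD2r.
by apply: le_trans (hC k I); exact: ler_norm.
Qed.

Lemma mcvgM m n p (A : nat -> 'M[K]_(m, n)) (B : nat -> 'M[K]_(n, p)) A0 B0 :
  mcvg A A0 -> mcvg B B0 -> mcvg (fun k => A k *m B k) (A0 *m B0).
Proof.
move=> hA hB; have [C C0 hC] := mcvg_bounded hA.
apply: (@mcvg_le _ _ _ _ (fun k => C * nm (B k - B0) + nm B0 * nm (A k - A0))) => [k|].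
  have -> : A k *m B k - A0 *m B0 = A k *m (B k - B0) + (A k - A0) *m B0.
    by rewrite mulmxBr mulmxBl addrA subrK.
  apply: le_trans (nmD _ _) _; apply: lerD.
    by apply: le_trans (nmM _ _) _; apply: ler_wpM2r; [exact: nm_ge0|exact: hC].
  by rewrite mulrC; exact: nmM.
by rewrite -[X in _ --> X]addr0; apply: cvgD; exact: cvg0_scale.
Qed.

Lemma mcvgD m n (A B : nat -> 'M[K]_(m, n)) A0 B0 :
  mcvg A A0 -> mcvg B B0 -> mcvg (fun k => A k + B k) (A0 + B0).
Proof.
move=> hA hB; apply: (@mcvg_le _ _ _ _ (fun k => nm (A k - A0) + nm (B k - B0))) => [k|].
  by rewrite opprD addrACA nmD.
by rewrite -[X in _ --> X]addr0; apply: cvgD.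
Qed.

Lemma mcvgZ m n a (A : nat -> 'M[K]_(m, n)) A0 : mcvg A A0 -> mcvg (fun k => a *: A k) (a *: A0).
Proof.
move=> hA; apply: (@mcvg_le _ _ _ _ (fun k => nc a * nm (A k - A0))) => [k|].
  by rewrite -scalerBr nmZ.
exact: cvg0_scale.
Qed.

Lemma mcvgN m n (A : nat -> 'M[K]_(m, n)) A0 : mcvg A A0 -> mcvg (fun k => - A k) (- A0).
Proof. by move=> h; apply: mcvg_le h => k; rewrite -opprD nmN. Qed.

Lemma mcvg_trmxC m n (A : nat -> 'M[K]_(m, n)) A0 : mcvg A A0 -> mcvg (fun k => (A k)^t*) (A0^t*).
Proof. by rewrite /mcvg => h; under eq_fun do rewrite -trmxCB nm_trmxC. Qed.

Lemma mcvg_Re m n (A : nat -> 'M[K]_(m, n)) A0 i j : mcvg A A0 ->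
  Re (A k i j) @[k --> \oo] --> Re (A0 i j).
Proof.
apply: cvg_squeeze0 => k; rewrite -ReB; apply: le_trans (nc_Re _) _.
by have := nm_entry (A k - A0) i j; rewrite !mxE.
Qed.

Lemma mcvg_Retr n (A : nat -> 'M[K]_n) A0 : mcvg A A0 ->
  Re (\tr (A k)) @[k --> \oo] --> Re (\tr A0).
Proof.
apply: cvg_squeeze0 => k; rewrite -ReB; apply: le_trans (nc_Re _) _.
by rewrite -raddfB; exact: nm_trace.
Qed.

Lemma mcvg_qf n (A : nat -> 'M[K]_n) A0 (v : nat -> 'cV[K]_n) v0 :
  mcvg A A0 -> mcvg v v0 -> qf (A k) (v k) @[k --> \oo] --> qf A0 v0.
Proof. by move=> hA hv; apply: (mcvg_Re (i := 0) (j := 0) (mcvgM (mcvgM (mcvg_trmxC hv) hA) hv)). Qed.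

Lemma mcvg_nm m n (A : nat -> 'M[K]_(m, n)) A0 : mcvg A A0 -> nm (A k) @[k --> \oo] --> nm A0.
Proof.
apply: cvg_squeeze0 => k; rewrite ler_norml lerBlDr lerBrDr.
rewrite -{3}(subrK A0 (A k)) nmD andbT addrC lerBlDr nmBC.
by rewrite -{1}(subrK (A k) A0) addrC; apply: le_trans (nmD _ _) _; rewrite addrC.
Qed.

Lemma invmx_sub n (A B : 'M[K]_n) : A \in unitmx -> B \in unitmx ->
  invmx B - invmx A = invmx B *m (A - B) *m invmx A.
Proof. by move=> uA uB; rewrite mulmxBr mulmxBl mulVmx// mul1mx -mulmxA mulmxV// mulmx1. Qed.

Lemma nm_invmx_near n (A B : 'M[K]_n) : A \in unitmx -> B \in unitmx ->
  nm (A - B) * nm (invmx A) <= 1 / 2 ->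
  nm (invmx B) <= 2 * nm (invmx A).
Proof.
move=> uA uB h; have : nm (invmx B) <= nm (invmx A) + nm (invmx B) * (nm (A - B) * nm (invmx A)).
  rewrite -{1}(subrK (invmx A) (invmx B)) addrC; apply: le_trans (nmD _ _) _.
  rewrite lerD2l invmx_sub// mulrA; apply: le_trans (nmM _ _) _.
  by apply: ler_wpM2r; [exact: nm_ge0|exact: nmM].
have := nm_ge0 (invmx B); nra.
Qed.

Lemma mcvg_invmx n (A : nat -> 'M[K]_n) A0 : (forall k, A k \in unitmx) -> A0 \in unitmx ->
  mcvg A A0 -> mcvg (fun k => invmx (A k)) (invmx A0).
Proof.
move=> uA u0 h; have h' := cvg0_scale (nm (invmx A0)) h.
apply: (@mcvg_near _ _ _ _ (fun k => 2 * nm (invmx A0) * nm (invmx A0) * nm (A k - A0))).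
  move/cvgrPdist_lt: h' => /(_ (1 / 2) ltac:(by rewrite divr_gt0)); apply: filterS => k.
  rewrite sub0r normrN => hk.
  have H : nm (A0 - A k) * nm (invmx A0) <= 1 / 2.
    by rewrite mulrC nmBC ltW// (le_lt_trans _ hk)// ler_norm.
  rewrite invmx_sub//; apply: le_trans (nmM _ _) _.
  rewrite -mulrA [X in _ <= _ * X]mulrC mulrA; apply: ler_wpM2r; first exact: nm_ge0.
  apply: le_trans (nmM _ _) _; rewrite nmBC; apply: ler_wpM2r; first exact: nm_ge0.
  exact: nm_invmx_near.
exact: cvg0_scale.
Qed.

Lemma unitmx_kernel n (A : 'M[K]_n) : A \notin unitmx -> exists2 v : 'cV[K]_n, v != 0 & A *m v = 0.
Proof.
rewrite -unitmx_tr unitmxE unitfE negbK => /det0P[v v0 hv].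
exists v^T; first by rewrite -(inj_eq trmx_inj) trmxK trmx0.
by apply: trmx_inj; rewrite trmx_mul trmxK hv trmx0.
Qed.
End MatrixConvergence.

(** * The self-consistent equation *)

Section Resolvent.
Context {R : realType} {p : nat}.
Local Notation K := R[i].
Implicit Types (M : 'M[K]_p) (T : 'M[R]_p).

Lemma im_mx_qf M v : qf (im_mx M) v = Im (hf M v v).
Proof.
rewrite /qf /im_mx hfZ hfB -hfJ invfM.
have -> : (2 : K)^-1 = (2^-1)%:C by rewrite fmorphV rmorph_nat.
have -> : ('i : K)^-1 = - 'i.
  apply: (mulfI (neq0Ci K)); rewrite mulfV ?neq0Ci//.
  by rewrite mulrN -expr2 sqr_i opprK.
rewrite -mulrA ReZ mulNr ReN ReM ReB ImB ReJ ImJ /=.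
by lra.
Qed.

Definition pert (a : R) M T : 'M[K]_p := 1%:M + (a^-1)%:C *: (M *m toC T).

Lemma Gmx_pert a M T : Gmx a M T = toC T *m invmx (pert a M T). Proof. by []. Qed.

Lemma Gmx_mul a M T : pert a M T \in unitmx -> Gmx a M T *m pert a M T = toC T.
Proof. by move=> u; rewrite Gmx_pert mulmxKV. Qed.

Lemma Gmx_comm a M T : pert a M T \in unitmx ->
  (1%:M + (a^-1)%:C *: (toC T *m M)) *m Gmx a M T = toC T.
Proof.
move=> u; apply: (can_inj (mulmxK u)).
rewrite -mulmxA (Gmx_mul u) /pert mulmxDl mulmxDr mul1mx mulmx1.
by rewrite -scalemxAl -scalemxAr mulmxA.
Qed.

Lemma dot_addZ M (w v : 'cV[K]_p) c :
  (w^t* *m (v + c *: (M *m w))) 0 0 = (w^t* *m v) 0 0 + c * hf M w w.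
Proof. by rewrite mulmxDr -scalemxAr mulmxA [LHS]mxE [X in _ + X]mxE. Qed.

(** With v = (1 + M T / a)^-1 u one has F u = T v and u = v + M F u / a. In the conjugate of u^* F u
    the term v^* T v is real, so the imaginary part comes from M alone. *)
Lemma Gmx_im a M T u : sym_mx T -> pert a M T \in unitmx ->
  a^-1 * qf (im_mx M) (Gmx a M T *m u) = - Im (hf (Gmx a M T) u u).
Proof.
move=> sT uG; set F := Gmx a M T; pose v := invmx (pert a M T) *m u.
have hu : u = v + (a^-1)%:C *: (M *m (F *m u)).
  rewrite /F Gmx_pert -!mulmxA -/v -[in LHS](mulKVmx uG u) -/v /pert mulmxDl mul1mx.
  by rewrite -scalemxAl -mulmxA.
have hFv : F *m u = toC T *m v by rewrite /F Gmx_pert -mulmxA.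
have E : Num.conj (hf F u u) = hf (toC T) v v + (a^-1)%:C * hf M (F *m u) (F *m u).
  have -> : Num.conj (hf F u u) = ((F *m u)^t* *m u) 0 0.
    by rewrite hfJ /hf trmxCM.
  move: (F *m u) hu hFv => w hu hFv; rewrite hu dot_addZ; congr (_ + _).
  by rewrite hFv /hf trmxCM trmxC_toC sT.
rewrite im_mx_qf -ImZ -ImJ E ImD.
have -> : Im (hf (toC T) v v) = 0 by rewrite hf_herm// trmxC_toC sT.
by rewrite add0r.
Qed.

Lemma Gmx_herm a M T : sym_mx T -> M^t* = M -> pert a M T \in unitmx ->
  (Gmx a M T)^t* = Gmx a M T.
Proof.
move=> sT hM u; pose G' := 1%:M + (a^-1)%:C *: (toC T *m M).
have hG : G' = (pert a M T)^t*.
  by rewrite /G' /pert trmxCD trmxC1 trmxCZr trmxCM trmxC_toC sT hM.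
have uG' : G' \in unitmx by rewrite hG trmxC_unit.
apply: (can_inj (mulKmx uG')); rewrite {2}/G' Gmx_comm//.
by rewrite hG -trmxCM Gmx_mul// trmxC_toC sT.
Qed.

Lemma Gmx_diff a M M' T : pert a M T \in unitmx -> pert a M' T \in unitmx ->
  Gmx a M' T - Gmx a M T = - ((a^-1)%:C *: (Gmx a M' T *m (M' - M) *m Gmx a M T)).
Proof.
move=> u u'; rewrite !Gmx_pert -mulmxBr invmx_sub// mulmxA mulmxA.
have -> : pert a M T - pert a M' T = - ((a^-1)%:C *: ((M' - M) *m toC T)).
  by rewrite /pert mulmxBl scalerBr opprB opprD addrACA subrr add0r.
by rewrite !mulmxN mulNmx -!scalemxAr -scalemxAl !mulmxA.
Qed.

(** By [Gmx_im], each column w of F satisfies k |w|^2 <= a |w| up to the choice of norm. The bound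
    is uniform in T. *)
Lemma nm_Gmx a M T k : 0 < a -> 0 < k -> sym_mx T -> pert a M T \in unitmx ->
  (forall v, k * sq v <= qf (im_mx M) v) -> nm (Gmx a M T) <= p%:R ^+ 2 * (a / k).
Proof.
move=> a0 k0 sT u hk; set F := Gmx a M T.
have col j : nm (F *m (delta_mx j 0 : 'cV_p)) <= p%:R * (a / k).
  set w := F *m _; have h : k * sq w <= a * nm w.
    apply: le_trans (hk w) _; rewrite -ler_pdivrMl//.
    rewrite Gmx_im//; apply: le_trans (ler_norm _) _; rewrite normrN; apply: le_trans (nc_Im _) _.
    rewrite -/F /hf -mulmxA -/w; apply: le_trans (nm_entry _ 0 0) _; apply: le_trans (nmM _ _) _.
    rewrite nm_trmxC [X in X * _](_ : _ = 1) ?mul1r//.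
    rewrite nm_cV (bigD1 j)//= mxE !eqxx nc1 big1 ?addr0// => i ij.
    by rewrite mxE (negbTE ij) nc0.
  have [w0|wp] := leP (nm w) 0.
    by apply: le_trans w0 _; rewrite mulr_ge0// divr_ge0 ?ltW.
  have h2 := nm_le_sq w.
  rewrite -(ler_pM2r wp) -expr2; apply: le_trans h2 _.
  by rewrite -!mulrA; apply: ler_wpM2l => //; rewrite mulrCA ler_pdivlMl.
rewrite /nm exchange_big /=.
apply: (@le_trans _ _ (\sum_(j < p) p%:R * (a / k))); last first.
  by rewrite sumr_const card_ord -[_ *+ p]mulr_natl expr2 mulrA.
apply: ler_sum => j _; apply: le_trans (col j).
by move: (F) => F'; rewrite -colE nm_cV; apply: ler_sum => i _; rewrite mxE.
Qed.
End Resolvent.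

Section Equation.
Context {R : realType} {d : measure_display} {W : measurableType d}.
Variable P : probability W R.
Context {p : nat}.
Local Notation K := R[i].
Variables (T : W -> 'M[R]_p) (alpha : R).
Hypotheses (mT : measurable_mx T) (sT : {ae P, forall w, sym_mx (T w)}) (a0 : 0 < alpha).
Variable Omega : set R -> 'M[K]_p.
Hypothesis hO : psd_measure Omega.
Hypothesis hO1 : Omega setT = 1%:M.
Local Notation S := (stieltjes Omega).
Local Notation F z := (fun w => Gmx alpha (S z) (T w)).
Hypothesis hM : forall z : K, 0 < Im z -> [/\ S z \in unitmx,
  {ae P, forall w, pert alpha (S z) (T w) \in unitmx}
  & invmx (S z) = - z%:M + EmxC P (F z)].

Lemma mmeas_pert M : mmeas (fun w => pert alpha M (T w)).
Proof.
apply: mmeasD; first exact: mmeas_cst.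
by apply: mmeasZ; apply: mmeasM; [exact: mmeas_cst|exact: mmeas_toC].
Qed.

Lemma mmeas_Gmx M : mmeas (fun w => Gmx alpha M (T w)).
Proof. by apply: mmeasM; [exact: mmeas_toC|apply: mmeas_invmx; exact: mmeas_pert]. Qed.

Lemma im_mx_S z v : 0 < Im z -> qf (im_mx (S z)) v = Im z * Kq hO z v.
Proof. by move=> z0; rewrite im_mx_qf (Im_stieltjes hO1 (away_im hO z0)). Qed.

Lemma sqint_upper z : 0 < Im z -> sqint P (F z).
Proof.
move=> z0; have [k k0 hk] := pd_lower (pd_Kmx hO1 (away_im hO z0)).
have [_ u _] := hM z0.
apply: (@sqint_bounded _ _ _ _ _ _ _ (p%:R ^+ 2 * (alpha / (Im z * k)))); first exact: mmeas_Gmx.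
have hk' v : Im z * k * sq v <= qf (im_mx (S z)) v.
  rewrite im_mx_S// -mulrA; apply: ler_wpM2l; first exact: ltW.
  by rewrite -(qf_Kmx hO1 (away_im hO z0)).
by apply: filterS2 u sT => w uw sw; exact: (nm_Gmx a0 (mulr_gt0 z0 k0) sw uw hk').
Qed.

Lemma mint_upper z : 0 < Im z -> mint P (F z).
Proof. by move=> z0; apply: sqint_mint; exact: sqint_upper. Qed.

Lemma MI_upper z : 0 < Im z -> MI P (F z) = invmx (S z) + z%:M.
Proof. by move=> z0; have [_ _ ->] := hM z0; rewrite EmxCE addrAC addNr add0r. Qed.

(** The imaginary part of the equation at u, divided by Im z: [Gmx_im] evaluates the mean of F, and
    the substitution u = S v evaluates the inverse of S. *)
Lemma Kq_upper z u : 0 < Im z ->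
  RI P (fun w => qf (Kmx Omega z) (F z w *m u)) + alpha * sq u = alpha * Kq hO z (invmx (S z) *m u).
Proof.
move=> z0; have [uS uG _] := hM z0; have aw := away_im hO z0.
have sF := sqint_upper z0; have iF := mint_upper z0.
have key : RI P (fun w => - (Im z * qf (Kmx Omega z) (F z w *m u))) =
  RI P (fun w => alpha * Im (hf (F z w) u u)).
  have m1 := rint_meas (rint_qfF (Kmx Omega z) u sF).
  apply: RI_eq.
  - by apply: measurable_funN; apply: measurable_funM => //; exact: measurable_cst.
  - by apply: measurable_funM; [exact: measurable_cst|exact: rint_meas (cint_hf u u iF).2].
  apply: filterS2 uG sT => w uw sw.
  rewrite (qf_Kmx hO1 aw) -im_mx_S// -[RHS]opprK -mulrN -(Gmx_im _ sw uw).
  by rewrite mulrA divff ?mul1r ?gt_eqF.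
have r1 : rint P (fun w => qf (Kmx Omega z) (F z w *m u)) by exact: rint_qfF.
rewrite RIN ?(RIZ _ r1) ?(RIZ _ (cint_hf u u iF).2) in key; last exact: rintZ.
have E : RI P (fun w => Im (hf (F z w) u u)) = Im (hf (invmx (S z)) u u) + Im z * sq u.
  rewrite -[LHS]/(Im (CI P (fun w => hf (F z w) u u))) -hf_MI// MI_upper// hfD ImD.
  congr (_ + _); case: (z) => x y; rewrite /hf mul_mx_scalar -scalemxAl mxE sqE ImM /=.
  by rewrite mulr0 add0r.
have E2 : Im (hf (invmx (S z)) u u) = - (Im z * Kq hO z (invmx (S z) *m u)).
  rewrite -im_mx_S// im_mx_qf; set v := invmx _ *m u.
  have -> : u = S z *m v by rewrite /v mulKVmx.
  transitivity (Im (Num.conj (hf (S z) v v))); last by rewrite ImJ.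
  by rewrite hfJ /hf trmxCM -!mulmxA (mulKmx uS).
rewrite E E2 in key.
apply: (mulfI (lt0r_neq0 z0)); rewrite mulrDr.
move: key; lra.
Qed.
End Equation.

Lemma ler_mul_sqr {R : realType} (s t : R) : 0 <= s -> 0 <= t -> s * t <= s ^+ 2 + t ^+ 2.
Proof. by move=> s0 t0; have := ler_2M s t; have := mulr_ge0 s0 t0; lra. Qed.

Lemma nm_le_cols {R : realType} m n (A : 'M[R[i]]_(m, n)) :
  nm A ^+ 2 <= (m%:R * n%:R) ^+ 2 * \sum_j sq (A *m (delta_mx j 0 : 'cV_n)).
Proof.
set s := \sum_j _; have s0 : 0 <= s by apply: sumr_ge0 => j _; exact: sq_ge0.
have h : nm A <= m%:R * n%:R * Num.sqrt s.
  apply: nm_le => i j; rewrite -(ger0_norm (nc_ge0 _)) -sqrtr_sqr ler_sqrt//.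
  rewrite /s (bigD1 j)//= -colE {1}/sq (bigD1 i)//= mxE -addrA lerDl.
  by apply: addr_ge0; apply: sumr_ge0 => k _; [exact: sqr_ge0|exact: sq_ge0].
have h0 : 0 <= m%:R * n%:R * Num.sqrt s by rewrite !mulr_ge0// sqrtr_ge0.
by rewrite -(sqr_sqrtr s0) -exprMn ler_pXn2r// nnegrE// nm_ge0.
Qed.

Lemma sqM_le {R : realType} m n (A : 'M[R[i]]_(m, n)) u : sq (A *m u) <= nm A ^+ 2 * nm u ^+ 2.
Proof.
apply: le_trans (sq_le_nm _) _; rewrite -exprMn ler_pXn2r// ?nnegrE ?mulr_ge0 ?nm_ge0//.
exact: nmM.
Qed.

Lemma qfNv {R : realType} n (A : 'M[R[i]]_n) v : qf A (- v) = qf A v.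
Proof. by rewrite /qf /hf trmxCN !mulNmx mulmxN opprK. Qed.

(** * The equation to the right of the support *)

Section RealAxis.
Context {R : realType} {d : measure_display} {W : measurableType d}.
Variable P : probability W R.
Context {p : nat}.
Local Notation K := R[i].
Variables (T : W -> 'M[R]_p) (alpha : R).
Hypotheses (mT : measurable_mx T) (sT : {ae P, forall w, sym_mx (T w)}) (a0 : 0 < alpha).
Variable Omega : set R -> 'M[K]_p.
Hypothesis hO : psd_measure Omega.
Hypothesis hO1 : Omega setT = 1%:M.
Local Notation S := (stieltjes Omega).
Hypothesis hM : forall z : K, 0 < Im z -> [/\ S z \in unitmx,
  {ae P, forall w, pert alpha (S z) (T w) \in unitmx}
  & invmx (S z) = - z%:M + EmxC P (fun w => Gmx alpha (S z) (T w))].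
Variables (x g : R).
Hypothesis hx : below hO x g.
Local Notation M := (S x%:C).
Local Notation Mn n := (S (vseq x n)).
Local Notation F := (fun w => Gmx alpha M (T w)).
Local Notation Fn n := (fun w => Gmx alpha (Mn n) (T w)).
Local Notation Kn n := (Kmx Omega (vseq x n)).
Local Notation K0 := (Kmx Omega x%:C).

Lemma Im_vseq n : 0 < Im (vseq x n). Proof. exact: harmonic_gt0. Qed.

Lemma away_vseq n : away hO (vseq x n) g. Proof. exact: below_away. Qed.

Lemma unit_S : M \in unitmx.
Proof.
have := pd_unit (pd_NS hO1 hx) => u.
suff : M *m (- invmx (- M)) = 1%:M by move=> /mulmx1_unit[].
by rewrite mulmxN -mulNmx mulmxV.
Qed.

Lemma invS_opp : invmx M = - invmx (- M).
Proof.
apply: (can_inj (mulKmx unit_S)); rewrite mulmxV ?unit_S//.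
by rewrite mulmxN -mulNmx mulmxV// (pd_unit (pd_NS hO1 hx)).
Qed.

Lemma mcvg_Sn : mcvg (fun n => Mn n) M. Proof. exact: (cvg_S_vseq hO1 hx). Qed.

Lemma mcvg_invSn : mcvg (fun n => invmx (Mn n)) (invmx M).
Proof.
apply: mcvg_invmx; [|exact: unit_S|exact: mcvg_Sn].
by move=> n; have [] := hM (Im_vseq n).
Qed.

Lemma mcvg_Kn : mcvg (fun n => Kn n) K0.
Proof.
rewrite /mcvg; apply: cvg_nm0 => v.
have := cvg_dist0 (Kq_vseq (v := v) hO1 hx).
rewrite (_ : (fun n => `|_|) = (fun k => nc (hf (Kn k - K0) v v)))//.
apply/funext => k; rewrite hfB (hf_Kmx hO1 (away_vseq k)) (hf_Kmx hO1 (below_awayR hx)).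
by rewrite -raddfB nc_real.
Qed.

(** The kernel decreases with the height above the real axis, and the points [vseq x n] have height
    at most 1, so the form at x + i is a common lower bound. *)
Lemma Kn_lower : exists2 k, 0 < k & forall n v, k * sq v <= qf (Kn n) v.
Proof.
have a1 : away hO (x +i* 1) 1 by exact: (away_im hO (z := x +i* 1)).
have [k k0 hk] := pd_lower (pd_Kmx hO1 a1); exists k; first exact: k0.
move=> n v.
apply: le_trans (hk v) _; rewrite (qf_Kmx hO1 a1) (qf_Kmx hO1 (away_vseq n)).
apply: RI_le; [exact: (rint_ker2 hO1 a1)|exact: (rint_ker2 hO1 (away_vseq n))|].
apply: aeW => l; rewrite /ker2 !nc_sqr !ReB !ImB /= !sub0r !sqrrN.
have h1 : n.+1%:R^-1 ^+ 2 <= 1 ^+ 2 :> R.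
  by rewrite ler_pXn2r// ?nnegrE ?invr_ge0// invf_le1// ler1n.
have h2 : 0 < n.+1%:R^-1 ^+ 2 :> R by rewrite exprn_gt0// invr_gt0.
have := sqr_ge0 (l - x) => h3.
move: ((l - x) ^+ 2) (n.+1%:R^-1 ^+ 2) h1 h2 h3 => b e h1 h2 h3.
by rewrite expr1n in h1 *; rewrite lef_pV2 ?posrE; lra.
Qed.

Lemma RI_Fn u n : RI P (fun w => qf (Kn n) (Fn n w *m u)) <= alpha * qf (Kn n) (invmx (Mn n) *m u).
Proof.
rewrite (qf_Kmx hO1 (away_vseq n)) -(Kq_upper mT sT a0 hO hO1 hM u (Im_vseq n)) lerDl.
by rewrite mulr_ge0 ?sq_ge0// ltW.
Qed.

Lemma sqint_Fn n : sqint P (Fn n). Proof. exact: (sqint_upper mT sT a0 hO hO1 hM (Im_vseq n)). Qed.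

Lemma RI_sq_Fn u : exists c, forall n, RI P (fun w => sq (Fn n w *m u)) <= c.
Proof.
have [k k0 hk] := Kn_lower; have [C C0 hC] := mcvg_bounded mcvg_invSn.
exists (k^-1 * (alpha * ((g ^+ 2)^-1 * (C ^+ 2 * nm u ^+ 2)))) => n.
rewrite ler_pdivlMl// -RIZ; last first.
  by under eq_fun do rewrite -qf1; exact: rint_qfF (sqint_Fn n).
apply: le_trans (_ : _ <= RI P (fun w => qf (Kn n) (Fn n w *m u))) _.
  apply: RI_le.
  - by apply: rintZ; under eq_fun do rewrite -qf1; exact: rint_qfF (sqint_Fn n).
  - exact: rint_qfF (sqint_Fn n).
  - by apply: aeW => w; exact: hk.
apply: le_trans (RI_Fn u n) _; apply: ler_wpM2l; first exact: ltW.
rewrite (qf_Kmx hO1 (away_vseq n)); apply: le_trans (Kq_le hO1 (away_vseq n) _) _.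
apply: ler_wpM2l; first by rewrite invr_ge0 sqr_ge0.
apply: le_trans (sqM_le _ _) _; apply: ler_wpM2r; first exact: sqr_ge0.
by rewrite ler_pXn2r// nnegrE// nm_ge0.
Qed.

Lemma RI_nm_Fn : exists c, forall n, RI P (fun w => nm (Fn n w) ^+ 2) <= c.
Proof.
have [c hc] := choice (fun j : 'I_p => RI_sq_Fn (delta_mx j 0)).
exists ((p%:R * p%:R) ^+ 2 * \sum_j c j) => n.
have rs (j : 'I_p) : rint P (fun w => sq (Fn n w *m (delta_mx j 0 : 'cV_p))).
  by under eq_fun do rewrite -qf1; exact: rint_qfF (sqint_Fn n).
apply: le_trans (_ : _ <= RI P (fun w => (p%:R * p%:R) ^+ 2 * \sum_j sq (Fn n w *m (delta_mx j 0 : 'cV_p)))) _.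
  apply: RI_le; first by have [] := sqint_Fn n.
    by apply: rintZ; exact: rint_sum.
  by apply: aeW => w; exact: nm_le_cols.
rewrite RIZ; last exact: rint_sum.
apply: ler_wpM2l; first exact: sqr_ge0.
by rewrite RI_sum//; apply: ler_sum => j _; exact: hc.
Qed.

Lemma ae_Fn : {ae P, forall w, forall n, pert alpha (Mn n) (T w) \in unitmx}.
Proof. by apply/ae_foralln => n; have [] := hM (Im_vseq n). Qed.

Lemma mcvg_pert w : mcvg (fun n => pert alpha (Mn n) (T w)) (pert alpha M (T w)).
Proof.
apply: mcvgD; first exact: mcvg_cst.
by apply: mcvgZ; apply: mcvgM; [exact: mcvg_Sn|exact: mcvg_cst].
Qed.

(** If v is in the kernel, the vectors u_n = (1 + M_n T / alpha) v tend to 0, while F_n u_n = T v is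
    fixed and nonzero, so the norm of F_n tends to infinity. The uniform second moments of F_n and
    [fatou_not_infty] make this a null event. *)
Lemma ae_pert : {ae P, forall w, pert alpha M (T w) \in unitmx}.
Proof.
have [c hc] := RI_nm_Fn.
have := @fatou_not_infty _ _ _ P (fun n w => nm (Fn n w) ^+ 2) c _ _ hc.
move=> /(_ (fun n => (sqint_Fn n).2) (fun n w => sqr_ge0 _)).
apply: filterS2 ae_Fn => w uw; apply: contra_notT => /unitmx_kernel[v v0 hv].
have Tv0 : toC (T w) *m v != 0.
  apply/eqP => h; move: hv; rewrite /pert mulmxDl mul1mx -scalemxAl -mulmxA h mulmx0 scaler0 addr0.
  by move=> e; rewrite e eqxx in v0.
pose u n := pert alpha (Mn n) (T w) *m v.
have hu n : Fn n w *m u n = toC (T w) *m v by rewrite /u mulmxA (Gmx_mul (uw n)).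
have u0 : mcvg u 0 by rewrite -hv; apply: mcvgM; [exact: mcvg_pert|exact: mcvg_cst].
have nu : nm (u n) @[n --> \oo] --> (0 : R) by have := mcvg_nm u0; rewrite nm0.
have tp : 0 < nm (toC (T w) *m v).
  by rewrite lt_neqAle nm_ge0 andbT eq_sym; apply: contra_neq Tv0 => h; apply: nm_eq0; rewrite h.
have F0 n : 0 < nm (Fn n w).
  rewrite lt_neqAle nm_ge0 andbT eq_sym; apply/eqP => h.
  by move: tp; rewrite -(hu n) (nm_eq0 (A := Fn n w)) ?h// mul0mx nm0 ltxx.
apply: (@ger_cvgy _ _ _ _ (fun n => nm (Fn n w) - 1)).
  by apply: nearW => n; have := sqr_ge0 (nm (Fn n w) - 1 / 2); rewrite sqrrB; lra.
suff h : nm (Fn n w) @[n --> \oo] --> +oo%R.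
  apply/cvgryPge => A; move/cvgryPge: h => /(_ (A + 1)); apply: filterS => n; lra.
apply/gtr0_cvgV0; first exact: nearW.
apply: (cvg_squeeze0 (g := fun n => (nm (toC (T w) *m v))^-1 * nm (u n))) => [n|]; last exact: cvg0_scale.
rewrite subr0 ger0_norm ?invr_ge0 ?nm_ge0//.
rewrite ler_pdivlMl// ler_pdivrMr ?F0// mulrC -(hu n); exact: nmM.
Qed.

Lemma mcvg_Fn w : (forall n, pert alpha (Mn n) (T w) \in unitmx) -> pert alpha M (T w) \in unitmx ->
  mcvg (fun n => Fn n w) (F w).
Proof.
move=> un u; apply: mcvgM; first exact: mcvg_cst.
by apply: mcvg_invmx => //; exact: mcvg_pert.
Qed.

Lemma ae_mcvg_Fn : {ae P, forall w, mcvg (fun n => Fn n w) (F w)}.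
Proof. by apply: filterS2 ae_Fn ae_pert => w; exact: mcvg_Fn. Qed.

Lemma sqint_F : sqint P F.
Proof.
split; first exact: mmeas_Gmx.
have [c hc] := RI_nm_Fn.
have [] := @fatou_le _ _ _ P (fun n w => nm (Fn n w) ^+ 2) (fun w => nm (F w) ^+ 2) (fun=> c) c
  (fun n => (sqint_Fn n).2) (fun n w => sqr_ge0 _) _ _ hc _ => //.
- by apply: measurable_funX; apply: measurable_nm; exact: mmeas_Gmx.
- apply: filterS ae_mcvg_Fn => w h; exact: (cvgM (mcvg_nm h) (mcvg_nm h)).
- exact: cvg_cst.
Qed.

Lemma ae_herm_F : {ae P, forall w, (F w)^t* = F w}.
Proof. by apply: filterS2 sT ae_pert => w sw uw; exact: Gmx_herm (herm_S hO1 hx) uw. Qed.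

(* Imaginary part of the equation for [M] at x + i eta, divided by eta; Fatou's lemma
   only leaves an inequality in the limit eta -> 0. *)
Lemma RI_qf_F u : RI P (fun w => qf K0 (F w *m u)) <= alpha * qf K0 (invmx (- M) *m u).
Proof.
have [] := @fatou_le _ _ _ P (fun n w => qf (Kn n) (Fn n w *m u)) (fun w => qf K0 (F w *m u))
  (fun n => alpha * qf (Kn n) (invmx (Mn n) *m u)) (alpha * qf K0 (invmx (- M) *m u)) => //.
- by move=> n; exact: rint_qfF (sqint_Fn n).
- move=> n w; rewrite (qf_Kmx hO1 (away_vseq n)); exact: (Kq_ge0 hO1 (away_vseq n)).
- exact: rint_meas (rint_qfF K0 u sqint_F).
- apply: filterS ae_mcvg_Fn => w h; apply: mcvg_qf; first exact: mcvg_Kn.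
  by apply: mcvgM h _; exact: mcvg_cst.
- by move=> n; exact: RI_Fn.
have -> : qf K0 (invmx (- M) *m u) = qf K0 (invmx M *m u).
  by rewrite invS_opp mulNmx qfNv.
apply: cvgM; first exact: cvg_cst.
apply: mcvg_qf; first exact: mcvg_Kn.
by apply: mcvgM mcvg_invSn _; exact: mcvg_cst.
Qed.

(** Limit of the equation at [vseq x n]. The resolvent identity writes F_n - F as a product of F_n,
    M_n - M and F, so uniform second moments give convergence in mean at the rate of M_n - M. *)
Lemma MI_F : MI P F = (x%:C)%:M - invmx (- M).
Proof.
rewrite -invS_opp addrC.
have h1 : mcvg (fun n => MI P (Fn n)) (invmx M + (x%:C)%:M).
  have -> : (fun n => MI P (Fn n)) = (fun n => invmx (Mn n) + (vseq x n)%:M).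
    by apply/funext => n; exact: (MI_upper hM (Im_vseq n)).
  apply: mcvgD; first exact: mcvg_invSn.
  apply: (@mcvg_le _ _ _ _ _ (fun n => nm (1%:M : 'M[K]_p) * harmonic n)) => [n|].
    rewrite (_ : _ - _ = (vseq x n - x%:C) *: 1%:M); last by rewrite scalemx1 raddfB.
    by rewrite nmZ nc_vseq mulrC.
  by apply: cvg0_scale; exact: cvg_harmonic.
apply: (cvg_nm_eq _ h1) => {h1}.
have [c hc] := RI_nm_Fn; have [mF rF] := sqint_F.
have iF := sqint_mint sqint_F.
pose C := 2 * p%:R * p%:R * (alpha^-1 * (c + RI P (fun w => nm (F w) ^+ 2))).
apply: (@mcvg_le _ _ _ _ _ (fun n => C * nm (Mn n - M))) => [n|]; last first.
  by apply: cvg0_scale; exact: mcvg_Sn.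
have iFn := sqint_mint (sqint_Fn n).
have ia : 0 <= alpha^-1 by rewrite invr_ge0 ltW.
rewrite -MIB//; apply: le_trans (nm_MI (mintB iFn iF)) _.
rewrite /C -[leRHS]mulrA; apply: ler_wpM2l; first by rewrite !mulr_ge0.
have rb : rint P (fun w => nm (Fn n w) ^+ 2 + nm (F w) ^+ 2) by exact: (rintD (sqint_Fn n).2 rF).
apply: le_trans (_ : _ <= RI P (fun w => alpha^-1 * nm (Mn n - M) * (nm (Fn n w) ^+ 2 + nm (F w) ^+ 2))) _.
  apply: RI_le; [exact: mint_nm (mintB iFn iF)|exact: rintZ|].
  apply: filterS2 ae_Fn ae_pert => w un u.
  rewrite (Gmx_diff u (un n)) nmN nmZ nc_real (ger0_norm ia) -[leRHS]mulrA.
  apply: ler_wpM2l; first exact: ia.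
  apply: le_trans (nmM _ _) _; apply: le_trans (ler_wpM2r (nm_ge0 _) (nmM _ _)) _.
  rewrite mulrAC [X in _ <= X]mulrC; apply: ler_wpM2r; first exact: nm_ge0.
  by apply: ler_mul_sqr; exact: nm_ge0.
rewrite (RIZ _ rb) (RID (sqint_Fn n).2 rF) -!mulrA.
apply: ler_wpM2l; first exact: ia.
rewrite mulrC; apply: ler_wpM2r; first exact: nm_ge0.
by rewrite lerD2r; exact: hc.
Qed.
End RealAxis.

(** * The sign of h and the lower bound *)

Section TensorForm.
Context {R : realType}.
Local Notation K := R[i].

Definition vecC m n (V : 'M[K]_(m, n)) : 'cV[K]_(m * n) :=
  \col_k V (mxtens_unindex k).1 (mxtens_unindex k).2.
Definition unvecC m n (v : 'cV[K]_(m * n)) : 'M[K]_(m, n) :=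
  \matrix_(i, j) v (mxtens_index (i, j)) 0.

Lemma vecCE m n (V : 'M[K]_(m, n)) i j : vecC V (mxtens_index (i, j)) 0 = V i j.
Proof. by rewrite mxE mxtens_indexK. Qed.

Lemma unvecCK m n (v : 'cV[K]_(m * n)) : vecC (unvecC v) = v.
Proof.
by apply/colP => k; case: (mxtens_indexP k) => i j; rewrite vecCE mxE.
Qed.

Lemma tr_formE m n (V : 'M[K]_(m, n)) (A : 'M[K]_m) (B : 'M[K]_n) :
  \tr (V^t* *m A *m V *m B) =
  \sum_i \sum_j \sum_k \sum_l Num.conj (V i j) * A i k * V k l * B l j.
Proof.
rewrite /mxtrace.
transitivity (\sum_j \sum_l \sum_k \sum_i Num.conj (V i j) * A i k * V k l * B l j).
  apply: eq_bigr => j _; rewrite mxE; apply: eq_bigr => l _.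
  rewrite mxE mulr_suml; apply: eq_bigr => k _.
  rewrite mxE !mulr_suml; apply: eq_bigr => i _.
  by rewrite trmxCE.
rewrite [RHS]exchange_big; apply: eq_bigr => j _ /=.
rewrite [LHS]exchange_big [RHS]exchange_big; apply: eq_bigr => k _ /=.
by rewrite exchange_big.
Qed.

Lemma hf_tens m n (V : 'M[K]_(m, n)) (A : 'M[K]_m) (B : 'M[K]_n) :
  hf (A *t B) (vecC V) (vecC V) = \tr (V^t* *m A *m V *m B^T).
Proof.
rewrite hfE tr_formE sum_mxtens; apply: eq_bigr => i _; apply: eq_bigr => j _.
rewrite sum_mxtens; apply: eq_bigr => k _; apply: eq_bigr => l _.
by rewrite !vecCE tensmxE mxE; ring.
Qed.

Lemma sq_vecC m n (V : 'M[K]_(m, n)) : sq (vecC V) = Re (\tr (V^t* *m V)).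
Proof.
rewrite /sq sum_mxtens /mxtrace Re_sum exchange_big; apply: eq_bigr => j _ /=.
rewrite mxE Re_sum; apply: eq_bigr => i _.
by rewrite vecCE trmxCE mulcJ.
Qed.
End TensorForm.

Section TestMatrix.
Context {R : realType} {d : measure_display} {W : measurableType d}.
Variable P : probability W R.
Context {p r : nat}.
Local Notation K := R[i].
Variables (F : W -> 'M[K]_p) (C : W -> 'M[R]_r) (Q : 'M[K]_p) (x : R).
Hypotheses (p0 : (0 < p)%N) (r0 : (0 < r)%N).
Hypotheses (sF : sqint P F) (hF : {ae P, forall w, (F w)^t* = F w}).
Hypothesis EF : MI P F = (x%:C)%:M - Q.
Local Notation Bc := (fun w => toC (C w - 1%:M)).
Hypotheses (sB : sqint P Bc) (hB : {ae P, forall w, sym_mx (C w - 1%:M)}).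

Lemma symC : {ae P, forall w, sym_mx (C w)}.
Proof.
apply: filterS hB => w; rewrite /sym_mx linearB /= trmx1 => /(congr1 (+%R^~ 1%:M)).
by rewrite !subrK.
Qed.

Lemma sqint_C : sqint P (fun w => toC (C w)).
Proof.
have -> : (fun w => toC (C w)) = fun w => toC (C w - 1%:M) + 1%:M.
  by apply/funext => w; rewrite toCB toC1 subrK.
by apply: sqintD => //; exact: sqint_cst.
Qed.

Lemma mint_tens : mint P (fun w => F w *t toC (C w)).
Proof.
move=> k l; case: (mxtens_indexP k) => i j; case: (mxtens_indexP l) => i' j'.
have : mint P (fun w => (F w *m (delta_mx i' 0 : 'cV_p)) *m ((delta_mx 0 j : 'rV_r) *m toC (C w))).
  by apply: mint_mul; [exact: sqintMr|exact/sqintMl/sqint_C].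
move=> /(_ i j'); congr (cint _ _); apply/funext => w.
by rewrite tensmxE -colE -rowE mxE big_ord1 mxE [X in _ * X]mxE.
Qed.

Lemma RI_trB V : RI P (fun w => Re (\tr (V^t* *m F w *m V *m Bc w))) =
  qf (EmxC P (fun w => F w *t toC (C w))) (vecC V) - x * sq (vecC V) + Re (\tr (V^t* *m Q *m V)).
Proof.
have iF := sqint_mint sF.
have iV : mint P (fun w => V^t* *m F w *m V) by exact/mintMr/mintMl.
have rt := (cint_tr iV).1; have rq := rint_qf (vecC V) mint_tens.
rewrite EmxCE (qf_MI _ mint_tens).
have -> : RI P (fun w => Re (\tr (V^t* *m F w *m V *m Bc w))) =
    RI P (fun w => qf (F w *t toC (C w)) (vecC V) - Re (\tr (V^t* *m F w *m V))).
  apply: RI_eq.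
  - have sV : sqint P (fun w => V^t* *m F w *m V) by exact/sqintMr/sqintMl.
    exact: rint_meas (cint_tr (mint_mul sV sB)).1.
  - exact: rint_meas (rintB rq rt).
  apply: filterS symC => w sC.
  rewrite toCB toC1 mulmxBr mulmx1 linearB /= ReB; congr (_ - _).
  have sCC : (toC (C w))^T = toC (C w) by rewrite /toC map_trmx sC.
  by rewrite /qf hf_tens sCC.
rewrite (RIB rq rt) -addrA; congr (_ + _).
rewrite -[RI P (fun w => Re _)]/(Re (CI P (fun w => \tr (V^t* *m F w *m V)))) -(tr_MI iV).
rewrite MIMr ?MIMl ?EF//; last exact: mintMl.
rewrite mulmxBr mulmxBl linearB /= ReB opprB addrC sq_vecC; congr (_ - _).
by rewrite mul_mx_scalar -scalemxAl linearZ ReZ.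
Qed.

Lemma herm_tens : (EmxC P (fun w => F w *t toC (C w)))^t* = EmxC P (fun w => F w *t toC (C w)).
Proof.
rewrite !EmxCE -(MI_trmxC mint_tens); apply: MI_eq.
- exact: mint_meas (mint_trmxC mint_tens).
- exact: mint_meas mint_tens.
apply: filterS2 hF symC => w hw sC; apply/matrixP => k l; rewrite trmxCE.
case: (mxtens_indexP k) => i j; case: (mxtens_indexP l) => i' j'.
rewrite !tensmxE rmorphM -[in RHS]hw trmxCE; congr (_ * _).
by have := congr1 (fun A : 'M[K]_r => A j j') (trmxC_toC (C w)); rewrite /= trmxCE sC.
Qed.

(* Since [Q] = x - E F, the form of E[F (x) C] - x at [vecC V] is
   E Re tr (V^* F V B) - Re tr (V^* Q V). *)
Lemma h_gt0P :
  0 < lambda1 (EmxC P (fun w => F w *t toC (C w))) - x <->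
  exists V : 'M[K]_(p, r), Re (\tr (V^t* *m Q *m V)) <
    RI P (fun w => Re (\tr (V^t* *m F w *m V *m Bc w))).
Proof.
rewrite subr_gt0 (lambda1_gtP _ _ herm_tens) ?muln_gt0 ?p0//; split => [[v [v0 h]]|[V h]].
  by exists (unvecC v); rewrite RI_trB unvecCK; lra.
exists (vecC V); last by rewrite RI_trB in h; lra.
apply/eqP => V0; have {}V0 : V = 0.
  by apply/matrixP => i j; rewrite -vecCE V0 !mxE.
move: h; rewrite V0 trmxC0 !mul0mx linear0 /=.
under eq_fun do rewrite !mul0mx linear0 /=.
by rewrite RI0 ltxx.
Qed.
End TestMatrix.

(** * The lower bound on the threshold *)

Section LowerBound.
Context {R : realType} {d : measure_display} {W : measurableType d}.
Variable P : probability W R.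
Context {p r : nat}.
Local Notation K := R[i].
Variables (T : W -> 'M[R]_p) (alpha : R).
Hypotheses (mT : measurable_mx T) (sT : {ae P, forall w, sym_mx (T w)}) (a0 : 0 < alpha).
Variable Omega : set R -> 'M[K]_p.
Hypothesis hO : psd_measure Omega.
Hypothesis hO1 : Omega setT = 1%:M.
Local Notation S := (stieltjes Omega).
Hypothesis hM : forall z : K, 0 < Im z -> [/\ S z \in unitmx,
  {ae P, forall w, pert alpha (S z) (T w) \in unitmx}
  & invmx (S z) = - z%:M + EmxC P (fun w => Gmx alpha (S z) (T w))].
Variables (x g : R).
Hypothesis hx : below hO x g.
Local Notation M := (S x%:C).
Local Notation F := (fun w => Gmx alpha M (T w)).
Local Notation Q := (invmx (- M)).
Variable C : W -> 'M[R]_r.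
Local Notation Bc := (fun w => toC (C w - 1%:M)).
Hypotheses (p0 : (0 < p)%N) (r0 : (0 < r)%N).
Hypotheses (sB : sqint P Bc) (hB : {ae P, forall w, sym_mx (C w - 1%:M)}).
Hypothesis hne : (0 < P [set w | C w <> 1%:M])%E.
Local Notation rho := (opnorm_sym (calA P C)).

Lemma alpha_rho_gt1 :
  0 < lambda1 (EmxC P (fun w => F w *t toC (C w))) - x -> 1 < alpha * rho.
Proof.
have sF := sqint_F mT sT a0 hO1 hM hx.
have hF := ae_herm_F mT sT a0 hO1 hM hx.
have EF := MI_F mT sT a0 hO1 hM hx.
have pQ := pd_inv (pd_NS hO1 hx).
have rp := rho_gt0 sB hB hne.
move=> /(h_gt0P p0 r0 sF hF EF sB hB)[V hV].
have [k k0 hk] := pd_lower (pd_Kmx hO1 (below_awayR hx)).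
(* Scaling that makes V dominated by K and the identity: K >= k gives 1 <= K / k on one side, and
   the summand 1 takes care of the other side. *)
pose tau := nm V * (p%:R + r%:R) * (k^-1 + 1).
have n0 : 0 <= nm V * (p%:R + r%:R) :> R by rewrite mulr_ge0 ?nm_ge0// addr_ge0.
have k1 : 0 <= k^-1 by rewrite invr_ge0 ltW.
have t0 : 0 <= tau by rewrite mulr_ge0// addr_ge0.
pose Ps (n : nat) : 'M[K]_p := tau%:C *: Kmx Omega x%:C.
pose Rs n : 'M[K]_r := tau%:C *: toC (Rseq P C n).
have hPs n a : RI P (fun w => qf (Ps n) (F w *m (invmx Q *m a))) <= alpha * qf (Ps n.+1) a.
  under eq_fun do rewrite qfZ.
  rewrite RIZ; last exact: rint_qfF.
  rewrite qfZ mulrCA; apply: ler_wpM2l => //.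
  have := RI_qf_F mT sT a0 hO1 hM hx (invmx Q *m a).
  by rewrite mulmxA mulmxV ?mul1mx// pd_unit.
have hRs n b : RI P (fun w => qf (Rs n) (Bc w *m (invmx 1%:M *m b))) <= rho * qf (Rs n.+1) b.
  rewrite invmx1 mul1mx; under eq_fun do rewrite qfZ.
  rewrite RIZ; last exact: rint_qfF.
  by rewrite (Rseq_qf sB hB hne) qfZ mulrCA.
have uPs n a : qf (Ps n) a <= tau * (g ^+ 2)^-1 * sq a.
  rewrite qfZ -mulrA; apply: ler_wpM2l => //.
  by rewrite (qf_Kmx hO1 (below_awayR hx)); exact: (Kq_le hO1 (below_awayR hx)).
have uRs n b : qf (Rs n) b <= tau * @Rbound R r * sq b.
  by rewrite qfZ -mulrA; apply: ler_wpM2l => //; exact: (Rseq_bound sB hB hne).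
have dom : dominated V 1 (Ps 0%N) (Rs 0%N).
  move=> a b; rewrite mul1r /Ps /Rs !qfZ /Rseq /= toC1 qf1 -mulrDr.
  apply: le_trans (Re_bilinear_le V a b) _; rewrite /tau -[leRHS]mulrA; apply: ler_wpM2l => //.
  have := hk a; rewrite -(ler_pM2l (_ : 0 < k^-1)) ?invr_gt0// mulrA mulVf ?gt_eqF// mul1r => h1.
  have h2 := sq_ge0 a; have h3 := sq_ge0 b.
  have h4 : 0 <= qf (Kmx Omega x%:C) a by apply: le_trans (hk a); rewrite mulr_ge0// ltW.
  have h5 : 0 <= k^-1 * sq b by rewrite mulr_ge0.
  rewrite mulrDl mul1r mulrDr; lra.
have BcH : {ae P, forall w, (Bc w)^t* = Bc w} by exact: BcH hB.
have := trop_rayleigh sF sB hF BcH pQ (pd1 r) a0 rp hPs hRs uPs uRs dom.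
rewrite /trform mulmx1 => H.
have := lt_le_trans hV H; set t := Re _ => ht.
have t0' : 0 <= t by have := tr_psd_ge0 V (pd_psd pQ) (pd_psd (pd1 r)); rewrite mulmx1.
have tp : 0 < t by rewrite lt_neqAle t0' andbT eq_sym; apply/eqP => e; move: ht; rewrite e mulr0 ltxx.
rewrite -{1}(mul1r t) ltr_pM2r// in ht.
rewrite -(ltr_sqrt 1) ?sqrtr1//; exact: mulr_gt0.
Qed.
End LowerBound.

(** * The gap identity *)

(** With E = D and b = F + F D b, the left side is b D F = b - F. The right side is arranged so that
    both terms are positive as soon as D - D^2 >= 0 and 1 + b >= 0. *)
Lemma gap_alg (A : pzRingType) n (E F b : 'M[A]_n) :
  (F + F *m (E *m b)) *m (E *m F) =
  F *m (E - E *m E) *m F + F *m E *m (1%:M + b) *m (E *m F).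
Proof.
rewrite !(mulmxBr, mulmxBl, mulmxDr, mulmxDl, mulmx1, mulNmx, mulmxA).
by rewrite [RHS]addrA subrK.
Qed.

(** Shows E - E^2 >= 0 for 0 <= E <= 1 as a sum of two congruences, without diagonalizing E. *)
Lemma gap_alg2 (A : pzRingType) n (E : 'M[A]_n) :
  E - E *m E = E *m (1%:M - E) *m E + (1%:M - E) *m E *m (1%:M - E).
Proof.
rewrite !(mulmxBr, mulmxBl, mulmx1, mul1mx, mulmxA).
by rewrite [RHS]addrC subrK.
Qed.

Section Pathwise.
Context {R : realType} {p : nat}.
Local Notation K := R[i].
Variables (a : R) (M b : 'M[K]_p) (T : 'M[R]_p) (c : R).
Hypotheses (hM : M^t* = M) (hb : b^t* = b) (hc : forall v, c * sq v <= sq v + qf b v).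
Hypotheses (c0 : 0 < c) (c1 : c <= 1).
Hypothesis hT : toC T = 1%:M - invmx (1%:M + b).
Local Notation F := (Gmx a M T).
Local Notation D := (1%:M + (a^-1)%:C *: M).

Lemma pd_1b : pd (1%:M + b).
Proof.
split=> [|v v0]; first by rewrite trmxCD trmxC1 hb.
by rewrite qfD qf1; apply: lt_le_trans (hc v); rewrite mulr_gt0// sq_gt0.
Qed.

Lemma herm_D : D^t* = D. Proof. by rewrite trmxCD trmxC1 trmxCZr hM. Qed.

Lemma T1b : toC T *m (1%:M + b) = b.
Proof. by rewrite hT mulmxBl mul1mx mulVmx ?(pd_unit pd_1b)// addrC addKr. Qed.

Lemma pert_1Db : pert a M T *m (1%:M + b) = 1%:M + D *m b.
Proof.
rewrite /pert [LHS]mulmxDl mul1mx -scalemxAl -mulmxA T1b mulmxDl mul1mx -scalemxAl.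
by rewrite addrA.
Qed.

Lemma unit_pert : (pert a M T \in unitmx) = (1%:M + D *m b \in unitmx).
Proof. by rewrite -pert_1Db unitmx_mul (pd_unit pd_1b) andbT. Qed.

Lemma F_1Db : pert a M T \in unitmx -> F *m (1%:M + D *m b) = b.
Proof. by move=> u; rewrite -pert_1Db mulmxA (Gmx_mul u) T1b. Qed.

(* For T = 1 - (1 + b)^-1, F = T (1 + M T / a)^-1 solves F (1 + D b) = b. *)
Lemma gap_eq : F^t* = F -> pert a M T \in unitmx ->
  b - F = F^t* *m (D - D *m D) *m F + (D *m F)^t* *m (1%:M + b) *m (D *m F).
Proof.
move=> hF u; have e1 := F_1Db u.
have e2 : (1%:M + b *m D) *m F = b.
  have := congr1 (fun A : 'M[K]_p => A^t*) e1.
  by rewrite /= trmxCM trmxCD trmxC1 trmxCM hF hb herm_D.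
rewrite trmxCM hF herm_D.
rewrite mulmxDl mul1mx -mulmxA in e2; rewrite mulmxDr mulmx1 in e1.
have -> : b - F = b *m (D *m F) by rewrite -{1}e2 addrAC subrr add0r.
by rewrite -{1}e1 gap_alg.
Qed.

Lemma qf_gap u : F^t* = F -> pert a M T \in unitmx ->
  qf (b - F) u = qf (D - D *m D) (F *m u) + qf (1%:M + b) (D *m F *m u).
Proof. by move=> hF up; rewrite gap_eq// qfD !qf_congr. Qed.

Hypotheses (D0 : forall v, 0 <= qf D v) (N0 : forall v, 0 <= qf (1%:M - D) v).

Lemma qf_DDD v : qf (D - D *m D) v = qf (1%:M - D) (D *m v) + qf D ((1%:M - D) *m v).
Proof.
by rewrite -!qf_congr -qfD trmxCB trmxC1 herm_D -gap_alg2.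
Qed.

Lemma qf_DDD_ge0 v : 0 <= qf (D - D *m D) v.
Proof. by rewrite qf_DDD addr_ge0. Qed.

Lemma qf_gap_ge0 u : F^t* = F -> pert a M T \in unitmx -> 0 <= qf (b - F) u.
Proof.
move=> hF up; rewrite qf_gap// addr_ge0 ?qf_DDD_ge0//.
by rewrite qfD qf1; apply: le_trans (hc _); rewrite mulr_ge0 ?sq_ge0// ltW.
Qed.

(** If v = - D b v, put u = b v. Then v^* b v = - u^* D u and |v|^2 = u^* D^2 u, so c |v|^2 <= |v|^2
    + v^* b v = - u^* (D - D^2) u <= 0. *)
Lemma unit_1Db : 1%:M + D *m b \in unitmx.
Proof.
have [//|/unitmx_kernel[v v0]] := boolP (1%:M + D *m b \in unitmx); rewrite mulmxDl mul1mx -mulmxA => h.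
pose u := b *m v; have hv : v = - (D *m u) by apply/eqP; rewrite -addr_eq0 h.
have e1 : qf b v = - qf D u.
  rewrite /qf /hf -mulmxA -/u {1}hv trmxCN mulNmx mxE ReN; congr (- _).
  by rewrite trmxCM herm_D.
have e2 : sq v = qf (D *m D) u.
  by rewrite -qf1 hv qfNv -qf_congr mulmx1 herm_D.
have := hc v; rewrite e1 e2 => h1.
have h2 := qf_DDD_ge0 u; rewrite qfB in h2.
have : c * sq v <= 0 by rewrite e2; apply: le_trans h1 _; rewrite -oppr_ge0 opprB.
by rewrite pmulr_rle0// leNgt sq_gt0.
Qed.
End Pathwise.

Lemma nm_cols {R : realType} m n (A : 'M[R[i]]_(m, n)) k :
  (forall j, nm (A *m (delta_mx j 0 : 'cV_n)) <= k) -> nm A <= n%:R * k.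
Proof.
move=> h; rewrite /nm exchange_big /=.
apply: (@le_trans _ _ (\sum_(j < n) k)); last first.
  by rewrite sumr_const card_ord -[_ *+ n]mulr_natl.
apply: ler_sum => j _; apply: le_trans (h j).
by rewrite -colE nm_cV; apply: ler_sum => i _; rewrite mxE.
Qed.

Lemma nm_delta {R : realType} n (j : 'I_n) : nm (delta_mx j 0 : 'cV[R[i]]_n) = 1.
Proof.
rewrite nm_cV (bigD1 j)//= mxE !eqxx nc1 big1 ?addr0// => i ij.
by rewrite mxE (negbTE ij) nc0.
Qed.

Lemma nm_invmx_lower {R : realType} n (A : 'M[R[i]]_n) c : 0 < c -> A^t* = A ->
  (forall v, c * sq v <= qf A v) -> nm (invmx A) <= n%:R * (c^-1 * n%:R).
Proof.
move=> c0 hA h.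
have uA : A \in unitmx.
  by apply: pd_unit; split => // v v0; apply: lt_le_trans (h v); rewrite mulr_gt0// sq_gt0.
apply: nm_cols => j; set v := delta_mx j 0 : 'cV_n; set w := invmx A *m v.
have q : forall v w : 'cV_n, v = A *m w -> qf A w = Re (hf 1%:M v w).
  by move=> ? ? ->; rewrite /qf /hf trmxCM hA mulmx1.
have {}q := q v w (esym (mulKVmx uA v)).
have n1 : nc (hf 1%:M v w) <= nm w.
  rewrite /hf mulmx1; apply: le_trans (nm_entry _ 0 0) _; apply: le_trans (nmM _ _) _.
  by rewrite nm_trmxC nm_delta mul1r.
have h1 : c * sq w <= nm w.
  by apply: le_trans (h w) _; rewrite q; apply: le_trans n1; apply: le_trans (nc_Re _); exact: ler_norm.
have h2 := nm_le_sq w.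
have [w00|wp] := leP (nm w) 0.
  by apply: le_trans w00 _; rewrite mulr_ge0// invr_ge0 ltW.
rewrite ler_pdivlMl// -(ler_pM2r wp) -mulrA -expr2.
apply: le_trans (ler_wpM2l (ltW c0) h2) _.
by rewrite mulrCA ler_wpM2l.
Qed.

(** * Stability of the equation and continuation across the edge *)

Section Stability.
Context {R : realType} {p : nat}.
Local Notation K := R[i].

(** The resolvent identity bounds the difference by half the norm of the unknown F, which is
    absorbed on the left: |F| <= cF + |F| / 2. *)
Lemma nm_Gmx_near (a : R) (M M0 : 'M[K]_p) (T : 'M[R]_p) e cF : 0 < a ->
  pert a M T \in unitmx -> pert a M0 T \in unitmx ->
  nm (Gmx a M0 T) <= cF -> nm (M - M0) <= e -> a^-1 * (e * cF) <= 1 / 2 ->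
  nm (Gmx a M T) <= 2 * cF /\ nm (Gmx a M T - Gmx a M0 T) <= a^-1 * (2 * cF * e * cF).
Proof.
move=> a0 u u0 h0 he ha; have := Gmx_diff u0 u.
move: (Gmx a M T) (Gmx a M0 T) h0 => F F0 h0 hd.
have ai : 0 <= a^-1 by rewrite invr_ge0 ltW.
have step : nm (F - F0) <= a^-1 * (nm F * e * cF).
  rewrite hd nmN nmZ nc_real (ger0_norm ai); apply: ler_wpM2l => //.
  apply: le_trans (nmM _ _) _; apply: ler_pM; [exact: nm_ge0|exact: nm_ge0| |exact: h0].
  by apply: le_trans (nmM _ _) _; apply: ler_wpM2l; [exact: nm_ge0|].
have F2 : nm F <= 2 * cF.
  have : nm F <= nm F0 + nm (F - F0) by rewrite -{1}(subrK F0 F) addrC; exact: nmD.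
  have : a^-1 * (nm F * e * cF) <= nm F * (1 / 2).
    by rewrite -!mulrA [leLHS]mulrCA; apply: ler_wpM2l; [exact: nm_ge0|].
  move=> h1 h2; have h3 := le_trans h2 (lerD h0 (le_trans step h1)).
  move: (nm F) h3 => f; lra.
split=> //; apply: le_trans step _; apply: ler_wpM2l => //.
have e0 : 0 <= e by apply: le_trans he; exact: nm_ge0.
have c0 : 0 <= cF by apply: le_trans h0; exact: nm_ge0.
by apply: ler_wpM2r => //; apply: ler_wpM2r.
Qed.

Lemma qf_near (L A A0 : 'M[K]_p) v k e : nm A <= k -> nm A0 <= k -> nm (A - A0) <= e ->
  qf L (A *m v) <= qf L (A0 *m v) + p%:R * (2 * (k * nm L * e)) * sq v.
Proof.
move=> h h0 he; rewrite -lerBlDl -!qf_congr -qfB.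
apply: le_trans (ler_norm _) _; apply: le_trans (qf_le _ _) _.
apply: ler_wpM2r; first exact: sq_ge0.
apply: ler_wpM2l => //.
have -> : A^t* *m L *m A - A0^t* *m L *m A0 = (A - A0)^t* *m L *m A + A0^t* *m L *m (A - A0).
  by rewrite trmxCB mulmxBr !mulmxBl addrA subrK.
have k0 : 0 <= k by apply: le_trans h; exact: nm_ge0.
have e0 : 0 <= e by apply: le_trans he; exact: nm_ge0.
have L0 := nm_ge0 L.
apply: le_trans (nmD _ _) _; rewrite mulr_natl mulr2n; apply: lerD.
  apply: le_trans (nmM _ _) _; rewrite (_ : k * nm L * e = e * nm L * k); last by ring.
  apply: ler_pM => //; [exact: nm_ge0|exact: nm_ge0|].
  apply: le_trans (nmM _ _) _; apply: ler_wpM2r => //.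
  by rewrite nm_trmxC.
apply: le_trans (nmM _ _) _; apply: ler_pM => //; [exact: nm_ge0|exact: nm_ge0|].
apply: le_trans (nmM _ _) _; apply: ler_wpM2r => //.
by rewrite nm_trmxC.
Qed.

Lemma contraction (A1 th t0 x q : R) : 0 <= th < 1 ->
  (forall n, x <= (A1 / (1 - th) + th ^+ n * t0) * q) -> x <= A1 / (1 - th) * q.
Proof.
move=> /andP[th0 th1] h; apply: (@cvg_ge_lim _ (fun n => (A1 / (1 - th) + th ^+ n * t0) * q)) => //.
rewrite -[X in _ --> X * q]addr0 -[X in _ --> (_ + X) * q](mul0r t0).
apply: cvgM; last exact: cvg_cst.
apply: cvgD; first exact: cvg_cst.
apply: cvgM; last exact: cvg_cst.
by apply: cvg_expr; rewrite ger0_norm.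
Qed.
End Stability.

Section Continuation.
Context {R : realType} {d : measure_display} {W : measurableType d}.
Variable P : probability W R.
Context {p : nat}.
Local Notation K := R[i].
Variables (T : W -> 'M[R]_p) (alpha : R).
Hypotheses (mT : measurable_mx T) (sT : {ae P, forall w, sym_mx (T w)}) (a0 : 0 < alpha).
Variable Omega : set R -> 'M[K]_p.
Hypothesis hO : psd_measure Omega.
Hypothesis hO1 : Omega setT = 1%:M.
Local Notation S := (stieltjes Omega).
Hypothesis hM : forall z : K, 0 < Im z -> [/\ S z \in unitmx,
  {ae P, forall w, pert alpha (S z) (T w) \in unitmx}
  & invmx (S z) = - z%:M + EmxC P (fun w => Gmx alpha (S z) (T w))].
Variables (M0 L : 'M[K]_p) (th0 cF : R).
Local Notation F0 := (fun w => Gmx alpha M0 (T w)).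
Hypotheses (pL : pd L) (th01 : 0 <= th0 < 1) (cF0 : 0 < cF).
Hypothesis hp0 : {ae P, forall w, pert alpha M0 (T w) \in unitmx}.
Hypothesis hF0 : {ae P, forall w, nm (F0 w) <= cF}.
Hypothesis hL : forall v, RI P (fun w => qf L (F0 w *m (M0 *m v))) <= alpha * th0 * qf L v.

Lemma sqint_F0 : sqint P F0.
Proof. by apply: (sqint_bounded _ hF0); exact: mmeas_Gmx. Qed.

(* By the imaginary part of the equation, K = Im S / Im z satisfies
   alpha K = alpha S^* S + E[(F S)^* K (F S)]; near [M0] the second term is a
   contraction in the order defined by [L], which bounds [K] uniformly in [z]. *)
Lemma stable_ball : exists e c, [/\ 0 < e, 0 <= c &
  forall z : K, 0 < Im z -> nm (S z - M0) <= e -> forall v, Kq hO z v <= c * sq v].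
Proof.
have [l l0 hl] := pd_lower pL.
have /andP[t00 t01] := th01.
pose m0 := nm M0 + 1; have m01 : 1 <= m0 by rewrite lerDr nm_ge0.
have m00 : 0 <= m0 by exact: le_trans ler01 m01.
(* The contraction rate is relaxed halfway to 1; the difference to th0, measured through L >= l, is
   the room [gap] for the perturbation. *)
pose th1 := (1 + th0) / 2; have th11 : 0 <= th1 < 1 by rewrite /th1; apply/andP; split; lra.
pose k1 := alpha^-1 * (2 * cF * cF).
have ai : 0 <= alpha^-1 by rewrite invr_ge0 ltW.
have k10 : 0 <= k1 by rewrite mulr_ge0// !mulr_ge0// ltW.
pose k2 := k1 * m0 + cF.
have k20 : 0 <= k2 by rewrite addr_ge0 ?(ltW cF0)// mulr_ge0.
pose k3 := p%:R * (2 * (2 * cF * m0 * nm L * k2)).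
have k30 : 0 <= k3.
  by rewrite mulr_ge0// mulr_ge0// mulr_ge0// mulr_ge0 ?nm_ge0// !mulr_ge0// ltW.
pose gap := l * (alpha * (th1 - th0)).
have gap0 : 0 < gap by rewrite /gap mulr_gt0// mulr_gt0// /th1; lra.
(* The three constraints bound S by m0, make [nm_Gmx_near] applicable, and keep the perturbation of
   the L-form below [gap]. *)
pose e := Num.min 1 (Num.min (alpha / (2 * cF)) (gap / (k3 + 1))).
have k31 : 0 < k3 + 1 by rewrite ltr_wpDl.
have e0 : 0 < e by rewrite !lt_min ltr01 !divr_gt0// mulr_gt0.
have e1 : e <= 1 by rewrite ge_min lexx.
have e2 : alpha^-1 * (e * cF) <= 1 / 2.
  have : e <= alpha / (2 * cF) by rewrite !ge_min lexx orbT.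
  rewrite ler_pdivlMr ?mulr_gt0// => h; rewrite ler_pdivrMl//.
  by move: h; lra.
have e3 : k3 * e <= gap.
  have : e <= gap / (k3 + 1) by rewrite !ge_min lexx !orbT.
  rewrite ler_pdivlMr// => h; apply: le_trans h; rewrite mulrC; apply: ler_wpM2l; first exact: ltW.
  by rewrite lerDl.
pose A1 := m0 ^+ 2 * (p%:R * l^-1).
exists e, (A1 / (1 - th1) * (p%:R * nm L)); split => //.
  have /andP[_ th1lt] := th11.
  rewrite mulr_ge0 ?mulr_ge0 ?nm_ge0 ?sqr_ge0 ?invr_ge0 ?(ltW l0)//.
  by rewrite subr_ge0 ltW.
move=> z z0 hz.
have aw := away_im hO z0; have [uS uG _] := hM z0.
have sF := sqint_upper mT sT a0 hO hO1 hM z0.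
have nS : nm (S z) <= m0.
  rewrite -(subrK M0 (S z)) addrC; apply: le_trans (nmD _ _) _.
  by rewrite lerD2l; exact: le_trans hz e1.
have qL v : RI P (fun w => qf L (Gmx alpha (S z) (T w) *m (S z *m v))) <= alpha * th1 * qf L v.
  apply: le_trans (_ : RI P (fun w => qf L (F0 w *m (M0 *m v)) + k3 * e * sq v) <= _).
    have r0 := rint_qfF L (M0 *m v) sqint_F0.
    apply: RI_le; [exact: rint_qfF|exact: (rintD r0 (rint_cst _ _))|].
    apply: filterS2 uG (filterI hp0 hF0) => w uw [u0 hF].
    have [n1 n2] := nm_Gmx_near a0 uw u0 hF hz e2.
    move: (Gmx alpha (S z) (T w)) (Gmx alpha M0 (T w)) n1 n2 hF => G G0 n1 n2 hF.
    rewrite !mulmxA.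
    have -> : k3 * e = p%:R * (2 * (2 * cF * m0 * nm L * (k2 * e))) by rewrite /k3; ring.
    have c2 : cF <= 2 * cF by rewrite ler_peMl ?(ltW cF0)// ler1n.
    apply: qf_near.
    - by apply: le_trans (nmM _ _) _; apply: ler_pM => //; exact: nm_ge0.
    - apply: le_trans (nmM _ _) _; apply: ler_pM; [exact: nm_ge0|exact: nm_ge0|exact: le_trans hF c2|].
      by rewrite lerDl.
    have -> : G *m S z - G0 *m M0 = (G - G0) *m S z + G0 *m (S z - M0).
      by rewrite mulmxBl mulmxBr addrA subrK.
    apply: le_trans (nmD _ _) _; rewrite /k2 mulrDl; apply: lerD.
      apply: le_trans (nmM _ _) _; rewrite mulrAC; apply: ler_pM => //; [exact: nm_ge0|exact: nm_ge0|].
      by apply: le_trans n2 _; rewrite /k1 le_eqVlt; apply/orP; left; apply/eqP; ring.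
    by apply: le_trans (nmM _ _) _; apply: ler_pM => //; exact: nm_ge0.
  rewrite (RID (rint_qfF L (M0 *m v) sqint_F0) (rint_cst _ _)) RI_cst.
  apply: le_trans (lerD (hL v) (lexx _)) _.
  have h1 : k3 * e * sq v <= alpha * (th1 - th0) * qf L v.
    apply: le_trans (ler_wpM2r (sq_ge0 v) e3) _.
    rewrite /gap (mulrC l) -[leLHS]mulrA; apply: ler_wpM2l => //.
    by rewrite mulr_ge0 ?(ltW a0)// /th1; lra.
  apply: le_trans (lerD (lexx _) h1) _.
  by rewrite le_eqVlt; apply/orP; left; apply/eqP; ring.
have rec v : RI P (fun w => qf (Kmx Omega z) (Gmx alpha (S z) (T w) *m (S z *m v))) + alpha * sq (S z *m v) = alpha * Kq hO z v.
  by rewrite (Kq_upper mT sT a0 hO hO1 hM (S z *m v) z0) mulKmx.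
have sqS v : sq (S z *m v) <= A1 * qf L v.
  apply: le_trans (sqM_le _ _) _; rewrite /A1 -mulrA; apply: ler_pM; [exact: sqr_ge0|exact: sqr_ge0| |].
    by rewrite ler_pXn2r// nnegrE// nm_ge0.
  apply: le_trans (nm_le_sq _) _; rewrite -mulrA; apply: ler_wpM2l => //.
  by rewrite ler_pdivlMl.
have step t : 0 <= t -> (forall v, Kq hO z v <= t * qf L v) -> forall v, Kq hO z v <= (A1 + th1 * t) * qf L v.
  move=> t0 ht v; rewrite -(ler_pM2l a0) -rec.
  have h1 : RI P (fun w => qf (Kmx Omega z) (Gmx alpha (S z) (T w) *m (S z *m v))) <= t * (alpha * th1 * qf L v).
    apply: le_trans (_ : _ <= t * RI P (fun w => qf L (Gmx alpha (S z) (T w) *m (S z *m v)))) _; last exact: ler_wpM2l.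
    have r1 := rint_qfF L (S z *m v) sF.
    rewrite -(RIZ _ r1); apply: RI_le; [exact: rint_qfF|exact: rintZ|].
    by apply: aeW => w; rewrite (qf_Kmx hO1 aw); exact: ht.
  apply: le_trans (lerD h1 (ler_wpM2l (ltW a0) (sqS v))) _.
  by rewrite le_eqVlt; apply/orP; left; apply/eqP; ring.
move=> v; have /andP[th10 th1lt] := th11.
have d0 : 0 < 1 - th1 by rewrite subr_gt0.
have A10 : 0 <= A1 by rewrite mulr_ge0 ?sqr_ge0// mulr_ge0// invr_ge0 ltW.
(* A crude initial bound that depends on Im z. It is multiplied by th1 at each iteration and
   disappears in the limit, leaving the fixed point A1 / (1 - th1), which is uniform in z. *)
pose t0 := ((Im z) ^+ 2)^-1 * l^-1.
have t0p : 0 <= t0 by rewrite mulr_ge0 ?invr_ge0 ?sqr_ge0// ltW.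
have it n : forall v, Kq hO z v <= (A1 / (1 - th1) + th1 ^+ n * t0) * qf L v.
  elim: n => [|n IH] u.
    rewrite expr0 mul1r; apply: le_trans (Kq_le hO1 aw u) _.
    apply: (@le_trans _ _ (t0 * qf L u)).
      by rewrite /t0 -mulrA; apply: ler_wpM2l; [rewrite invr_ge0 sqr_ge0|rewrite ler_pdivlMl].
    apply: ler_wpM2r; last by rewrite lerDr divr_ge0// ltW.
    by apply: le_trans (hl u); rewrite mulr_ge0 ?sq_ge0// ltW.
  have := step _ (addr_ge0 (divr_ge0 A10 (ltW d0)) (mulr_ge0 (exprn_ge0 n th10) t0p)) IH u.
  move=> h; apply: le_trans h _; rewrite le_eqVlt; apply/orP; left; apply/eqP; rewrite exprS.
  by field; rewrite gt_eqF.
apply: le_trans (contraction th11 (it^~ v)) _; rewrite -[leRHS]mulrA.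
apply: ler_wpM2l; first by rewrite divr_ge0// ltW.
by apply: le_trans (ler_norm _) _; exact: qf_le.
Qed.
End Continuation.

Lemma nc_re_diff {R : realType} (x y eta : R) : nc ((x +i* eta) - (y +i* eta)) = `|x - y|.
Proof.
by rewrite -(sqrtr_sqr (x - y)) /nc /= subrr expr0n addr0.
Qed.

Lemma nc_im_diff {R : realType} (x eta eta' : R) : nc ((x +i* eta) - (x +i* eta')) = `|eta - eta'|.
Proof. by rewrite -(sqrtr_sqr (eta - eta')) /nc /= subrr expr0n add0r. Qed.

(** * Moving the edge of the support *)

Section EdgeBounds.
Context {R : realType} {p : nat}.
Local Notation K := R[i].
Variable Omega : set R -> 'M[K]_p.
Hypothesis hO : psd_measure Omega.
Hypothesis hO1 : Omega setT = 1%:M.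
Hypothesis p0 : (0 < p)%N.
Local Notation S := (stieltjes Omega).
Local Notation mu := (qmu hO).
Variables (M0 : 'M[K]_p) (e c : R).
Hypotheses (e0 : 0 < e) (c0 : 0 <= c).
Hypothesis good : forall z : K, 0 < Im z -> nm (S z - M0) <= e -> forall v, Kq hO z v <= c * sq v.

Let q := 4 * p%:R ^+ 2 * c.
Let q0 : 0 <= q. Proof. by rewrite !mulr_ge0 ?sqr_ge0. Qed.
(** Paths of length at most 2 del meet the length condition of [S_path]; the 1 in the denominator
    allows q = 0. *)
Let del := e / (8 * (q + 1)).
Let del0 : 0 < del. Proof. by rewrite divr_gt0// mulr_gt0// ltr_wpDl. Qed.
Let qdel t : t <= 2 * del -> 4 * p%:R ^+ 2 * (t * c) <= e / 4.
Proof.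
move=> ht; have h : 4 * p%:R ^+ 2 * (t * c) <= q * (2 * del).
  by rewrite (_ : _ * (t * c) = q * t); [exact: ler_wpM2l|rewrite /q; ring].
apply: le_trans h _; have q1 : 0 < q + 1 by rewrite ltr_wpDl.
have -> : q * (2 * del) = e / 4 * (q / (q + 1)) by rewrite /del; field; rewrite gt_eqF.
rewrite ler_piMr ?divr_ge0 ?(ltW e0)//.
by rewrite ler_pdivrMr// mul1r lerDl.
Qed.

(* A bounded Im S / Im z keeps [S] in the stable ball along paths, and leaves no mass
   under them. *)
Lemma extend_left x0 : (lambda_plus Omega <= x0%:E)%E ->
  (forall eps d, 0 < eps -> 0 < d ->
     exists x1, [/\ x0 < x1, x1 < x0 + d & nm (S x1%:C - M0) <= eps]) ->
  (lambda_plus Omega <= (x0 - del)%:E)%E.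
Proof.
move=> hl lim.
have e8 : 0 < e / 8 by rewrite divr_gt0.
have [x1 [x01 x1d hx1]] := lim _ _ e8 del0.
have [|g hg] := @below_lambda _ _ _ hO p0 x1.
  by apply: le_lt_trans hl _; rewrite lte_fin.
have g0 : 0 < g by have [] := hg.
pose r := 4 * p%:R ^+ 2 * (g ^+ 2)^-1.
have r0 : 0 <= r by rewrite mulr_ge0 ?invr_ge0 ?sqr_ge0// mulr_ge0 ?sqr_ge0.
have r1 : 0 < r + 1 by rewrite ltr_wpDl.
(* At heights below this one, the Lipschitz bound r above the gap at x1 keeps S within e / 8 of its
   real value. Horizontal paths to the left of x1 thus start within e / 4 of [M0]. *)
pose etab := e / 8 / (r + 1).
have etab0 : 0 < etab by rewrite divr_gt0.
have start eta : 0 < eta -> eta < etab -> nm (S (x1 +i* eta) - M0) <= e / 4.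
  move=> eta0 etal; have -> : e / 4 = e / 8 + e / 8 by field.
  apply: le_trans (nm_tri _ (S x1%:C) _) _; apply: lerD => //.
  apply: le_trans (nm_S_lip hO1 (below_away eta hg) (below_awayR hg)) _.
  have -> : nc ((x1 +i* eta) - x1%:C) = eta.
    by rewrite -[x1%:C]/(x1 +i* 0) nc_im_diff subr0 gtr0_norm.
  rewrite [eta * _]mulrC mulrA -/r; apply: le_trans (_ : r * etab <= _).
    by apply: ler_wpM2l => //; exact: ltW.
  rewrite /etab mulrA ler_pdivrMr// [r * _]mulrC; apply: ler_wpM2l; first exact: ltW.
  by rewrite lerDl.
have mass := @qmu_no_mass _ _ _ hO hO1 (x0 - del) x1 etab c etab0 _ _.
apply: (null_lambda_plus p0 (hO := hO)) => v.
have A0 : mu v `]x0 - del, x1[%classic = 0%E.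
  apply: mass => [|x eta /andP[xa xb] /andP[ea eb] u].
    by apply: lt_trans x01; rewrite ltrBlDr ltrDl.
  have i1 : 0 < Im (x1 +i* eta) by [].
  have i2 : 0 < Im (x +i* eta) by [].
  apply: (S_path hO1 e0 c0 i1 i2 good (start _ ea eb)).
  apply: qdel; rewrite nc_re_diff distrC gtr0_norm ?subr_gt0//.
  by rewrite mulr_natl mulr2n lerBlDr; move: x1d xa; lra.
have B0 := lambda_plus_null hO p0 hl v.
apply/eqP; rewrite eq_le measure_ge0 andbT.
apply: (@le_trans _ _ (mu v (`]x0 - del, x1[%classic `|` `]x0, +oo[%classic))).
  apply: le_measure; rewrite ?inE; [exact: measurable_itv|by apply: measurableU; exact: measurable_itv|].
  move=> l /=; rewrite !in_itv /= !andbT => h.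
  by case: (ltP l x1) => h1; [left; rewrite h|right; exact: lt_le_trans h1].
apply: le_trans (measureU2 _ _ _) _; try exact: measurable_itv.
have hA : (mu v `](x0 - del)%R, x1[%classic <= 0)%E by rewrite A0.
have hB : (mu v `]x0, +oo[%classic <= 0)%E by rewrite B0.
by apply: le_trans (leeD hA hB) _; rewrite adde0.
Qed.

(** Far to the right S is close to 0 at height del by [S_far]. Vertical paths going down from there
    stay in the stable ball around 0, so no mass lies beyond X. *)
Lemma lambda_plus_bounded : M0 = 0 -> exists X, (lambda_plus Omega <= X%:E)%E.
Proof.
move=> M00; have e4 : 0 < e / 4 by rewrite divr_gt0.
have [X hX] := S_far hO hO1 del0 e4; exists X.
have mass n v : mu v `]X, X + n.+1%:R[%classic = 0%E.
  apply: (@qmu_no_mass _ _ _ hO hO1 X (X + n.+1%:R) del c del0) => [|x eta /andP[xa xb] /andP[ea eb] u].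
    by rewrite ltrDl ltr0n.
  have i1 : 0 < Im (x +i* del) by [].
  have i2 : 0 < Im (x +i* eta) by [].
  apply: (S_path hO1 e0 c0 i1 i2 good).
    by rewrite M00 subr0; apply: hX; exact: ltW.
  apply: qdel; rewrite nc_im_diff distrC gtr0_norm ?subr_gt0//.
  by move: ea eb del0; lra.
apply: (null_lambda_plus p0 (hO := hO)) => v.
have mI n : measurable (`]X, X + n.+1%:R[%classic : set R) by exact: measurable_itv.
have mU : measurable (\bigcup_n (`]X, X + n.+1%:R[%classic : set R)) by exact: bigcup_measurable.
apply/eqP; rewrite eq_le measure_ge0 andbT.
apply: (@le_trans _ _ (mu v (\bigcup_n (`]X, X + n.+1%:R[%classic)))).
  apply: le_measure; rewrite ?inE//.
  move=> l /=; rewrite in_itv /= andbT => Xl.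
  have l0 : 0 <= l - X by rewrite subr_ge0 ltW.
  have /andP[_ h] := truncn_itv l0.
  by exists (Num.truncn (l - X)) => //=; rewrite in_itv /= Xl -ltrBlDl.
apply: le_trans (measure_sigma_subadditive _ mI mU (@subset_refl _ _)) _.
by rewrite eseries0.
Qed.
End EdgeBounds.

(** * The optimal preprocessing map *)

Lemma Re_tr_sub_scalar {R : realType} n (E A : 'M[R[i]]_n) (a : R) :
  Re (\tr (E *m (A - (a%:C)%:M))) = Re (\tr (E *m A)) - a * Re (\tr E).
Proof. by rewrite mulmxBr linearB /= mul_mx_scalar linearZ /= ReB ReZ. Qed.

Lemma sq_mul {R : realType} m n (X : 'M[R[i]]_(m, n)) v : sq (X *m v) = qf (X^t* *m X) v.
Proof. by rewrite -qf1 -qf_congr mulmx1. Qed.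

(** From A <= A^2 / ... in the form t A^2 <= A, which is the hypothesis at A v, and from (1 - t A)^2
    >= 0. *)
Lemma qf_inv_le {R : realType} n (A : 'M[R[i]]_n) t : 0 < t -> A^t* = A -> A \in unitmx ->
  (forall v, t * sq v <= qf (invmx A) v) -> forall v, qf A v <= t^-1 * sq v.
Proof.
move=> t0 hA uA h v; rewrite ler_pdivlMl//.
have e1 : qf (invmx A) (A *m v) = qf A v by rewrite -qf_congr hA mulmxKV.
have := h (A *m v); rewrite e1 => h1.
have := sq_ge0 ((1%:M - t%:C *: A) *m v).
rewrite sq_mul trmxCB trmxC1 trmxCZr hA.
rewrite mulmxBl mul1mx mulmxBr mulmx1 -scalemxAr -scalemxAl !qfB !qfZ qf1.
have -> : qf (A *m A) v = sq (A *m v) by rewrite sq_mul hA.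
move: (qf A v) (sq v) (sq (A *m v)) h1 => q s u h1 h2.
have := ler_wpM2l (ltW t0) h1; lra.
Qed.

Section Optimal.
Context {R : realType} {d : measure_display} {W : measurableType d}.
Variable P : probability W R.
Context {p : nat}.
Local Notation K := R[i].
Variables (T : W -> 'M[R]_p) (alpha : R).
Hypotheses (mT : measurable_mx T) (sT : {ae P, forall w, sym_mx (T w)}) (a0 : 0 < alpha).
Variable Omega : set R -> 'M[K]_p.
Hypothesis hO : psd_measure Omega.
Hypothesis hO1 : Omega setT = 1%:M.
Hypothesis p0 : (0 < p)%N.
Local Notation S := (stieltjes Omega).
Hypothesis hM : forall z : K, 0 < Im z -> [/\ S z \in unitmx,
  {ae P, forall w, pert alpha (S z) (T w) \in unitmx}
  & invmx (S z) = - z%:M + EmxC P (fun w => Gmx alpha (S z) (T w))].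
Variables (b : W -> 'M[K]_p) (c : R).
Hypotheses (c0 : 0 < c) (c1 : c <= 1).
Hypothesis sb : sqint P b.
Hypothesis Eb : MI P b = 0.
Hypothesis hb : {ae P, forall w, (b w)^t* = b w}.
Hypothesis hbc : {ae P, forall w, forall v, c * sq v <= sq v + qf (b w) v}.
Hypothesis hT : {ae P, forall w, toC (T w) = 1%:M - invmx (1%:M + b w)}.

Local Notation F x := (fun w => Gmx alpha (S x%:C) (T w)).
Local Notation Q x := (invmx (- S x%:C)).
Local Notation D x := (1%:M + (alpha^-1)%:C *: S x%:C).
Local Notation J x := (fun w => b w - F x w).

Section RightOfSupport.
Variables (x g : R).
Hypothesis hx : below hO x g.

Lemma ae_gap : {ae P, forall w, [/\ (b w)^t* = b w, (F x w)^t* = F x w,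
  pert alpha (S x%:C) (T w) \in unitmx, toC (T w) = 1%:M - invmx (1%:M + b w)
  & forall v, c * sq v <= sq v + qf (b w) v]}.
Proof.
have h1 := ae_herm_F mT sT a0 hO1 hM hx; have h2 := ae_pert mT sT a0 hO1 hM hx.
by apply: filterS2 (filterI hb (filterI h1 h2)) (filterI hT hbc) => w [? [? ?]] [? ?]; split.
Qed.

Lemma sqint_J : sqint P (J x).
Proof. by apply: sqintB => //; exact: (sqint_F mT sT a0 hO1 hM hx). Qed.

Lemma MI_J : MI P (J x) = Q x - (x%:C)%:M.
Proof.
rewrite MIB ?Eb; [|exact: sqint_mint|exact: (sqint_mint (sqint_F mT sT a0 hO1 hM hx))].
by rewrite (MI_F mT sT a0 hO1 hM hx) sub0r opprB.
Qed.

Lemma qf_D v : qf (D x) v = sq v - alpha^-1 * qf (- S x%:C) v.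
Proof. by rewrite qfD qf1 qfZ qfN mulrN opprK. Qed.

(** The hypothesis says D >= 0, hence 0 <= D <= 1 and b - F >= 0 almost surely; the mean of b - F is
    Q - x. *)
Lemma qf_Q_lower v : (forall v, alpha^-1 * qf (- S x%:C) v <= sq v) -> x * sq v <= qf (Q x) v.
Proof.
move=> hN.
have : 0 <= qf (MI P (J x)) v.
  rewrite qf_MI; last exact: sqint_mint sqint_J.
  apply: RI_ge0; first exact: rint_qf (sqint_mint sqint_J).
  apply: filterS ae_gap => w [bw Fw uw Tw cw].
  apply: (qf_gap_ge0 (a := alpha) (M := S x%:C) (herm_S hO1 hx) bw cw c0 Tw) => // u.
    by rewrite qf_D subr_ge0.
  rewrite qfB qf_D qf1 opprB addrC subrK mulr_ge0 ?invr_ge0 ?(ltW a0)//.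
  by have /pd_psd/psdE[_ ->] := pd_NS hO1 hx.
by rewrite MI_J qfB qf_scalar subr_ge0.
Qed.

End RightOfSupport.

Lemma below_shift x y g : x <= y -> below hO x g -> below hO y g.
Proof.
by move=> xy [g0 h]; split=> // v; apply: filterS (h v) => l hl; apply: le_trans hl _; rewrite lerD2r.
Qed.

Lemma NS_lip x g y y' v : below hO x g -> x <= y' -> y' <= y ->
  qf (- S y'%:C) v <= qf (- S y%:C) v + (y - y') * (g ^+ 2)^-1 * sq v.
Proof.
move=> hx xy' yy'.
have h' := below_awayR (below_shift xy' hx); have h := below_awayR (below_shift (le_trans xy' yy') hx).
have := hf_stieltjes_sub hO1 v h h' ltr01.
rewrite invr1 !mul1r -raddfB nc_real ger0_norm ?subr_ge0// => H.
rewrite -lerBlDl -qfB opprK addrC; apply: le_trans (ler_norm _) _.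
apply: le_trans (nc_Re _) _; apply: le_trans H _; rewrite -mulrA.
apply: ler_wpM2l; first by rewrite subr_ge0.
have := Kq_le hO1 h v; have := Kq_le hO1 h' v.
by move: (Kq _ _ _) (Kq _ _ _) (_ * sq v) => k1 k2 q; lra.
Qed.

(* The bound -S(x) <= 1/x improves on the hypothesis -S(x) <= alpha of [qf_Q_lower],
   so that it propagates from +oo down to x in steps of fixed length. *)
Lemma NS_bound x g v : below hO x g -> 1 < alpha * x -> qf (- S x%:C) v <= x^-1 * sq v.
Proof.
move=> hx ax; have g0 : 0 < g by have [] := hx.
have x0 : 0 < x by rewrite -(pmulr_rgt0 x a0); apply: lt_trans ax.
have ai : 0 < alpha^-1 by rewrite invr_gt0.
have drop y : x <= y -> (forall v, alpha^-1 * qf (- S y%:C) v <= sq v) ->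
    forall v, qf (- S y%:C) v <= x^-1 * sq v.
  move=> xy h u; have hy := below_shift xy hx; have [hA _] := pd_NS hO1 hy.
  have y0 : 0 < y by exact: lt_le_trans xy.
  apply: le_trans (qf_inv_le y0 hA (pd_unit (pd_NS hO1 hy)) (fun v => qf_Q_lower hy v h) u) _.
  by apply: ler_wpM2r; [exact: sq_ge0|rewrite lef_pV2].
(* del / g^2 = alpha - 1 / x is the room between the improved bound and the hypothesis, and a step
   of length del to the left raises - S by at most del / g^2. *)
pose del := (1 - (alpha * x)^-1) * alpha * g ^+ 2.
have del0 : 0 < del.
  by rewrite /del !mulr_gt0 ?exprn_gt0// subr_gt0 invf_lt1// (lt_trans _ ax).
have back n : (forall v, alpha^-1 * qf (- S (x + n%:R * del)%:C) v <= sq v) ->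
    forall v, alpha^-1 * qf (- S x%:C) v <= sq v.
  elim: n => [|n IH] h; first by move: h; rewrite mul0r addr0.
  apply: IH => u.
  have n1 : x <= x + n%:R * del by rewrite lerDl mulr_ge0// ltW.
  have n2 : x + n%:R * del <= x + n.+1%:R * del by rewrite lerD2l ler_wpM2r ?(ltW del0)// ler_nat.
  have h1 := NS_lip u hx n1 n2.
  have h2 := drop _ (le_trans n1 n2) h u.
  rewrite (ler_pdivrMl _ _ a0); apply: le_trans (le_trans h1 (lerD h2 (lexx _))) _.
  have -> : alpha * sq u = x^-1 * sq u + (x + n.+1%:R * del - (x + n%:R * del)) / g ^+ 2 * sq u.
    by move: (sq u) => s; rewrite -natr1 /del; field; rewrite !gt_eqF.
  exact: lexx.
(* The descent starts where - S <= 1 / (n del + g) <= alpha holds because the support is far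
   away. *)
apply: (drop x (lexx x)); apply: (back (Num.truncn (alpha * del)^-1).+1) => u.
set n := _.+1.
have hn : (alpha * del)^-1 < n%:R.
  have i0 : 0 <= (alpha * del)^-1 by rewrite invr_ge0 ltW// mulr_gt0.
  by have /andP[] := truncn_itv i0.
have n1 : x <= x + n%:R * del by rewrite lerDl mulr_ge0// ltW.
have hy := below_le n1 hx; have := NS_le_inv hO1 u hy.
rewrite addrC addrK => h.
rewrite (ler_pdivrMl _ _ a0); apply: le_trans h _; apply: ler_wpM2r; first exact: sq_ge0.
have d1 : 0 < n%:R * del + g by rewrite ltr_wpDl// mulr_ge0// ltW.
rewrite -[leLHS]mul1r ler_pdivrMr// mulrDr ler_wpDr ?mulr_ge0 ?(ltW a0) ?(ltW g0)//.
have ad : 0 < alpha * del := mulr_gt0 a0 del0.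
move: (ltW hn); rewrite -[leLHS]mul1r (ler_pdivrMr _ _ ad) => h1.
by rewrite mulrCA.
Qed.

Local Notation gain x X := (RI P (fun w => Re (\tr (X^t* *m F x w *m X *m b w))) - Re (\tr (X^t* *m Q x *m X))).

Lemma gap_FDb x g : below hO x g -> {ae P, forall w, F x w *m D x *m b w = J x w}.
Proof.
move=> hx; apply: filterS (ae_gap hx) => w [bw Fw uw Tw cw].
have := F_1Db bw cw c0 Tw uw; rewrite mulmxDr mulmx1 mulmxA => {2}<-.
by rewrite addrAC subrr add0r.
Qed.

(* F D b = b - F has mean Q - x, as b has mean 0. *)
Lemma gain_D x g : below hO x g -> gain x (D x) = (alpha^-1 - x) * Re (\tr (D x)).
Proof.
move=> hx; have hD : (D x)^t* = D x by apply: herm_D; exact: herm_S hx.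
have sJ := sqint_J hx; have iJ := sqint_mint sJ.
have sF := sqint_F mT sT a0 hO1 hM hx.
have -> : RI P (fun w => Re (\tr ((D x)^t* *m F x w *m D x *m b w))) = RI P (fun w => Re (\tr (D x *m J x w))).
  apply: RI_eq.
  - exact: rint_meas (rint_tr sF sb (D x) (D x)).
  - exact: rint_meas (cint_tr (mintMl (D x) iJ)).1.
  by apply: filterS (gap_FDb hx) => w <-; rewrite hD !mulmxA.
rewrite -[RI P _]/(Re (CI P (fun w => \tr (D x *m J x w)))) -(tr_MI (mintMl (D x) iJ)).
rewrite MIMl// (MI_J hx) hD -mulmxA.
have -> : Q x *m D x = Q x - (alpha^-1)%:C%:M.
  have qs : Q x *m S x%:C = - 1%:M.
    by apply: oppr_inj; rewrite -mulmxN mulVmx ?opprK// (pd_unit (pd_NS hO1 hx)).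
  by rewrite mulmxDr mulmx1 -scalemxAr qs scalerN scalemx1.
have aux (t s : R) : t - x * s - (t - alpha^-1 * s) = (alpha^-1 - x) * s by ring.
by rewrite !Re_tr_sub_scalar; exact: aux.
Qed.
End Optimal.

Lemma le_limit {R : realType} (a b k : R) : 0 <= k -> (forall t, 0 < t -> a <= b + t * k) -> a <= b.
Proof.
move=> k0 h; rewrite leNgt; apply/negP => ab.
have k1 : 0 < 2 * (k + 1) by rewrite mulr_gt0// ltr_wpDl.
have /h : 0 < (a - b) / (2 * (k + 1)) by rewrite divr_gt0// subr_gt0.
have : (a - b) / (2 * (k + 1)) * k <= (a - b) / 2.
  rewrite mulrAC ler_pdivrMr// -mulrA ler_wpM2l ?subr_ge0 ?ltW//; lra.
lra.
Qed.

Lemma mxtrace_qf {R : realType} n (A : 'M[R[i]]_n) : Re (\tr A) = \sum_i qf A (delta_mx i 0).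
Proof. by rewrite /mxtrace Re_sum; apply: eq_bigr => i _; rewrite /qf hf_delta. Qed.

Lemma tr_le_shift {R : realType} n (A B : 'M[R[i]]_n) s :
  (forall i, qf A (delta_mx i 0) <= qf B (delta_mx i 0) + s) ->
  Re (\tr A) <= Re (\tr B) + n%:R * s.
Proof.
move=> h; rewrite (mxtrace_qf A) (mxtrace_qf B).
have -> : n%:R * s = \sum_(i < n) s by rewrite sumr_const card_ord mulr_natl.
by rewrite -big_split; apply: ler_sum => i _; exact: h.
Qed.

Lemma tr_1D_shift {R : realType} n (a s : R) (A B : 'M[R[i]]_n) : 0 <= a ->
  (forall v, qf (- B) v <= qf (- A) v + s * sq v) ->
  Re (\tr (1%:M + a%:C *: A)) <= Re (\tr (1%:M + a%:C *: B)) + n%:R * (a * s).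
Proof.
move=> a0 h; apply: tr_le_shift => j; rewrite !qfD !qf1 !qfZ sq_delta.
have := h (delta_mx j 0); rewrite !qfN sq_delta mulr1.
move: (qf A _) (qf B _) => x y {}h; have := ler_wpM2l a0 h.
by rewrite mulrDr !mulrN; lra.
Qed.

Lemma psd_tr0 {R : realType} n (A : 'M[R[i]]_n) : A^t* = A -> (forall v, 0 <= qf A v) ->
  Re (\tr A) <= 0 -> A = 0.
Proof.
move=> hA A0; rewrite mxtrace_qf => h.
apply/matrixP => i j; have : A *m (delta_mx j 0 : 'cV_n) = 0.
  apply: psd_kernel; first exact/psdE.
  by apply: le_trans h; rewrite (bigD1 j)//= lerDl sumr_ge0.
by move=> /matrixP/(_ i 0); rewrite -colE !mxE.
Qed.

Lemma Re_tr_sqr_gt0 {R : realType} m n (X : 'M[R[i]]_(m, n)) : X != 0 -> 0 < Re (\tr (X^t* *m X)).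
Proof.
move=> X0; rewrite -sq_vecC; apply: sq_gt0; apply: contra_neq X0 => h.
by apply/matrixP => i j; rewrite -vecCE h !mxE.
Qed.

Section Attained.
Context {R : realType} {d : measure_display} {W : measurableType d}.
Variable P : probability W R.
Context {p : nat}.
Local Notation K := R[i].
Variables (T : W -> 'M[R]_p) (alpha : R).
Hypotheses (mT : measurable_mx T) (sT : {ae P, forall w, sym_mx (T w)}) (a0 : 0 < alpha).
Variable Omega : set R -> 'M[K]_p.
Hypothesis hO : psd_measure Omega.
Hypothesis hO1 : Omega setT = 1%:M.
Hypothesis p0 : (0 < p)%N.
Local Notation S := (stieltjes Omega).
Hypothesis hM : forall z : K, 0 < Im z -> [/\ S z \in unitmx,
  {ae P, forall w, pert alpha (S z) (T w) \in unitmx}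
  & invmx (S z) = - z%:M + EmxC P (fun w => Gmx alpha (S z) (T w))].
Variables (b : W -> 'M[K]_p) (c : R).
Hypotheses (c0 : 0 < c) (c1 : c <= 1).
Hypothesis sb : sqint P b.
Hypothesis Eb : MI P b = 0.
Hypothesis hb : {ae P, forall w, (b w)^t* = b w}.
Hypothesis hbc : {ae P, forall w, forall v, c * sq v <= sq v + qf (b w) v}.
Hypothesis hT : {ae P, forall w, toC (T w) = 1%:M - invmx (1%:M + b w)}.
Variables (H : 'M[K]_p) (rho : R).
Hypotheses (pH : pd H) (hH : MI P (fun w => b w *m H *m b w) = rho%:C *: H).
Hypothesis ar : 1 < alpha * rho.

Local Notation F x := (fun w => Gmx alpha (S x%:C) (T w)).
Local Notation Q x := (invmx (- S x%:C)).
Local Notation D x := (1%:M + (alpha^-1)%:C *: S x%:C).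
Local Notation gain x X := (RI P (fun w => Re (\tr (X^t* *m F x w *m X *m b w))) - Re (\tr (X^t* *m Q x *m X))).

Lemma pd_neq0 : H != 0.
Proof.
apply/eqP => h; have [_ /(_ (delta_mx (Ordinal p0) 0))] := pH.
rewrite h /qf /hf mulmx0 mul0mx mxE ltxx => /(_ _); suff /[swap]/[apply] : (delta_mx (Ordinal p0) 0 : 'cV[K]_p) != 0 by [].
by apply/eqP => /matrixP/(_ (Ordinal p0) 0); rewrite !mxE !eqxx => /eqP; rewrite oner_eq0.
Qed.

(* When D = 0, F = b, and the gain at [H] is (rho - 1/alpha) |H|^2. *)
Lemma gain_degenerate x g : below hO x g -> x = alpha^-1 -> D x = 0 -> 0 < gain x H.
Proof.
move=> hx xE hD; have hHH : H^t* = H by case: pH.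
have sF := sqint_F mT sT a0 hO1 hM hx.
have ib : mint P (fun w => b w *m H *m b w) by apply: mint_mul => //; exact: sqintMr.
have -> : RI P (fun w => Re (\tr (H^t* *m F x w *m H *m b w))) = RI P (fun w => Re (\tr (H *m (b w *m H *m b w)))).
  apply: RI_eq.
  - exact: rint_meas (rint_tr sF sb H H).
  - exact: rint_meas (cint_tr (mintMl H ib)).1.
  apply: filterS (ae_gap mT sT a0 hO1 hM hb hbc hT hx) => w [bw Fw uw Tw cw].
  have := F_1Db bw cw c0 Tw uw; rewrite hD mul0mx addr0 mulmx1 => ->.
  by rewrite hHH !mulmxA.
rewrite -[RI P _]/(Re (CI P (fun w => \tr (H *m (b w *m H *m b w))))) -(tr_MI (mintMl H ib)) MIMl// hH.
have NS : - S x%:C = (alpha%:C)%:M.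
  apply/eqP; rewrite eq_sym -subr_eq0 opprK; apply/eqP.
  have : alpha%:C *: D x = 0 by rewrite hD scaler0.
  rewrite scalerDr scalemx1 scalerA -rmorphM mulfV ?gt_eqF// scale1r => <-.
  by [].
have QE : Q x = (alpha^-1)%:C%:M.
  by rewrite NS invmx_scalar invc_real.
have e1 : Re (\tr (H *m (rho%:C *: H))) = rho * Re (\tr (H^t* *m H)).
  by rewrite -scalemxAr linearZ /= ReZ hHH.
have e2 : Re (\tr (H^t* *m Q x *m H)) = alpha^-1 * Re (\tr (H^t* *m H)).
  by rewrite QE mul_mx_scalar -scalemxAl linearZ /= ReZ.
rewrite e1 e2 -mulrBl.
apply: mulr_gt0; last by rewrite Re_tr_sqr_gt0// pd_neq0.
by rewrite subr_gt0 -[alpha^-1]mul1r ltr_pdivrMr// mulrC.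
Qed.

(** At x0 = 1 / alpha the gain of D vanishes. If tr D(x0) > 0, moving slightly to the left makes
    both factors of [gain_D] positive; otherwise D(x0) = 0, being positive, and H is used at x0
    itself. *)
Lemma gain_right_edge : (lambda_plus Omega < (alpha^-1)%:E)%E ->
  exists x g X, [/\ below hO x g, (lambda_plus Omega < x%:E)%E & 0 < gain x X].
Proof.
move=> hl; have [y [ly yx0]] := ereal_between hl.
set x0 := alpha^-1 in hl yx0 *; pose x1 := (y + x0) / 2.
have yx1 : y < x1 by rewrite /x1; lra.
have x10 : x1 < x0 by rewrite /x1; lra.
have lx x : x1 <= x -> (lambda_plus Omega < x%:E)%E.
  by move=> h; apply: le_lt_trans ly _; rewrite lte_fin; exact: lt_le_trans yx1 h.
have [g hx1] := below_lambda hO p0 (lx x1 (lexx _)).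
have hx0 : below hO x0 g by apply: below_shift hx1; exact: ltW.
have g2 : 0 <= (g ^+ 2)^-1 by rewrite invr_ge0 sqr_ge0.
have x00 : 0 < x0 by rewrite invr_gt0.
(* [NS_bound] requires alpha x > 1, so the bound at x0 is obtained as a limit from the right. *)
have N1 v : alpha^-1 * qf (- S x0%:C) v <= sq v.
  rewrite (ler_pdivrMl _ _ a0); apply: (@le_limit _ _ _ ((g ^+ 2)^-1 * sq v)).
    by rewrite mulr_ge0 ?sq_ge0.
  move=> t t0; have xt : x0 <= x0 + t by rewrite lerDl ltW.
  have h1 := NS_lip hO1 v hx1 (ltW x10) xt.
  have ax : 1 < alpha * (x0 + t) by rewrite mulrDr mulfV ?gt_eqF// ltrDl mulr_gt0.
  have h2 := NS_bound mT sT a0 hO1 hM c0 sb Eb hb hbc hT v (below_shift xt hx0) ax.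
  apply: le_trans h1 _; rewrite addrAC subrr add0r mulrA lerD2r; apply: le_trans h2 _.
  apply: ler_wpM2r; first exact: sq_ge0.
  by rewrite -[alpha]invrK lef_pV2 ?posrE// addr_gt0.
have hD : (D x0)^t* = D x0 by apply: herm_D; exact: (herm_S hO1 hx0).
have D0 v : 0 <= qf (D x0) v by rewrite qf_D subr_ge0.
have [t0|tp] := leP (Re (\tr (D x0))) 0.
  exists x0, g, H; split => //.
  by apply: (gain_degenerate hx0) => //; exact: psd_tr0.
pose k := alpha^-1 * (g ^+ 2)^-1 * p%:R.
have k0 : 0 <= k by rewrite !mulr_ge0// invr_ge0 ltW.
(* The shift remains to the right of x1, where the gap g is available, and costs less than tr D(x0)
   because the trace is Lipschitz with constant k. *)
pose t := Num.min (x0 - x1) (Re (\tr (D x0)) / (2 * (k + 1))).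
have k1 : 0 < 2 * (k + 1) by rewrite mulr_gt0// ltr_wpDl.
have t0 : 0 < t by rewrite lt_min subr_gt0 x10 divr_gt0.
have tx : x1 <= x0 - t by rewrite lerBrDr -lerBrDl ge_min lexx.
have tk : t * k < Re (\tr (D x0)).
  have : t <= Re (\tr (D x0)) / (2 * (k + 1)) by rewrite ge_min lexx orbT.
  rewrite ler_pdivlMr// => h; apply: lt_le_trans h.
  rewrite mulrC [ltRHS]mulrC ltr_pM2r//; move: k0; lra.
exists (x0 - t), g, (D (x0 - t)); have hx := below_shift tx hx1.
split => //; first exact: lx.
rewrite (gain_D mT sT a0 hO1 hM c0 sb Eb hb hbc hT hx).
apply: mulr_gt0; first by rewrite opprB addrCA subrr addr0.
have : Re (\tr (D x0)) - t * k <= Re (\tr (D (x0 - t))).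
  rewrite lerBlDr.
  have -> : t * k = p%:R * (x0 * (t * (g ^+ 2)^-1)) by rewrite /k /x0; ring.
  have xt : x0 - t <= x0 by rewrite lerBlDr lerDl ltW.
  apply: tr_1D_shift => [|v]; first exact: ltW.
  have := NS_lip hO1 v hx1 tx xt.
  by rewrite opprB addrCA subrr addr0.
by apply: lt_le_trans; rewrite subr_gt0.
Qed.
End Attained.

Lemma diag_kernel {R : realType} n m (d : 'I_n -> R) (Z : 'M[R[i]]_(n, m)) :
  diag_mx (\row_i (d i)%:C) *m Z = 0 -> diag_mx (\row_i ((d i == 0)%:R : R)%:C) *m Z = Z.
Proof.
move=> h; apply/matrixP => i j; have /matrixP/(_ i j) := h.
rewrite !mul_diag_mx !mxE => /eqP; rewrite mulf_eq0 => /orP[di|/eqP ->]; last by rewrite mulr0.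
have -> : d i == 0 by move: di; rewrite fmorph_eq0.
by rewrite mul1r.
Qed.

Lemma invmx_eigen {R : realType} n m (A : 'M[R[i]]_n) (X : 'M[R[i]]_(n, m)) (a : R) : A \in unitmx -> a != 0 ->
  A *m X = a%:C *: X -> invmx A *m X = (a^-1)%:C *: X.
Proof.
move=> uA a0 h; apply: (can_inj (mulKmx uA)).
by rewrite mulKVmx// -scalemxAr h scalerA -rmorphM mulVf// scale1r.
Qed.

Lemma psd_congr {R : realType} n (H Pi : 'M[R[i]]_n) : psd H -> psd (Pi^t* *m H *m Pi).
Proof.
case/psdE=> hH H0; apply/psdE; split=> [|v]; last by rewrite qf_congr.
by rewrite !trmxCM trmxCK hH mulmxA.
Qed.

Lemma shifted_mul_eq {R : realType} n m (F b D : 'M[R[i]]_n) (X : 'M[R[i]]_(n, m)) :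
  (1%:M + b *m D) *m F = b -> D *m F *m X = 0 -> F *m X = b *m X.
Proof.
by move=> e h; rewrite -[in RHS]e mulmxDl mul1mx mulmxDl -!mulmxA (mulmxA D) h mulmx0 addr0.
Qed.

Lemma tr_rot {R : realType} n (F X : 'M[R[i]]_n) :
  Re (\tr (F *m X *m F *m X)) = Re (\tr (X *m F *m X *m F)).
Proof. by rewrite mxtrace_mulC !mulmxA. Qed.

Lemma kernel_proj {R : realType} n (A : 'M[R[i]]_n) : A^t* = A ->
  exists Pi : 'M[R[i]]_n, [/\ Pi^t* = Pi, A *m Pi = 0 &
    forall m (Y : 'M[R[i]]_(n, m)), A *m Y = 0 -> Pi *m Y = Y].
Proof.
move=> hA; have [U [d [h1 h2 hd]]] := spectral hA.
pose e (i : 'I_n) : R := (d i == 0)%:R.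
pose E : 'M[R[i]]_n := diag_mx (\row_i (e i)%:C).
exists (U^t* *m E *m U); split.
- rewrite !trmxCM trmxCK mulmxA; congr (_ *m _ *m _).
  apply/matrixP => i j; rewrite trmxCE !mxE eq_sym.
  by case: eqP => [->|]; rewrite ?mulr1n ?mulr0n ?conj_realC ?rmorph0.
- rewrite hd -!mulmxA (mulmxA U) h1 mul1mx (mulmxA (diag_mx _)) mulmx_diag.
  rewrite (_ : \row_j _ = 0) ?linear0 ?mul0mx ?mulmx0//.
  apply/rowP => j; rewrite !mxE -rmorphM /e.
  by case: eqP => [->|_]; rewrite ?mul0r ?mulr0.
- move=> m Y; rewrite hd -!mulmxA => h.
  have {}h : diag_mx (\row_i (d i)%:C) *m (U *m Y) = 0.
    by rewrite -[LHS]mul1mx -h1 -mulmxA h mulmx0.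
  by rewrite (diag_kernel h) mulmxA h2 mul1mx.
Qed.

Lemma RI_ae_eq0 {R : realType} {d : measure_display} {W : measurableType d}
    (mu : {measure set W -> \bar R}) (f : W -> R) : rint mu f ->
  {ae mu, forall w, 0 <= f w} -> RI mu f <= 0 -> {ae mu, forall w, f w = 0}.
Proof.
move=> rf f0 h; have e : RI mu (fun w => `|f w|) = RI mu f.
  apply: RI_eq; [exact: rint_meas (rint_abs rf)|exact: rint_meas rf|].
  by apply: filterS f0 => w h0; rewrite ger0_norm.
have := RI_eq0 (rint_abs rf) (fun w => normr_ge0 (f w)); rewrite e => /(_ h).
by apply: filterS => w /eqP; rewrite normr_eq0 => /eqP.
Qed.

(** * The limit of the equation at the edge *)

Section EdgeLimit.
Context {R : realType} {d : measure_display} {W : measurableType d}.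
Variable P : probability W R.
Context {p : nat}.
Local Notation K := R[i].
Variables (T : W -> 'M[R]_p) (alpha : R).
Hypotheses (mT : measurable_mx T) (sT : {ae P, forall w, sym_mx (T w)}) (a0 : 0 < alpha).
Variable Omega : set R -> 'M[K]_p.
Hypothesis hO : psd_measure Omega.
Hypothesis hO1 : Omega setT = 1%:M.
Local Notation S := (stieltjes Omega).
Hypothesis hM : forall z : K, 0 < Im z -> [/\ S z \in unitmx,
  {ae P, forall w, pert alpha (S z) (T w) \in unitmx}
  & invmx (S z) = - z%:M + EmxC P (fun w => Gmx alpha (S z) (T w))].
Variables (b : W -> 'M[K]_p) (c : R).
Hypotheses (c0 : 0 < c) (c1 : c <= 1).
Hypothesis sb : sqint P b.
Hypothesis Eb : MI P b = 0.
Hypothesis hb : {ae P, forall w, (b w)^t* = b w}.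
Hypothesis hbc : {ae P, forall w, forall v, c * sq v <= sq v + qf (b w) v}.
Hypothesis hT : {ae P, forall w, toC (T w) = 1%:M - invmx (1%:M + b w)}.
Variables (xs gs : nat -> R) (x0 : R) (M0 : 'M[K]_p).
Hypothesis hxs : forall n, below hO (xs n) (gs n).
Hypothesis xs_lim : xs n @[n --> \oo] --> x0.
Hypothesis xs_gt : forall n, 1 < alpha * xs n.
Hypothesis S_lim : mcvg (fun n => S (xs n)%:C) M0.
Hypothesis pB : pd (- M0).
Local Notation D := (1%:M + (alpha^-1)%:C *: M0).
Hypothesis D0 : forall v, 0 <= qf D v.
Hypothesis ax0 : alpha^-1 <= x0.

Local Notation Fn n := (fun w => Gmx alpha (S (xs n)%:C) (T w)).
Local Notation Qn n := (invmx (- S (xs n)%:C)).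
Local Notation F := (fun w => Gmx alpha M0 (T w)).
Local Notation Q := (invmx (- M0)).

Lemma herm_M0 : M0^t* = M0.
Proof. by have [h _] := pB; apply: oppr_inj; rewrite -trmxCN. Qed.

Lemma N0_ge0 v : 0 <= qf (1%:M - D) v.
Proof.
rewrite opprD addrA subrr add0r -scalerN qfZ mulr_ge0 ?invr_ge0 ?(ltW a0)//.
by have /pd_psd/psdE[_ ->] := pB.
Qed.

Definition regular w := [/\ (b w)^t* = b w, (F w)^t* = F w,
  pert alpha M0 (T w) \in unitmx, toC (T w) = 1%:M - invmx (1%:M + b w)
  & forall v, c * sq v <= sq v + qf (b w) v].

(** [M0] is only a limit of values of S, with no gap behind it, so [ae_pert] does not apply;
    invertibility comes from 0 <= D <= 1 through [unit_1Db]. *)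
Lemma ae_regular : {ae P, forall w, regular w}.
Proof.
apply: filterS2 (filterI hb sT) (filterI hT hbc) => w [bw sw] [Tw cw].
have u : pert alpha M0 (T w) \in unitmx.
  by rewrite (unit_pert alpha M0 bw cw c0 Tw); exact: (unit_1Db herm_M0 cw c0 D0 N0_ge0).
by split => //; exact: Gmx_herm herm_M0 u.
Qed.

Lemma ae_seq : {ae P, forall w, forall n, (Fn n w)^t* = Fn n w /\ pert alpha (S (xs n)%:C) (T w) \in unitmx}.
Proof.
apply/ae_foralln => n; apply: filterS (ae_gap mT sT a0 hO1 hM hb hbc hT (hxs n)) => w.
by case.
Qed.

Lemma ae_Fn_lim : {ae P, forall w, mcvg (fun n => Fn n w) (F w)}.
Proof.
apply: filterS2 ae_regular ae_seq => w [_ _ u _ _] hn.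
apply: mcvgM; first exact: mcvg_cst.
apply: mcvg_invmx; [by move=> n; have [] := hn n|exact: u|].
apply: mcvgD; first exact: mcvg_cst.
by apply: mcvgZ; apply: mcvgM; [exact: S_lim|exact: mcvg_cst].
Qed.

Lemma mcvg_Qn : mcvg (fun n => Qn n) Q.
Proof.
apply: mcvg_invmx; [|exact: pd_unit|exact: mcvgN].
by move=> n; exact: pd_unit (pd_NS hO1 (hxs n)).
Qed.

Lemma qf_gap_limit w u : regular w ->
  qf (b w - F w) u = qf (D - D *m D) (F w *m u) + qf (1%:M + b w) (D *m F w *m u).
Proof. by move=> [bw Fw uw Tw cw]; exact: (qf_gap herm_M0 bw cw c0 Tw u Fw uw). Qed.

Lemma qf_gap_limit_ge0 w u : regular w -> 0 <= qf (b w - F w) u.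
Proof. by move=> [bw Fw uw Tw cw]; exact: (qf_gap_ge0 herm_M0 bw cw c0 Tw D0 N0_ge0 u Fw uw). Qed.

Lemma gap_n_ge0 n : {ae P, forall w, forall u, 0 <= qf (b w - Fn n w) u}.
Proof.
apply: filterS (ae_gap mT sT a0 hO1 hM hb hbc hT (hxs n)) => w [bw Fw uw Tw cw] u.
have hN v := NS_bound mT sT a0 hO1 hM c0 sb Eb hb hbc hT v (hxs n) (xs_gt n).
apply: (qf_gap_ge0 (herm_S hO1 (hxs n)) bw cw c0 Tw _ _ u Fw uw) => v.
  rewrite qf_D subr_ge0 (ler_pdivrMl _ _ a0); apply: le_trans (hN v) _.
  apply: ler_wpM2r; first exact: sq_ge0.
  have xp : 0 < xs n by rewrite -(pmulr_rgt0 _ a0); exact: lt_trans ltr01 (xs_gt n).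
  by rewrite -[leLHS]mul1r ler_pdivrMr// ltW.
rewrite opprD addrA subrr add0r -scalerN qfZ mulr_ge0 ?invr_ge0 ?(ltW a0)//.
by have /pd_psd/psdE[_ ->] := pd_NS hO1 (hxs n).
Qed.

(** Fatou's lemma for the nonnegative forms of b - F_n, whose mean is Q_n - x_n. Absolute values are
    taken because nonnegativity holds only almost surely, while [fatou_le] requires it
    everywhere. *)
Lemma gap_limit u : rint P (fun w => qf (b w - F w) u) /\
  RI P (fun w => qf (b w - F w) u) <= qf Q u - x0 * sq u.
Proof.
have sJ n := sqint_J mT sT a0 hO1 hM sb (hxs n).
have rJ n : rint P (fun w => qf (b w - Fn n w) u) by exact: rint_qf (sqint_mint (sJ n)).
have mF : mmeas (fun w => b w - F w) by apply: mmeasB; [case: sb|exact: mmeas_Gmx].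
have mq : measurable_fun [set: W] (fun w => qf (b w - F w) u).
  have : mmeas (fun w => u^t* *m (b w - F w) *m u).
    by apply: mmeasM; [apply: mmeasM => //; exact: mmeas_cst|exact: mmeas_cst].
  by move=> /(_ 0 0)[].
have [||||r h] := @fatou_le _ _ _ P (fun n w => `|qf (b w - Fn n w) u|) (fun w => `|qf (b w - F w) u|)
  (fun n => qf (Qn n) u - xs n * sq u) (qf Q u - x0 * sq u) (fun n => rint_abs (rJ n)) (fun n w => normr_ge0 _).
- exact: measurableT_comp.
- apply: filterS ae_Fn_lim => w h; apply: cvg_norm; apply: mcvg_qf; last exact: mcvg_cst.
  by apply: mcvgD; [exact: mcvg_cst|exact: mcvgN].
- move=> n; have -> : RI P (fun w => `|qf (b w - Fn n w) u|) = RI P (fun w => qf (b w - Fn n w) u).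
    apply: RI_eq; [exact: rint_meas (rint_abs (rJ n))|exact: rint_meas (rJ n)|].
    by apply: filterS (gap_n_ge0 n) => w h; rewrite ger0_norm.
  rewrite -(qf_MI _ (sqint_mint (sJ n))) (MI_J mT sT a0 hO1 hM sb Eb (hxs n)).
  by rewrite qfB qf_scalar.
- apply: cvgB; first by apply: mcvg_qf; [exact: mcvg_Qn|exact: mcvg_cst].
  by apply: cvgM => //; exact: cvg_cst.
have rF : rint P (fun w => qf (b w - F w) u) by apply: (rint_dom mq r); exact: aeW.
split=> //; apply: le_trans h; apply: RI_le => //.
by apply: aeW => w; exact: ler_norm.
Qed.

Variables (H : 'M[K]_p) (rho : R).
Hypotheses (pH : pd H) (hH : MI P (fun w => b w *m H *m b w) = rho%:C *: H).
Hypothesis ar : 1 < alpha * rho.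

(* On the kernel of D the gap inequality at the edge is saturated, which makes b commute
   with the projection Pi; then Pi H Pi is an eigenvector of X |-> E[b X b] for rho > 1/alpha,
   against E tr (F X F X) <= alpha tr (X Q X Q). *)
Section KernelProjection.
Variable Pi : 'M[K]_p.
Hypotheses (hPi : Pi^t* = Pi) (DPi : D *m Pi = 0)
  (PiY : forall m (Y : 'M[K]_(p, m)), D *m Y = 0 -> Pi *m Y = Y).

Lemma Q_Pi : Q *m Pi = (alpha^-1)%:C *: Pi.
Proof.
have h : - M0 *m Pi = alpha%:C *: Pi.
  have : alpha%:C *: (D *m Pi) = 0 by rewrite DPi scaler0.
  rewrite mulmxDl mul1mx scalerDr -scalemxAl scalerA -rmorphM mulfV ?gt_eqF// scale1r => /eqP.
  by rewrite addr_eq0 -mulNmx => /eqP ->.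
by apply: invmx_eigen => //; [exact: pd_unit|rewrite gt_eqF].
Qed.

(** On the kernel of D, Q = 1 / alpha, so the mean of the gap is at most 1 / alpha - x0 <= 0 and the
    gap vanishes almost surely. Since 1 + b >= c this forces D F Pi = 0, hence F Pi = b Pi; so b
    preserves the kernel of D and, being Hermitian, commutes with Pi. *)
Lemma ae_Pi : {ae P, forall w, regular w /\ F w *m Pi = b w *m Pi /\
  Pi *m b w = b w *m Pi}.
Proof.
have z (j : 'I_p) : {ae P, forall w, qf (b w - F w) (Pi *m (delta_mx j 0 : 'cV_p)) = 0}.
  have [r h] := gap_limit (Pi *m (delta_mx j 0 : 'cV_p)).
  apply: RI_ae_eq0 r _ _.
    by apply: filterS ae_regular => w hw; exact: qf_gap_limit_ge0.
  apply: le_trans h _; set u := Pi *m _.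
  have -> : qf Q u = alpha^-1 * sq u.
    have Qu : Q *m u = (alpha^-1)%:C *: u by rewrite /u mulmxA Q_Pi scalemxAl.
    by rewrite /qf /hf -mulmxA Qu -scalemxAr mxE sqE ReZ.
  by rewrite -mulrBl mulr_le0_ge0 ?sq_ge0// subr_le0.
apply: filterS2 ae_regular (ae_fin z) => w hw hz; split=> //.
have [bw Fw uw Tw cw] := hw.
have DF : D *m F w *m Pi = 0.
  apply/matrixP => i j; have : D *m F w *m (Pi *m (delta_mx j 0 : 'cV_p)) = 0.
    have := hz j; rewrite (qf_gap_limit _ hw); set u := Pi *m _ => e.
    have h1 := qf_DDD_ge0 herm_M0 D0 N0_ge0 (F w *m u).
    have h2 : c * sq (D *m F w *m u) <= qf (1%:M + b w) (D *m F w *m u) by rewrite qfD qf1.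
    apply: sq_eq0; rewrite -(pmulr_rle0 _ c0); apply: le_trans h2 _.
    by rewrite -e lerDr.
  by rewrite mulmxA -colE => /matrixP/(_ i 0); rewrite !mxE.
have e1 := F_1Db bw cw c0 Tw uw.
have e2 : (1%:M + b w *m D) *m F w = b w.
  have := congr1 (fun A : 'M[K]_p => A^t*) e1.
  by rewrite /= trmxCM trmxCD trmxC1 trmxCM Fw bw (herm_D alpha herm_M0).
have FPi : F w *m Pi = b w *m Pi.
  exact: (shifted_mul_eq e2 DF).
have bPi : Pi *m (b w *m Pi) = b w *m Pi by apply: PiY; rewrite -FPi mulmxA DF.
have Pib : Pi *m b w = b w *m Pi.
  have := congr1 (fun A : 'M[K]_p => A^t*) bPi.
  by rewrite /= !trmxCM hPi bw -mulmxA bPi => <-.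
by split.
Qed.

(** For X = Pi H Pi, [trop_rayleigh] with F in both roles gives E tr (F X F X) <= alpha tr (X Q X Q)
    along the sequence, and Fatou's lemma passes to the limit. There F X = b X and Q X = X / alpha,
    so rho tr X^2 <= tr X^2 / alpha, which alpha rho > 1 allows only for X = 0. *)
Lemma Pi_eq0 : Pi *m H *m Pi = 0.
Proof.
set X := Pi *m H *m Pi; have hHH : H^t* = H by case: pH.
have hX : X^t* = X by rewrite /X !trmxCM hPi hHH mulmxA.
have psX : psd X.
  by rewrite /X -{1}hPi; exact: psd_congr (pd_psd pH).
have sFn n := sqint_F mT sT a0 hO1 hM (hxs n).
have ib : mint P (fun w => b w *m H *m b w) by apply: mint_mul => //; exact: sqintMr.
have ibX : mint P (fun w => b w *m X *m b w) by apply: mint_mul => //; exact: sqintMr.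
have EX : MI P (fun w => b w *m X *m b w) = rho%:C *: X.
  rewrite (_ : rho%:C *: X = Pi *m (rho%:C *: H) *m Pi); last by rewrite -scalemxAr -scalemxAl.
  rewrite -hH -MIMl// -MIMr; last exact: mintMl.
  apply: MI_eq; [exact: mint_meas|exact: mint_meas (mintMr _ (mintMl _ ib))|].
  apply: filterS ae_Pi => w [_ [_ e]].
  by rewrite /X !mulmxA e -!mulmxA e.
pose f n w := Re (\tr ((Fn n w)^t* *m X *m Fn n w *m X)).
have f0 n w : 0 <= f n w by exact: tr_psd_ge0.
have iFX n : mint P (fun w => (Fn n w)^t* *m X *m Fn n w).
  by apply: mint_mul => //; apply: sqintMr; exact: sqint_trmxC.
have rf n : rint P (f n) by exact: (cint_tr (mintMr X (iFX n))).1.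
have bound n : RI P (f n) <= alpha * Re (\tr (X *m Qn n *m X *m Qn n)).
  have pQ := pd_inv (pd_NS hO1 (hxs n)).
  have hF := ae_herm_F mT sT a0 hO1 hM (hxs n).
  have [k k0 hk] := pd_lower (pd_Kmx hO1 (below_awayR (hxs n))).
  pose tau := nm X * (p%:R + p%:R) * k^-1.
  have n0 : 0 <= nm X * (p%:R + p%:R) :> R by rewrite mulr_ge0 ?nm_ge0// addr_ge0.
  have t0 : 0 <= tau by rewrite mulr_ge0// invr_ge0 ltW.
  pose Ps (m : nat) : 'M[K]_p := tau%:C *: Kmx Omega (xs n)%:C.
  have hPs m a : RI P (fun w => qf (Ps m) (Fn n w *m (invmx (Qn n) *m a))) <= alpha * qf (Ps m.+1) a.
    under eq_fun do rewrite qfZ.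
    rewrite RIZ; last exact: rint_qfF.
    rewrite qfZ mulrCA; apply: ler_wpM2l => //.
    have := RI_qf_F mT sT a0 hO1 hM (hxs n) (invmx (Qn n) *m a).
    by rewrite [Qn n *m (_ *m _)]mulmxA mulmxV ?mul1mx// pd_unit.
  have uPs m a : qf (Ps m) a <= tau * (gs n ^+ 2)^-1 * sq a.
    rewrite qfZ -mulrA; apply: ler_wpM2l => //.
    by rewrite (qf_Kmx hO1 (below_awayR (hxs n))); exact: (Kq_le hO1 (below_awayR (hxs n))).
  have dom : dominated X 1 (Ps 0%N) (Ps 0%N).
    move=> a e; rewrite mul1r /Ps !qfZ -mulrDr.
    apply: le_trans (Re_bilinear_le X a e) _; rewrite /tau -[leRHS]mulrA; apply: ler_wpM2l => //.
    by rewrite ler_pdivlMl// mulrDr lerD.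
  have := trop_rayleigh (sFn n) (sFn n) hF hF pQ pQ a0 a0 hPs hPs uPs uPs dom.
  have sa : Num.sqrt (alpha * alpha) = alpha by rewrite -expr2 sqrtr_sqr gtr0_norm.
  rewrite /trform hX sa => h; apply: le_trans h.
  rewrite le_eqVlt; apply/orP; left; apply/eqP; apply: RI_eq.
  - exact: rint_meas (rf n).
  - by have := rint_meas (rint_tr (sFn n) (sFn n) X X); rewrite hX.
  by apply: filterS hF => w hw; rewrite /f hw; exact: tr_rot.
have mF : mmeas F by exact: mmeas_Gmx.
have mFX : mmeas (fun w => (F w)^t* *m X *m F w *m X).
  apply: mmeasM; last exact: mmeas_cst.
  by apply: mmeasM => //; apply: mmeasM; [exact: mmeas_trmxC|exact: mmeas_cst].
have mtr : measurable_fun [set: W] (fun w => Re (\tr ((F w)^t* *m X *m F w *m X))).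
  exact: (cmeas_sum (index_enum _) (fun i => mFX i i)).1.
have [||r h] := @fatou_le _ _ _ P f (fun w => Re (\tr ((F w)^t* *m X *m F w *m X)))
  (fun n => alpha * Re (\tr (X *m Qn n *m X *m Qn n))) (alpha * Re (\tr (X *m Q *m X *m Q))) rf f0 mtr _ bound _.
- apply: filterS ae_Fn_lim => w h; apply: mcvg_Retr.
  exact: (mcvgM (mcvgM (mcvgM (mcvg_trmxC h) (mcvg_cst X)) h) (mcvg_cst X)).
- apply: cvgM; first exact: cvg_cst.
  apply: mcvg_Retr.
  exact: (mcvgM (mcvgM (mcvgM (mcvg_cst X) mcvg_Qn) (mcvg_cst X)) mcvg_Qn).
have QX : Q *m X = (alpha^-1)%:C *: X by rewrite /X !mulmxA Q_Pi -!scalemxAl.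
have e1 : Re (\tr (X *m Q *m X *m Q)) = alpha^-1 * (alpha^-1 * Re (\tr (X *m X))).
  rewrite -(mulmxA X) QX -scalemxAr -scalemxAl linearZ /= ReZ mxtrace_mulC mulmxA QX.
  by rewrite -scalemxAl linearZ /= ReZ.
have e2 : RI P (fun w => Re (\tr ((F w)^t* *m X *m F w *m X))) = rho * Re (\tr (X *m X)).
  rewrite -ReZ -linearZ /= scalemxAl -EX -MIMr// (tr_MI (mintMr X ibX)).
  rewrite -[RHS]/(RI P (fun w => Re (\tr (b w *m X *m b w *m X)))).
  apply: RI_eq; [exact: mtr|exact: rint_meas (cint_tr (mintMr X ibX)).1|].
  apply: filterS ae_Pi => w [[_ Fw _ _ _] [e _]]; rewrite Fw.
  have FX : F w *m X = b w *m X by rewrite /X !mulmxA e.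
  by rewrite -(mulmxA (F w *m X)) FX mulmxA.
have [//|Xn] := eqVneq X 0.
have t0 : 0 < Re (\tr (X *m X)) by rewrite -{1}hX; exact: Re_tr_sqr_gt0.
move: h; rewrite e1 e2 [alpha * _]mulrA mulfV ?gt_eqF// mul1r ler_pM2r//.
rewrite leNgt => /negP; case.
by rewrite -[alpha^-1]mul1r ltr_pdivrMr// mulrC.
Qed.
End KernelProjection.

(** A kernel vector v of D is fixed by Pi, so v^* H v = v^* Pi H Pi v = 0, against the positivity of
    H. *)
Lemma D_pd : pd D.
Proof.
have hD := herm_D alpha herm_M0; split=> // v v0.
rewrite lt_neqAle D0 andbT eq_sym; apply/eqP => h.
have Dv : D *m v = 0 by apply: psd_kernel; [exact/psdE|rewrite h].
have [Pi [hPi DPi PiY]] := kernel_proj hD.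
have := Pi_eq0 hPi DPi PiY => X0.
have e := qf_congr Pi H v; rewrite hPi X0 (PiY _ _ Dv) in e.
have [_ /(_ v v0)] := pH; rewrite -e /qf /hf mulmx0 mul0mx mxE ltxx.
by [].
Qed.
End EdgeLimit.

Lemma qf_inv_ge {R : realType} n (D : 'M[R[i]]_n) v : pd D ->
  (forall v, 0 <= qf (D - D *m D) v) -> sq v <= qf (invmx D) v.
Proof.
move=> pD h; have uD := pd_unit pD; have [hD _] := pD.
have := h (invmx D *m v); rewrite qfB -{3}hD -sq_mul mulKVmx// subr_ge0 => {}h.
apply: le_trans h _; rewrite -qf_congr trmxC_inv hD mulVmx// mul1mx.
by [].
Qed.

Lemma qf_inv_mul {R : realType} n (A : 'M[R[i]]_n) v : A^t* = A -> A \in unitmx ->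
  qf (invmx A) (A *m v) = qf A v.
Proof. by move=> hA uA; rewrite -qf_congr hA mulmxV// mul1mx. Qed.

(** From (D - k)^2 >= 0, D^2 >= 2 k D - k^2, and k^2 <= k D. *)
Lemma sq_mul_lower {R : realType} n (D : 'M[R[i]]_n) k v : 0 <= k -> D^t* = D ->
  (forall v, k * sq v <= qf D v) -> k * qf D v <= sq (D *m v).
Proof.
move=> k0 hD h; have := sq_ge0 ((D - k%:C%:M) *m v).
rewrite sq_mul trmxCB hD.
have -> : (k%:C%:M : 'M[R[i]]_n)^t* = k%:C%:M by rewrite -scalemx1 trmxCZr trmxC1.
rewrite mulmxBl !mulmxBr mul_mx_scalar !mul_scalar_mx scale_scalar_mx -rmorphM !qfB !qfZ qf_scalar -{1}hD -sq_mul.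
have := ler_wpM2l k0 (h v); move: (sq _) (qf _ _) (sq _) => s q u.
by rewrite mulrA; move: (k * k * _) (k * q) => *; lra.
Qed.

(** With G = D^-1 + b one has F = D^-1 - D^-1 G^-1 D^-1, and D^-1 >= 1 gives G >= 1 + b >= c. Hence
    F is bounded although b is not. *)
Lemma nm_shifted_solution {R : realType} n (D b F : 'M[R[i]]_n) c : 0 < c -> c <= 1 -> pd D ->
  (forall v, 0 <= qf (D - D *m D) v) -> b^t* = b ->
  (forall v, c * sq v <= sq v + qf b v) -> (1%:M + b *m D) *m F = b ->
  nm F <= nm (invmx D) * (nm (1%:M : 'M[R[i]]_n) + n%:R * (c^-1 * n%:R) * nm (invmx D)).
Proof.
move=> c0 c1 pD hDD hb hbc e; have uD := pd_unit pD; have [hD _] := pD.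
pose G := invmx D + b.
have hG : G^t* = G by rewrite trmxCD trmxC_inv hD hb.
have G0 v : c * sq v <= qf G v.
  by rewrite qfD; apply: le_trans (hbc v) _; rewrite lerD2r; exact: qf_inv_ge.
have uG : G \in unitmx.
  by apply: pd_unit; split => // v v0; apply: lt_le_trans (G0 v); rewrite mulr_gt0// sq_gt0.
have -> : F = invmx D *m (1%:M - invmx G *m invmx D).
  have e1 : G *m (D *m F) = b by rewrite mulmxA mulmxDl mulVmx.
  have -> : F = invmx D *m (invmx G *m b) by rewrite -e1 (mulKmx uG) (mulKmx uD).
  by congr (_ *m _); rewrite -[b in LHS](addKr (invmx D)) -/G mulmxDr (mulVmx uG) mulmxN addrC.
apply: nmMc => //; apply: le_trans (nmB _ _) _; rewrite lerD2l.
by apply: nmMc => //; exact: nm_invmx_lower.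
Qed.

(** The right side is that of [gap_limit] at u = M v with x0 replaced by 1 / a, which is how D - D^2
    appears as the Lyapunov form. *)
Lemma qf_DDD_scale {R : realType} n (a : R) (M : 'M[R[i]]_n) v : a != 0 -> M^t* = M ->
  let D := 1%:M + (a^-1)%:C *: M in
  a * qf (D - D *m D) v = qf (- M) v - a^-1 * sq (M *m v).
Proof.
move=> a0 hM /=; rewrite sq_mul hM.
rewrite mulmxDl mul1mx opprD addNKr -scalemxAl mulmxDr mulmx1 -scalemxAr scalerDr scalerA.
rewrite [in LHS]qfN [in LHS]qfD -rmorphM !qfZ qfN.
move: (qf M v) (qf _ v) => x y; by field.
Qed.

(** * The edge lies to the left of 1 / alpha *)

Section EdgeBound.
Context {R : realType} {d : measure_display} {W : measurableType d}.
Variable P : probability W R.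
Context {p : nat}.
Local Notation K := R[i].
Variables (T : W -> 'M[R]_p) (alpha : R).
Hypotheses (mT : measurable_mx T) (sT : {ae P, forall w, sym_mx (T w)}) (a0 : 0 < alpha).
Variable Omega : set R -> 'M[K]_p.
Hypothesis hO : psd_measure Omega.
Hypothesis hO1 : Omega setT = 1%:M.
Hypothesis p0 : (0 < p)%N.
Local Notation S := (stieltjes Omega).
Hypothesis hM : forall z : K, 0 < Im z -> [/\ S z \in unitmx,
  {ae P, forall w, pert alpha (S z) (T w) \in unitmx}
  & invmx (S z) = - z%:M + EmxC P (fun w => Gmx alpha (S z) (T w))].
Variables (b : W -> 'M[K]_p) (c : R).
Hypotheses (c0 : 0 < c) (c1 : c <= 1).
Hypothesis sb : sqint P b.
Hypothesis Eb : MI P b = 0.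
Hypothesis hb : {ae P, forall w, (b w)^t* = b w}.
Hypothesis hbc : {ae P, forall w, forall v, c * sq v <= sq v + qf (b w) v}.
Hypothesis hT : {ae P, forall w, toC (T w) = 1%:M - invmx (1%:M + b w)}.
Variables (H : 'M[K]_p) (rho : R).
Hypotheses (pH : pd H) (hH : MI P (fun w => b w *m H *m b w) = rho%:C *: H).
Hypothesis ar : 1 < alpha * rho.

Lemma pert0 w : pert alpha 0 (T w) = 1%:M.
Proof. by rewrite /pert mul0mx scaler0 addr0. Qed.

Lemma Gmx0 w : Gmx alpha 0 (T w) = toC (T w).
Proof. by rewrite /Gmx mul0mx scaler0 addr0 invmx1 mulmx1. Qed.

(** At M = 0 the resolvent factor F is T itself, which is bounded because 1 + b >= c, and the
    linearized map vanishes, so [stable_ball] applies with contraction rate 0. *)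
Lemma lambda_plus_lt_infty : exists X, (lambda_plus Omega <= X%:E)%E.
Proof.
pose cF := nm (1%:M : 'M[K]_p) + p%:R * (c^-1 * p%:R) + 1.
have cF0 : 0 < cF by rewrite ltr_wpDl// addr_ge0 ?nm_ge0// mulr_ge0// mulr_ge0// invr_ge0 ltW.
have pL : pd (1%:M : 'M[K]_p).
  by split=> [|v v0]; [exact: trmxC1|rewrite qf1 sq_gt0].
have th01 : 0 <= (0 : R) < 1 by apply/andP.
have hp0 : {ae P, forall w, pert alpha 0 (T w) \in unitmx}.
  by apply: aeW => w; rewrite pert0 unitmx1.
have hF0 : {ae P, forall w, nm (Gmx alpha 0 (T w)) <= cF}.
  apply: filterS2 (filterI hb hbc) hT => w [bw cw] Tw; rewrite Gmx0 Tw.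
  apply: le_trans (nmB _ _) _; rewrite /cF -addrA lerD2l; apply: (@le_trans _ _ (p%:R * (c^-1 * p%:R))).
    apply: nm_invmx_lower => // [|v]; last by rewrite qfD qf1.
    by rewrite trmxCD trmxC1 bw.
  by rewrite lerDl.
have hL v : RI P (fun w => qf (1%:M : 'M[K]_p) (Gmx alpha 0 (T w) *m (0 *m v))) <= alpha * 0 * qf (1%:M : 'M[K]_p) v.
  under eq_fun do rewrite mul0mx mulmx0 qf1 sq0.
  by rewrite RI_cst mulr0 mul0r.
have [e [k [e0 k0 good]]] := stable_ball mT sT a0 hO hO1 hM pL th01 cF0 hp0 hF0 hL.
exact: (lambda_plus_bounded hO1 p0 e0 k0 good erefl).
Qed.

Section AtEdge.
Variable x0 : R.
Hypotheses (lx0 : lambda_plus Omega = x0%:E) (ax0 : alpha^-1 <= x0).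
Local Notation xs n := (x0 + n.+1%:R^-1).

Lemma x0_gt0 : 0 < x0.
Proof. by apply: lt_le_trans ax0; rewrite invr_gt0. Qed.

Lemma xs_gt n : 1 < alpha * xs n.
Proof.
have h : 1 <= alpha * x0 by rewrite -(ler_pdivrMl _ _ a0) mulr1.
by apply: (le_lt_trans h); rewrite mulrDr ltrDl mulr_gt0// invr_gt0 ltr0n.
Qed.

Lemma xs_lim : (xs n : R) @[n --> \oo] --> x0.
Proof.
rewrite -[X in _ --> X]addr0; apply: cvgD; first exact: cvg_cst.
exact: cvg_harmonic.
Qed.

(** As x decreases to x0, the forms of - S(x) increase and stay below 1 / x0 <= alpha by [NS_bound].
    Monotonicity makes the limit positive definite, and the bound gives D >= 0. *)
Lemma edge_limit (gs : nat -> R) : (forall n, below hO (xs n) (gs n)) ->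
  exists M0 : 'M[K]_p, [/\ mcvg (fun n => S (xs n)%:C) M0, pd (- M0) &
    forall v, 0 <= qf (1%:M + (alpha^-1)%:C *: M0) v].
Proof.
move=> hxs.
have nb n v : qf (- S (xs n)%:C) v <= x0^-1 * sq v.
  apply: le_trans (NS_bound mT sT a0 hO1 hM c0 sb Eb hb hbc hT v (hxs n) (xs_gt n)) _.
  apply: ler_wpM2r; first exact: sq_ge0.
  have x00 := x0_gt0; have i0 : 0 <= (n.+1%:R^-1 : R) by rewrite invr_ge0.
  by rewrite lef_pV2 ?posrE ?lerDl// ltr_wpDr.
have nd v : nondecreasing_seq (fun n => qf (- S (xs n)%:C) v).
  move=> m n mn; have e : xs n <= xs m by rewrite lerD2l lef_pV2 ?posrE ?ltr0n// ler_nat ltnS.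
  exact: (NS_le hO1 v (hxs n) e).
have cv v : cvgn (fun n => qf (- S (xs n)%:C) v).
  apply: nondecreasing_is_cvgn; first exact: nd.
  by exists (x0^-1 * sq v) => _ [n _ <-].
have hA n : (- S (xs n)%:C)^t* = - S (xs n)%:C by have [] := pd_NS hO1 (hxs n).
have [B [hB cB qB]] := herm_limit hA cv.
have Ble v : qf B v <= x0^-1 * sq v.
  by rewrite qB; apply: (@cvg_le_lim _ _ _ _ (fun n => nb n v)); exact: cv.
exists (- B); split.
- have := mcvgN cB; apply: cvg_trans; apply: near_eq_cvg; apply: nearW => n.
  by rewrite opprK.
- rewrite opprK; split => // v v0; apply: lt_le_trans (_ : qf (- S (xs 0)%:C) v <= _).
    by have [_ ->] := pd_NS hO1 (hxs 0%N).
  by rewrite qB; exact: nondecreasing_cvgn_le (nd v) (cv v) 0%N.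
- move=> v; rewrite qfD qf1 qfZ qfN mulrN subr_ge0 (ler_pdivrMl _ _ a0).
  apply: le_trans (Ble v) _; apply: ler_wpM2r; first exact: sq_ge0.
  by rewrite -[leRHS]invrK lef_pV2 ?posrE ?invr_gt0//; exact: x0_gt0.
Qed.

(** With L = D - D^2, the gap form at u is at least (1 + c dl) times the L-form at F u, since 1 + b
    >= c and D^2 >= dl D >= dl L. Its mean at u = M0 v is at most alpha L(v). So the linearized
    equation contracts, and [extend_left] would push the edge strictly below itself. *)
Lemma edge_contradiction : False.
Proof.
have lxs n : (lambda_plus Omega < (xs n)%:E)%E.
  by rewrite lx0 lte_fin ltrDl invr_gt0 ltr0n.
have [gs hxs] := choice (fun n => below_lambda hO p0 (lxs n)).
have [M0 [cM0 pB D0]] := edge_limit hxs.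
pose D := 1%:M + (alpha^-1)%:C *: M0.
have pD : pd D := D_pd mT sT a0 hO1 hM c0 sb Eb hb hbc hT hxs xs_lim xs_gt cM0 pB D0 ax0 pH hH ar.
have hM0 := herm_M0 pB; have N0 := N0_ge0 a0 pB.
have hreg := ae_regular sT a0 c0 hb hbc hT pB D0.
have DD0 := qf_DDD_ge0 hM0 D0 N0.
have ai : 0 < alpha^-1 by rewrite invr_gt0.
pose L := D - D *m D.
have [dl dl0 hdl] := pd_lower pD; have [hD _] := pD.
have LE v := qf_DDD_scale v (lt0r_neq0 a0) hM0.
have pL : pd L.
  split=> [|v v0]; first by rewrite /L trmxCB trmxCM hD.
  rewrite /L (qf_DDD alpha hM0) ltr_wpDr// opprD addrA subrr add0r -scalerN qfZ mulr_gt0//.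
  have [_] := pB; apply; apply: contra_neq v0 => h.
  by rewrite -(mulKmx (pd_unit pD) v) h mulmx0.
pose th := (1 + c * dl)^-1.
have cd : 0 < c * dl by rewrite mulr_gt0.
have cd1 : 0 < 1 + c * dl by rewrite ltr_wpDl.
have th01 : 0 <= th < 1 by rewrite invr_ge0 ltW//= invf_lt1// ltrDl.
pose cF := nm (invmx D) * (nm (1%:M : 'M[K]_p) + p%:R * (c^-1 * p%:R) * nm (invmx D)) + 1.
have cF0 : 0 < cF.
  rewrite ltr_wpDl// mulr_ge0 ?nm_ge0// addr_ge0 ?nm_ge0// mulr_ge0 ?nm_ge0// mulr_ge0// mulr_ge0//.
  by rewrite invr_ge0 ltW.
have hp0 : {ae P, forall w, pert alpha M0 (T w) \in unitmx} by apply: filterS hreg => w [].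
have hF0 : {ae P, forall w, nm (Gmx alpha M0 (T w)) <= cF}.
  apply: filterS hreg => w [bw Fw uw Tw cw].
  have e1 := F_1Db bw cw c0 Tw uw.
  have e2 : (1%:M + b w *m D) *m Gmx alpha M0 (T w) = b w.
    have := congr1 (fun A : 'M[K]_p => A^t*) e1.
    by rewrite /= trmxCM trmxCD trmxC1 trmxCM Fw bw (herm_D alpha hM0).
  by apply: le_trans (nm_shifted_solution c0 c1 pD DD0 bw cw e2) _; rewrite lerDl.
have hL v : RI P (fun w => qf L (Gmx alpha M0 (T w) *m (M0 *m v))) <= alpha * th * qf L v.
  rewrite mulrAC -/th ler_pdivlMr// mulrC.
  have sF : sqint P (fun w => Gmx alpha M0 (T w)) by apply: (sqint_bounded _ hF0); exact: mmeas_Gmx.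
  have rL := rint_qfF L (M0 *m v) sF.
  rewrite -(RIZ _ rL).
  have [rG hG] := gap_limit mT sT a0 hO1 hM c0 sb Eb hb hbc hT hxs xs_lim xs_gt cM0 pB D0 (M0 *m v).
  apply: (@le_trans _ _ (RI P (fun w => qf (b w - Gmx alpha M0 (T w)) (M0 *m v)))).
    apply: RI_le => //; first exact: rintZ.
    apply: filterS hreg => w hw; rewrite (qf_gap_limit c0 pB _ hw).
    have [bw Fw uw Tw cw] := hw.
    rewrite -mulmxA; move: (Gmx alpha M0 (T w) *m (M0 *m v)) => y.
    rewrite -/D -/L mulrDl mul1r lerD2l (qfD 1%:M) qf1; apply: le_trans (cw _).
    rewrite -mulrA; apply: ler_wpM2l; first exact: ltW.
    apply: (@le_trans _ _ (dl * qf D y)); last exact: (sq_mul_lower _ (ltW dl0) hD hdl).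
    apply: ler_wpM2l; first exact: ltW.
    by rewrite /L qfB -{2}hD -sq_mul lerBlDr lerDl sq_ge0.
  apply: le_trans hG _; rewrite LE; apply: lerB.
    have [hB _] := pB; by rewrite -(qf_inv_mul v hB (pd_unit pB)) mulNmx qfNv lexx.
  by apply: ler_wpM2r; first exact: sq_ge0.
have [e [k [e0 k0 good]]] := stable_ball mT sT a0 hO hO1 hM pL th01 cF0 hp0 hF0 hL.
have lx : (lambda_plus Omega <= x0%:E)%E by rewrite lx0.
have := extend_left hO1 p0 e0 k0 good lx; rewrite lx0 lee_fin => h.
have {h} : x0 <= x0 - e / (8 * (4 * p%:R ^+ 2 * k + 1)).
  apply: h => eps dd eps0 dd0.
  have [n [hn1 hn2]] : exists n, xs n < x0 + dd /\ nm (S (xs n)%:C - M0) <= eps.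
    have h1 : \forall n \near \oo, xs n < x0 + dd.
      by move/cvgrPdist_lt: xs_lim => /(_ _ dd0); apply: filterS => n; rewrite ltr_distlC => /andP[].
    have h2 : \forall n \near \oo, nm (S (xs n)%:C - M0) <= eps.
      move/cvgrPdist_le: cM0 => /(_ _ eps0); apply: filterS => n.
      by rewrite sub0r normrN ger0_norm// nm_ge0.
    exact: (filter_ex (filterI h1 h2)).
  by exists (xs n); split => //; rewrite ltrDl invr_gt0 ltr0n.
apply/negP; rewrite -ltNge ltrBlDr ltrDl divr_gt0// mulr_gt0// ltr_wpDl//.
by rewrite !mulr_ge0 ?sqr_ge0.
Qed.
End AtEdge.

Lemma lambda_plus_lt : (lambda_plus Omega < (alpha^-1)%:E)%E.
Proof.
rewrite ltNge; apply/negP => h; have [X hX] := lambda_plus_lt_infty.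
case E : (lambda_plus Omega) => [l||].
- by apply: (edge_contradiction E); rewrite E lee_fin in h.
- by rewrite E leye_eq in hX.
- by rewrite E leeNy_eq in h.
Qed.
End EdgeBound.

Lemma sandwich_mul {A : pzRingType} m n (V : 'M[A]_(n, m)) (U : 'M[A]_(m, n)) (B : 'M[A]_m) (N : 'M[A]_n) :
  (V *m B *m U) *m N *m (V *m B *m U) = V *m (B *m (U *m N *m V) *m B) *m U.
Proof. by rewrite !mulmxA. Qed.

(** * Positivity of h for the optimal map *)

Section UpperBound.
Context {R : realType} {d : measure_display} {W : measurableType d}.
Variable P : probability W R.
Context {p r : nat}.
Local Notation K := R[i].
Variables (T : W -> 'M[R]_p) (alpha : R).
Hypotheses (mT : measurable_mx T) (sT : {ae P, forall w, sym_mx (T w)}) (a0 : 0 < alpha).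
Variable Omega : set R -> 'M[K]_p.
Hypothesis hO : psd_measure Omega.
Hypothesis hO1 : Omega setT = 1%:M.
Local Notation S := (stieltjes Omega).
Hypothesis hM : forall z : K, 0 < Im z -> [/\ S z \in unitmx,
  {ae P, forall w, pert alpha (S z) (T w) \in unitmx}
  & invmx (S z) = - z%:M + EmxC P (fun w => Gmx alpha (S z) (T w))].
Hypotheses (p0 : (0 < p)%N) (r0 : (0 < r)%N).
Variables (C : W -> 'M[R]_r) (U : 'M[R]_(r, p)) (c : R).
Local Notation Bc := (fun w => toC (C w - 1%:M)).
Local Notation b := (fun w => (toC U)^t* *m Bc w *m toC U).
Hypotheses (sB : sqint P Bc) (hB : {ae P, forall w, sym_mx (C w - 1%:M)}).
Hypotheses (c0 : 0 < c) (c1 : c <= 1).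
Hypothesis EB : MI P Bc = 0.
Hypothesis hBc : {ae P, forall w, forall v, c * sq v <= sq v + qf (Bc w) v}.
Hypothesis UU : (toC U)^t* *m toC U = 1%:M.
Hypothesis hT : {ae P, forall w, toC (T w) = 1%:M - invmx (1%:M + b w)}.
Variables (H : 'M[R]_r) (rho : R).
Hypotheses (pH : pd ((toC U)^t* *m toC H *m toC U))
  (UH : toC U *m ((toC U)^t* *m toC H *m toC U) *m (toC U)^t* = toC H)
  (hH : calA P C H = rho *: H) (ar : 1 < alpha * rho).

(* The test matrix for [gain_right_edge] is transported by V = X U^*. *)
Lemma exists_h_gt0 : exists x, (lambda_plus Omega < x%:E)%E /\
  0 < lambda1 (EmxC P (fun w => Gmx alpha (S x%:C) (T w) *t toC (C w))) - x.
Proof.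
have sb : sqint P b by apply: sqintMr; exact: sqintMl.
have iB := sqint_mint sB.
have Eb : MI P b = 0 by rewrite MIMr ?MIMl ?EB ?mulmx0 ?mul0mx//; exact: mintMl.
have hb : {ae P, forall w, (b w)^t* = b w}.
  by apply: filterS (BcH hB) => w h; rewrite !trmxCM trmxCK h mulmxA.
have hbc : {ae P, forall w, forall v, c * sq v <= sq v + qf (b w) v}.
  apply: filterS hBc => w h v; have := h (toC U *m v).
  by rewrite sq_mul UU qf1 qf_congr.
have bH : MI P (fun w => b w *m ((toC U)^t* *m toC H *m toC U) *m b w) =
    rho%:C *: ((toC U)^t* *m toC H *m toC U).
  have i2 := mint_BXB sB (toC H).
  have -> : rho%:C *: ((toC U)^t* *m toC H *m toC U) = (toC U)^t* *m (rho%:C *: toC H) *m toC U.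
    by rewrite -scalemxAr -scalemxAl.
  rewrite -toCZ -hH toC_calA.
  rewrite -MIMl// -MIMr; last exact: mintMl.
  congr (MI P); apply/funext => w.
  apply: etrans (sandwich_mul _ _ _ _) _.
  exact: (congr1 (fun Z => _ *m (_ *m Z *m _) *m _) UH).
have hl := lambda_plus_lt mT sT a0 hO hO1 p0 hM c0 c1 sb Eb hb hbc hT pH bH ar.
have [x [g [X [hx lx gX]]]] := gain_right_edge mT sT a0 hO hO1 p0 hM c0 sb Eb hb hbc hT pH bH ar hl.
exists x; split => //.
have sF := sqint_F mT sT a0 hO1 hM hx.
have hF := ae_herm_F mT sT a0 hO1 hM hx.
have EF := MI_F mT sT a0 hO1 hM hx.
apply/(h_gt0P p0 r0 sF hF EF sB hB); exists (X *m (toC U)^t*).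
rewrite -subr_gt0; apply: lt_le_trans gX _; rewrite le_eqVlt; apply/orP; left; apply/eqP.
congr (_ - _).
  congr (RI P); apply/funext => w; rewrite trmxCM trmxCK; congr (Re _).
  by rewrite -!mulmxA [RHS]mxtrace_mulC !mulmxA.
rewrite trmxCM trmxCK; congr (Re _).
by rewrite -!mulmxA [RHS]mxtrace_mulC -!mulmxA UU mulmx1.
Qed.
End UpperBound.

Lemma hf_toC {R : realType} n (A : 'M[R]_n) (x y : 'cV[R]_n) :
  hf (toC A) (toC x) (toC y) = ((x^T *m A *m y) 0 0)%:C.
Proof. by rewrite /hf trmxC_toC -!toCM mxE. Qed.

(** In terms of the real and imaginary parts of v the cross terms are purely imaginary and do not
    contribute to [qf]. *)
Lemma qf_toC_ge0 {R : realType} n (A : 'M[R]_n) (v : 'cV[R[i]]_n) :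
  (forall v : 'cV[R]_n, 0 <= (v^T *m A *m v) 0 0) -> 0 <= qf (toC A) v.
Proof.
move=> h; pose x : 'cV[R]_n := \col_k Re (v k 0); pose y : 'cV[R]_n := \col_k Im (v k 0).
have -> : v = toC x + 'i *: toC y.
  by apply/matrixP => k l; rewrite !mxE (ord1 l) -complexE.
rewrite /qf hfDl !hfDr !hfZl !hfZr !hf_toC.
move: (h x) (h y); move: ((x^T *m A *m x) 0 0) ((y^T *m A *m y) 0 0)
  ((x^T *m A *m y) 0 0) ((y^T *m A *m x) 0 0) => a b e f a0 b0.
rewrite ?complexiE /=. lra.
Qed.

Lemma psd_toC {R : realType} n (A : 'M[R]_n) : psd_real A -> psd (toC A).
Proof.
move=> [sA h]; apply/psdE; split; first by rewrite trmxC_toC sA.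
by move=> v; exact: qf_toC_ge0.
Qed.

(** * The thresholds *)

Lemma toC_invmx {R : realType} n (A : 'M[R]_n) : toC (invmx A) = invmx (toC A).
Proof. exact: map_invmx. Qed.

Lemma measurable_mx_toC {R : realType} {d : measure_display} {W : measurableType d} m n
  (X : W -> 'M[R]_(m, n)) : mmeas (fun w => toC (X w)) -> measurable_mx X.
Proof. by move=> h i j; have [] := h i j; under eq_fun do rewrite mxE. Qed.

Lemma sqint_toC {R : realType} {d : measure_display} {W : measurableType d}
  (P : probability W R) m n (X : W -> 'M[R]_(m, n)) : measurable_mx X ->
  (forall i j, rint P (fun w => X w i j ^+ 2)) -> sqint P (fun w => toC (X w)).
Proof.
move=> mX h; apply: (sqint_dom (g := fun w => (m%:R * n%:R) ^+ 2 * \sum_i \sum_j X w i j ^+ 2)).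
- exact: mmeas_toC.
- by apply: rintZ; apply: rint_sum => i; exact: rint_sum.
apply: aeW => w; rewrite -frob_sqr -exprMn.
by rewrite ler_pXn2r ?nnegrE ?nm_ge0 ?mulr_ge0 ?frob_ge0// nm_toC_frob.
Qed.

Lemma is_Omega_stieltjes {R : realType} {d : measure_display} {W : measurableType d}
  (P : probability W R) p (T : W -> 'M[R]_p) alpha (Omega : set R -> 'M[R[i]]_p) :
  is_Omega P T alpha Omega -> [/\ psd_measure Omega, Omega setT = 1%:M &
  forall z : R[i], 0 < Im z -> [/\ stieltjes Omega z \in unitmx,
    {ae P, forall w, pert alpha (stieltjes Omega z) (T w) \in unitmx}
    & invmx (stieltjes Omega z) = - z%:M + EmxC P (fun w => Gmx alpha (stieltjes Omega z) (T w))]].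
Proof.
move=> [M [[_ _ _ h] hO hO1 e]]; split; [exact: hO|exact: hO1|move=> z z0].
by have := h z z0; rewrite (e z z0).
Qed.

Section OrthonormalRange.
Context {R : realType} {r p : nat}.
Variables (H : 'M[R]_r) (U : 'M[R]_(r, p)).
Hypotheses (psdH : psd_real H) (hU : orthonormal_range H U).

Lemma UU_toC : (toC U)^t* *m toC U = 1%:M.
Proof. by have [h _] := hU; rewrite trmxC_toC -toCM h toC1. Qed.

Lemma orthonormal_range_proj : U *m U^T *m H = H.
Proof.
have [h /andP[_ /submxP[Y hY]]] := hU.
have -> : H = U *m Y^T by rewrite -[H]trmxK hY trmx_mul trmxK.
by rewrite -mulmxA (mulmxA U^T) h mul1mx.
Qed.

Lemma UHU_toC : toC U *m ((toC U)^t* *m toC H *m toC U) *m (toC U)^t* = toC H.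
Proof.
have e := orthonormal_range_proj; have [sH _] := psdH.
rewrite trmxC_toC -!toCM; congr (toC _).
have e2 : H *m (U *m U^T) = H.
  by have := congr1 trmx e; rewrite !trmx_mul trmxK sH.
by rewrite -[RHS]e -[in RHS]e2 !mulmxA.
Qed.

(** If the form vanishes at v, then H U v = 0 as H >= 0. The rows of U^T are combinations of rows of
    H, so v = U^T U v = 0. *)
Lemma pd_range : pd ((toC U)^t* *m toC H *m toC U).
Proof.
have pH := psd_toC psdH; have [hH H0] := (psdE _).1 pH.
split=> [|v v0]; first by rewrite !trmxCM trmxCK hH mulmxA.
rewrite qf_congr lt_neqAle H0 andbT eq_sym; apply/eqP => h.
have Hv : toC H *m (toC U *m v) = 0 by apply: psd_kernel; rewrite ?h.
have [_ /andP[/submxP[X hX] _]] := hU; have [sH _] := psdH.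
move: v0; rewrite -[v]mul1mx -UU_toC trmxC_toC hX sH toCM -mulmxA -mulmxA Hv mulmx0 eqxx.
by [].
Qed.
End OrthonormalRange.

Section Threshold.
Context {R : realType} {d : measure_display} {W : measurableType d}.
Variable P : probability W R.
Context {r : nat}.
Variable C : W -> 'M[R]_r.
Hypothesis r0 : (0 < r)%N.
Local Notation Bc := (fun w => toC (C w - 1%:M)).
Hypotheses (sB : sqint P Bc) (hB : {ae P, forall w, sym_mx (C w - 1%:M)}).
Hypothesis hne : (0 < P [set w | C w <> 1%:M])%E.
Local Notation rho := (opnorm_sym (calA P C)).

Lemma Delta_gt0_alpha p (T : W -> 'M[R]_p) (Omega : R -> set R -> 'M[R[i]]_p) alpha :
  (0 < p)%N -> measurable_mx T -> {ae P, forall w, sym_mx (T w)} -> 0 < alpha ->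
  is_Omega P T alpha (Omega alpha) -> (0 < Delta P T C Omega alpha)%E -> rho^-1 < alpha.
Proof.
move=> p0 mT sT a0 /is_Omega_stieltjes[hO hO1 hM] /ereal_sup_gt[_ [x hx <-]]; rewrite lte_fin => h.
have [g hg] := below_lambda hO p0 hx.
have := alpha_rho_gt1 mT sT a0 hO1 hM hg p0 r0 sB hB hne h.
by rewrite -[rho^-1]mul1r ltr_pdivrMr// (rho_gt0 sB hB hne).
Qed.

Lemma alpha_c_min_ge p (T : W -> 'M[R]_p) (Omega : R -> set R -> 'M[R[i]]_p) :
  (0 < p)%N -> measurable_mx T -> {ae P, forall w, sym_mx (T w)} ->
  (forall alpha, 0 < alpha -> is_Omega P T alpha (Omega alpha)) ->
  (rho^-1%:E <= alpha_c_min P T C Omega)%E.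
Proof.
move=> p0 mT sT hO; apply: le_ereal_inf_tmp => _ [a [a0 ha] <-].
by rewrite lee_fin ltW// (Delta_gt0_alpha p0 mT sT a0 (hO a a0) ha).
Qed.

Section OptimalMap.
Variables (p : nat) (U : 'M[R]_(r, p)) (H : 'M[R]_r) (c : R).
Local Notation T := (fun w => Tstar U (C w)).
Variable Omega : R -> set R -> 'M[R[i]]_p.
Hypotheses (p0 : (0 < p)%N) (mC : measurable_mx C) (c0 : 0 < c) (c1 : c <= 1).
Hypothesis EB : MI P Bc = 0.
Hypothesis hBc : {ae P, forall w, forall v, c * sq v <= sq v + qf (Bc w) v}.
Hypotheses (psdH : psd_real H) (hH : calA P C H = rho *: H) (hU : orthonormal_range H U).
Hypothesis hOmega : forall alpha, 0 < alpha -> is_Omega P T alpha (Omega alpha).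

Lemma toC_Tstar w : toC (T w) = 1%:M - invmx (1%:M + (toC U)^t* *m Bc w *m toC U).
Proof.
rewrite /Tstar toCB toC1 toC_invmx; congr (_ - invmx _).
rewrite !toCM toCB toC1 -trmxC_toC mulmxBr mulmx1 mulmxBl (UU_toC hU) addrC subrK.
by [].
Qed.

Lemma measurable_Tstar : measurable_mx T.
Proof.
apply: measurable_mx_toC; under eq_fun do rewrite /Tstar toCB toC1 toC_invmx !toCM.
apply: mmeasB; first exact: mmeas_cst.
apply: mmeas_invmx; apply: mmeasM; last exact: mmeas_cst.
by apply: mmeasM; [exact: mmeas_cst|exact: mmeas_toC].
Qed.

Lemma sym_Tstar : {ae P, forall w, sym_mx (T w)}.
Proof.
apply: filterS (symC hB) => w sC; rewrite /sym_mx /Tstar linearB /= trmx1 trmx_inv.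
by rewrite !trmx_mul trmxK sC mulmxA.
Qed.

Lemma Delta_Tstar_gt0 alpha : rho^-1 < alpha -> (0 < Delta P T C Omega alpha)%E.
Proof.
move=> ra; have rp := rho_gt0 sB hB hne.
have a0 : 0 < alpha by apply: lt_trans ra; rewrite invr_gt0.
have ar : 1 < alpha * rho by rewrite -ltr_pdivrMr// mul1r.
have [hO hO1 hM] := is_Omega_stieltjes (hOmega a0).
have hT : {ae P, forall w, toC (T w) = 1%:M - invmx (1%:M + (toC U)^t* *m Bc w *m toC U)}.
  by apply: aeW => w; exact: toC_Tstar.
have [x [lx hx]] := exists_h_gt0 measurable_Tstar sym_Tstar a0 hO hO1 hM p0 r0 sB hB c0 c1 EB hBc
  (UU_toC hU) hT (pd_range psdH hU) (UHU_toC psdH hU) hH ar.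
apply: (@lt_le_trans _ _ (h P T C Omega alpha x)%:E); first by rewrite lte_fin.
by apply: ereal_sup_ubound; exists x.
Qed.

Lemma alpha_c_min_Tstar : alpha_c_min P T C Omega = (rho^-1)%:E.
Proof.
apply/eqP; rewrite eq_le; apply/andP; split; last first.
  exact: alpha_c_min_ge p0 measurable_Tstar sym_Tstar hOmega.
have rp := rho_gt0 sB hB hne.
apply/lee_addgt0Pr => e e0; apply: ereal_inf_lbound; exists (rho^-1 + e) => //.
split; first by rewrite addr_gt0// invr_gt0.
by apply: Delta_Tstar_gt0; rewrite ltrDl.
Qed.

Lemma alpha_c_max_Tstar : alpha_c_max P T C Omega = (rho^-1)%:E.
Proof.
have rp := rho_gt0 sB hB hne.
apply/eqP; rewrite eq_le; apply/andP; split.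
  apply: ereal_inf_lbound; exists (rho^-1) => //; split; first by rewrite invr_gt0.
  by move=> a; exact: Delta_Tstar_gt0.
apply: le_ereal_inf_tmp => _ [a [a0 ha] <-]; rewrite lee_fin leNgt; apply/negP => h.
(* A candidate a below 1 / rho would make Delta positive at the midpoint of a and 1 / rho, which
   contradicts the lower bound. *)
have [h1 h2] := midf_lt h.
have m0 : 0 < (a + rho^-1) / 2 := lt_trans a0 h1.
have := Delta_gt0_alpha p0 measurable_Tstar sym_Tstar m0 (hOmega m0) (ha _ h1).
by rewrite ltNge ltW.
Qed.
End OptimalMap.
End Threshold.

(** * Properties of the conditional second moment matrix *)

Section PosteriorCovariance.
Context {R : realType} {d : measure_display} {W : measurableType d}.
Variable P : probability W R.
Context {r q : nat}.
Variables (s : W -> r.-tuple R) (y : W -> q.-tuple R) (C : q.-tuple R -> 'M[R]_r).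
Hypotheses (hs : standard_gaussian P s) (my : measurable_fun [set: W] y).
Hypothesis hC : cond_expectation_mx P y (fun w => outer (s w)) C.

Lemma measurable_C : measurable_mx (C \o y).
Proof. by have [mC _] := hC; move=> i j; exact: measurableT_comp (mC i j) my. Qed.

Lemma sqint_C_sub1 : sqint P (fun w => toC (C (y w) - 1%:M)).
Proof.
have [mC h] := hC; under eq_fun do rewrite toCB.
apply: sqintB; last exact: sqint_cst.
apply: sqint_toC => [|i j]; first exact: measurable_C.
have [iC eC] := h i j; have [r2 r1] := second_moment hs i j.
exact: (cond_exp_L2 my (mC i j) iC r1 r2 eC).
Qed.

Lemma MI_C_sub1 : MI P (fun w => toC (C (y w) - 1%:M)) = 0.
Proof.
rewrite -toC_Emx; have [mC h] := hC.
apply/matrixP => i j; rewrite mxE EmxE [RHS]mxE; apply/eqP; rewrite fmorph_eq0; apply/eqP.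
have [iC eC] := h i j; have [r2 r1] := second_moment hs i j.
under eq_fun do rewrite mxE [X in _ + X]mxE.
rewrite RIB//; last exact: rint_cst.
rewrite RI_cst (_ : RI P _ = RI P (fun w => outer (s w) i j)).
  by rewrite covariance_gauss// mxE subrr.
by have := eC setT measurableT; rewrite preimage_setT /RI => ->.
Qed.

Lemma sym_C_sub1 c : {ae P, forall w, psd_real (C (y w) - c%:M)} ->
  {ae P, forall w, sym_mx (C (y w) - 1%:M)}.
Proof.
apply: filterS => w [sC _]; move: sC; rewrite /sym_mx !linearB /= !tr_scalar_mx => /addIr ->.
by [].
Qed.

Lemma C_sub1_lower c e : e <= c -> {ae P, forall w, psd_real (C (y w) - c%:M)} ->
  {ae P, forall w, forall v, e * sq v <= sq v + qf (toC (C (y w) - 1%:M)) v}.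
Proof.
move=> ec; apply: filterS => w h v.
have /psdE[_ /(_ v)] := psd_toC h; rewrite !toCB !toC_scalar !qfB !qf_scalar mul1r subr_ge0 [sq v + _]addrC subrK => h1.
by apply: le_trans h1; apply: ler_wpM2r => //; exact: sq_ge0.
Qed.
End PosteriorCovariance.

Theorem theorem1p10 (R : realType) (r q : nat) (hr : (0 < r)%N) (hq : (0 < q)%N)
  (* model: s ~ N(0, I_r), y | s ~ Pstar, C(y) = E[s s^T | y] *)
  (Pstar : R.-pker (r.-tuple R) ~> (q.-tuple R))
  (d : measure_display) (W : measurableType d) (P : probability W R)
  (s : W -> r.-tuple R) (y : W -> q.-tuple R)
  (hs : standard_gaussian P s) (hy : conditional_law P s y Pstar)
  (C : q.-tuple R -> 'M[R]_r)
  (hC : cond_expectation_mx P y (fun w => outer (s w)) C)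
  (hCneq : (0 < P [set w | C (y w) <> 1%:M])%E)
  (c : R) (hc : 0 < c) (hCc : {ae P, forall w, psd_real (C (y w) - c%:M)})
  (* the optimal preprocessing map *)
  (Hstar : 'M[R]_r) (hHstar : relint (scrP P (C \o y)) Hstar)
  (pstar : nat) (hpstar : pstar = \rank Hstar)
  (Ustar : 'M[R]_(r, pstar)) (hUstar : orthonormal_range Hstar Ustar)
  (Omega_star : R -> set R -> 'M[R[i]]_pstar)
  (hOmega_star : forall alpha : R, 0 < alpha ->
     is_Omega P (fun w => Tstar Ustar (C (y w))) alpha (Omega_star alpha)) :
  exists alpha_c : R,
    [/\ alpha_c_min P (fun w => Tstar Ustar (C (y w))) (C \o y) Omega_star
          = alpha_c%:E,
        alpha_c_max P (fun w => Tstar Ustar (C (y w))) (C \o y) Omega_star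
          = alpha_c%:E,
        0 < alpha_c,
        1 / alpha_c =
          opnorm_mx (Emx P (fun w => (C (y w) - 1%:M) *t (C (y w) - 1%:M)))
      & forall (p : nat) (T : q.-tuple R -> 'M[R]_p)
          (Omega : R -> set R -> 'M[R[i]]_p),
          (0 < p)%N ->
          measurable_mx T -> (forall v, sym_mx (T v)) ->
          (0 < P [set w | T (y w) <> 0%R])%E ->
          (exists2 CT : R, 0 < CT &
             {ae P, forall w, opnorm_mx (T (y w)) <= CT}) ->
          (forall alpha : R, 0 < alpha ->
             is_Omega P (T \o y) alpha (Omega alpha)) ->
          (alpha_c%:E <= alpha_c_min P (T \o y) (C \o y) Omega)%E].
Proof.
have [my _] := hy.
have mC := measurable_C my hC; have sB := sqint_C_sub1 hs my hC.
have EB := MI_C_sub1 hs hC; have hB := sym_C_sub1 hCc.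
(* The lower bound on C is weakened to a constant at most 1, the normalization under which the edge
   analysis is carried out. *)
have c0 : 0 < Num.min c 1 by rewrite lt_min hc ltr01.
have c1 : Num.min c 1 <= 1 by rewrite ge_min lexx orbT.
have cc : Num.min c 1 <= c by rewrite ge_min lexx.
have hBc := C_sub1_lower cc hCc.
have [[psdH trH hH] _] := hHstar.
(* The trace condition excludes [Hstar] = 0, so its rank is positive. *)
have p0 : (0 < pstar)%N.
  rewrite hpstar lt0n mxrank_eq0; apply/eqP => h.
  by move: trH; rewrite h linear0 => /eqP; rewrite eq_sym oner_eq0.
exists (opnorm_sym (calA P (C \o y)))^-1; split.
- exact: (alpha_c_min_Tstar hr sB hB hCneq p0 mC c0 c1 EB hBc psdH hH hUstar hOmega_star).
- exact: (alpha_c_max_Tstar hr sB hB hCneq p0 mC c0 c1 EB hBc psdH hH hUstar hOmega_star).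
- by rewrite invr_gt0 (rho_gt0 sB hB hCneq).
- by rewrite div1r invrK (opnorm_mx_calA sB hB hCneq).
move=> p T Omega p1 mT sT _ _ hO.
apply: (alpha_c_min_ge hr sB hB hCneq p1 _ _ hO).
  by move=> i j; exact: measurableT_comp (mT i j) my.
by apply: aeW => w; exact: sT.
Qed.
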